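(* Let $\ell\geq5$ be prime and let $Q$ be a squarefree positive integer with $\gcd(Q,6\ell)=1$ and prime factorization $Q=Q_1\cdots Q_t$. Let $\beta_0\in\mathbb Z$ with $\gcd(Q,24\beta_0-1)=1$, and suppose $p(\ell Qn+\beta_0)\equiv0\pmod\ell$ for all integers $n$. Let $\delta:=\left(\frac{1-24\beta_0}{\ell}\right)$, which lies in $\{0,-1\}$, and for $d\mid Q$ let $\lambda_d:=d^{-1}\left(\frac{-12}{d}\right)\left(\frac{24\beta_0-1}{d}\right)$. Then $$f_{\ell,\delta}\,|\,(U_{Q_1}+\lambda_{Q_1}V_{Q_1})\cdots(U_{Q_t}+\lambda_{Q_t}V_{Q_t})\equiv0\pmod\ell.$$
   Context: $p(n)$ is the partition function ($p(0)=1$, $p(x)=0$ if $x$ is not a nonnegative integer). Symbols $\left(\frac{\cdot}{d}\right)$ are Jacobi symbols; $d^{-1}$ is the inverse in the ring $\mathcal O_\ell$ of algebraic numbers integral at primes above $\ell$. Let $q=e^{2\pi i\tau}$, $\eta(\tau)=q^{1/24}\prod_{n\ge1}(1-q^n)$, $\nu_\eta$ the multiplier with $\eta(\gamma\tau)=\nu_\eta(\gamma)(c\tau+d)^{1/2}\eta(\tau)$ on $\mathrm{SL}_2(\mathbb Z)$; $S_k(1,\nu_\eta^{-1})$ the cusp forms of weight $k$ with $f(\gamma\tau)=\nu_\eta(\gamma)^{-1}(c\tau+d)^kf(\tau)$ and coefficients in $\mathcal O_\ell$, expanded as $\sum a(n)q^{n/24}$. For $f=\sum a(n)q^{n/24}$: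 $f|U_m=\sum a(mn)q^{n/24}$, $f|V_m=\sum a(n)q^{mn/24}$; operators are applied successively left to right. Congruence mod $\ell$ is coefficientwise in $\mathcal O_\ell$. $f_{\ell,\delta}=\sum a_{\ell,\delta}(n)q^{n/24}$ lies in $S_{(\ell^2-2\ell)/2}(1,\nu_\eta^{-1})$ if $\delta=0$, in $S_{(\ell^2-2)/2}(1,\nu_\eta^{-1})$ if $\delta=-1$, with $a_{\ell,\delta}(n)\equiv p\left(\frac{n+1}{24}\right)\pmod\ell$ when $\left(\frac{-n}\ell\right)=\delta$ and $\equiv0$ otherwise. *)

(* Defs.v *)
From HB Require Import structures.
From mathcomp Require Import all_boot all_order all_algebra all_field.
Set Implicit Arguments. Unset Strict Implicit. Unset Printing Implicit Defensive.
Import Order.TTheory GRing.Theory Num.Theory.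

(* Partition function p(n) on nat: number of partitions of n, counted via the
   multiplicity representation: m i = number of parts equal to i+1. *)
Definition partition_count (n : nat) : nat :=
  #|[set m : {ffun 'I_n -> 'I_n.+1} | (\sum_(i < n) i.+1 * m i)%N == n]|.

Definition p_int (x : int) : nat :=
  match x with Posz k => partition_count k | Negz _ => 0%N end.

Definition p_shift (n : nat) : nat :=
  if (24 %| n.+1)%N then partition_count (n.+1 %/ 24) else 0%N.

Definition legendre (a : int) (p : nat) : int :=
  if (p%:Z %| a)%Z then 0%R
  else if [exists x : 'I_p, (p%:Z %| (x%:Z ^+ 2 - a)%R)%Z] then 1%R else (-1)%R.

Definition jacobi (a : int) (d : nat) : int :=
  (\prod_(q <- primes d) legendre a q ^+ logn q d)%R.

Definition squarefree (n : nat) : Prop :=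
  forall q : nat, prime q -> ~~ (q ^ 2 %| n)%N.

Local Open Scope ring_scope.

(* O_ell : algebraic numbers integral at all primes above ell
   (equivalently: m * x is an algebraic integer for some integer m prime to ell). *)
Definition in_Oell (ell : nat) (x : algC) : Prop :=
  exists m : nat, coprime m ell /\ (m%:R * x) \in Aint.

Definition cong_mod (ell : nat) (x y : algC) : Prop :=
  in_Oell ell ((x - y) / ell%:R).

(* a q-series sum_n a(n) q^{n/24}, n >= 0 (cusp form: a(0) irrelevant, coefficients
   at non-positive exponents vanish) is represented by its coefficient sequence. *)
Definition opU (m : nat) (a : nat -> algC) : nat -> algC := fun n => a (m * n)%N.
Definition opV (m : nat) (a : nat -> algC) : nat -> algC :=
  fun n => if (m %| n)%N then a (n %/ m)%N else 0.

Definition opUV (m : nat) (lam : algC) (a : nat -> algC) : nat -> algC :=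
  fun n => opU m a n + lam * opV m a n.

Definition lambda_coef (beta0 : int) (d : nat) : algC :=
  (d%:R)^-1 * (jacobi (-12) d)%:~R * (jacobi (24 * beta0 - 1) d)%:~R.

Definition apply_ops (beta0 : int) (Q : nat) (a : nat -> algC) : nat -> algC :=
  foldl (fun b q => opUV q (lambda_coef beta0 q) b) a (primes Q).

Definition is_f_coeffs (ell : nat) (delta : int) (a : nat -> algC) : Prop :=
  forall n : nat, in_Oell ell (a n) /\
    cong_mod ell (a n)
      (if jacobi (- n%:Z) ell == delta then (p_shift n)%:R else 0).

(* Main.v *)
Require Import Defs.
From HB Require Import structures.
From mathcomp Require Import all_boot all_order all_fingroup all_algebra all_solvable all_field.
From mathcomp Require Import boolp zify ring.
From mathcomp Require generic_quotient.

(** Everything happens with q-expansions over a finite field k of characteristic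
    ell.  Theta series in k[[S]], with q a power of S, give the Tate curve
    Y^2 = 4 X (X - alpha) (X - beta) and the coordinates X_v, Y_v of its N-torsion
    points, v in (Z/N)^2.  The ell-division polynomial near the origin shows that
    1 is homogeneous of degree (ell - 1)/2 in alpha and beta (Hasse invariant), so
    the relations between alpha, beta, X_v, Y_v are those between modular forms
    modulo ell.

    The maps of v that preserve these relations are linear and contain the shear
    S |-> xi S.  If they all preserved the line of multiplicative p-torsion, the
    sum of X over it would be a linear form in alpha and beta, which its
    q-expansion excludes.  Conjugating the shear yields the Weyl element at p.

    The product of Y_w / (X_w - X_2w) over half of the multiples w of v = (j, 1)
    is, up to harmless factors, 1 / E(zeta^j q^(1/N)) with E the Euler product.  So
    the generating function of p(n), cut to a class modulo ell by a polynomial in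
    S d/dS, is a uniform function of the torsion coordinates, and the Weyl elements
    turn its vanishing on a class modulo p into the annihilation by U_p plus a
    quotient of Gauss sums times V_p.

    With N = Q p for an auxiliary prime p, the same argument moves the vanishing
    from the class of M = 24 n - 1 to its multiples by squares, so it depends only
    on the Legendre symbol at ell.  With N = Q it then gives the theorem, and
    p(0) = 1 excludes delta = 1. *)

Set Implicit Arguments. Unset Strict Implicit. Unset Printing Implicit Defensive.
Import Order.TTheory GRing.Theory Num.Theory.
Local Open Scope ring_scope.

Lemma sum_expr_unity_root (R : idomainType) n (z : R) :
  z ^+ n = 1 -> z != 1 -> \sum_(i < n) z ^+ i = 0.
Proof.
move=> zn z1; apply/eqP; have : (z - 1) * \sum_(i < n) z ^+ i == 0.
  by rewrite -subrX1 zn subrr.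
by rewrite mulf_eq0 subr_eq0 (negPf z1).
Qed.

Lemma coprimen6 n : coprime n 6 = ~~ (2 %| n)%N && ~~ (3 %| n)%N.
Proof. by rewrite (coprimeMr n 2 3) ![coprime n _]coprime_sym !prime_coprime. Qed.

Lemma coprime_prod_primes p qs : prime p -> all prime qs -> p \notin qs -> coprime p (\prod_(q <- qs) q).
Proof.
move=> pp; elim: qs => [|q qs IH] /=; first by rewrite big_nil coprimen1.
move=> /andP[hq hqs]; rewrite inE negb_or big_cons coprimeMr => /andP[pq nq].
by rewrite IH // andbT prime_coprime // dvdn_prime2.
Qed.
Lemma dvdn_prod_primes qs x : uniq qs -> all prime qs -> (\prod_(q <- qs) q %| x)%N = all (fun p => p %| x)%N qs.
Proof.
elim: qs => [|q qs IH] /=; first by rewrite big_nil dvd1n.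
by move=> /andP[nq uq] /andP[hq hqs]; rewrite big_cons Gauss_dvd ?IH // coprime_prod_primes.
Qed.
Lemma prod_primes_gt0 qs : all prime qs -> (0 < \prod_(q <- qs) q)%N.
Proof. by move=> /allP hq; rewrite big_seq prodn_cond_gt0 // => q /hq/prime_gt0. Qed.

Lemma expN1z_neq0 (k : fieldType) (z : int) : (-1 : k) ^ z != 0.
Proof. by rewrite expfz_neq0 // oppr_eq0 oner_eq0. Qed.
Lemma expN1zN (k : fieldType) (z : int) : (-1 : k) ^ (- z) = (-1) ^ z.
Proof. by rewrite -exprz_inv invrN1. Qed.
Lemma expN1z6 (k : fieldType) (z : int) : (-1 : k) ^ (6 * z) = 1.
Proof. by rewrite -exprz_exp (_ : (-1) ^ 6 = 1) ?exp1rz // -exprnP; ring. Qed.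

Lemma size_enum_predC1 (T : finType) (x : T) : size (filter (predC1 x) (enum T)) = #|T|.-1.
Proof. by rewrite -(cardC1 x) cardE /enum_mem -filter_predI; congr size; apply: eq_filter => y; rewrite inE andbT. Qed.

Section Derivation.
Variables (R : comNzRingType) (D : R -> R).
Hypothesis DD : forall x y, D (x + y) = D x + D y.
Hypothesis DM : forall x y, D (x * y) = D x * y + x * D y.

Lemma derivation0 : D 0 = 0.
Proof. by apply: (addrI (D 0)); rewrite -DD !addr0. Qed.
Lemma derivation1 : D 1 = 0.
Proof. by apply: (addrI (D 1)); have := DM 1 1; rewrite !mulr1 mul1r addr0. Qed.
Lemma derivationN x : D (- x) = - D x.
Proof. by apply/eqP; rewrite -addr_eq0 -DD addNr derivation0. Qed.
Lemma derivationB x y : D (x - y) = D x - D y. Proof. by rewrite DD derivationN. Qed.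
Lemma derivationX x n : D (x ^+ n) = n%:R * x ^+ n.-1 * D x.
Proof.
elim: n => [|n IH]; first by rewrite expr0 derivation1 !mul0r.
rewrite exprS DM IH; case: n {IH} => [|n]; first by rewrite !expr0; ring.
by rewrite /= [x ^+ n.+1]exprS [n.+2%:R]mulrS; ring.
Qed.
Lemma derivation_horner (p : {poly R}) x : D p.[x] = (map_poly D p).[x] + p^`().[x] * D x.
Proof.
elim/poly_ind: p => [|p c IH].
  by rewrite horner0 derivation0 /map_poly size_poly0 poly_def big_ord0 deriv0 !hornerE ?mul0r.
have -> : map_poly D (p * 'X + c%:P) = map_poly D p * 'X + (D c)%:P.
  apply/polyP => i; rewrite !(coef_map_id0 _ _ derivation0) !coefD DD !coefMX !coefC.
  by case: eqP; rewrite ?(coef_map_id0 _ _ derivation0) ?derivation0.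
by rewrite !derivE !hornerE DD DM IH; ring.
Qed.
End Derivation.

Lemma derivationV (F : fieldType) (D : F -> F) (x : F) :
  (forall x y, D (x + y) = D x + D y) -> (forall x y, D (x * y) = D x * y + x * D y) ->
  D x^-1 = - (D x * x^-1 ^+ 2).
Proof.
move=> DD DM; have [->|x0] := eqVneq x 0; first by rewrite invr0 (derivation0 DD) mul0r oppr0.
apply: (mulfI x0); have := DM x x^-1; rewrite divff // (derivation1 DM) => /eqP.
by rewrite eq_sym addrC addr_eq0 => /eqP ->; field.
Qed.

(** * Formal power series *)

(* The variable of these series is written [S] in the comments. *)
Record fps (R : Type) := Fps { fcoef : nat -> R }.

HB.instance Definition _ (R : Type) := gen_eqMixin (fps R).
HB.instance Definition _ (R : Type) := gen_choiceMixin (fps R).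

Lemma fpsP (R : Type) (f g : fps R) : (forall n, fcoef f n = fcoef g n) -> f = g.
Proof. by case: f => f; case: g => g /= H; congr Fps; apply: funext. Qed.

Section FpsRing.
Variable R : comNzRingType.
Implicit Types f g h : fps R.

Definition fps_add f g := Fps (fun n => fcoef f n + fcoef g n).
Definition fps_opp f := Fps (fun n => - fcoef f n).
Definition fps_zero : fps R := Fps (fun=> 0).
Definition fps_trunc n f : {poly R} := \poly_(i < n) fcoef f i.
Definition fps_mul f g :=
  Fps (fun n => (fps_trunc n.+1 f * fps_trunc n.+1 g)`_n).
Definition fps_one : fps R := Fps (fun n => (n == 0)%:R).

Lemma fps_addA : associative fps_add.
Proof. by move=> f g h; apply: fpsP => n /=; rewrite addrA. Qed.
Lemma fps_addC : commutative fps_add.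
Proof. by move=> f g; apply: fpsP => n /=; rewrite addrC. Qed.
Lemma fps_add0 : left_id fps_zero fps_add.
Proof. by move=> f; apply: fpsP => n /=; rewrite add0r. Qed.
Lemma fps_addN : left_inverse fps_zero fps_opp fps_add.
Proof. by move=> f; apply: fpsP => n /=; rewrite addNr. Qed.
HB.instance Definition _ :=
  GRing.isZmodule.Build (fps R) fps_addA fps_addC fps_add0 fps_addN.

Lemma fps_mulE f g n :
  fcoef (fps_mul f g) n = \sum_(i < n.+1) fcoef f i * fcoef g (n - i)%N.
Proof.
rewrite /= coefM; apply: eq_bigr => i _.
by rewrite !coef_poly ltn_ord ltnS leq_subr.
Qed.

Lemma fps_mul_trunc f g n N : (n < N)%N ->
  fcoef (fps_mul f g) n = (fps_trunc N f * fps_trunc N g)`_n.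
Proof.
move=> ltnN; rewrite fps_mulE coefM; apply: eq_bigr => i _.
by rewrite !coef_poly (leq_ltn_trans _ ltnN) ?(leq_ltn_trans _ ltnN) ?leq_subr // -ltnS.
Qed.

Lemma fps_mulC : commutative fps_mul.
Proof. by move=> f g; apply: fpsP => n /=; rewrite mulrC. Qed.

Lemma fps_mulA : associative fps_mul.
Proof.
move=> f g h; apply: fpsP => n.
rewrite fps_mulE [RHS]fps_mulE.
transitivity ((fps_trunc n.+1 f * (fps_trunc n.+1 g * fps_trunc n.+1 h))`_n).
  rewrite coefM; apply: eq_bigr => i _.
  by rewrite coef_poly ltn_ord (@fps_mul_trunc g h _ n.+1) // ltnS leq_subr.
rewrite mulrA coefM; apply: eq_bigr => i _.
by rewrite [in RHS](@fps_mul_trunc f g _ n.+1) // [X in _ * X]coef_poly ltnS leq_subr.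
Qed.

Lemma fps_mul1 : left_id fps_one fps_mul.
Proof.
move=> f; apply: fpsP => n; rewrite fps_mulE big_ord_recl /= mul1r subn0.
by rewrite big1 ?addr0 // => i _; rewrite mul0r.
Qed.

Lemma fps_mulDl : left_distributive fps_mul fps_add.
Proof.
move=> f g h; apply: fpsP => n; rewrite fps_mulE /=.
rewrite -[X in _ = X + _]/(fcoef (fps_mul f h) n) -[X in _ = _ + X]/(fcoef (fps_mul g h) n).
by rewrite !fps_mulE -big_split; apply: eq_bigr => i _; rewrite mulrDl.
Qed.

Lemma fps_one_neq0 : fps_one != fps_zero.
Proof.
by apply/eqP => /(congr1 (fun f => fcoef f 0)) /= /eqP; rewrite oner_eq0.
Qed.

HB.instance Definition _ := GRing.Zmodule_isComNzRing.Build (fps R)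
  fps_mulA fps_mulC fps_mul1 fps_mulDl fps_one_neq0.

Lemma fcoef0 n : fcoef (0 : fps R) n = 0. Proof. by []. Qed.
Lemma fcoef1 n : fcoef (1 : fps R) n = (n == 0)%:R. Proof. by []. Qed.
Lemma fcoefD f g n : fcoef (f + g) n = fcoef f n + fcoef g n. Proof. by []. Qed.
Lemma fcoefN f n : fcoef (- f) n = - fcoef f n. Proof. by []. Qed.
Lemma fcoefB f g n : fcoef (f - g) n = fcoef f n - fcoef g n. Proof. by []. Qed.
Lemma fcoefM f g n :
  fcoef (f * g) n = \sum_(i < n.+1) fcoef f i * fcoef g (n - i)%N.
Proof. exact: fps_mulE. Qed.
Lemma fcoef_sum (I : Type) (r : seq I) (P : pred I) (F : I -> fps R) n :
  fcoef (\sum_(i <- r | P i) F i) n = \sum_(i <- r | P i) fcoef (F i) n.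
Proof. by elim/big_rec2: _ => // i x y _ <-. Qed.

Definition fpsC (c : R) : fps R := Fps (fun n => if n == 0 then c else 0).
Definition fpsX (e : nat) : fps R := Fps (fun n => (n == e)%:R).

Lemma fcoefCM c f n : fcoef (fpsC c * f) n = c * fcoef f n.
Proof.
rewrite fcoefM big_ord_recl /= subn0 big1 ?addr0 // => i _.
by rewrite mul0r.
Qed.

Lemma fcoefXM e f n : fcoef (fpsX e * f) n = if (n < e)%N then 0 else fcoef f (n - e).
Proof.
rewrite fcoefM; case: ltnP => [lt_ne | le_en].
  rewrite big1 // => i _ /=; case: eqP => [Ei|_]; last by rewrite mul0r.
  by have := ltn_ord i; rewrite Ei ltnS leqNgt lt_ne.
rewrite (bigD1 (Ordinal (n:=n.+1) (m:=e) le_en)) //= eqxx mul1r big1 ?addr0 //.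
move=> i; rewrite -val_eqE /= => /negPf->; exact: mul0r.
Qed.

Lemma fpsC_zmod : zmod_morphism fpsC.
Proof.
by move=> a b; apply: fpsP => n; rewrite fcoefB /=; case: eqP => // _; rewrite subr0.
Qed.
Lemma fpsC_monoid : monoid_morphism fpsC.
Proof.
split; first by apply: fpsP => n /=; case: eqP.
by move=> a b; apply: fpsP => n; rewrite fcoefCM /=; case: eqP => // _; rewrite mulr0.
Qed.
HB.instance Definition _ := GRing.isZmodMorphism.Build R (fps R) fpsC fpsC_zmod.
HB.instance Definition _ := GRing.isMonoidMorphism.Build R (fps R) fpsC fpsC_monoid.

Lemma fpsX0 : fpsX 0 = 1. Proof. exact: fpsP. Qed.
Lemma fpsXD a b : fpsX (a + b) = fpsX a * fpsX b.
Proof.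
apply: fpsP => n; rewrite fcoefXM /=.
case: ltnP => Hn; last by congr (_%:R); lia.
by case: eqP => // ?; lia.
Qed.
Lemma fpsXM a n : fpsX (a * n) = fpsX a ^+ n.
Proof. by elim: n => [|n IH]; rewrite ?muln0 ?fpsX0 ?expr0 // mulnS fpsXD IH exprS. Qed.

Definition fderiv f : fps R := Fps (fun n => fcoef f n *+ n).
Lemma fderivD f g : fderiv (f + g) = fderiv f + fderiv g.
Proof. by apply: fpsP => n /=; rewrite mulrnDl. Qed.
Lemma fderivM f g : fderiv (f * g) = fderiv f * g + f * fderiv g.
Proof.
apply: fpsP => n; rewrite [LHS]/= -[X in X *+ n]/(fcoef (f * g) n) fcoefD !fcoefM -big_split -sumrMnl.
apply: eq_bigr => i _ /=.
rewrite mulrnAl mulrnAr -mulrnDr subnKC //.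
by rewrite -ltnS.
Qed.

(* The substitution [S |-> c S]. *)
Definition fscale (c : R) f : fps R := Fps (fun n => c ^+ n * fcoef f n).
Lemma fscale_zmod c : zmod_morphism (fscale c).
Proof. by move=> f g; apply: fpsP => n; rewrite fcoefB /= mulrBr. Qed.
Lemma fscale_monoid c : monoid_morphism (fscale c).
Proof.
split; first by apply: fpsP => -[|n] /=; rewrite ?mulr0 ?expr0 ?mul1r.
move=> f g; apply: fpsP => n; rewrite fcoefM [LHS]/= -[X in _ * X]/(fcoef (f * g) n) fcoefM mulr_sumr.
apply: eq_bigr => i _; rewrite /= mulrACA -exprD subnKC // -ltnS.
exact: ltn_ord.
Qed.
HB.instance Definition _ c := GRing.isZmodMorphism.Build (fps R) (fps R) (fscale c) (fscale_zmod c).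
HB.instance Definition _ c := GRing.isMonoidMorphism.Build (fps R) (fps R) (fscale c) (fscale_monoid c).

Definition feqm n f g := forall i, (i < n)%N -> fcoef f i = fcoef g i.

Lemma feqm_refl n f : feqm n f f. Proof. by []. Qed.
Lemma feqm_sym n f g : feqm n f g -> feqm n g f.
Proof. by move=> H i /H. Qed.
Lemma feqm_trans n f g h : feqm n f g -> feqm n g h -> feqm n f h.
Proof. by move=> H1 H2 i lt; rewrite H1 ?H2. Qed.
Lemma feqm_le n m f g : (n <= m)%N -> feqm m f g -> feqm n f g.
Proof. by move=> le H i lt; apply: H; apply: leq_trans le. Qed.
Lemma feqmD n f f' g g' : feqm n f f' -> feqm n g g' -> feqm n (f + g) (f' + g').
Proof. by move=> H1 H2 i lt; rewrite !fcoefD H1 ?H2. Qed.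
Lemma feqmN n f f' : feqm n f f' -> feqm n (- f) (- f').
Proof. by move=> H1 i lt; rewrite !fcoefN H1. Qed.
Lemma feqmM n f f' g g' : feqm n f f' -> feqm n g g' -> feqm n (f * g) (f' * g').
Proof.
move=> H1 H2 i lt; rewrite !fcoefM; apply: eq_bigr => j _.
by rewrite H1 ?H2 //; apply: leq_ltn_trans lt; rewrite ?leq_subr // -ltnS.
Qed.
Lemma feqmX n f f' m : feqm n f f' -> feqm n (f ^+ m) (f' ^+ m).
Proof. by move=> H; elim: m => [|m IH]; rewrite ?expr0 // !exprS; apply: feqmM. Qed.
Lemma feqm_eq f g : (forall n, feqm n f g) -> f = g.
Proof. by move=> H; apply: fpsP => n; apply: (H n.+1). Qed.
Lemma feqm_prod1 n (s : seq nat) (f : nat -> fps R) :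
  (forall i, i \in s -> feqm n (f i) 1) -> feqm n (\prod_(i <- s) f i) 1.
Proof.
elim: s => [|i s IH] h; first by rewrite big_nil.
rewrite big_cons -[X in feqm _ _ X]mulr1; apply: feqmM; first by apply: h; rewrite mem_head.
by apply: IH => j js; apply: h; rewrite inE js orbT.
Qed.
Lemma feqm_sum n (I : Type) (r : seq I) (P : pred I) (F G : I -> fps R) :
  (forall i, P i -> feqm n (F i) (G i)) ->
  feqm n (\sum_(i <- r | P i) F i) (\sum_(i <- r | P i) G i).
Proof.
by move=> H; elim/big_rec2: _ => // i x y Pi Hxy; apply: feqmD => //; apply: H.
Qed.

Lemma fcoef0_exp f n : fcoef (f ^+ n) 0 = fcoef f 0 ^+ n.
Proof.
elim: n => [|n IH]; first by [].
by rewrite !exprS fcoefM big_ord_recl big_ord0 addr0 IH.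
Qed.

Lemma fcoef_exp_small h n i : fcoef h 0 = 0 -> (i < n)%N -> fcoef (h ^+ n) i = 0.
Proof.
move=> h0; elim: n i => // n IH i; rewrite ltnS => le_in.
rewrite exprS fcoefM big_ord_recl h0 mul0r add0r big1 // => j _.
rewrite IH ?mulr0 //.
by rewrite lift0; have := ltn_ord j; lia.
Qed.

Lemma fps_inv_1sub h : fcoef h 0 = 0 -> exists g, g * (1 - h) = 1.
Proof.
move=> h0; exists (Fps (fun i => fcoef (\sum_(n < i.+1) h ^+ n) i)).
have E N : feqm N (Fps (fun i => fcoef (\sum_(n < i.+1) h ^+ n) i)) (\sum_(n < N) h ^+ n).
  move=> i lt_iN /=; rewrite !fcoef_sum.
  rewrite -(subnKC lt_iN) big_split_ord /= [X in _ = _ + X]big1 ?addr0 // => j _.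
  by rewrite fcoef_exp_small // ltn_addr.
apply: feqm_eq => N.
apply: (feqm_trans (feqmM (E N) (@feqm_refl N (1 - h)))).
rewrite mulrC -opprB mulNr -subrX1 opprB => i lt.
by rewrite fcoefB fcoef_exp_small // subr0.
Qed.

End FpsRing.

Arguments fpsX {R} e.

Section FpsUnit.
Variable R : comUnitRingType.
Implicit Types f g h : fps R.

Definition fps_unit : pred (fps R) := fun f => `[< exists g, g * f = 1 >].
Definition fps_inv f : fps R :=
  if pselect (exists g, g * f = 1) is left H then projT1 (cid H) else f.
Lemma fps_mulVr : {in fps_unit, left_inverse 1 fps_inv *%R}.
Proof.
move=> f; rewrite /fps_inv => Hf; case: pselect => [H|]; last first.
  by case; apply/asboolP.
exact: (projT2 (cid H)).
Qed.
Lemma fps_unitP f g : g * f = 1 -> fps_unit f.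
Proof. by move=> H; apply/asboolP; exists g. Qed.
Lemma fps_inv_out : {in [predC fps_unit], fps_inv =1 id}.
Proof.
move=> f; rewrite inE /= /fps_inv; case: pselect => // H.
by move/negP; case; apply/asboolP.
Qed.
HB.instance Definition _ := GRing.ComNzRing_hasMulInverse.Build (fps R)
  fps_mulVr fps_unitP fps_inv_out.

Lemma fps_unit_coef0 f : fcoef f 0 \is a GRing.unit -> f \is a GRing.unit.
Proof.
move=> Uf; have [|g Hg] := @fps_inv_1sub R (1 - fpsC (fcoef f 0)^-1 * f).
  by rewrite fcoefB fcoefCM mulVr // fcoef1 subrr.
apply/unitrPr; exists (g * fpsC (fcoef f 0)^-1).
by rewrite -{}Hg opprB addrC subrK mulrC -mulrA.
Qed.
End FpsUnit.

Section FpsIdomain.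
Variable R : idomainType.
Implicit Types f g h : fps R.

Lemma fps_valuation f : f != 0 ->
  exists2 n, fcoef f n != 0 & forall i, (i < n)%N -> fcoef f i = 0.
Proof.
move=> nz; have ex : exists n, fcoef f n != 0.
  apply: contrapT => H; case/eqP: nz; apply: fpsP => n.
  by apply/eqP/negPn/negP => nzn; apply: H; exists n.
case: (ex_minnP ex) => n nzn Hmin; exists n => // i lt.
by apply/eqP/negPn/negP => /Hmin; rewrite leqNgt lt.
Qed.

Lemma fps_idomain f g : f * g = 0 -> (f == 0) || (g == 0).
Proof.
move=> fg0; apply/norP => -[/fps_valuation [m nzm Hm] /fps_valuation [n nzn Hn]].
have: fcoef (f * g) (m + n) = fcoef f m * fcoef g n.
  rewrite fcoefM (bigD1 (Ordinal (leq_addr n m : (m < (m + n).+1)%N))) //=.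
  rewrite addKn big1 ?addr0 // => i; rewrite -val_eqE /= => ne.
  have [lt|ge] := ltnP i m; first by rewrite Hm ?mul0r.
  rewrite [fcoef g _]Hn ?mulr0 //.
  have := ltn_ord i; move: ne ge; lia.
by rewrite fg0 fcoef0 => /esym/eqP; rewrite mulf_eq0 (negPf nzm) (negPf nzn).
Qed.
HB.instance Definition _ := GRing.ComUnitRing_isIntegral.Build (fps R) fps_idomain.

Lemma fpsX_neq0 e : fpsX e != 0 :> fps R.
Proof.
by apply/eqP => /(congr1 (fun f => fcoef f e)) /= /eqP; rewrite eqxx oner_eq0.
Qed.
Lemma fpsC_inj : injective (@fpsC R).
Proof. by move=> a b /(congr1 (fun f => fcoef f 0)). Qed.
End FpsIdomain.

Section FpsMap.
Variables (R R' : comNzRingType) (phi : {rmorphism R -> R'}).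
Definition fmap (f : fps R) : fps R' := Fps (fun n => phi (fcoef f n)).
Lemma fmap_zmod : zmod_morphism fmap.
Proof. by move=> f g; apply: fpsP => n; rewrite fcoefB /= rmorphB. Qed.
Lemma fmap_monoid : monoid_morphism fmap.
Proof.
split; first by apply: fpsP => n /=; rewrite rmorph_nat.
move=> f g; apply: fpsP => n; rewrite fcoefM [LHS]/= -[X in phi X]/(fcoef (f * g) n) fcoefM rmorph_sum.
by apply: eq_bigr => i _; rewrite rmorphM.
Qed.
HB.instance Definition _ := GRing.isZmodMorphism.Build (fps R) (fps R') fmap fmap_zmod.
HB.instance Definition _ := GRing.isMonoidMorphism.Build (fps R) (fps R') fmap fmap_monoid.
End FpsMap.

Definition finite_fibers (I : eqType) (x : I -> nat) :=
  forall e, exists s : seq I, forall i, x i = e -> i \in s.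

Lemma finite_fibers_le (I : eqType) (x : I -> nat) : finite_fibers x ->
  forall e, exists2 s : seq I, uniq s & forall i, (x i <= e)%N -> i \in s.
Proof.
move=> px e; suff [s Hs] : exists s : seq I, forall i, (x i <= e)%N -> i \in s.
  by exists (undup s); rewrite ?undup_uniq // => i /Hs; rewrite mem_undup.
elim: e => [|e [s Hs]].
  by have [s Hs] := px 0; exists s => i; rewrite leqn0 => /eqP/Hs.
have [t Ht] := px e.+1; exists (s ++ t) => i; rewrite mem_cat leq_eqVlt.
by case/orP => [/eqP/Ht -> | /Hs ->]; rewrite ?orbT.
Qed.

Lemma finite_fibers_can (I J : eqType) (x : I -> nat) (h : J -> I) (g : I -> J) :
  cancel h g -> finite_fibers x -> finite_fibers (x \o h).
Proof.
move=> hK px e; have [s Hs] := px e; exists (map g s) => j /= /Hs hs.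
by rewrite -(hK j) map_f.
Qed.

Lemma finite_fibers_add (I J : eqType) (x : I -> nat) (y : J -> nat) :
  finite_fibers x -> finite_fibers y -> finite_fibers (fun p : I * J => x p.1 + y p.2)%N.
Proof.
move=> /finite_fibers_le px /finite_fibers_le py e.
have [s _ Hs] := px e; have [t _ Ht] := py e.
exists [seq (a, b) | a <- s, b <- t] => -[a b] /= E.
by apply: allpairs_f; [apply: Hs | apply: Ht]; lia.
Qed.

Section FormalSum.
Variable R : comNzRingType.

(* The sum of [w i * S ^ (x i)] over all [i]; junk unless the fibres of [x] are finite. *)
Definition fpsum (I : eqType) (w : I -> R) (x : I -> nat) : fps R :=
  Fps (fun e =>
    if pselect (exists s : seq I, forall i, x i = e -> i \in s) is left H
    then \sum_(i <- undup (projT1 (cid H)) | x i == e) w i else 0).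

Lemma fpsumE (I : eqType) (w : I -> R) (x : I -> nat) e (s : seq I) :
  uniq s -> (forall i, x i = e -> i \in s) ->
  fcoef (fpsum w x) e = \sum_(i <- s | x i == e) w i.
Proof.
move=> us Hs /=; case: pselect => [H|]; last by case; exists s.
case: (cid H) => t Ht /=; rewrite -big_filter -[RHS]big_filter; apply: perm_big.
apply: uniq_perm; rewrite ?filter_uniq ?undup_uniq // => i.
by rewrite !mem_filter mem_undup; case: eqP => //= E; rewrite Ht ?Hs.
Qed.

Lemma eq_fpsum (I : eqType) (w w' : I -> R) (x x' : I -> nat) :
  w =1 w' -> x =1 x' -> fpsum w x = fpsum w' x'.
Proof. by move=> /funext -> /funext ->. Qed.

Lemma fpsum_eq0 (I : eqType) (w : I -> R) (x : I -> nat) :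
  (forall i, w i = 0) -> fpsum w x = 0.
Proof.
move=> w0; apply: fpsP => e /=; case: pselect => // H.
by rewrite big1 // => i _; rewrite w0.
Qed.

Lemma fpsumM (I J : eqType) (w : I -> R) (x : I -> nat) (v : J -> R) (y : J -> nat) :
  finite_fibers x -> finite_fibers y ->
  fpsum w x * fpsum v y = fpsum (fun p => w p.1 * v p.2) (fun p => x p.1 + y p.2)%N.
Proof.
move=> /finite_fibers_le px /finite_fibers_le py; apply: fpsP => e.
have [s us Hs] := px e; have [t ut Ht] := py e.
rewrite fcoefM (@fpsumE _ _ _ _ [seq (a, b) | a <- s, b <- t]); first last.
- by move=> [a b] /= E; apply: allpairs_f; [apply: Hs | apply: Ht]; lia.
- by apply: allpairs_uniq => // -[a b] [a' b'].
rewrite [RHS]big_mkcond [RHS]big_allpairs_dep.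
transitivity (\sum_(i < e.+1) \sum_(a <- s | x a == i) w a * \sum_(b <- t | y b == (e - i)%N) v b).
  apply: eq_bigr => i _; have := ltn_ord i; rewrite ltnS => le_ie.
  rewrite (@fpsumE _ w x _ s) ?(@fpsumE _ v y _ t) ?mulr_suml //.
    by move=> b E; apply: Ht; rewrite E leq_subr.
  by move=> a E; apply: Hs; rewrite E.
rewrite (exchange_big_dep xpredT) //=; apply: eq_big_seq => a a_s.
have [le_xe | lt_ex] := leqP (x a) e.
  rewrite (bigD1 (Ordinal (n:=e.+1) (m:=x a) le_xe)) //= [X in _ + X]big1 ?addr0; last first.
    move=> i /andP[/eqP E]; rewrite -val_eqE /= -E eqxx //.
  rewrite mulr_sumr big_mkcond /=; apply: eq_bigr => b _.
  by congr (if _ then _ else _); apply/eqP/eqP; lia.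
rewrite big1 => [|i /eqP E]; last by have := ltn_ord i; lia.
by rewrite big1 // => b _; case: eqP => // ?; lia.
Qed.

Lemma fpsum_reindex (I J : eqType) (h : J -> I) (w : I -> R) (x : I -> nat) :
  bijective h -> finite_fibers x -> fpsum w x = fpsum (w \o h) (x \o h).
Proof.
case=> g hK gK px; apply: fpsP => e; have [s us Hs] := finite_fibers_le px e.
rewrite (@fpsumE _ w x e s) //; last by move=> i E; apply: Hs; rewrite E.
rewrite (@fpsumE _ _ _ e (map g s)); first last.
- by move=> j /= E; rewrite -(hK j) map_f // Hs // E.
- by rewrite map_inj_uniq //; apply: can_inj gK.
by rewrite big_map; apply: eq_big => i /=; rewrite gK.
Qed.

Lemma fpsum_sumtype (I J : eqType) (w : I + J -> R) (x : I + J -> nat) : finite_fibers x ->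
  fpsum w x = fpsum (w \o inl) (x \o inl) + fpsum (w \o inr) (x \o inr).
Proof.
move=> px; apply: fpsP => e; have [s us Hs] := finite_fibers_le px e.
rewrite fcoefD (@fpsumE _ w x e s) //; last by move=> i E; apply: Hs; rewrite E.
pose sl := pmap (fun z : I + J => if z is inl a then Some a else None) s.
pose sr := pmap (fun z : I + J => if z is inr a then Some a else None) s.
have Msl a : (a \in sl) = (inl a \in s).
  rewrite mem_pmap; apply/mapP/idP => [[[b|b] // Hb [->]] //|Ha].
  by exists (inl a).
have Msr a : (a \in sr) = (inr a \in s).
  rewrite mem_pmap; apply/mapP/idP => [[[b|b] // Hb [->]] //|Ha].
  by exists (inr a).
have usl : uniq sl.
  apply: (@pmap_uniq _ _ (fun z : I + J => if z is inl a then Some a else None) inl) => //.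
  by case.
have usr : uniq sr.
  apply: (@pmap_uniq _ _ (fun z : I + J => if z is inr a then Some a else None) inr) => //.
  by case.
rewrite (@fpsumE _ _ _ e sl) //; last by move=> a /= E; rewrite Msl Hs // E.
rewrite (@fpsumE _ _ _ e sr) //; last by move=> a /= E; rewrite Msr Hs // E.
have -> : \sum_(i <- s | x i == e) w i = \sum_(i <- map inl sl ++ map inr sr | x i == e) w i.
  apply: perm_big; apply: uniq_perm => //.
    rewrite cat_uniq !map_inj_uniq ?usl ?usr //=; try by move=> ? ? [].
    by rewrite andbT; apply/hasPn => z /mapP[b _ ->]; apply/mapP => -[].
  move=> [a|b]; rewrite mem_cat.
    rewrite mem_map ?Msl => [|? ? [] //]; case: (inl a \in s) => //=.
    by apply/esym/negbTE/mapP => -[].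
  rewrite [X in _ = _ || X]mem_map ?Msr => [|? ? [] //]; case: (inr b \in s); rewrite ?orbT //.
  by rewrite orbF; apply/esym/negbTE/mapP => -[].
by rewrite big_cat !big_map.
Qed.

Lemma fpsumZ (I : eqType) (c : R) (w : I -> R) (x : I -> nat) :
  fpsum (fun i => c * w i) x = fpsC c * fpsum w x.
Proof.
apply: fpsP => e; rewrite fcoefCM /=; case: pselect => [H|_]; last by rewrite mulr0.
by rewrite mulr_sumr.
Qed.

Lemma fpsumN (I : eqType) (w : I -> R) (x : I -> nat) :
  fpsum (fun i => - w i) x = - fpsum w x.
Proof.
apply: fpsP => e; rewrite fcoefN /=; case: pselect => [H|_]; last by rewrite oppr0.
by rewrite sumrN.
Qed.

Lemma fpsumD (I : eqType) (w v : I -> R) (x : I -> nat) :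
  fpsum (fun i => w i + v i) x = fpsum w x + fpsum v x.
Proof.
apply: fpsP => e; rewrite fcoefD /=; case: pselect => [H|_]; last by rewrite addr0.
exact: big_split.
Qed.

Lemma fpsum_lin (J : Type) (s : seq J) (I : eqType) (c : J -> R) (w : J -> I -> R) (x : I -> nat) :
  \sum_(j <- s) fpsC (c j) * fpsum (w j) x = fpsum (fun i => \sum_(j <- s) c j * w j i) x.
Proof.
apply: fpsP => e; rewrite fcoef_sum (eq_bigr _ (fun j _ => fcoefCM _ _ _)) /fpsum /=.
case: pselect => H; last by rewrite big1 // => j _; rewrite mulr0.
by rewrite exchange_big; apply: eq_bigr => j _; rewrite mulr_sumr.
Qed.

Lemma fpsum_support (I J : eqType) (h : J -> I) (D : pred I) (w : I -> R) (x : I -> nat) :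
  injective h -> (forall i, D i -> exists j, h j = i) -> (forall j, D (h j)) -> finite_fibers x ->
  fpsum (fun i => (D i)%:R * w i) x = fpsum (w \o h) (x \o h).
Proof.
move=> hI hD Dh px; apply: fpsP => e; have [s us] := finite_fibers_le px e => hs.
pose g i : option J := if pselect (exists j, h j = i) is left H then Some (projT1 (cid H)) else None.
have gK : ocancel g h by move=> i; rewrite /g; case: pselect => //= H; exact: (projT2 (cid H)).
have hg j : g (h j) = Some j.
  rewrite /g; case: pselect => [H|[]]; last by exists j.
  by congr Some; apply: hI; exact: (projT2 (cid H)).
rewrite (@fpsumE _ _ _ e s) //; last by move=> i xi; apply: hs; rewrite xi.
rewrite (@fpsumE _ _ _ e (pmap g s)); last 2 first.
- by apply: (pmap_uniq gK).
- by move=> j xj; rewrite mem_pmap; apply/mapP; exists (h j); rewrite ?hg //; apply: hs; rewrite /= in xj; rewrite xj.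
rewrite big_mkcond [RHS]big_mkcond big_pmap; apply: eq_bigr => i _.
case E: (g i) => [j|] /=.
  have <- : h j = i by have := gK i; rewrite E.
  by rewrite Dh mul1r.
case: ifP => // _; case Di: (D i); last by rewrite mul0r.
by have [j Ej] := hD i Di; move: E; rewrite -Ej hg.
Qed.

Lemma fscale_fpsum (I : eqType) c (w : I -> R) (x : I -> nat) :
  fscale c (fpsum w x) = fpsum (fun i => c ^+ x i * w i) x.
Proof.
apply: fpsP => e /=; case: pselect => [H|_]; last by rewrite mulr0.
by rewrite mulr_sumr; apply: eq_bigr => i /eqP->.
Qed.

Lemma fderiv_fpsum (I : eqType) (w : I -> R) (x : I -> nat) :
  fderiv (fpsum w x) = fpsum (fun i => w i *+ x i) x.
Proof.
apply: fpsP => e /=; case: pselect => [H|_]; last by rewrite mul0rn.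
by rewrite -sumrMnl; apply: eq_bigr => i /eqP->.
Qed.

Lemma fpsX_fpsum (I : eqType) a (w : I -> R) (x : I -> nat) : finite_fibers x ->
  fpsX a * fpsum w x = fpsum w (fun i => a + x i)%N.
Proof.
move=> px; apply: fpsP => e; rewrite fcoefXM.
have [s us Hs] := finite_fibers_le px e.
rewrite (@fpsumE _ w (fun i => a + x i)%N e s) //; last by move=> i E; apply: Hs; lia.
case: ltnP => [lt|le]; first by rewrite big1 // => i /eqP E; lia.
rewrite (@fpsumE _ w x _ s) //; last by move=> i E; apply: Hs; lia.
by apply: eq_bigl => i; apply/eqP/eqP; lia.
Qed.

Lemma fcoef_fpsum0 (I : eqType) (w : I -> R) (x : I -> nat) e :
  (forall i, x i <> e) -> fcoef (fpsum w x) e = 0.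
Proof.
by move=> H; rewrite (@fpsumE _ _ _ e [::]) ?big_nil // => i /H.
Qed.

Lemma fcoef_fpsum1 (I : eqType) (w : I -> R) (x : I -> nat) i0 :
  (forall i, x i = x i0 -> i = i0) -> fcoef (fpsum w x) (x i0) = w i0.
Proof.
move=> H; rewrite (@fpsumE _ _ _ _ [:: i0]) // ?big_cons ?big_nil ?eqxx ?addr0 //.
by move=> i /H ->; rewrite inE.
Qed.
End FormalSum.

Lemma fmap_fpsum (R R' : comNzRingType) (phi : {rmorphism R -> R'}) (I : eqType)
  (w : I -> R) (x : I -> nat) : fmap phi (fpsum w x) = fpsum (phi \o w) x.
Proof.
apply: fpsP => e /=; case: pselect => [H|_]; last by rewrite rmorph0.
by rewrite rmorph_sum.
Qed.

Lemma fpsum_odd_eq0 (R : idomainType) (I : eqType) (h : I -> I) (w : I -> R) (x : I -> nat) :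
  (2%:R : R) != 0 -> bijective h -> finite_fibers x -> (forall i, w (h i) = - w i) ->
  (forall i, x (h i) = x i) -> fpsum w x = 0.
Proof.
move=> nz2 bh px wh xh; have := fpsum_reindex w bh px.
rewrite (@eq_fpsum _ _ (w \o h) (fun i => - w i) (x \o h) x) // fpsumN => E.
apply: fpsP => e; have /(congr1 (fun f => fcoef f e)) := E; rewrite fcoefN fcoef0.
move=> H; apply/eqP; move/eqP: H; rewrite -addr_eq0 -mulr2n -mulr_natr mulf_eq0.
by rewrite (negPf nz2) orbF.
Qed.

(** * Theta series and the Jacobi triple product *)

Lemma abszX2 (x : int) : ((`|x|%N ^ 2)%N)%:Z = x ^+ 2.
Proof. by rewrite -mulnn PoszM abszE -expr2 real_normK ?num_real. Qed.

Lemma finite_fibers_sqr (k : nat) (a b : int) : (0 < k)%N -> a != 0 ->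
  finite_fibers (fun n : int => (k * `|(a * n + b)%R| ^ 2)%N).
Proof.
move=> k0 a0 e; exists [seq i%:Z - (e + `|b|)%:Z | i <- iota 0 (2 * (e + `|b|)).+1].
move=> n E; have Hn : (`|n| <= e + `|b|)%N.
  have H1 : (`|(a * n + b)%R| <= e)%N.
    rewrite -E; apply: leq_trans (leq_pmull _ k0).
    by case: `|_|%N => // m; rewrite -mulnn leq_pmull.
  have H2 : (`|n| <= `|(a * n)%R|)%N by rewrite abszM leq_pmull // lt0n absz_eq0.
  lia.
apply/mapP; exists `|(n + (e + `|b|)%:Z)%R|%N; last by lia.
by rewrite mem_iota; lia.
Qed.

Notation off_lattice N c m := (((2 * N)%:Z %| m)%Z -> c != 1).

Section Theta.
Variable R : idomainType.
Variable N : nat.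
Hypothesis N0 : (0 < N)%N.

Definition theta_exp (m n : int) : nat := (`|((2 * N)%:Z * n + (m - N%:Z))%R| ^ 2)%N.
Definition even_exp (m b : int) : nat := (2 * `|((2 * N)%:Z * b + m)%R| ^ 2)%N.
Definition odd_exp (m b : int) : nat := (2 * `|((2 * N)%:Z * b + (N%:Z + m))%R| ^ 2)%N.

Lemma theta_expE m n : (theta_exp m n)%:Z = (2 * N%:Z * n + (m - N%:Z)) ^+ 2.
Proof. by rewrite /theta_exp abszX2 PoszM. Qed.
Lemma even_expE m n : (even_exp m n)%:Z = 2 * (2 * N%:Z * n + m) ^+ 2.
Proof. by rewrite /even_exp [LHS]PoszM abszX2 PoszM. Qed.
Lemma odd_expE m n : (odd_exp m n)%:Z = 2 * (2 * N%:Z * n + (N%:Z + m)) ^+ 2.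
Proof. by rewrite /odd_exp [LHS]PoszM abszX2 PoszM. Qed.

Lemma twoN_neq0 : (2 * N)%:Z != 0. Proof. lia. Qed.
Lemma finite_fibers_theta_exp m : finite_fibers (theta_exp m).
Proof.
move=> e; have [s Hs] := finite_fibers_sqr (m - N%:Z) (ltn0Sn 0) twoN_neq0 e.
by exists s => i Hi; apply: Hs; rewrite mul1n.
Qed.
Lemma finite_fibers_even_exp m : finite_fibers (even_exp m). Proof. exact: finite_fibers_sqr twoN_neq0. Qed.
Lemma finite_fibers_odd_exp m : finite_fibers (odd_exp m). Proof. exact: finite_fibers_sqr twoN_neq0. Qed.

(* The pair [(c, m)] stands for the argument [u = c S ^ (4 N m)] of the Jacobi theta function with nome [q = S ^ (8 N ^ 2)]. *)
Definition theta (c : R) (m : int) : fps R := fpsum (fun n : int => (- c) ^ n) (theta_exp m).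
Definition theta_even (c : R) (m : int) : fps R := fpsum (fun b : int => c ^ (2 * b)) (even_exp m).
Definition theta_odd (c : R) (m : int) : fps R := fpsum (fun b : int => c ^ (2 * b + 1)) (odd_exp m).

Lemma fpsum_theta_mul (w : int -> int -> R) m1 m2 :
  fpsum (fun p : int * int => w p.1 p.2)
     (fun p => theta_exp (m1 + m2) p.1 + theta_exp (m1 - m2) p.2)%N =
  fpsum (fun p : int * int => w (p.1 + p.2 + 1) (p.1 - p.2 + 1))
     (fun p => odd_exp m1 p.1 + even_exp m2 p.2)%N +
  fpsum (fun p : int * int => w (p.1 + p.2 + 1) (p.1 - p.2))
     (fun p => even_exp m1 p.1 + odd_exp m2 p.2)%N.
Proof.
pose h (z : (int * int) + (int * int)) : int * int :=
  match z with inl p => (p.1 + p.2 + 1, p.1 - p.2 + 1)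
             | inr p => (p.1 + p.2 + 1, p.1 - p.2) end.
pose g (p : int * int) : (int * int) + (int * int) :=
  if ((p.1 - p.2) %% 2)%Z == 0
  then inl (((p.1 + p.2) %/ 2)%Z - 1, ((p.1 - p.2) %/ 2)%Z)
  else inr (((p.1 + p.2) %/ 2)%Z, ((p.1 - p.2) %/ 2)%Z).
have bh : bijective h.
  exists g => [[[a b]|[a b]]|[n n']]; rewrite /g /h /=.
  - by rewrite ifT; [congr (inl (_, _)); lia | lia].
  - by rewrite ifF; [congr (inr (_, _)); lia | lia].
  - by case: ifP => H /=; congr pair; lia.
have px := finite_fibers_add (finite_fibers_theta_exp (m1 + m2)) (finite_fibers_theta_exp (m1 - m2)).
rewrite (fpsum_reindex _ bh px) fpsum_sumtype; last first.
  by case: bh => g' hK gK; apply: finite_fibers_can hK px.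
congr (_ + _); apply: eq_fpsum => // -[a b] /=; apply/eqP; rewrite -eqz_nat.
- by rewrite PoszD [X in _ == X]PoszD !theta_expE even_expE odd_expE; apply/eqP; ring.
- by rewrite PoszD [X in _ == X]PoszD !theta_expE even_expE odd_expE; apply/eqP; ring.
Qed.

Lemma exprNz_double (c : R) (n : int) : (- c) ^ (2 * n) = c ^ (2 * n).
Proof. by rewrite -!exprz_exp -[_ ^ 2]/(_ ^+ 2) sqrrN. Qed.

Lemma theta_mul c1 c2 m1 m2 : c1 \is a GRing.unit -> c2 \is a GRing.unit ->
  theta (c1 * c2) (m1 + m2) * theta (c1 / c2) (m1 - m2) =
  fpsC c1 * (theta_odd c1 m1 * theta_even c2 m2 - theta_even c1 m1 * theta_odd c2 m2).
Proof.
move=> U1 U2; rewrite fpsumM; try exact: finite_fibers_theta_exp.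
rewrite (fpsum_theta_mul (fun n n' => (- (c1 * c2)) ^ n * (- (c1 / c2)) ^ n')) mulrBr.
have E n n' : (- (c1 * c2)) ^ n * (- (c1 / c2)) ^ n' =
    (-1) ^ (n + n') * c1 ^ (n + n') * c2 ^ (n - n').
  have U3 : c2^-1 \is a GRing.unit by rewrite unitrV.
  rewrite -[- (c1 * c2)]mulN1r -[- (c1 / c2)]mulN1r.
  rewrite !exprzMl ?unitrN ?unitr1 ?unitrM ?U1 ?U2 ?U3 //.
  rewrite !exprzDr ?unitrN ?unitr1 //.
  by rewrite exprz_inv; ring.
congr (_ + _).
  rewrite /theta_odd /theta_even fpsumM; try exact: finite_fibers_even_exp; try exact: finite_fibers_odd_exp.
  rewrite -fpsumZ; apply: eq_fpsum => // -[a b] /=; rewrite E.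
  have -> : a + b + 1 + (a - b + 1) = 2 * (a + 1) by ring.
  have -> : a + b + 1 - (a - b + 1) = 2 * b by ring.
  rewrite exprNz_double exp1rz mul1r mulrA; congr (_ * _).
  have -> : 2 * (a + 1) = 1 + (2 * a + 1) :> int by ring.
  by rewrite (exprzDr U1 1) expr1z.
rewrite /theta_odd /theta_even fpsumM; try exact: finite_fibers_even_exp; try exact: finite_fibers_odd_exp.
rewrite -fpsumZ -fpsumN; apply: eq_fpsum => // -[a b] /=; rewrite E.
have -> : a + b + 1 + (a - b) = 2 * a + 1 by ring.
have -> : a + b + 1 - (a - b) = 2 * b + 1 by ring.
rewrite !(@exprzDr R _ _ (2 * a) 1) ?unitrN ?unitr1 // exprNz_double exp1rz mul1r !expr1z.
by ring.
Qed.

Lemma theta_shift c m : c \is a GRing.unit ->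
  theta c (m + (2 * N)%:Z) = - (fpsC c^-1 * theta c m).
Proof.
move=> Uc; have b1 : bijective (fun n : int => n - 1).
  by exists (fun n => n + 1) => n; ring.
rewrite /theta (fpsum_reindex _ b1 (finite_fibers_theta_exp _)) -fpsumZ -fpsumN; apply: eq_fpsum => n /=.
  rewrite exprzDr ?unitrN // -[(- c) ^ (-1)]/((- c) ^- 1) expr1 invrN mulrC.
  by rewrite mulNr.
by rewrite /theta_exp; congr (_ ^ _)%N; congr absz; ring.
Qed.

Lemma theta_inv c m : c \is a GRing.unit -> theta c^-1 (- m) = - (fpsC c^-1 * theta c m).
Proof.
move=> Uc; have b1 : bijective (fun n : int => 1 - n).
  by exists (fun n => 1 - n) => n; ring.
rewrite /theta (fpsum_reindex _ b1 (finite_fibers_theta_exp _)) -fpsumZ -fpsumN; apply: eq_fpsum => n /=.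
  rewrite -invrN exprz_inv opprB exprzDr ?unitrN //.
  by rewrite -[(- c) ^ (-1)]/((- c) ^- 1) expr1 invrN mulrC mulNr.
by rewrite /theta_exp -abszN; congr (_ ^ _)%N; congr absz; ring.
Qed.

Lemma theta_evenN c m : theta_even (- c) m = theta_even c m.
Proof. by apply: eq_fpsum => // b; rewrite exprNz_double. Qed.

Lemma theta_oddN c m : c \is a GRing.unit -> theta_odd (- c) m = - theta_odd c m.
Proof.
move=> Uc; rewrite /theta_odd -fpsumN; apply: eq_fpsum => // b.
by rewrite !(@exprzDr R _ _ _ 1) ?unitrN // exprNz_double !expr1z mulrN.
Qed.

Definition theta_alt_even (c : R) (m : int) : fps R := fpsum (fun b : int => (-1) ^ b * c ^ (2 * b)) (even_exp m).
Definition theta_alt_odd (c : R) (m : int) : fps R := fpsum (fun b : int => (-1) ^ b * c ^ (2 * b + 1)) (odd_exp m).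
Definition theta_alt_null : fps R := fpsum (fun b : int => (-1) ^ b) (even_exp 0).

Lemma theta_sqr_mul c m : c \is a GRing.unit ->
  theta (c ^+ 2) (2 * m) * theta (-1) 0 = - (fpsC (2%:R * c) * (theta_alt_even c m * theta_alt_odd c m)).
Proof.
move=> Uc; rewrite fpsumM; try exact: finite_fibers_theta_exp.
have -> : (fun p : int * int => (theta_exp (2 * m) p.1 + theta_exp 0 p.2)%N) =
          (fun p => (theta_exp (m + m) p.1 + theta_exp (m - m) p.2)%N).
  by apply: funext => p; congr (theta_exp _ _ + theta_exp _ _)%N; ring.
rewrite (fpsum_theta_mul (fun n n' => (- c ^+ 2) ^ n * (- -1) ^ n')).
have E n n' : (- c ^+ 2) ^ n * (- -1) ^ n' = (-1) ^ n * c ^ (2 * n).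
  rewrite opprK exp1rz mulr1 -[- c ^+ 2]mulN1r exprzMl ?unitrN ?unitr1 ?unitrX //.
  by rewrite (exprnP c) exprz_exp.
have F a b : (-1) ^ (a + b + 1) * c ^ (2 * (a + b + 1)) =
    - (c * (((-1) ^ a * c ^ (2 * a)) * ((-1) ^ b * c ^ (2 * b + 1)))).
  have -> : 2 * (a + b + 1) = 2 * a + (2 * b + 1) + 1 :> int by ring.
  rewrite !exprzDr ?unitrN ?unitr1 // !expr1z; ring.
rewrite [X in X + _](_ : _ = - (fpsC c * (theta_alt_odd c m * theta_alt_even c m))); last first.
  rewrite fpsumM; try exact: finite_fibers_even_exp; try exact: finite_fibers_odd_exp.
  rewrite -fpsumZ -fpsumN; apply: eq_fpsum => // -[a b] /=.
  by rewrite E F !exprzDr // !expr1z; ring.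
rewrite [X in _ + X](_ : _ = - (fpsC c * (theta_alt_even c m * theta_alt_odd c m))); last first.
  rewrite fpsumM; try exact: finite_fibers_even_exp; try exact: finite_fibers_odd_exp.
  by rewrite -fpsumZ -fpsumN; apply: eq_fpsum => // -[a b] /=; rewrite E F.
by rewrite rmorphM rmorph_nat; ring.
Qed.

Lemma theta_alt_odd_shift c m : c \is a GRing.unit -> theta_alt_odd c (m + N%:Z) = - (fpsC c^-1 * theta_alt_even c m).
Proof.
move=> Uc; have b1 : bijective (fun n : int => n - 1).
  by exists (fun n => n + 1) => n; ring.
rewrite /theta_alt_odd (fpsum_reindex _ b1 (finite_fibers_odd_exp _)) -fpsumZ -fpsumN; apply: eq_fpsum => n /=.
  have -> : 2 * (n - 1) + 1 = 2 * n - 1 :> int by ring.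
  rewrite !exprzDr ?unitrN ?unitr1 //.
  rewrite -[(- 1) ^ (-1)]/((- 1) ^- 1) -[c ^ (-1)]/(c ^- 1) !expr1 invrN invr1.
  ring.
by rewrite /even_exp /odd_exp; congr (_ * _ ^ _)%N; congr absz; ring.
Qed.
End Theta.

Section ThetaDomain.
Variable R : idomainType.
Variable N : nat.
Hypothesis N0 : (0 < N)%N.
Hypothesis nz2 : (2%:R : R) != 0.
Local Notation theta := (@theta R N).
Local Notation theta_alt_even := (@theta_alt_even R N).
Local Notation theta_alt_odd := (@theta_alt_odd R N).
Local Notation theta_alt_null := (@theta_alt_null R N).

Lemma theta_mulN c m : c \is a GRing.unit ->
  theta c m * theta (- c) m = - (fpsC c * (theta_alt_odd c m * theta_alt_null)).
Proof.
move=> Uc; rewrite fpsumM; try exact: finite_fibers_theta_exp.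
have -> : (fun p : int * int => (theta_exp N m p.1 + theta_exp N m p.2)%N) =
          (fun p => (theta_exp N (m + 0) p.1 + theta_exp N (m - 0) p.2)%N).
  by apply: funext => p; congr (theta_exp _ _ _ + theta_exp _ _ _)%N; ring.
rewrite (fpsum_theta_mul N0 (fun n n' => (- c) ^ n * (- - c) ^ n')).
have E n n' : (- c) ^ n * (- - c) ^ n' = (-1) ^ n * c ^ (n + n').
  rewrite opprK -[- c]mulN1r exprzMl ?unitrN ?unitr1 //.
  by rewrite exprzDr // mulrA.
rewrite [X in X + _](_ : _ = - (fpsC c * (theta_alt_odd c m * theta_alt_null))); last first.
  rewrite fpsumM; try exact: finite_fibers_even_exp; try exact: finite_fibers_odd_exp.
  rewrite -fpsumZ -fpsumN; apply: eq_fpsum => // -[a b] /=; rewrite E.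
  have -> : a + b + 1 + (a - b + 1) = (2 * a + 1) + 1 by ring.
  by rewrite !(@exprzDr R _ _ _ 1) ?unitrN ?unitr1 // exprzDr ?unitrN ?unitr1 // !expr1z; ring.
rewrite [X in _ + X](_ : _ = fpsum (fun b : int => - (-1) ^ b * c ^ (2 * b + 1)) (even_exp N m) *
    fpsum (fun b : int => (-1) ^ b) (odd_exp N 0)); last first.
  rewrite fpsumM; try exact: finite_fibers_even_exp; try exact: finite_fibers_odd_exp.
  apply: eq_fpsum => // -[a b] /=; rewrite E.
  have -> : a + b + 1 + (a - b) = 2 * a + 1 by ring.
  by rewrite !(@exprzDr R _ _ _ 1) ?unitrN ?unitr1 // exprzDr ?unitrN ?unitr1 // !expr1z; ring.
rewrite [X in _ + _ * X](_ : _ = 0) ?mulr0 ?addr0 //.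
apply: (@fpsum_odd_eq0 _ _ (fun b => - 1 - b)) => //.
- by exists (fun b => -1 - b) => b; ring.
- exact: finite_fibers_odd_exp.
- move=> b; have E1 : (-1 : R) ^ b * (-1) ^ b = 1.
    by rewrite -exprzMl ?unitrN ?unitr1 // mulrNN mulr1 exp1rz.
  apply: (@mulIr _ ((-1) ^ b)); first by rewrite unitrXz ?unitrN ?unitr1.
  rewrite mulNr E1 -exprzDr ?unitrN ?unitr1 // subrK.
  by rewrite -[(- 1) ^ (-1)]/((- 1) ^- 1) expr1 invrN invr1.
- by move=> b; rewrite /odd_exp -abszN; congr (_ * _ ^ _)%N; congr absz; ring.
Qed.

Lemma theta_mulN_shift c m : c \is a GRing.unit ->
  theta c (m + N%:Z) * theta (- c) (m + N%:Z) = theta_alt_even c m * theta_alt_null.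
Proof.
move=> Uc; rewrite theta_mulN // theta_alt_odd_shift // mulNr mulrN opprK !mulrA -rmorphM.
by rewrite divrr // rmorph1 mul1r.
Qed.

Lemma theta_alt_even10 : theta_alt_even 1 0 = theta_alt_null.
Proof. by apply: eq_fpsum => // b; rewrite exp1rz mulr1. Qed.

Lemma theta_null34 : theta 1 N%:Z * theta (-1) N%:Z = theta_alt_null ^+ 2.
Proof.
have := theta_mulN_shift 0 (unitr1 R).
by rewrite add0r theta_alt_even10 expr2.
Qed.

Lemma theta_duplication c m : c \is a GRing.unit ->
  theta (c ^+ 2) (2 * m) * (theta (-1) 0 * theta (-1) N%:Z * theta 1 N%:Z) =
  2%:R * (theta c m * theta (- c) m * (theta c (m + N%:Z) * theta (- c) (m + N%:Z))).
Proof.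
move=> Uc.
rewrite theta_mulN_shift // ?theta_mulN // -mulrA [theta (-1) N%:Z * _]mulrC theta_null34 mulrA theta_sqr_mul //.
by rewrite rmorphM rmorph_nat; ring.
Qed.
End ThetaDomain.

Lemma bin2D a b : 'C(a + b, 2) = ('C(a, 2) + a * b + 'C(b, 2))%N.
Proof.
elim: b => [|b IH]; first by rewrite addn0 muln0 !addn0.
by rewrite addnS !binS !bin1 IH mulnS; lia.
Qed.

Lemma bin2sq b : (b * b = 2 * 'C(b, 2) + b)%N.
Proof. by elim: b => // b IH; rewrite binS bin1 mulnS mulSn IH; lia. Qed.

Section QBinomial.
Variables (R : comNzRingType) (q : R).

Fixpoint qbinom (n k : nat) : R :=
  match n, k with
  | _, 0 => 1
  | 0, _.+1 => 0
  | n'.+1, k'.+1 => qbinom n' k + q ^+ (n' - k') * qbinom n' k'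
  end.
Definition qpoch (n : nat) : R := \prod_(i < n) (1 - q ^+ i.+1).

Arguments qbinom : simpl never.

Lemma qbinom0 n : qbinom n 0 = 1. Proof. by case: n. Qed.
Lemma qbinomS n k : qbinom n.+1 k.+1 = qbinom n k.+1 + q ^+ (n - k) * qbinom n k. Proof. by []. Qed.
Lemma qbinom_small n k : (n < k)%N -> qbinom n k = 0.
Proof.
elim: n k => [|n IH] [|k] // lt; rewrite qbinomS !IH ?mulr0 ?addr0 //.
exact: ltn_trans lt.
Qed.

Lemma qbinomial_thm x y n :
  \prod_(i < n) (y + q ^+ i * x) =
  \sum_(j < n.+1) q ^+ 'C(j, 2) * qbinom n j * x ^+ j * y ^+ (n - j).
Proof.
elim: n => [|n IH]; first by rewrite big_ord0 big_ord1 /= !expr0 !mulr1.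
rewrite big_ord_recr /= {}IH mulrDr [RHS]big_ord_recl [nat_of_ord ord0]/= subn0 bin0n qbinom0 !expr0 !mulr1 mul1r.
under [X in _ = _ + X]eq_bigr => j _ do rewrite lift0 qbinomS subSS
  !mulrDr !mulrDl.
rewrite big_split /= [RHS]addrA; congr (_ + _).
  rewrite mulr_suml [LHS]big_ord_recl [nat_of_ord ord0]/= subn0 bin0n qbinom0 !expr0 !mulr1 mul1r exprSr; congr (_ + _).
  rewrite [RHS]big_ord_recr /= (@qbinom_small n n.+1) // !(mulr0, mul0r) addr0.
  apply: eq_bigr => i _; rewrite /bump leq0n add1n -!mulrA; do 3 congr (_ * _).
  by rewrite -exprSr; congr (_ ^+ _); have := ltn_ord i; lia.
rewrite mulr_suml; apply: eq_bigr => j _.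
have le_jn : (j <= n)%N by rewrite -ltnS.
have -> : q ^+ n = q ^+ j * q ^+ (n - j) by rewrite -exprD subnKC.
by rewrite binS bin1 exprD [x ^+ j.+1]exprS; ring.
Qed.

Lemma qbinom_qpoch n j : (j <= n)%N -> qbinom n j * qpoch j * qpoch (n - j) = qpoch n.
Proof.
elim: n j => [|n IH] [|j] //; rewrite ?ltnS => le.
- by rewrite /qpoch /= !big_ord0 !mulr1.
- by rewrite qbinom0 /qpoch big_ord0 subn0 !mul1r.
rewrite qbinomS subSS.
have qfS m : qpoch m.+1 = qpoch m * (1 - q ^+ m.+1) by rewrite /qpoch big_ord_recr.
have Hj := IH j le.
rewrite 2!mulrDl qfS.
have -> : q ^+ (n - j) * qbinom n j * (qpoch j * (1 - q ^+ j.+1)) * qpoch (n - j) =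
  q ^+ (n - j) * (1 - q ^+ j.+1) * qpoch n by rewrite -Hj; ring.
have [lt|ge] := ltnP j n.
  have Hj1 := IH j.+1 lt.
  have E : (n - j)%N = (n - j.+1).+1 by lia.
  have -> : qbinom n j.+1 * (qpoch j * (1 - q ^+ j.+1)) * qpoch (n - j) =
     (1 - q ^+ (n - j)) * qpoch n.
    by rewrite -Hj1 {1 2}E !qfS -E; ring.
  rewrite qfS; have -> : q ^+ n.+1 = q ^+ (n - j) * q ^+ j.+1.
    by rewrite -exprD; congr (_ ^+ _); lia.
  by ring.
have -> : j = n by lia.
by rewrite qbinom_small // subnn expr0 qfS; ring.
Qed.
End QBinomial.

Section InfiniteProducts.
Variable R : comNzRingType.
Implicit Types (F G : nat -> fps R).

Definition infprod F : fps R := Fps (fun i => fcoef (\prod_(n < i.+1) F n) i).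

Definition tends_to_1 F := forall n, feqm n (F n) 1.

Lemma feqm_prod_widen F n m k : tends_to_1 F -> (k <= n)%N -> (n <= m)%N ->
  feqm k (\prod_(i < m) F i) (\prod_(i < n) F i).
Proof.
move=> cF kn; elim: m => [|m IH] nm; first by have -> : n = 0 by lia.
have [->|lt] := eqVneq n m.+1; first by [].
rewrite big_ord_recr -[X in feqm _ _ X]mulr1; apply: feqmM; first by apply: IH; lia.
by apply: feqm_le (cF m); lia.
Qed.

Lemma feqm_infprod F n m : tends_to_1 F -> (n <= m)%N -> feqm n (infprod F) (\prod_(i < m) F i).
Proof.
move=> cF nm i lt /=; apply: esym; apply: (feqm_prod_widen cF (leqnn i.+1)) => //.
exact: leq_trans nm.
Qed.

Lemma infprod_unique F f : tends_to_1 F -> (forall n, exists2 m, (n <= m)%N & feqm n f (\prod_(i < m) F i)) ->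
  f = infprod F.
Proof.
move=> cF H; apply: feqm_eq => n; have [m nm Hm] := H n.
exact: feqm_trans Hm (feqm_sym (feqm_infprod cF nm)).
Qed.

Lemma tends_to_1M F G : tends_to_1 F -> tends_to_1 G -> tends_to_1 (fun n => F n * G n).
Proof. by move=> cF cG n; rewrite -[X in feqm _ _ X](mulr1 1); apply: feqmM. Qed.

Lemma infprodM F G : tends_to_1 F -> tends_to_1 G -> infprod F * infprod G = infprod (fun n => F n * G n).
Proof.
move=> cF cG; apply: infprod_unique; first exact: tends_to_1M.
by move=> n; exists n => //; rewrite big_split; apply: feqmM; apply: feqm_infprod.
Qed.

Lemma eq_infprod F G : F =1 G -> infprod F = infprod G.
Proof. by move=> /funext ->. Qed.

Lemma infprod_recl F : tends_to_1 F -> tends_to_1 (fun n => F n.+1) ->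
  infprod F = F 0 * infprod (fun n => F n.+1).
Proof.
move=> cF cG; apply: esym; apply: infprod_unique => // n; exists n.+1 => //.
by rewrite big_ord_recl; apply: feqmM => //; apply: feqm_infprod.
Qed.

Lemma prod_residues (d m : nat) F :
  \prod_(i < d * m) F i = \prod_(j < d) \prod_(a < m) F (d * a + j)%N.
Proof.
rewrite exchange_big /=; elim: m => [|m IH]; first by rewrite muln0 !big_ord0.
by rewrite mulnS addnC big_ord_recr /= -IH big_split_ord.
Qed.

Lemma tends_to_1_sub (d j : nat) F : (0 < d)%N -> tends_to_1 F -> tends_to_1 (fun a => F (d * a + j)%N).
Proof.
by move=> d0 cF n; apply: feqm_le (cF _); apply: leq_trans (leq_addr _ _); rewrite leq_pmull.
Qed.

Lemma infprod_split (d : nat) F : (0 < d)%N -> tends_to_1 F ->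
  infprod F = \prod_(j < d) infprod (fun a => F (d * a + j)%N).
Proof.
move=> d0 cF; apply: esym; apply: infprod_unique => // n; exists (d * n)%N.
  by rewrite leq_pmull.
rewrite prod_residues; elim/big_rec2: _ => // j x y _ H; apply: feqmM => //.
by apply: feqm_infprod => //; apply: tends_to_1_sub.
Qed.

Lemma fcoef0_infprod F : fcoef (infprod F) 0 = fcoef (F 0) 0.
Proof. by rewrite /= big_ord_recl big_ord0 mulr1. Qed.

(* Meaningful only for [q] without constant term. *)
Definition qpochinf (q z : fps R) := infprod (fun i => 1 - q ^+ i * z).
Definition euler (q : fps R) := qpochinf q q.

Lemma feqm_exp0 (q : fps R) n : fcoef q 0 = 0 -> feqm n (q ^+ n) 0.
Proof. by move=> q0 i lt; rewrite fcoef_exp_small. Qed.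

Lemma tends_to_1_qpochinf q z : fcoef q 0 = 0 -> tends_to_1 (fun i => 1 - q ^+ i * z).
Proof.
move=> q0 n; rewrite -[X in feqm _ _ X](subr0 1); apply: feqmD => //; apply: feqmN.
by rewrite -[X in feqm _ _ X](mul0r z); apply: feqmM => //; apply: feqm_exp0.
Qed.

Lemma feqm_qpochinf q z n m : fcoef q 0 = 0 -> (n <= m)%N ->
  feqm n (qpochinf q z) (\prod_(i < m) (1 - q ^+ i * z)).
Proof. by move=> q0 nm; apply: feqm_infprod => //; apply: tends_to_1_qpochinf. Qed.

Lemma qpochinf_recl q z : fcoef q 0 = 0 -> qpochinf q z = (1 - z) * qpochinf q (q * z).
Proof.
move=> q0; rewrite /qpochinf infprod_recl; first 1 last.
- exact: tends_to_1_qpochinf.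
- have -> : (fun n => 1 - q ^+ n.+1 * z) = (fun n => 1 - q ^+ n * (q * z)).
    by apply: funext => n; rewrite exprSr mulrA.
  exact: tends_to_1_qpochinf.
rewrite expr0 mul1r; congr (_ * _); apply: eq_infprod => n.
by rewrite exprSr mulrA.
Qed.

Lemma feqm_euler q n m : fcoef q 0 = 0 -> (n <= m)%N -> feqm n (euler q) (qpoch q m).
Proof.
move=> q0 nm; apply: feqm_trans (feqm_qpochinf q q0 nm) _.
rewrite [X in feqm _ _ X](_ : _ = \prod_(i < m) (1 - q ^+ i * q)) //.
by apply: eq_bigr => i _; rewrite exprSr.
Qed.

Lemma qpochinf_split d q z : (0 < d)%N -> fcoef q 0 = 0 ->
  qpochinf q z = \prod_(j < d) qpochinf (q ^+ d) (q ^+ j * z).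
Proof.
move=> d0 q0; rewrite /qpochinf (infprod_split d0) ?tends_to_1_qpochinf //; last exact: tends_to_1_qpochinf.
apply: eq_bigr => j _; apply: eq_infprod => a.
by rewrite mulrA -exprM -exprD.
Qed.
End InfiniteProducts.

Section JacobiTripleProduct.
Variable R : idomainType.
Implicit Types q z : fps R.

Lemma euler_unit q : fcoef q 0 = 0 -> euler q \is a GRing.unit.
Proof.
move=> q0; apply: fps_unit_coef0.
by rewrite /euler /qpochinf fcoef0_infprod expr0 mul1r fcoefB q0 subr0 unitr1.
Qed.
Lemma euler_neq0 q : fcoef q 0 = 0 -> euler q != 0.
Proof. by move=> q0; apply: contraTneq (euler_unit q0) => ->; rewrite unitr0. Qed.

Section CentralTerms.
Variables (z z' : fps R) (q : fps R) (M : nat).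
Hypothesis zz : z * z' = q.
Let c := (- z) ^+ M * q ^+ ('C(M, 2) + M * M).

Lemma prod_central_qbinomial : \prod_(i < 2 * M) (q ^+ M + q ^+ i * (- z)) =
  c * (\prod_(i < M) (1 - q ^+ i * z) * \prod_(i < M) (1 - q ^+ i * z')).
Proof.
have prodMl (a : fps R) (F : nat -> fps R) : \prod_(i < M) (a * F i) = a ^+ M * \prod_(i < M) F i.
  by rewrite big_split prodr_const card_ord.
rewrite mul2n -addnn big_split_ord /=.
have -> : \prod_(i < M) (q ^+ M + q ^+ (M + i) * - z) = q ^+ (M * M) * \prod_(i < M) (1 - q ^+ i * z).
  rewrite exprM -(prodMl _ (fun i => 1 - q ^+ i * z)); apply: eq_bigr => i _ /=.
  by rewrite exprD; ring.
have -> : \prod_(i < M) (q ^+ M + q ^+ i * - z) = (- z) ^+ M * q ^+ 'C(M, 2) * \prod_(i < M) (1 - q ^+ i * z').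
  rewrite -bin2_sum big_mkord -prodrXr [X in _ = _ * X](reindex_inj rev_ord_inj) /= -mulrA -big_split.
  rewrite -(prodMl _ (fun i => q ^+ i * (1 - q ^+ (M - i.+1) * z'))) /=; apply: eq_bigr => i _ /=.
  have -> : q ^+ M = q ^+ i * (q * q ^+ (M - i.+1)).
    by rewrite -exprS -exprD; congr (_ ^+ _); have := ltn_ord i; lia.
  by rewrite -{2}zz; ring.
by rewrite /c exprD; ring.
Qed.

Lemma qbinomial_term_above n : (n <= M)%N ->
  q ^+ 'C(M + n, 2) * (- z) ^+ (M + n) * q ^+ M ^+ (M - n) = c * ((-1) ^+ n * q ^+ 'C(n, 2) * z ^+ n).
Proof.
move=> le; rewrite /c bin2D -exprM (_ : M * M = M * n + M * (M - n))%N; last by rewrite -mulnDr subnKC.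
by rewrite !exprD [(- z) ^+ n]exprNn; ring.
Qed.
Lemma qbinomial_term_below n : (n <= M)%N ->
  q ^+ 'C(M - n, 2) * (- z) ^+ (M - n) * q ^+ M ^+ (M + n) = c * ((-1) ^+ n * q ^+ 'C(n, 2) * z' ^+ n).
Proof.
move=> le; rewrite /c -exprM mulnDr !exprD.
have -> : (- z) ^+ M = (- z) ^+ (M - n) * ((-1) ^+ n * z ^+ n) by rewrite -exprNn -exprD subnK.
have E : q ^+ 'C(M - n, 2) * q ^+ (M * n) = q ^+ 'C(M, 2) * q ^+ 'C(n, 2) * (z ^+ n * z' ^+ n).
  rewrite -exprMn zz -!exprD; congr (_ ^+ _); have := bin2D (M - n) n; rewrite subnK // => ->.
  by have := bin2sq n; rewrite mulnBl; have : (n * n <= M * n)%N; [rewrite leq_mul2r le orbT | lia].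
have S1 : (-1) ^+ n * (-1) ^+ n = 1 :> fps R by rewrite -expr2 sqrr_sign.
transitivity ((q ^+ 'C(M - n, 2) * q ^+ (M * n)) * (- z) ^+ (M - n) * q ^+ (M * M)); first by ring.
rewrite E -[LHS]mul1r -{1}S1; ring.
Qed.
End CentralTerms.

(* The q-binomial theorem for [2 M] factors, with the sum reindexed from its middle term. *)
Lemma finite_jacobi_triple q z z' M : z * z' = q -> q != 0 ->
  \prod_(i < M) (1 - q ^+ i * z) * \prod_(i < M) (1 - q ^+ i * z') =
  qbinom q (2 * M) M + \sum_(n < M) (-1) ^+ n.+1 * q ^+ 'C(n.+1, 2) *
    (qbinom q (2 * M) (M + n.+1) * z ^+ n.+1 + qbinom q (2 * M) (M - n.+1) * z' ^+ n.+1).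
Proof.
move=> zz q0; have z0 : z != 0 by apply: contraNneq q0 => z0; rewrite -zz z0 mul0r.
have c0 : (- z) ^+ M * q ^+ ('C(M, 2) + M * M) != 0 by rewrite mulf_neq0 ?expf_neq0 ?oppr_eq0.
apply: (mulfI c0); rewrite -prod_central_qbinomial // qbinomial_thm.
have -> : (2 * M).+1 = (M + (1 + M))%N by lia.
rewrite big_split_ord /= [X in _ + X]big_split_ord /= big_ord1 addn0 mulrDr addrCA; congr (_ + _).
  by rewrite (_ : (2 * M - M)%N = M) ?exprD ?exprM; [ring|lia].
rewrite [X in X + _](reindex_inj rev_ord_inj) /= -big_split /= mulr_sumr; apply: eq_bigr => n _.
have le : (n < M)%N by []; rewrite add1n.
have -> : (2 * M - (M + n.+1))%N = (M - n.+1)%N by lia.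
have -> : (2 * M - (M - n.+1))%N = (M + n.+1)%N by lia.
have := qbinomial_term_above z q le; have := qbinomial_term_below zz le.
move: (qbinom _ _ _) (qbinom _ _ _) => b2 b1 Eb Ea.
transitivity ((q ^+ 'C(M - n.+1, 2) * (- z) ^+ (M - n.+1) * q ^+ M ^+ (M + n.+1)) * b1 +
  (q ^+ 'C(M + n.+1, 2) * (- z) ^+ (M + n.+1) * q ^+ M ^+ (M - n.+1)) * b2); first by ring.
by rewrite Ea Eb; ring.
Qed.

Definition jacobi_series q z z' L : fps R :=
  1 + \sum_(n < L) (-1) ^+ n.+1 * q ^+ 'C(n.+1, 2) * (z ^+ n.+1 + z' ^+ n.+1).

Lemma jacobi_triple q z z' K L : z * z' = q -> q != 0 -> fcoef q 0 = 0 -> (K.+2 <= L)%N ->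
  feqm K (euler q * qpochinf q z * qpochinf q z') (jacobi_series q z z' L).
Proof.
move=> zz q0 q00 KL; pose M := (L + K)%N.
have Hsmall n : (K < n)%N -> feqm K (q ^+ 'C(n.+1, 2)) 0.
  move=> lt; apply: (@feqm_le _ K 'C(n.+1, 2)); last exact: feqm_exp0.
  rewrite binS bin1; apply: leq_trans (leq_addl _ _); exact: ltnW.
have Hqb j : (K <= j)%N -> (j <= 2 * M - K)%N -> feqm K (euler q * qbinom q (2 * M) j) 1.
  move=> Kj jM; have U := euler_unit q00.
  have E := qbinom_qpoch q (leq_trans jM (leq_subr _ _)).
  suff H : feqm K (euler q * (euler q * qbinom q (2 * M) j)) (euler q).
    by have := feqmM (@feqm_refl _ K (euler q)^-1) H; rewrite mulKr // mulVr.
  apply: (@feqm_trans _ _ _ (qpoch q (2 * M))); last first.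
    by apply: feqm_sym; apply: feqm_euler => //; lia.
  have -> : euler q * (euler q * qbinom q (2 * M) j) = qbinom q (2 * M) j * euler q * euler q by ring.
  by rewrite -E; apply: feqmM; [apply: feqmM => // |]; apply: feqm_euler => //; lia.
apply: (@feqm_trans _ _ _ (euler q * (\prod_(i < M) (1 - q ^+ i * z) * \prod_(i < M) (1 - q ^+ i * z')))).
  rewrite -mulrA; apply: feqmM => //.
  by apply: feqmM; apply: feqm_qpochinf => //; rewrite /M leq_addl.
rewrite (finite_jacobi_triple M zz q0) mulrDr; apply: feqmD.
  by apply: Hqb; rewrite /M; lia.
rewrite mulr_sumr.
have -> : \sum_(n < L) (-1) ^+ n.+1 * q ^+ 'C(n.+1, 2) * (z ^+ n.+1 + z' ^+ n.+1) =
  \sum_(n < M) (if (n < L)%N then (-1) ^+ n.+1 * q ^+ 'C(n.+1, 2) * (z ^+ n.+1 + z' ^+ n.+1) else 0).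
  rewrite -big_mkcond /= -(big_mkord xpredT (fun n => (-1) ^+ n.+1 * q ^+ 'C(n.+1, 2) * (z ^+ n.+1 + z' ^+ n.+1))).
  rewrite (big_nat_widen 0 L M) /= ?big_mkord //.
  by rewrite /M leq_addr.
apply: feqm_sum => n _; case: ltnP => [ltnL|leLn].
  have -> : euler q * ((-1) ^+ n.+1 * q ^+ 'C(n.+1, 2) *
     (qbinom q (2 * M) (M + n.+1) * z ^+ n.+1 + qbinom q (2 * M) (M - n.+1) * z' ^+ n.+1)) =
     (-1) ^+ n.+1 * q ^+ 'C(n.+1, 2) * (euler q * qbinom q (2 * M) (M + n.+1) * z ^+ n.+1 +
        euler q * qbinom q (2 * M) (M - n.+1) * z' ^+ n.+1) by ring.
  rewrite -[X in feqm _ _ (_ * (X + _))]mul1r -[X in feqm _ _ (_ * (_ + X))]mul1r.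
  by apply: feqmM => //; apply: feqmD; apply: feqmM => //; apply: Hqb; move: ltnL; rewrite /M; clear; move: (n : nat) => i; lia.
have Z := Hsmall n (ltnW (leq_trans KL leLn)).
set A := (X in euler q * (_ * _ * X)).
have -> : euler q * ((-1) ^+ n.+1 * q ^+ 'C(n.+1, 2) * A) =
   q ^+ 'C(n.+1, 2) * (euler q * (-1) ^+ n.+1 * A) by ring.
by rewrite -[X in feqm _ _ X](mul0r (euler q * (-1) ^+ n.+1 * A)); apply: feqmM.
Qed.

Lemma feqm_fpsum (I : eqType) (w : I -> R) (x : I -> nat) K (s : seq I) :
  uniq s -> (forall i, (x i < K)%N -> i \in s) ->
  feqm K (fpsum w x) (\sum_(i <- s) fpsC (w i) * fpsX (x i)).
Proof.
move=> us Hs e lt; rewrite (@fpsumE _ _ _ _ _ s) //; last by move=> i E; apply: Hs; rewrite E.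
rewrite fcoef_sum big_mkcond; apply: eq_bigr => i _; rewrite fcoefCM /= eq_sym.
by case: eqP; rewrite ?mulr1 ?mulr0.
Qed.

Lemma feqm_fpsum_jacobi_series (w : int -> R) (x : int -> nat) q z z' K :
  (forall n, fpsC (w n%:Z) * fpsX (x n%:Z) = (-1) ^+ n * q ^+ 'C(n, 2) * z ^+ n) ->
  (forall n, fpsC (w (- n%:Z)) * fpsX (x (- n%:Z)) = (-1) ^+ n * q ^+ 'C(n, 2) * z' ^+ n) ->
  (forall n : int, (x n < K)%N -> (`|n| <= K.+2)%N) ->
  feqm K (fpsum w x) (jacobi_series q z z' K.+2).
Proof.
move=> H1 H2 H3; pose s := [seq i%:Z - (K.+2)%:Z | i <- iota 0 (2 * K.+2).+1].
apply: feqm_trans (feqm_fpsum _ _ (s := s) _) _.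
- by rewrite map_inj_uniq ?iota_uniq // => a b; lia.
- move=> n /H3 le; apply/mapP; exists `|(n + K.+2%:Z)%R|%N; last by lia.
  by rewrite mem_iota; lia.
suff -> : \sum_(i <- s) fpsC (w i) * fpsX (x i) = jacobi_series q z z' K.+2 by [].
rewrite /s big_map -[iota 0 _]/(index_iota 0 (2 * K.+2).+1) big_mkord.
have -> : (2 * K.+2).+1 = (K.+2 + (1 + K.+2))%N by lia.
rewrite big_split_ord /= [X in _ + X]big_split_ord /= big_ord1 addn0 addrCA; congr (_ + _).
  by rewrite subrr -[0]/(0%:Z) H1 /= !expr0 !mulr1.
rewrite [X in X + _](reindex_inj rev_ord_inj) /= -big_split /=.
apply: eq_bigr => n _; rewrite addrC mulrDr; congr (_ + _).
  have -> : Posz (K.+2 + (1 + n)) - Posz K.+2 = n.+1%:Z by lia.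
  exact: H1.
have -> : Posz (K.+2 - n.+1) - Posz K.+2 = - n.+1%:Z by have := ltn_ord n; lia.
exact: H2.
Qed.
End JacobiTripleProduct.

Lemma bin2sqz (n : nat) : n%:Z * n%:Z = 2 * 'C(n, 2)%:Z + n%:Z.
Proof. by rewrite -PoszM bin2sq [LHS]PoszD PoszM. Qed.

Section ConstantCoefficient.
Variable R : comNzRingType.
Definition const_coef (f : fps R) : R := fcoef f 0.
Lemma const_coef_zmod : zmod_morphism const_coef. Proof. by []. Qed.
Lemma const_coef_monoid : monoid_morphism const_coef.
Proof. by split=> // f g; rewrite /const_coef fcoefM big_ord_recl big_ord0 addr0. Qed.
HB.instance Definition _ := GRing.isZmodMorphism.Build (fps R) R const_coef const_coef_zmod.
HB.instance Definition _ := GRing.isMonoidMorphism.Build (fps R) R const_coef const_coef_monoid.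
End ConstantCoefficient.
Arguments const_coef : simpl never.

Section MapProd.
Variables (R R' : comNzRingType) (phi : {rmorphism R -> R'}).
Lemma feqm_fmap n f g : feqm n f g -> feqm n (fmap phi f) (fmap phi g).
Proof. by move=> H i lt /=; rewrite H. Qed.
Lemma fmap_fpsX e : fmap phi (fpsX e) = fpsX e.
Proof. by apply: fpsP => n /=; rewrite rmorph_nat. Qed.
Lemma fmap_fpsC c : fmap phi (fpsC c) = fpsC (phi c).
Proof. by apply: fpsP => n /=; case: eqP; rewrite ?rmorph0. Qed.
Lemma fmap_qpochinf q z : fcoef q 0 = 0 -> fmap phi (qpochinf q z) = qpochinf (fmap phi q) (fmap phi z).
Proof.
move=> q0; have q0' : fcoef (fmap phi q) 0 = 0 by rewrite /= q0 rmorph0.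
apply: infprod_unique; first exact: tends_to_1_qpochinf.
move=> n; exists n => //; apply: feqm_trans (feqm_fmap (feqm_qpochinf z q0 (leqnn n))) _.
by rewrite rmorph_prod; under eq_bigr => i _ do rewrite rmorphB rmorphM rmorph1 rmorphXn.
Qed.
End MapProd.

Section Products.
Variable R : idomainType.
Variable N : nat.
Hypothesis N0 : (0 < N)%N.
Local Notation nome := (fpsX (8 * N ^ 2)%N : fps R).
Local Notation theta := (@theta R N).

Lemma fpsX_coef0 e : (0 < e)%N -> fcoef (fpsX e : fps R) 0 = 0.
Proof. by case: e. Qed.

Lemma nome_coef0 : fcoef nome 0 = 0.
Proof. by apply: fpsX_coef0; rewrite muln_gt0 expn_gt0 N0. Qed.

Lemma fpsCX (c : R) n : fpsC c ^+ n = fpsC (c ^+ n). Proof. by rewrite rmorphXn. Qed.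

Lemma fpsCM (a b : R) : fpsC (a * b) = fpsC a * fpsC b. Proof. by rewrite rmorphM. Qed.

Lemma exprN1z_opp (n : nat) : (-1 : R) ^ (- n%:Z) = (-1) ^+ n.
Proof. by rewrite -exprz_inv invrN invr1. Qed.

Lemma fpsCN1 n : fpsC ((-1) ^+ n : R) = (-1) ^+ n.
Proof. by rewrite rmorphXn rmorphN1. Qed.

Lemma theta_prod c (m : nat) : c \is a GRing.unit -> (m <= 2 * N)%N ->
  theta c m%:Z = fpsX (`|m%:Z - N%:Z| ^ 2)%N *
    (euler nome * qpochinf nome (fpsC c * fpsX (4 * N * m)) *
     qpochinf nome (fpsC c^-1 * fpsX (8 * N ^ 2 - 4 * N * m))).
Proof.
move=> Uc le; pose x' (n : int) := `|(4 * N%:Z * n * (N%:Z * n + (m%:Z - N%:Z)))%R|%N.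
have x'E (n : int) : (x' n)%:Z = 4 * N%:Z * n * (N%:Z * n + (m%:Z - N%:Z)).
  rewrite /x' gez0_abs //; have [n0|n1] := lerP n 0.
    have [->|n0'] := eqVneq n 0; first by rewrite mulr0 mul0r.
    by rewrite -mulrNN mulr_ge0 //; [nia | nia].
  by rewrite mulr_ge0 //; nia.
have exE' (n : int) : theta_exp N m%:Z n = (`|m%:Z - N%:Z| ^ 2 + x' n)%N.
  apply/eqP; rewrite -eqz_nat PoszD theta_expE x'E abszX2; apply/eqP; ring.
have px' : finite_fibers x'.
  move=> e; have [s Hs] := finite_fibers_theta_exp N0 m%:Z (`|m%:Z - N%:Z| ^ 2 + e)%N.
  by exists s => i E; apply: Hs; rewrite exE' E.
have -> : theta c m%:Z = fpsX (`|m%:Z - N%:Z| ^ 2)%N * fpsum (fun n : int => (- c) ^ n) x'.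
  by rewrite fpsX_fpsum //; apply: eq_fpsum.
congr (_ * _); apply: feqm_eq => K.
have le2 : (4 * N * m <= 8 * N ^ 2)%N by rewrite -mulnn; nia.
apply: feqm_trans (feqm_sym (jacobi_triple (L := K.+2) _ _ nome_coef0 _)) => //; last 2 first.
- rewrite mulrACA -fpsCM divrr // rmorph1 mul1r -fpsXD; congr fpsX; lia.
- exact: fpsX_neq0.
apply: feqm_fpsum_jacobi_series => n.
- have -> : (- c) ^ n%:Z = (-1) ^+ n * c ^+ n by rewrite -exprnP -exprNn.
  have -> : x' n%:Z = (8 * N ^ 2 * 'C(n, 2) + 4 * N * m * n)%N.
    apply/eqP; rewrite -eqz_nat x'E -mulnn.
    move: (bin2sqz n); move: 'C(n, 2) => b B; rewrite PoszD !PoszM; apply/eqP; nia.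
  rewrite fpsCM fpsCN1 -[fpsC (c ^+ n)]fpsCX fpsXD !fpsXM exprMn.
  by ring.
- have -> : (- c) ^ (- n%:Z) = (-1) ^+ n * c^-1 ^+ n.
    by rewrite -exprz_inv -exprnP invrN -exprNn.
  have -> : x' (- n%:Z) = (8 * N ^ 2 * 'C(n, 2) + (8 * N ^ 2 - 4 * N * m) * n)%N.
    apply/eqP; rewrite -eqz_nat x'E; move: (le2); rewrite -mulnn => le3.
    move: (bin2sqz n); move: 'C(n, 2) => b B; rewrite PoszD [X in _ == _ + X]PoszM.
    by rewrite -subzn // !PoszM; apply/eqP; nia.
  rewrite fpsCM fpsCN1 -[fpsC (c^-1 ^+ n)]fpsCX fpsXD !fpsXM exprMn.
  by ring.
- move=> lt; have := x'E n; move: lt; set X := x' n => lt E.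
  have [n0|n1] := lerP n 0; first by have [->|] := eqVneq n 0; [ | nia].
  nia.
Qed.

Definition pent (n : int) : nat := (`|(n * (3 * n - 1))%R| %/ 2)%N.

Lemma pentE (n : int) : 2 * (pent n)%:Z = n * (3 * n - 1).
Proof.
have ge0 : 0 <= n * (3 * n - 1) by have [n0|n1] := lerP n 0; nia.
have ev : (2 %| `|(n * (3 * n - 1))%R|)%N.
  rewrite -(absz_nat 2) -[(_ %| _)%N]/(2%:Z %| n * (3 * n - 1))%Z.
  have [k [Ek|Ek]] : exists k : int, n = 2 * k \/ n = 2 * k + 1.
    by exists (n %/ 2)%Z; lia.
    by apply/dvdzP; exists (k * (3 * n - 1)); rewrite Ek; ring.
  by apply/dvdzP; exists (n * (3 * k + 1)); rewrite Ek; ring.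
by rewrite /pent -PoszM mulnC divnK // gez0_abs.
Qed.

Lemma euler_pentagonal (c : R) a : c \is a GRing.unit -> (0 < a)%N ->
  euler (fpsC c * fpsX a) =
  fpsum (fun n : int => (-1) ^ n * c ^+ pent n) (fun n => a * pent n)%N.
Proof.
move=> Uc a0; set t := fpsC c * fpsX a.
have t0 : fcoef t 0 = 0 by rewrite fcoefCM /=; case: a a0 @t => // a _ t; rewrite mulr0.
have t30 : fcoef (t ^+ 3) 0 = 0 by rewrite fcoef0_exp t0 expr0n.
have tn0 : t != 0.
  rewrite mulf_neq0 ?fpsX_neq0 // -(rmorph0 (@fpsC R)) (inj_eq (@fpsC_inj R)).
  by apply: contraTneq Uc => ->; rewrite unitr0.
have -> : euler t = euler (t ^+ 3) * qpochinf (t ^+ 3) t * qpochinf (t ^+ 3) (t ^+ 2).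
  rewrite /euler (@qpochinf_split _ 3 t t) // !big_ord_recl big_ord0 /= expr0 mul1r expr1 mulr1.
  by rewrite -expr2 -exprSr; ring.
apply: feqm_eq => K.
have := @jacobi_triple _ (t ^+ 3) t (t ^+ 2) K K.+2 _ _ t30 (leqnn _).
rewrite -exprS expf_neq0 // => /(_ erefl isT) H.
apply: feqm_trans H (feqm_sym _).
apply: feqm_fpsum_jacobi_series => n.
- have -> : pent n%:Z = (3 * 'C(n, 2) + n)%N.
    move: (pentE n%:Z); move: (bin2sqz n); move: 'C(n, 2) => b B E.
    apply/eqP; rewrite -eqz_nat PoszD PoszM; apply/eqP; nia.
  rewrite -exprnP fpsCM fpsCN1 -fpsCX fpsXM -mulrA -exprMn -/t exprD exprM.
  by rewrite mulrA.
- have -> : pent (- n%:Z) = (3 * 'C(n, 2) + 2 * n)%N.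
    move: (pentE (- n%:Z)); move: (bin2sqz n); move: 'C(n, 2) => b B E.
    apply/eqP; rewrite -eqz_nat PoszD !PoszM; apply/eqP; nia.
  by rewrite exprN1z_opp fpsCM fpsCN1 -fpsCX fpsXM -mulrA -exprMn -/t exprD !exprM mulrA.
- move=> lt; have E := pentE n; have lt' : (pent n < K)%N by nia.
  by have [n0|n1] := lerP n 0; nia.
Qed.

Lemma finite_fibers_pent a : (0 < a)%N -> finite_fibers (fun n => a * pent n)%N.
Proof.
move=> a0 e; exists [seq i%:Z - e.+1%:Z | i <- iota 0 (2 * e.+1).+1] => n E.
have P := pentE n; have le : (`|n| <= e.+1)%N.
  have : (pent n <= e)%N by rewrite -E leq_pmull.
  by have [n0|n1] := lerP n 0; nia.
by apply/mapP; exists `|(n + e.+1%:Z)%R|%N; [rewrite mem_iota; lia | lia].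
Qed.

Lemma theta_half_prod c r : N = (2 * r).+1 -> c ^+ N = 1 ->
  (\prod_(1 <= i < r.+1) theta (c ^+ i) (2 * i)%:Z) * euler nome =
  fpsX (\sum_(1 <= i < r.+1) `|(2 * i)%:Z - N%:Z| ^ 2)%N *
    (euler nome ^+ r * euler (fpsC c * fpsX (8 * N))).
Proof.
move=> Nr cN; have Uc : c \is a GRing.unit by rewrite -(@unitrX_pos _ c N) // cN unitr1.
set u := fpsC c * fpsX (8 * N).
have uN : u ^+ N = nome.
  by rewrite exprMn fpsCX cN rmorph1 mul1r -fpsXM; congr fpsX; rewrite -mulnn mulnA.
have u0 : fcoef u 0 = 0 by rewrite fcoefCM /=; case: eqP => [|_]; [lia | rewrite mulr0].
have -> : euler u = (\prod_(1 <= i < r.+1) (qpochinf nome (u ^+ i) * qpochinf nome (u ^+ (N - i)))) * euler nome.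
  rewrite /euler (@qpochinf_split _ N u u) // uN.
  have -> : \prod_(j < N) qpochinf nome (u ^+ j * u) = \prod_(1 <= j < N.+1) qpochinf nome (u ^+ j).
    by rewrite big_add1 /= big_mkord; apply: eq_bigr => j _; rewrite exprSr.
  rewrite big_nat_recr //= uN; congr (_ * _).
  rewrite (big_cat_nat _ (n := r.+1)) //=; last by lia.
  rewrite big_split /=; congr (_ * _).
  rewrite [RHS]big_nat_rev /= -[in LHS](add1n r) big_addn.
  have -> : (N - r = r.+1)%N by lia.
  by apply: eq_big_nat => i /andP[h1 h2]; congr (qpochinf _ (_ ^+ _)); lia.
have P i : (0 < i < r.+1)%N -> theta (c ^+ i) (2 * i)%:Z =
    fpsX (`|(2 * i)%:Z - N%:Z| ^ 2)%N * (euler nome * (qpochinf nome (u ^+ i) * qpochinf nome (u ^+ (N - i)))).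
  move=> /andP[h1 h2]; rewrite theta_prod ?unitrX //; last by lia.
  congr (_ * _); rewrite -mulrA; congr (_ * (qpochinf _ _ * qpochinf _ _)).
    by rewrite exprMn fpsCX -fpsXM; congr (_ * fpsX _); lia.
  rewrite exprMn fpsCX -fpsXM; congr (fpsC _ * fpsX _); last by rewrite -mulnn; nia.
  rewrite -exprVn; apply: (@mulrI _ (c ^+ i)); first by rewrite unitrX.
  by rewrite -exprD subnKC ?cN -?exprMn ?divrr ?expr1n //; lia.
rewrite (eq_big_nat _ _ P) 2!big_split /= prodr_const_nat subn1 /=.
have -> : \prod_(1 <= i < r.+1) fpsX (`|(2 * i)%:Z - N%:Z| ^ 2)%N =
    fpsX (\sum_(1 <= i < r.+1) `|(2 * i)%:Z - N%:Z| ^ 2)%N :> fps R.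
  by elim/big_rec2: _ => [|i x y _ ->]; rewrite ?fpsX0 // fpsXD.
by ring.
Qed.
End Products.

Section ThetaConstants.
Variable R : idomainType.
Variable N : nat.
Hypothesis N0 : (0 < N)%N.
Local Notation nome := (fpsX (8 * N ^ 2)%N : fps R).
Local Notation theta := (@theta R N).

Lemma theta_alt_null_prod : theta_alt_null R N = euler (nome ^+ 2) * qpochinf (nome ^+ 2) nome ^+ 2.
Proof.
have q2 : fcoef (nome ^+ 2) 0 = 0 by rewrite fcoef0_exp nome_coef0 // expr0n.
apply: feqm_eq => K.
apply: feqm_trans (feqm_sym _); last first.
  rewrite [qpochinf _ _ ^+ 2]expr2 mulrA; apply: (jacobi_triple (L := K.+2)) => //.
  by rewrite expf_neq0 // fpsX_neq0.
have E0 (n : int) : (even_exp N 0 n)%:Z = 8 * (N%:Z * N%:Z) * (n * n).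
  by rewrite even_expE; ring.
have F (n : nat) : even_exp N 0 n%:Z = (8 * N ^ 2 * 2 * 'C(n, 2) + 8 * N ^ 2 * n)%N.
  apply/eqP; rewrite -eqz_nat E0 -mulnn.
  by move: (bin2sqz n); move: 'C(n, 2) => b B; rewrite PoszD !PoszM; apply/eqP; nia.
have G n : even_exp N 0 (- n) = even_exp N 0 n.
  by apply/eqP; rewrite -eqz_nat !E0; apply/eqP; ring.
apply: feqm_fpsum_jacobi_series => n.
- by rewrite -exprnP fpsCN1 F fpsXD !fpsXM -mulrA.
- by rewrite exprN1z_opp fpsCN1 G F fpsXD !fpsXM -mulrA.
- move=> lt; have := E0 n; have N1 : (0 < N * N)%N by rewrite muln_gt0 N0.
  move: lt; set X := even_exp _ _ _ => lt E.
  have : `|n|%:Z * `|n|%:Z = n * n by rewrite abszE -expr2 real_normK ?num_real.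
  nia.
Qed.

Lemma theta2_prod : theta (-1) 0 = 2%:R * fpsX (N ^ 2)%N * euler nome * qpochinf nome (- nome) ^+ 2.
Proof.
rewrite -[0]/(0%:Z) theta_prod ?unitrN ?unitr1 // muln0 subn0 fpsX0 mulr1 invrN invr1.
rewrite !rmorphN !rmorph1 mulN1r (@qpochinf_recl _ nome (-1)) ?nome_coef0 // mulrN1 opprK.
have -> : (`|0%:Z - N%:Z| ^ 2 = N ^ 2)%N by rewrite sub0r abszN.
by rewrite -[1 + 1]/(2%:R); ring.
Qed.

Lemma theta_null_prod : (2%:R : R) != 0 ->
  theta (-1) 0 * (theta 1 N%:Z * theta (-1) N%:Z) = 2%:R * fpsX (N ^ 2)%N * euler nome ^+ 3.
Proof.
move=> nz2; rewrite theta_null34 // theta2_prod theta_alt_null_prod.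
have q0 : fcoef nome 0 = 0 by exact: nome_coef0.
have q2 : fcoef (nome ^+ 2) 0 = 0 by rewrite fcoef0_exp q0 expr0n.
have E1 : euler nome = qpochinf (nome ^+ 2) nome * euler (nome ^+ 2).
  rewrite /euler (@qpochinf_split _ 2 nome nome) // !big_ord_recl big_ord0 [nat_of_ord _]/= expr0 mul1r.
  by rewrite mulr1 -[lift _ _ : nat]/(1%N) expr1 -expr2.
have E2 : qpochinf nome (- nome) * euler nome = euler (nome ^+ 2).
  rewrite /euler /qpochinf infprodM; try exact: tends_to_1_qpochinf.
  by apply: eq_infprod => i; rewrite exprAC; ring.
have U := euler_unit q2; have U1 := euler_unit q0.
apply: (@mulIf _ (euler nome ^+ 2)); first by rewrite expf_neq0 // euler_neq0.
transitivity (2%:R * fpsX (N ^ 2)%N * euler nome * (qpochinf nome (- nome) * euler nome) ^+ 2 *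
  (euler (nome ^+ 2) * qpochinf (nome ^+ 2) nome ^+ 2) ^+ 2); first by ring.
by rewrite E2 E1; ring.
Qed.

(* The derivative of [theta c 0] at [c = 1]. *)
Definition dtheta : fps R := fpsum (fun n : int => (-1) ^ n * n%:~R) (theta_exp N 0).
End ThetaConstants.

Section ThetaDerivative.
Variable k : fieldType.
Variable N : nat.
Hypothesis N0 : (0 < N)%N.
Local Notation A := (fps k).
Local Notation nome := (fpsX (8 * N ^ 2)%N).

Definition onept : A := 1 + fpsX 1.

Lemma onept_unit : onept \is a GRing.unit.
Proof. by apply: fps_unit_coef0; rewrite /= addr0 unitr1. Qed.

Definition tcoef (i : nat) (f : fps A) : fps k := Fps (fun n => fcoef (fcoef f n) i).

Lemma tcoefD i f g : tcoef i (f + g) = tcoef i f + tcoef i g. Proof. exact: fpsP. Qed.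
Lemma tcoef_fpsum i (I : eqType) (w : I -> A) (x : I -> nat) :
  tcoef i (fpsum w x) = fpsum (fun j => fcoef (w j) i) x.
Proof.
apply: fpsP => e; rewrite /tcoef /=; case: pselect => [H|_] //.
by rewrite fcoef_sum.
Qed.

Lemma onept_exp (n : int) : (fcoef (onept ^ n) 0 = 1) /\ (fcoef (onept ^ n) 1 = n%:~R).
Proof.
have H0 m : fcoef (onept ^+ m) 0 = 1 by rewrite fcoef0_exp /= addr0 expr1n.
have H1 m : fcoef (onept ^+ m) 1 = m%:R.
  elim: m => // m IH; rewrite exprS fcoefM !big_ord_recl big_ord0 /= H0 IH.
  by rewrite !addr0 !add0r !mul1r natr1.
case: n => m; first by rewrite -exprnP H0 H1.
rewrite NegzE -[onept ^ _]/(onept ^- m.+1).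
have U : onept ^+ m.+1 \is a GRing.unit by rewrite unitrX // onept_unit.
have E := divrr U; set g := _^-1 in E *.
have /(congr1 (fun f => fcoef f 0)) := E; rewrite fcoefM big_ord_recl big_ord0 addr0 H0 mul1r fcoef1 /= => g0; rewrite subn0 in g0.
have /(congr1 (fun f => fcoef f 1)) := E; rewrite fcoefM !big_ord_recl big_ord0 addr0 fcoef1.
rewrite -[nat_of_ord ord0]/0%N -[nat_of_ord (lift _ _)]/1%N subn0 subnn H0 H1 g0 mul1r mulr1 => /eqP.
by rewrite addr_eq0 => /eqP ->; rewrite rmorphN.
Qed.

Lemma tcoef1_theta : tcoef 1 (theta N onept 0) = dtheta k N.
Proof.
rewrite tcoef_fpsum; apply: eq_fpsum => // n; have [E0 E1] := onept_exp n.
rewrite -[- onept]mulN1r exprzMl ?unitrN ?unitr1 ?onept_unit //.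
have -> : (-1 : A) ^ n = fpsC ((-1) ^ n).
  case: n {E0 E1} => m; first by rewrite -!exprnP rmorphXn rmorphN1.
  rewrite NegzE -!exprz_inv !invrN !invr1 -!exprnP rmorphXn rmorphN1 //.
by rewrite fcoefCM E1.
Qed.

Lemma theta_simple_zero (x : A) : fcoef x 0 = 0 -> exists E, theta N (1 + x) 0 = fpsC x * E /\
  fmap (@const_coef k) E = - (fpsX (N ^ 2)%N * euler nome ^+ 3).
Proof.
move=> x0; have Uc : 1 + x \is a GRing.unit by apply: fps_unit_coef0; rewrite fcoefD x0 addr0 unitr1.
rewrite -[X in theta _ _ X]/(0%:Z) theta_prod // muln0 subn0 fpsX0 mulr1.
rewrite (@qpochinf_recl _ nome) ?nome_coef0 //.
set G := qpochinf _ (nome * _); set H := qpochinf _ (fpsC (1 + x)^-1 * _).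
have -> : (`|0%:Z - N%:Z| ^ 2 = N ^ 2)%N by rewrite sub0r abszN.
exists (- (fpsX (N ^ 2)%N * (euler nome * G * H))); split; first by rewrite rmorphD rmorph1; ring.
rewrite rmorphN !rmorphM /= fmap_fpsX; congr (- (_ * _)).
have q0 : fcoef (nome : fps A) 0 = 0 by exact: nome_coef0.
have e0 : const_coef (1 + x) = 1 by rewrite -[const_coef _]/(1 + fcoef x 0) x0 addr0.
have e1 : const_coef (1 + x)^-1 = 1.
  have : const_coef (1 + x) * const_coef (1 + x)^-1 = 1 by rewrite -(rmorphM (@const_coef k)) divrr // rmorph1.
  by rewrite e0 mul1r.
rewrite /euler /G /H !fmap_qpochinf // !rmorphM /= !fmap_fpsX !fmap_fpsC.
rewrite [X in nome * fpsC X](_ : _ = 1) // [X in fpsC X * nome](_ : _ = 1) // rmorph1 mulr1 mul1r.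
by ring.
Qed.

Lemma tcoef1_mulX f : tcoef 1 (fpsC (fpsX 1) * f) = fmap (@const_coef k) f.
Proof.
apply: fpsP => n; rewrite -[LHS]/(fcoef (fcoef (fpsC (fpsX 1) * f) n) 1) fcoefCM fcoefXM.
by rewrite ltnn subnn.
Qed.

Lemma dtheta_prod : dtheta k N = - (fpsX (N ^ 2)%N * euler nome ^+ 3).
Proof.
rewrite -tcoef1_theta; have [E [-> <-]] := @theta_simple_zero (fpsX 1) erefl.
exact: tcoef1_mulX.
Qed.
End ThetaDerivative.

Section ThetaNonzero.
Variable R : idomainType.
Variable N : nat.
Hypothesis N0 : (0 < N)%N.

Lemma theta_shiftz (c : R) m (a : int) : c \is a GRing.unit ->
  theta N c (m + (2 * N)%:Z * a) = fpsC ((- c^-1) ^ a) * theta N c m.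
Proof.
move=> Uc; have U : - c^-1 \is a GRing.unit by rewrite unitrN unitrV.
have P (b : nat) m' : theta N c (m' + (2 * N)%:Z * b%:Z) = fpsC ((- c^-1) ^ b%:Z) * theta N c m'.
  elim: b => [|b IH]; first by rewrite mulr0 addr0 expr0z rmorph1 mul1r.
  rewrite intS mulrDr mulr1 addrCA -[X in theta N c X]addrC theta_shift // IH.
  rewrite (exprzDr U 1) expr1z fpsCM -mulrA -mulNr; congr (_ * _).
  by rewrite rmorphN.
case: a => b; first exact: P.
rewrite NegzE mulrN.
have := P b.+1 (m - (2 * N)%:Z * b.+1%:Z); rewrite subrK => ->.
rewrite mulrA -fpsCM -exprzDr // addNr expr0z.
by rewrite -[fpsC 1]/(fpsC (1 : R)) rmorph1 mul1r.
Qed.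

Lemma qpochinf_neq0 (q z : fps R) : fcoef q 0 = 0 -> fcoef z 0 != 1 -> qpochinf q z != 0.
Proof.
move=> q0 z1; apply/eqP => /(congr1 (fun f => fcoef f 0)).
rewrite /qpochinf fcoef0_infprod expr0 mul1r fcoefB fcoef1 fcoef0 => /eqP.
by rewrite subr_eq0 eq_sym; apply/negP.
Qed.

Lemma theta_neq0 (c : R) m : c \is a GRing.unit ->
  off_lattice N c m -> theta N c m != 0.
Proof.
move=> Uc H; rewrite (divz_eq m (2 * N)%:Z) addrC mulrC theta_shiftz //.
have U : - c^-1 \is a GRing.unit by rewrite unitrN unitrV.
rewrite mulf_neq0 //.
  rewrite -(rmorph0 (@fpsC R)) (inj_eq (@fpsC_inj R)).
  by apply: contraTneq (unitrXz (m %/ (2 * N)%:Z)%Z U) => ->; rewrite unitr0.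
have ge := modz_ge0 m (twoN_neq0 N0).
have lt : (m %% (2 * N)%:Z)%Z < (2 * N)%:Z by apply: ltz_pmod; lia.
have {}H : (m %% (2 * N)%:Z)%Z = 0 -> c != 1 by move=> E; apply: H; apply/dvdz_mod0P.
case: (m %% _)%Z ge lt H => // a _ lt H; rewrite theta_prod //; last by lia.
rewrite !mulf_neq0 ?fpsX_neq0 ?euler_neq0 ?nome_coef0 //; apply: qpochinf_neq0; rewrite ?nome_coef0 // fcoefCM.
  have [a0|a1] := posnP a; first by rewrite a0 muln0 /= mulr1; apply: H; rewrite a0.
  by rewrite fpsX_coef0 ?muln_gt0 ?N0 ?a1 // mulr0 eq_sym oner_eq0.
by rewrite fpsX_coef0 ?mulr0 1?eq_sym ?oner_eq0 // -mulnn; nia.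
Qed.
End ThetaNonzero.

(** * The Tate curve *)

Definition is_frac (R : idomainType) (F : fieldType) (iota : R -> F) :=
  injective iota /\ forall x, exists a b, b != 0 /\ x = iota a / iota b.

Lemma frac_ex (R : idomainType) (x : {fraction R}) :
  exists a b : R, b != 0 /\ x = FracField.tofrac a / FracField.tofrac b.
Proof.
exists \n_(generic_quotient.repr x), \d_(generic_quotient.repr x); have nz := denom_ratioP (generic_quotient.repr x); split=> //.
apply: (canRL (mulfK _)); first by rewrite tofrac_eq0.
rewrite -{1}[x]generic_quotient.reprK !generic_quotient.piE; apply/generic_quotient.eqmodP.
rewrite /= FracField.equivfE /FracField.mulf !numden_Ratio ?oner_eq0 // ?mulf_neq0 ?oner_eq0 //.
by rewrite !mulr1 mulrC.
Qed.

(* The fraction field is only used through [is_frac]: unfolding the quotient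
   construction makes unification very slow. *)
Lemma frac_exists (R : idomainType) :
  exists (F : fieldType) (iota : {rmorphism R -> F}), is_frac iota.
Proof.
exists {fraction R}, (@FracField.tofrac R); split=> [a b /eqP|x].
  by rewrite tofrac_eq => /eqP.
exact: frac_ex.
Qed.

Section FracExt.
Variables (R : idomainType) (F : fieldType) (iota : {rmorphism R -> F}).
Hypothesis Fr : is_frac iota.

Lemma iota_eq (a b : R) : (iota a == iota b) = (a == b).
Proof. by apply/eqP/eqP => [/(proj1 Fr)|->]. Qed.
Lemma iota_eq0 (a : R) : (iota a == 0) = (a == 0).
Proof. by rewrite -(rmorph0 iota) iota_eq. Qed.

Lemma divF_eq (a b c d : R) : b != 0 -> d != 0 ->
  (iota a / iota b == iota c / iota d) = (a * d == c * b).
Proof.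
move=> b0 d0; rewrite -(iota_eq (a * d)) !rmorphM.
by rewrite eqr_div ?iota_eq0.
Qed.
End FracExt.

Section FracMap.
Variables (R : idomainType) (F : fieldType) (iota : {rmorphism R -> F}).
Hypothesis Fr : is_frac iota.
Variable phi : {rmorphism R -> R}.
Hypothesis phi_inj : injective phi.

Definition fracmap (x : F) : F :=
  let ab := cid (proj2 Fr x) in iota (phi (projT1 ab)) / iota (phi (projT1 (cid (projT2 ab)))).

Lemma phi_neq0 b : b != 0 -> phi b != 0.
Proof. by apply: contraNneq => E; apply/eqP/phi_inj; rewrite E rmorph0. Qed.

Lemma fracmapE a b : b != 0 -> fracmap (iota a / iota b) = iota (phi a) / iota (phi b).
Proof.
move=> b0; rewrite /fracmap; case: cid => a' H /=; case: cid => b' [b'0 E] /=.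
move/eqP: E; rewrite (divF_eq Fr) // => /eqP E.
by apply/eqP; rewrite (divF_eq Fr) ?phi_neq0 // -!rmorphM E.
Qed.

Lemma fracmap_iota a : fracmap (iota a) = iota (phi a).
Proof. by have := @fracmapE a 1 (oner_neq0 _); rewrite !rmorph1 !divr1. Qed.

Lemma fracmap_zmod : zmod_morphism fracmap.
Proof.
move=> x y; have [a [b [b0 ->]]] := proj2 Fr x; have [c [d [d0 ->]]] := proj2 Fr y.
rewrite -mulNr -rmorphN addf_div ?(iota_eq0 Fr) // -!rmorphM -rmorphD !fracmapE ?mulf_neq0 //.
rewrite -mulNr -rmorphN addf_div ?(iota_eq0 Fr) ?phi_neq0 //.
by rewrite -!rmorphM -rmorphD !(rmorphD, rmorphM, rmorphN).
Qed.

Lemma fracmap_monoid : monoid_morphism fracmap.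
Proof.
split; first by rewrite -(rmorph1 iota) fracmap_iota rmorph1.
move=> x y; have [a [b [b0 ->]]] := proj2 Fr x; have [c [d [d0 ->]]] := proj2 Fr y.
rewrite mulf_div -!rmorphM !fracmapE ?mulf_neq0 // mulf_div -!rmorphM.
by rewrite !rmorphM.
Qed.
HB.instance Definition _ := GRing.isZmodMorphism.Build _ _ fracmap fracmap_zmod.
HB.instance Definition _ := GRing.isMonoidMorphism.Build _ _ fracmap fracmap_monoid.
End FracMap.

Section FracDer.
Variables (R : idomainType) (F : fieldType) (iota : {rmorphism R -> F}).
Hypothesis Fr : is_frac iota.
Variable d : R -> R.
Hypothesis dD : forall x y, d (x + y) = d x + d y.
Hypothesis dM : forall x y, d (x * y) = d x * y + x * d y.

Definition fracder (x : F) : F :=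
  let ab := cid (proj2 Fr x) in
  let a := projT1 ab in let b := projT1 (cid (projT2 ab)) in
  iota (d a * b - a * d b) / iota (b ^+ 2).

Lemma fracderE a b : b != 0 -> fracder (iota a / iota b) = iota (d a * b - a * d b) / iota (b ^+ 2).
Proof.
move=> b0; rewrite /fracder; case: cid => a' H /=; case: cid => b' [b'0 E] /=.
move/eqP: E; rewrite (divF_eq Fr) // => /eqP E.
have E' : d a * b' + a * d b' = d a' * b + a' * d b by rewrite -!dM E.
apply/eqP; rewrite (divF_eq Fr) ?expf_neq0 //; apply/eqP.
transitivity (b * b' * (d a' * b) - (a' * b) * b * d b'); first by ring.
have -> : d a' * b = d a * b' + a * d b' - a' * d b by rewrite E'; ring.
transitivity (b * b' ^+ 2 * d a + b * b' * a * d b' - b' * (a' * b) * d b - (a' * b) * b * d b').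
  by ring.
by rewrite -E; ring.
Qed.

Lemma fracder_iota a : fracder (iota a) = iota (d a).
Proof.
have := @fracderE a 1 (oner_neq0 _).
by rewrite (derivation1 dM) mulr0 subr0 mulr1 expr1n rmorph1 !divr1.
Qed.

Lemma fracderD x y : fracder (x + y) = fracder x + fracder y.
Proof.
have [a [b [b0 ->]]] := proj2 Fr x; have [c [e [e0 ->]]] := proj2 Fr y.
rewrite addf_div ?(iota_eq0 Fr) // -!rmorphM -rmorphD !fracderE ?mulf_neq0 //.
rewrite addf_div ?(iota_eq0 Fr) ?expf_neq0 // -!rmorphM -rmorphD; apply/eqP.
rewrite (divF_eq Fr) ?mulf_neq0 ?expf_neq0 ?mulf_neq0 // !(dD, dM); apply/eqP; ring.
Qed.

Lemma fracderM x y : fracder (x * y) = fracder x * y + x * fracder y.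
Proof.
have [a [b [b0 ->]]] := proj2 Fr x; have [c [e [e0 ->]]] := proj2 Fr y.
rewrite mulf_div -!rmorphM !fracderE ?mulf_neq0 // !mulf_div -!rmorphM.
rewrite addf_div ?(iota_eq0 Fr) ?mulf_neq0 ?expf_neq0 // -!rmorphM -rmorphD; apply/eqP.
rewrite (divF_eq Fr) ?mulf_neq0 ?expf_neq0 ?mulf_neq0 // !(dD, dM); apply/eqP; ring.
Qed.
End FracDer.

Record theta_datum (R : idomainType) (N : nat) (F : fieldType) := ThetaDatum {
  cst : R -> F; vtheta : R -> int -> F; vtheta_even : R -> int -> F; vtheta_odd : R -> int -> F; dvtheta : F;
  cstM : forall a b, cst (a * b) = cst a * cst b;
  cst1 : cst 1 = 1;
  cstN : forall a, cst (- a) = - cst a;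
  cst_neq0 : forall a, a \is a GRing.unit -> cst a != 0;
  vtheta_neq0 : forall c m, c \is a GRing.unit -> off_lattice N c m -> vtheta c m != 0;
  vtheta_shift : forall c m, c \is a GRing.unit -> vtheta c (m + (2 * N)%:Z) = - (vtheta c m / cst c);
  vtheta_inv : forall c m, c \is a GRing.unit -> vtheta c^-1 (- m) = - (vtheta c m / cst c);
  vtheta_evenN : forall c m, vtheta_even (- c) m = vtheta_even c m;
  vtheta_oddN : forall c m, c \is a GRing.unit -> vtheta_odd (- c) m = - vtheta_odd c m;
  vtheta_mul0 : forall c1 m1 c2 m2, c1 \is a GRing.unit -> c2 \is a GRing.unit ->
    vtheta (c1 * c2) (m1 + m2) * vtheta (c1 / c2) (m1 - m2) =
    cst c1 * (vtheta_odd c1 m1 * vtheta_even c2 m2 - vtheta_even c1 m1 * vtheta_odd c2 m2);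
  vtheta_duplication : forall c m, c \is a GRing.unit ->
    vtheta (c ^+ 2) (2 * m) * (vtheta (-1) 0 * vtheta (-1) N%:Z * vtheta 1 N%:Z) =
    2%:R * (vtheta c m * vtheta (- c) m * (vtheta c (m + N%:Z) * vtheta (- c) (m + N%:Z)));
  dvtheta_neq0 : dvtheta != 0;
  two_neq0 : (2%:R : F) != 0 }.

Section Concrete.
Variable R : idomainType.
Variable N : nat.
Hypothesis N0 : (0 < N)%N.
Hypothesis nz2 : (2%:R : R) != 0.
Variables (F : fieldType) (iota : {rmorphism fps R -> F}).
Hypothesis Fr : is_frac iota.
Variable T : F.
Hypothesis T0 : T != 0.

Lemma iota_cst_neq0 a : a \is a GRing.unit -> iota (fpsC a) != 0.
Proof.
move=> Ua; rewrite (iota_eq0 Fr) -(rmorph0 (@fpsC R)) (inj_eq (@fpsC_inj R)).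
by apply: contraTneq Ua => ->; rewrite unitr0.
Qed.

Lemma iota_cstV a : a \is a GRing.unit -> iota (fpsC a^-1) = (iota (fpsC a))^-1.
Proof.
move=> Ua; have E : iota (fpsC a) * iota (fpsC a^-1) = 1.
  by rewrite -rmorphM -fpsCM divrr // !rmorph1.
by apply: (mulfI (iota_cst_neq0 Ua)); rewrite E divff // iota_cst_neq0.
Qed.

Definition theta_datum_fps : theta_datum R N F.
Proof.
exists (fun c => iota (fpsC c)) (fun c m => iota (theta N c m))
  (fun c m => iota (theta_even N c m)) (fun c m => iota (theta_odd N c m)) T => //.
- by move=> a b; rewrite fpsCM rmorphM.
- by rewrite !rmorph1.
- by move=> a; rewrite !rmorphN.
- exact: iota_cst_neq0.
- by move=> c m Uc H; rewrite (iota_eq0 Fr); apply: theta_neq0.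
- by move=> c m Uc; rewrite theta_shift // rmorphN rmorphM iota_cstV // mulrC.
- by move=> c m Uc; rewrite theta_inv // rmorphN rmorphM iota_cstV // mulrC.
- by move=> c m; rewrite theta_evenN.
- by move=> c m Uc; rewrite theta_oddN // rmorphN.
- by move=> c1 m1 c2 m2 U1 U2; rewrite -rmorphM theta_mul // rmorphM rmorphB !rmorphM.
- by move=> c m Uc; rewrite -!rmorphM theta_duplication // !rmorphM rmorph_nat.
- rewrite -(rmorph_nat iota) (iota_eq0 Fr) -(rmorph_nat (@fpsC R)) -(rmorph0 (@fpsC R)).
  by rewrite (inj_eq (@fpsC_inj R)).
Defined.
End Concrete.

Section Elliptic.
Variables (R : idomainType) (N : nat) (F : fieldType) (D : theta_datum R N F).
Hypothesis N0 : (0 < N)%N.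
Hypothesis nz2 : (2%:R : R) != 0.
Local Notation cst := (cst D).
Local Notation vtheta := (vtheta D).
Local Notation vtheta_even := (vtheta_even D).
Local Notation vtheta_odd := (vtheta_odd D).
Local Notation T := (dvtheta D).
Local Notation T0 := (dvtheta_neq0 D).
Definition theta2 := vtheta (-1) 0.
Definition theta3 := vtheta (-1) N%:Z.
Definition theta4 := vtheta 1 N%:Z.

Lemma cstV a : a \is a GRing.unit -> cst a^-1 = (cst a)^-1.
Proof.
move=> Ua; have n0 := cst_neq0 D Ua; apply: (mulfI n0).
by rewrite divff // -cstM divrr // cst1.
Qed.
Lemma cstX a n : cst (a ^+ n) = cst a ^+ n.
Proof. by elim: n => [|n IH]; rewrite ?expr0 ?cst1 // !exprS cstM IH. Qed.

Lemma ndvdN : ((2 * N)%:Z %| N%:Z)%Z = false.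
Proof.
clear D nz2.
apply/negbTE/dvdzP => -[a]; rewrite PoszM => E; have := N0.
by have [a0|a1] := lerP a 0; nia.
Qed.

Lemma N1_neq1 : -1 != 1 :> R.
Proof. by rewrite eq_sym -subr_eq0 opprK. Qed.

Lemma theta2_neq0 : theta2 != 0. Proof. by apply: vtheta_neq0 => [|_]; rewrite ?unitrN ?unitr1 ?N1_neq1. Qed.
Lemma theta3_neq0 : theta3 != 0. Proof. by apply: vtheta_neq0; rewrite ?unitrN ?unitr1 ?ndvdN. Qed.
Lemma theta4_neq0 : theta4 != 0. Proof. by apply: vtheta_neq0; rewrite ?unitr1 ?ndvdN. Qed.

Definition theta_det (c1 : R) (m1 : int) (c2 : R) (m2 : int) : F :=
  cst c1 * cst c2 * (vtheta_odd c1 m1 * vtheta_even c2 m2 - vtheta_even c1 m1 * vtheta_odd c2 m2).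

Lemma vtheta_mul c1 m1 c2 m2 : c1 \is a GRing.unit -> c2 \is a GRing.unit ->
  cst c2 * vtheta (c1 * c2) (m1 + m2) * vtheta (c1 / c2) (m1 - m2) = theta_det c1 m1 c2 m2.
Proof.
by move=> U1 U2; rewrite -mulrA vtheta_mul0 // /theta_det; ring.
Qed.

Lemma vtheta_sqr c m : c \is a GRing.unit -> vtheta c m ^+ 2 = theta_det c m 1 0.
Proof.
by move=> Uc; rewrite -vtheta_mul ?unitr1 // cst1 mul1r !mulr1 invr1 mulr1 ?subr0 ?addr0 expr2.
Qed.

Lemma theta_det_plucker ca ma cb mb cc mc cd md :
  theta_det ca ma cb mb * theta_det cc mc cd md - theta_det ca ma cc mc * theta_det cb mb cd md
    + theta_det ca ma cd md * theta_det cb mb cc mc = 0.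
Proof. by rewrite /theta_det; ring. Qed.

Lemma vtheta_sqr_sub c1 m1 c2 m2 : c1 \is a GRing.unit -> c2 \is a GRing.unit ->
  vtheta c1 m1 ^+ 2 * vtheta (- c2) m2 ^+ 2 - vtheta (- c1) m1 ^+ 2 * vtheta c2 m2 ^+ 2 =
  cst c2 * vtheta (c1 * c2) (m1 + m2) * vtheta (c1 / c2) (m1 - m2) * theta2 ^+ 2.
Proof.
move=> U1 U2; rewrite vtheta_mul // /theta2 !vtheta_sqr ?unitrN ?unitr1 //.
rewrite /theta_det !vtheta_evenN !vtheta_oddN ?unitr1 // !cstN !cst1.
by ring.
Qed.

Lemma jacobi_quartic : theta3 ^+ 4 - theta4 ^+ 4 = theta2 ^+ 4.
Proof.
have U : (-1 : R) \is a GRing.unit by rewrite unitrN unitr1.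
have := @vtheta_sqr_sub 1 N%:Z (-1) N%:Z (unitr1 _) U.
rewrite opprK !mul1r subrr cstN cst1 invrN invr1 -/theta3 -/theta4 -/theta2.
have -> : N%:Z + N%:Z = 0 + (2 * N)%:Z by lia.
rewrite vtheta_shift // cstN cst1 -/theta2 => E.
transitivity (- (theta4 ^+ 2 * theta4 ^+ 2 - theta3 ^+ 2 * theta3 ^+ 2)); first by ring.
by rewrite E; field; rewrite oppr_eq0 oner_eq0.
Qed.

Definition Xcoord (c : R) (m : int)  := T ^+ 2 * vtheta (- c) m ^+ 2 / (vtheta c m ^+ 2 * theta2 ^+ 2).
Definition Ycoord (c : R) (m : int)  := cst c * vtheta (c ^+ 2) (2 * m) * T ^+ 3 / vtheta c m ^+ 4.
Definition alpha := Xcoord 1 N%:Z.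
Definition beta := Xcoord (-1) N%:Z.

Lemma alphaE : alpha = T ^+ 2 * theta3 ^+ 2 / (theta4 ^+ 2 * theta2 ^+ 2). Proof. by []. Qed.
Lemma betaE : beta = T ^+ 2 * theta4 ^+ 2 / (theta3 ^+ 2 * theta2 ^+ 2).
Proof. by rewrite /beta /Xcoord opprK. Qed.

Lemma alpha_neq0 : alpha != 0.
Proof. by rewrite alphaE !mulf_neq0 ?invr_eq0 ?mulf_neq0 ?expf_neq0 ?T0 ?theta2_neq0 ?theta3_neq0 ?theta4_neq0. Qed.
Lemma beta_neq0 : beta != 0.
Proof. by rewrite betaE !mulf_neq0 ?invr_eq0 ?mulf_neq0 ?expf_neq0 ?T0 ?theta2_neq0 ?theta3_neq0 ?theta4_neq0. Qed.
Lemma alpha_sub_beta : alpha - beta = T ^+ 2 * theta2 ^+ 2 / (theta3 ^+ 2 * theta4 ^+ 2).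
Proof.
rewrite alphaE betaE; have := theta2_neq0; have := theta3_neq0; have := theta4_neq0 => h4 h3 h2.
have E : theta2 ^+ 4 = theta3 ^+ 4 - theta4 ^+ 4 by rewrite jacobi_quartic.
apply: (@mulIf _ (theta2 ^+ 2 * theta3 ^+ 2 * theta4 ^+ 2)); first by rewrite !mulf_neq0 ?expf_neq0.
transitivity (T ^+ 2 * (theta3 ^+ 4 - theta4 ^+ 4)); first by field; rewrite h2 h3 h4.
by rewrite -E; field; rewrite h3 h4.
Qed.
Lemma discriminantE : alpha * beta * (alpha - beta) = T ^+ 6 / (theta2 * (theta3 * theta4)) ^+ 2.
Proof.
rewrite alpha_sub_beta alphaE betaE; field.
by rewrite theta2_neq0 theta3_neq0 theta4_neq0.
Qed.

Section OnePoint.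
Variables (c : R) (m : int).
Hypothesis Uc : c \is a GRing.unit.
Hypothesis gc : off_lattice N c m.

Lemma Xcoord_shift : Xcoord c (m + (2 * N)%:Z) = Xcoord c m.
Proof.
rewrite /Xcoord !vtheta_shift ?unitrN // cstN; have := vtheta_neq0 D Uc gc => t0.
by field; rewrite ?oppr_eq0 ?theta2_neq0 ?t0 ?cst_neq0.
Qed.

Lemma Ycoord_shift : Ycoord c (m + (2 * N)%:Z) = Ycoord c m.
Proof.
rewrite /Ycoord; have -> : 2 * (m + (2 * N)%:Z) = 2 * m + (2 * N)%:Z + (2 * N)%:Z by ring.
rewrite !vtheta_shift ?unitrX // cstX; have := vtheta_neq0 D Uc gc => t0.
by field; rewrite ?oppr_eq0 ?t0 ?cst_neq0.
Qed.

Lemma Xcoord_inv : Xcoord c^-1 (- m) = Xcoord c m.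
Proof.
rewrite /Xcoord -invrN !vtheta_inv ?unitrN // cstN; have := vtheta_neq0 D Uc gc => t0.
by field; rewrite ?oppr_eq0 ?theta2_neq0 ?t0 ?cst_neq0.
Qed.

Lemma Ycoord_inv : Ycoord c^-1 (- m) = - Ycoord c m.
Proof.
rewrite /Ycoord exprVn mulrN !vtheta_inv ?unitrX // cstX cstV //; have := vtheta_neq0 D Uc gc => t0.
by field; rewrite ?oppr_eq0 ?t0 ?cst_neq0.
Qed.
End OnePoint.

Lemma Xcoord_sub c1 m1 c2 m2 : c1 \is a GRing.unit -> c2 \is a GRing.unit ->
  off_lattice N c1 m1 -> off_lattice N c2 m2 ->
  Xcoord c1 m1 - Xcoord c2 m2 = - (T ^+ 2 * cst c2 * vtheta (c1 * c2) (m1 + m2) * vtheta (c1 / c2) (m1 - m2)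
     / (vtheta c1 m1 * vtheta c2 m2) ^+ 2).
Proof.
move=> U1 U2 g1 g2; have t1 := vtheta_neq0 D U1 g1; have t2 := vtheta_neq0 D U2 g2.
have E := vtheta_sqr_sub m1 m2 U1 U2.
have h2 := theta2_neq0.
apply: (@mulIf _ (vtheta c1 m1 ^+ 2 * vtheta c2 m2 ^+ 2 * theta2 ^+ 2)); first by rewrite !mulf_neq0 ?expf_neq0.
rewrite /Xcoord.
transitivity (- (T ^+ 2 * (vtheta c1 m1 ^+ 2 * vtheta (- c2) m2 ^+ 2 - vtheta (- c1) m1 ^+ 2 * vtheta c2 m2 ^+ 2))).
  by field; rewrite h2 t1 t2.
by rewrite E; field; rewrite t1 t2.
Qed.

Lemma alpha_mul_beta : alpha * beta = T ^+ 4 / theta2 ^+ 4.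
Proof. by rewrite alphaE betaE; field; rewrite theta2_neq0 theta3_neq0 theta4_neq0. Qed.
Lemma alpha_mul_sub : alpha * (alpha - beta) = T ^+ 4 / theta4 ^+ 4.
Proof. by rewrite alpha_sub_beta alphaE; field; rewrite theta2_neq0 theta3_neq0 theta4_neq0. Qed.
Lemma beta_mul_sub : beta * (beta - alpha) = - (T ^+ 4 / theta3 ^+ 4).
Proof. by rewrite -opprB alpha_sub_beta betaE; field; rewrite theta2_neq0 theta3_neq0 theta4_neq0. Qed.

Section Points.
Variables (c : R) (m : int).
Hypothesis Uc : c \is a GRing.unit.

Let U1 : (-1 : R) \is a GRing.unit. Proof. by rewrite unitrN unitr1. Qed.

Lemma vtheta_subN : vtheta c (m - N%:Z) = - (cst c * vtheta c (m + N%:Z)).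
Proof.
have -> : m + N%:Z = m - N%:Z + (2 * N)%:Z by lia.
by rewrite vtheta_shift //; field; rewrite cst_neq0.
Qed.

Lemma Xcoord_sub_alpha : off_lattice N c m -> Xcoord c m - alpha = T ^+ 2 * cst c * vtheta c (m + N%:Z) ^+ 2 / (vtheta c m * theta4) ^+ 2.
Proof.
move=> g; have t0 := vtheta_neq0 D Uc g.
rewrite Xcoord_sub ?unitr1 ?ndvdN //.
rewrite cst1 invr1 !mulr1 vtheta_subN -/theta4; field.
by rewrite t0 theta4_neq0.
Qed.

Lemma Xcoord_sub_beta : off_lattice N c m ->
  Xcoord c m - beta = T ^+ 2 * cst c * vtheta (- c) (m + N%:Z) ^+ 2 / (vtheta c m * theta3) ^+ 2.
Proof.
move=> g; have t0 := vtheta_neq0 D Uc g.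
rewrite Xcoord_sub ?ndvdN //.
rewrite cstN cst1 invrN invr1 !mulrN1.
have -> : m + N%:Z = m - N%:Z + (2 * N)%:Z by lia.
rewrite vtheta_shift ?unitrN // cstN -/theta3; field.
by rewrite t0 ?oppr_eq0 cst_neq0 // theta3_neq0.
Qed.

Lemma Ycoord_sqr : off_lattice N c m -> Ycoord c m ^+ 2 = 4%:R * (Xcoord c m * (Xcoord c m - alpha) * (Xcoord c m - beta)).
Proof.
move=> g; have t0 := vtheta_neq0 D Uc g; rewrite Xcoord_sub_alpha // Xcoord_sub_beta // /Ycoord /Xcoord.
have h2 := theta2_neq0; have h3 := theta3_neq0; have h4 := theta4_neq0.
have E := vtheta_duplication D m Uc; rewrite -/theta2 -/theta3 -/theta4 in E.
have -> : vtheta (c ^+ 2) (2 * m) =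
  2%:R * (vtheta c m * vtheta (- c) m * (vtheta c (m + N%:Z) * vtheta (- c) (m + N%:Z))) / (theta2 * theta3 * theta4).
  by rewrite -E mulfK // !mulf_neq0.
by field; rewrite t0 h2 h3 h4.
Qed.
End Points.

Lemma Xcoord_sqr_sub c m : c \is a GRing.unit -> vtheta c m != 0 ->
  Xcoord c m ^+ 2 - alpha * beta = T ^+ 4 * cst c * vtheta (- c ^+ 2) (2 * m) / (vtheta c m ^+ 4 * theta2).
Proof.
move=> Uc t0; have U' : - c \is a GRing.unit by rewrite unitrN.
have := vtheta_sqr_sub m m Uc U'; rewrite opprK mulrN -expr2 subrr invrN mulrN divrr // cstN -/theta2.
rewrite (_ : m + m = 2 * m) => [E|]; last by ring.
rewrite alpha_mul_beta /Xcoord; have h2 := theta2_neq0.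
transitivity (- (T ^+ 4 * (vtheta c m ^+ 2 * vtheta c m ^+ 2 - vtheta (- c) m ^+ 2 * vtheta (- c) m ^+ 2) /
  (vtheta c m ^+ 4 * theta2 ^+ 4))); first by field; rewrite t0 h2.
by rewrite E; field; rewrite t0 h2.
Qed.

Lemma Xcoord_dbl c m : c \is a GRing.unit -> vtheta c m != 0 -> vtheta (c ^+ 2) (2 * m) != 0 ->
  Xcoord (c ^+ 2) (2 * m) * Ycoord c m ^+ 2 = (Xcoord c m ^+ 2 - alpha * beta) ^+ 2.
Proof.
move=> Uc t0 t2; rewrite Xcoord_sqr_sub // /Xcoord /Ycoord; field.
by rewrite t0 t2 theta2_neq0.
Qed.

Lemma Xcoord_alpha_shift c m : c \is a GRing.unit -> off_lattice N c m -> off_lattice N c (m + N%:Z) ->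
  (Xcoord c m - alpha) * (Xcoord c (m + N%:Z) - alpha) = alpha * (alpha - beta).
Proof.
move=> Uc g g1; have t0 := vtheta_neq0 D Uc g; have t1 := vtheta_neq0 D Uc g1; have h4 := theta4_neq0.
rewrite alpha_mul_sub !Xcoord_sub_alpha // -addrA (_ : N%:Z + N%:Z = (2 * N)%:Z); last by lia.
by rewrite vtheta_shift //; field; rewrite t0 t1 h4 cst_neq0.
Qed.

Lemma Xcoord_alpha_quad c m : c \is a GRing.unit -> off_lattice N c m -> off_lattice N c (m + N%:Z) ->
  Xcoord c m ^+ 2 - 2%:R * alpha * Xcoord c m + alpha * beta =
  T ^+ 4 * cst c ^+ 2 * vtheta (c ^+ 2) (2 * m + N%:Z) / (vtheta c m ^+ 4 * theta4).
Proof.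
move=> Uc g g1; have t0 := vtheta_neq0 D Uc g; have t1 := vtheta_neq0 D Uc g1; have h4 := theta4_neq0.
transitivity ((Xcoord c m - alpha) * (Xcoord c m - alpha) - alpha * (alpha - beta)); first by ring.
rewrite -(Xcoord_alpha_shift Uc g g1).
rewrite -mulrBr opprB addrA subrK Xcoord_sub_alpha // Xcoord_sub // -expr2 divrr //.
have -> : m - (m + N%:Z) = - N%:Z by ring.
have -> : m + (m + N%:Z) = 2 * m + N%:Z by ring.
have E : vtheta 1 (- N%:Z) = - theta4.
  by have := vtheta_inv D N%:Z (unitr1 R); rewrite invr1 cst1 divr1.
rewrite E; field.
by rewrite t0 t1 h4.
Qed.

Lemma Xcoord_beta_quad c m : c \is a GRing.unit -> off_lattice N c m -> off_lattice N (- c) (m + N%:Z) ->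
  Xcoord c m ^+ 2 - 2%:R * beta * Xcoord c m + alpha * beta =
  T ^+ 4 * cst c ^+ 2 * vtheta (- c ^+ 2) (2 * m + N%:Z) / (vtheta c m ^+ 4 * theta3).
Proof.
move=> Uc g g1; have U' : - c \is a GRing.unit by rewrite unitrN.
have t0 := vtheta_neq0 D Uc g; have t1 := vtheta_neq0 D U' g1; have h3 := theta3_neq0.
transitivity ((Xcoord c m - beta) * (Xcoord c m - beta) - beta * (beta - alpha)); first by ring.
have -> : beta * (beta - alpha) = (Xcoord c m - beta) * (Xcoord (- c) (m + N%:Z) - beta).
  rewrite beta_mul_sub !Xcoord_sub_beta // opprK -addrA (_ : N%:Z + N%:Z = (2 * N)%:Z); last by lia.
  by rewrite vtheta_shift // cstN; field; rewrite t0 t1 h3 cst_neq0.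
rewrite -mulrBr opprB addrA subrK Xcoord_sub_beta // Xcoord_sub //.
have -> : c * - c = - c ^+ 2 by rewrite mulrN expr2.
have -> : c / - c = -1 by rewrite invrN mulrN divrr.
have -> : m - (m + N%:Z) = - N%:Z by ring.
have -> : m + (m + N%:Z) = 2 * m + N%:Z by ring.
have E : vtheta (-1) (- N%:Z) = theta3.
  have := vtheta_inv D N%:Z (_ : (-1 : R) \is a GRing.unit); rewrite invrN invr1 unitrN unitr1 => -> //.
  by rewrite cstN cst1 -/theta3; field; rewrite oppr_eq0 oner_eq0.
rewrite E cstN; field.
by rewrite t0 t1 h3.
Qed.

Lemma Ycoord_dbl c m : c \is a GRing.unit -> off_lattice N c m -> off_lattice N c (m + N%:Z) ->
  off_lattice N (- c) (m + N%:Z) -> off_lattice N (c ^+ 2) (2 * m) ->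
  Ycoord (c ^+ 2) (2 * m) * Ycoord c m ^+ 3 = 2%:R * (Xcoord c m ^+ 2 - alpha * beta) *
    (Xcoord c m ^+ 2 - 2%:R * alpha * Xcoord c m + alpha * beta) *
    (Xcoord c m ^+ 2 - 2%:R * beta * Xcoord c m + alpha * beta).
Proof.
move=> Uc g g1 g2 g3; have U2 : c ^+ 2 \is a GRing.unit by rewrite unitrX.
have t0 := vtheta_neq0 D Uc g; have t2 := vtheta_neq0 D U2 g3.
have h2 := theta2_neq0; have h3 := theta3_neq0; have h4 := theta4_neq0.
rewrite Xcoord_sqr_sub // Xcoord_alpha_quad // Xcoord_beta_quad // /Ycoord cstX.
have E := vtheta_duplication D (2 * m) U2; rewrite -/theta2 -/theta3 -/theta4 in E.
have -> : vtheta ((c ^+ 2) ^+ 2) (2 * (2 * m)) = 2%:R * (vtheta (c ^+ 2) (2 * m) * vtheta (- c ^+ 2) (2 * m) *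
  (vtheta (c ^+ 2) (2 * m + N%:Z) * vtheta (- c ^+ 2) (2 * m + N%:Z))) / (theta2 * theta3 * theta4).
  by rewrite -E mulfK // !mulf_neq0.
by field; rewrite t0 t2 h2 h3 h4.
Qed.

Section Addition.
Variables (c1 : R) (m1 : int) (c2 : R) (m2 : int).
Hypotheses (U1 : c1 \is a GRing.unit) (U2 : c2 \is a GRing.unit).
Hypotheses (g1 : off_lattice N c1 m1) (g2 : off_lattice N c2 m2).
Hypotheses (gp : off_lattice N (c1 * c2) (m1 + m2)) (gm : off_lattice N (c1 / c2) (m1 - m2)).

Let t1 : vtheta c1 m1 != 0. Proof. exact: (vtheta_neq0 D U1 g1). Qed.
Let t2 : vtheta c2 m2 != 0. Proof. exact: (vtheta_neq0 D U2 g2). Qed.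
Let Up : c1 * c2 \is a GRing.unit. Proof. by rewrite unitrM U1. Qed.
Let Um : c1 / c2 \is a GRing.unit. Proof. by rewrite unitrM U1 unitrV. Qed.
Let tp : vtheta (c1 * c2) (m1 + m2) != 0. Proof. exact: (vtheta_neq0 D Up gp). Qed.
Let tm : vtheta (c1 / c2) (m1 - m2) != 0. Proof. exact: (vtheta_neq0 D Um gm). Qed.

Lemma Xcoord_add_sub : (Xcoord c1 m1 - Xcoord c2 m2) ^+ 2 * (Xcoord (c1 / c2) (m1 - m2) - Xcoord (c1 * c2) (m1 + m2)) =
  Ycoord c1 m1 * Ycoord c2 m2.
Proof.
rewrite (Xcoord_sub U1 U2 g1 g2) (Xcoord_sub Um Up gm gp) /Ycoord.
have -> : c1 / c2 * (c1 * c2) = c1 ^+ 2 by rewrite mulrACA mulVr // mulr1 expr2.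
have -> : c1 / c2 / (c1 * c2) = (c2 ^+ 2)^-1.
  by rewrite invrM // mulrA mulrC -!mulrA mulKr // expr2 invrM.
have -> : m1 - m2 + (m1 + m2) = 2 * m1 by ring.
have -> : m1 - m2 - (m1 + m2) = - (2 * m2) by ring.
rewrite vtheta_inv ?unitrX // cstM cstX; field.
by rewrite t1 t2 tp tm cst_neq0.
Qed.

Lemma Xcoord_add_mul : (Xcoord c1 m1 - Xcoord c2 m2) ^+ 2 * (Xcoord (c1 * c2) (m1 + m2) * Xcoord (c1 / c2) (m1 - m2)) =
  (alpha * beta - Xcoord c1 m1 * Xcoord c2 m2) ^+ 2.
Proof.
have U' : - c1 \is a GRing.unit by rewrite unitrN.
have h2 := theta2_neq0.
have -> : alpha * beta - Xcoord c1 m1 * Xcoord c2 m2 = - (T ^+ 4 * cst c2 * vtheta (- (c1 * c2)) (m1 + m2) *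
    vtheta (- (c1 / c2)) (m1 - m2) / (vtheta c1 m1 ^+ 2 * vtheta c2 m2 ^+ 2 * theta2 ^+ 2)).
  have := vtheta_sqr_sub m1 m2 U' U2; rewrite opprK !mulNr => E.
  rewrite alpha_mul_beta /Xcoord.
  transitivity (- (T ^+ 4 * (vtheta (- c1) m1 ^+ 2 * vtheta (- c2) m2 ^+ 2 - vtheta c1 m1 ^+ 2 * vtheta c2 m2 ^+ 2) /
    (vtheta c1 m1 ^+ 2 * vtheta c2 m2 ^+ 2 * theta2 ^+ 4))); first by field; rewrite t1 t2 h2.
  by rewrite E; field; rewrite t1 t2 h2.
rewrite (Xcoord_sub U1 U2 g1 g2) /Xcoord; field.
by rewrite t1 t2 tp tm h2.
Qed.

Lemma Xcoord_add_mul_alpha : off_lattice N c1 (m1 + N%:Z) ->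
  (Xcoord c1 m1 - Xcoord c2 m2) ^+ 2 *
    ((Xcoord (c1 * c2) (m1 + m2) - alpha) * (Xcoord (c1 / c2) (m1 - m2) - alpha)) =
  (alpha * (Xcoord c1 m1 + Xcoord c2 m2) - alpha * beta - Xcoord c1 m1 * Xcoord c2 m2) ^+ 2.
Proof.
move=> g3; have t3 := vtheta_neq0 D U1 g3; have h4 := theta4_neq0.
have E : alpha * (Xcoord c1 m1 + Xcoord c2 m2) - alpha * beta - Xcoord c1 m1 * Xcoord c2 m2 =
   (Xcoord c1 m1 - alpha) * (Xcoord c1 (m1 + N%:Z) - Xcoord c2 m2).
  have A := Xcoord_alpha_shift U1 g1 g3.
  transitivity ((Xcoord c1 m1 - alpha) * (Xcoord c1 (m1 + N%:Z) - alpha) +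
    (Xcoord c1 m1 - alpha) * (alpha - Xcoord c2 m2)); last by ring.
  by rewrite A; ring.
rewrite {}E (Xcoord_sub U1 U2 g1 g2) (Xcoord_sub_alpha U1 g1) (Xcoord_sub_alpha Up gp) (Xcoord_sub_alpha Um gm) (Xcoord_sub U1 U2 g3 g2).
have -> : m1 + N%:Z + m2 = m1 + m2 + N%:Z by ring.
have -> : m1 + N%:Z - m2 = m1 - m2 + N%:Z by ring.
rewrite !cstM cstV //; field.
by rewrite t1 t2 tp tm t3 h4 cst_neq0.
Qed.

Lemma Xcoord_add_sum : off_lattice N c1 (m1 + N%:Z) ->
  alpha * (Xcoord c1 m1 - Xcoord c2 m2) ^+ 2 * (Xcoord (c1 * c2) (m1 + m2) + Xcoord (c1 / c2) (m1 - m2)) =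
  (alpha * beta - Xcoord c1 m1 * Xcoord c2 m2) ^+ 2 + alpha ^+ 2 * (Xcoord c1 m1 - Xcoord c2 m2) ^+ 2 -
  (alpha * (Xcoord c1 m1 + Xcoord c2 m2) - alpha * beta - Xcoord c1 m1 * Xcoord c2 m2) ^+ 2.
Proof. by move=> g3; rewrite -Xcoord_add_mul -Xcoord_add_mul_alpha //; ring. Qed.
End Addition.

Definition edsW (c : R) (m : int) (n : nat) : F :=
  cst c ^+ 'C(n, 2) * vtheta (c ^+ n) (m *+ n) * (T / vtheta c m) ^+ (n ^ 2) / T.

Lemma vtheta10 : vtheta 1 0 = 0.
Proof.
have := vtheta_inv D 0 (unitr1 R); rewrite invr1 oppr0 cst1 divr1 => /eqP.
by rewrite -addr_eq0 -mulr2n -mulr_natr mulf_eq0 (negPf (two_neq0 D)) orbF => /eqP.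
Qed.

Lemma edsW0 c m : edsW c m 0 = 0.
Proof. by rewrite /edsW expr0 mulr0n vtheta10 !(mulr0, mul0r). Qed.
Lemma edsW1 c m : c \is a GRing.unit -> off_lattice N c m -> edsW c m 1 = 1.
Proof.
move=> Uc g; rewrite /edsW !expr1 mulr1n expr0 mul1r; field.
by rewrite dvtheta_neq0 (vtheta_neq0 D Uc g).
Qed.
(* [edsW (x + y) * edsW (x - y)] is a [2 x 2] determinant up to the factors [edsW_norm], so the
   recurrence is a Pluecker relation. *)
Definition edsW_norm c m n : F := (cst c * (T / vtheta c m) ^+ 2) ^+ (n ^ 2) / cst c ^+ n / T.
Lemma edsW_det c m (x y : nat) : c \is a GRing.unit -> off_lattice N c m -> (y <= x)%N ->
  edsW c m (x + y) * edsW c m (x - y) =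
  edsW_norm c m x * edsW_norm c m y * theta_det (c ^+ x) (m *+ x) (c ^+ y) (m *+ y).
Proof.
move=> Uc g le; have T0 := dvtheta_neq0 D; have C0 n : cst c ^+ n != 0 by rewrite expf_neq0 ?cst_neq0.
rewrite -vtheta_mul ?unitrX // cstX -exprD -mulrnDr -mulrnBr //.
have -> : c ^+ x / c ^+ y = c ^+ (x - y) by rewrite -{1}(subnK le) exprD mulrK ?unitrX.
have EC : cst c ^+ 'C(x + y, 2) * cst c ^+ 'C(x - y, 2) = cst c ^+ (x ^ 2) * cst c ^+ (y ^ 2) / cst c ^+ x.
  apply: (mulIf (C0 x)); rewrite divfK // -!exprD; congr (_ ^+ _).
  by have := bin2sq (x + y); have := bin2sq (x - y); nia.
rewrite /edsW /edsW_norm; move: (T / vtheta c m) => r.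
have ER : r ^+ ((x + y) ^ 2) * r ^+ ((x - y) ^ 2) = (r ^+ 2) ^+ (x ^ 2) * (r ^+ 2) ^+ (y ^ 2).
  by rewrite -!exprM -!exprD; congr (_ ^+ _); nia.
rewrite ![(cst c * _) ^+ _]exprMn; move: EC ER (C0 x) (C0 y); move: (cst c ^+ 'C(_, 2)) (cst c ^+ 'C(_, 2)) (r ^+ _) (r ^+ _) => u v w z.
move: (cst c ^+ x) (cst c ^+ y) (_ ^+ (x ^ 2)) (_ ^+ (y ^ 2)) => Cx Cy Cxx Cyy EC ER x0 y0.
transitivity ((v * u) * (z * w) * (vtheta (c ^+ (x + y)) (m *+ (x + y)) * vtheta (c ^+ (x - y)) (m *+ (x - y))) / T ^+ 2).
  by field.
by rewrite EC ER; field; rewrite x0 y0 T0.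
Qed.

Lemma edsW_rec c m (a b : nat) : c \is a GRing.unit -> off_lattice N c m -> (b <= a)%N -> (0 < b)%N ->
  edsW c m (a + b) * edsW c m (a - b) =
  edsW c m a.+1 * edsW c m a.-1 * edsW c m b ^+ 2 - edsW c m b.+1 * edsW c m b.-1 * edsW c m a ^+ 2.
Proof.
move=> Uc g ba b0; have a0 : (0 < a)%N := leq_trans b0 ba; have E x y := @edsW_det c m x y Uc g.
have P := theta_det_plucker (c ^+ a) (m *+ a) (c ^+ b) (m *+ b) (c ^+ 1) (m *+ 1) (c ^+ 0) (m *+ 0).
have := E 1%N 0%N (leq0n _); rewrite addn0 subn0 edsW1 // mulr1 => E10.
have := E a 1%N a0; have := E b 1%N b0; rewrite !addn1 !subn1 => -> ->.
have := E a 0%N (leq0n _); have := E b 0%N (leq0n _); rewrite !addn0 !subn0 -!expr2 => -> ->.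
rewrite (E a b ba) -[LHS]mulr1 [X in _ * X]E10; move: P.
move: (theta_det _ _ _ _) (theta_det _ _ _ _) (theta_det _ _ _ _) (theta_det _ _ _ _) => d1 d2 d3 d4.
move: (theta_det _ _ _ _) (theta_det _ _ _ _) => d5 d6 P.
move: (edsW_norm c m a) (edsW_norm c m b) (edsW_norm c m 1) (edsW_norm c m 0) => ga gb g1 g0.
apply/eqP; rewrite -subr_eq0 -[X in _ == X](mulr0 (ga * gb * g1 * g0)) -[in X in _ == X]P; apply/eqP; ring.
Qed.

Lemma edsW2 c m : c \is a GRing.unit -> off_lattice N c m -> edsW c m 2 = Ycoord c m.
Proof.
move=> Uc g; rewrite /edsW /Ycoord -[(2 ^ 2)%N]/4%N expr1 -[m *+ 2]mulr_natl; field.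
by rewrite dvtheta_neq0 (vtheta_neq0 D Uc g).
Qed.

End Elliptic.

(** * Division polynomials and the Hasse invariant *)

Section Hom.
Variables (A F : comNzRingType) (phi : {rmorphism A -> F}) (a b : F).

Inductive homog : nat -> F -> Prop :=
| homog0 n : homog n 0
| homogC c : homog 0 (phi c)
| homoga : homog 1 a
| homogb : homog 1 b
| homogD n x y : homog n x -> homog n y -> homog n (x + y)
| homogM m n x y : homog m x -> homog n y -> homog (m + n) (x * y).

Lemma homogN n x : homog n x -> homog n (- x).
Proof.
move=> h; rewrite -[n]add0n -mulN1r -(rmorph1 phi) -(rmorphN phi).
by apply: homogM h; apply: homogC.
Qed.
Lemma homogB n x y : homog n x -> homog n y -> homog n (x - y).
Proof. by move=> hx hy; apply: homogD => //; apply: homogN. Qed.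
Lemma homog_nat m : homog 0 m%:R.
Proof. by rewrite -(rmorph_nat phi); apply: homogC. Qed.
Lemma homogZ c n x : homog n x -> homog n (phi c * x).
Proof. by move=> h; rewrite -[n]add0n; apply: homogM h; apply: homogC. Qed.
Lemma homogX n m x : homog n x -> homog (n * m) (x ^+ m).
Proof.
move=> h; elim: m => [|m IH]; first by rewrite muln0 expr0; apply: (homog_nat 1).
by rewrite mulnS exprS; apply: homogM.
Qed.
Lemma homog_sum n (I : Type) (r : seq I) (P : pred I) (E : I -> F) :
  (forall i, P i -> homog n (E i)) -> homog n (\sum_(i <- r | P i) E i).
Proof. by move=> H; apply: big_ind => //; [apply: homog0|move=> x y; apply: homogD]. Qed.

Lemma homog_prod (I : Type) (r : seq I) (d : I -> nat) (E : I -> F) :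
  (forall i, homog (d i) (E i)) -> homog (\sum_(i <- r) d i) (\prod_(i <- r) E i).
Proof.
move=> H; elim: r => [|i r IH]; first by rewrite !big_nil; apply: (homog_nat 1).
by rewrite !big_cons; apply: homogM.
Qed.

Definition homog_poly d (l : F) (p : {poly F}) :=
  [/\ (size p <= d.+1)%N, p`_d = l & forall i, (i <= d)%N -> homog (d - i) p`_i].

Lemma homog_poly_out d l p i : homog_poly d l p -> (d < i)%N -> p`_i = 0.
Proof. by case=> s _ _ h; rewrite nth_default // (leq_trans s). Qed.

Lemma homog_polyD d l l' p p' : homog_poly d l p -> homog_poly d l' p' -> homog_poly d (l + l') (p + p').
Proof.
case=> s e h [s' e' h']; split; rewrite ?coefD ?e ?e' //.
  by apply: (leq_trans (size_polyD _ _)); rewrite geq_max s.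
by move=> i le; rewrite coefD; apply: homogD; [apply: h|apply: h'].
Qed.
Lemma homog_polyN d l p : homog_poly d l p -> homog_poly d (- l) (- p).
Proof.
case=> s e h; split; rewrite ?size_polyN ?coefN ?e //.
by move=> i le; rewrite coefN; apply/homogN/h.
Qed.
Lemma homog_polyB d l l' p p' : homog_poly d l p -> homog_poly d l' p' -> homog_poly d (l - l') (p - p').
Proof. by move=> h h'; apply: homog_polyD => //; apply: homog_polyN. Qed.
Lemma homog_polyM d l p d' l' p' : homog_poly d l p -> homog_poly d' l' p' -> homog_poly (d + d') (l * l') (p * p').
Proof.
move=> H H'; have [s e h] := H; have [s' e' h'] := H'; split.
- by apply: (leq_trans (size_polyMleq _ _)); lia.
- have lt : (d < (d + d').+1)%N by lia.
  rewrite coefM (bigD1 (Ordinal lt)) //= addKn e e' big1 ?addr0 // => -[i li] /= ne.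
  have : (i != d)%N by apply: contra ne => /eqP E; apply/eqP/val_inj.
  rewrite neq_ltn => /orP[lt'|lt'].
    by rewrite (homog_poly_out H') ?mulr0 //; lia.
  by rewrite (homog_poly_out H) ?mul0r.
- move=> i le; rewrite coefM; apply: homog_sum => -[j lj] _ /=.
  have [le_jd|lt_dj] := leqP j d; last by rewrite (homog_poly_out H) // mul0r; apply: homog0.
  have [le_id|lt_di] := leqP (i - j) d'; last by rewrite (homog_poly_out H') // mulr0; apply: homog0.
  have -> : (d + d' - i = (d - j) + (d' - (i - j)))%N by lia.
  by apply: homogM; [apply: h|apply: h'].
Qed.
Lemma eq_homog_poly d l d' l' p : homog_poly d l p -> d = d' -> l = l' -> homog_poly d' l' p.
Proof. by move=> h <- <-. Qed.
Lemma homog_polyC d x : homog d x -> (0 < d)%N -> homog_poly d 0 x%:P.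
Proof.
move=> h d0; split; rewrite ?coefC ?size_polyC; first by case: (x == 0).
  by rewrite -[_ == _]negbK -lt0n d0.
by move=> [|i] _; rewrite coefC ?subn0 //; apply: homog0.
Qed.
Lemma homog_poly_nat m : homog_poly 0 m%:R m%:R.
Proof.
rewrite -polyC_natr; split; rewrite ?coefC ?size_polyC //; first by case: (_ == 0).
by move=> [|//] _; rewrite coefC; apply: homog_nat.
Qed.
Lemma homog_polyX : homog_poly 1 1 'X.
Proof.
split; rewrite ?size_polyX ?coefX //.
by move=> [|[|//]] _; rewrite coefX; [apply: homog0|apply: (homog_nat 1)].
Qed.
Lemma homog_polyXn d l p m : homog_poly d l p -> homog_poly (d * m) (l ^+ m) (p ^+ m).
Proof.
move=> h; elim: m => [|m IH]; first by rewrite muln0 !expr0; apply: (homog_poly_nat 1).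
by rewrite mulnS !exprS; apply: homog_polyM.
Qed.

Definition cubic : {poly F} := 4%:R * ('X * ('X - a%:P) * ('X - b%:P)).
Lemma homog_poly_cubic : homog_poly 3 4%:R cubic.
Proof.
have ha : homog_poly 1 1 ('X - a%:P).
  by have := homog_polyB homog_polyX (homog_polyC homoga isT); rewrite subr0.
have hb : homog_poly 1 1 ('X - b%:P).
  by have := homog_polyB homog_polyX (homog_polyC homogb isT); rewrite subr0.
by apply: eq_homog_poly (homog_polyM (homog_poly_nat 4) (homog_polyM (homog_polyM homog_polyX ha) hb)) _ _; rewrite ?mulr1.
Qed.
Lemma cubicE x : cubic.[x] = 4%:R * (x * (x - a) * (x - b)).
Proof. by rewrite /cubic -polyC_natr !hornerE. Qed.

Lemma homog_sum_roots (I : Type) (r : seq I) (x : I -> F) d l p :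
  (forall m, homog m (\sum_(i <- r) x i ^+ m)) -> homog_poly d l p ->
  homog d (\sum_(i <- r) p.[x i]).
Proof.
move=> H [s _ h]; under eq_bigr => i _ do rewrite (horner_coef_wide _ s).
rewrite exchange_big /=; apply: homog_sum => -[j lj] _ /=.
rewrite -mulr_sumr -[d](@subnK j) //; apply: homogM => //; exact: h.
Qed.
End Hom.

Lemma homog_dehomogenize (A : comNzRingType) (F : fieldType) (phi : {rmorphism A -> F}) (a b : F) n x :
  a != 0 -> homog phi a b n x ->
  exists p : {poly A}, (size p <= n.+1)%N /\ x = a ^+ n * (map_poly phi p).[b / a].
Proof.
move=> a0; elim=> {n x} [n|c|||n x y _ [p [sp ->]] _ [q [sq ->]]|m n x y _ [p [sp ->]] _ [q [sq ->]]].
- by exists 0; rewrite size_poly0 rmorph0 horner0 mulr0.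
- by exists c%:P; rewrite size_polyC map_polyC hornerC expr0 mul1r; split=> //; case: (c == 0).
- by exists 1; rewrite size_poly1 rmorph1 hornerC expr1 mulr1.
- by exists 'X; rewrite size_polyX map_polyX hornerX expr1 mulrC divfK.
- exists (p + q); rewrite rmorphD hornerD mulrDr; split=> //.
  by apply: (leq_trans (size_polyD _ _)); rewrite geq_max sp.
- exists (p * q); rewrite rmorphM hornerM exprD mulrACA; split=> //.
  by apply: (leq_trans (size_polyMleq _ _)); lia.
Qed.

Lemma homog_map (A A' F F' : comNzRingType) (phi : {rmorphism A -> F}) (phi' : {rmorphism A' -> F'})
  (psi : {rmorphism F -> F'}) a b n x : (forall c, exists c', psi (phi c) = phi' c') ->
  homog phi a b n x -> homog phi' (psi a) (psi b) n (psi x).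
Proof.
move=> E; elim=> {n x} [n|c|||n x y _ h _ h'|m n x y _ h _ h'].
- by rewrite rmorph0; apply: homog0.
- by have [c' ->] := E c; apply: homogC.
- exact: homoga.
- exact: homogb.
- by rewrite rmorphD; apply: homogD.
- by rewrite rmorphM; apply: homogM.
Qed.

Lemma homog_lift (A F F' : comNzRingType) (phi : {rmorphism A -> F}) (phi' : {rmorphism A -> F'})
  (psi : {rmorphism F -> F'}) a b n x : (forall c, phi' c = psi (phi c)) ->
  homog phi' (psi a) (psi b) n x -> exists y, homog phi a b n y /\ x = psi y.
Proof.
move=> E; elim=> {n x} [n|c|||n x y _ [x' [h ->]] _ [y' [h' ->]]|m n x y _ [x' [h ->]] _ [y' [h' ->]]].
- by exists 0; rewrite rmorph0; split=> //; apply: homog0.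
- by exists (phi c); split=> //; apply: homogC.
- by exists a; split=> //; apply: homoga.
- by exists b; split=> //; apply: homogb.
- by exists (x' + y'); rewrite rmorphD; split=> //; apply: homogD.
- by exists (x' * y'); rewrite rmorphM; split=> //; apply: homogM.
Qed.

Definition divpol_deg n := let s := n./2 in if odd n then (2 * s * s + 2 * s)%N else (2 * s * s - 2)%N.
Definition divpol_lead n := if odd n then n else n./2.

Lemma divpol_deg_odd s : divpol_deg (2 * s + 1) = (2 * s * s + 2 * s)%N.
Proof.
have e : (2 * s + 1)./2 = s by lia.
by rewrite /divpol_deg e; case: ifP => // /negP[]; lia.
Qed.
Lemma divpol_deg_even s : divpol_deg (2 * s) = (2 * s * s - 2)%N.
Proof.
have e : (2 * s)./2 = s by lia.
by rewrite /divpol_deg e; case: ifP => // o; exfalso; lia.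
Qed.

Section EDS.
Variables (R : idomainType) (N : nat) (F : fieldType) (D : theta_datum R N F).
Hypothesis N0 : (0 < N)%N.
Hypothesis nz2 : (2%:R : R) != 0.
Definition regular_pt (c : R) (m : int) :=
  [/\ c \is a GRing.unit, off_lattice N c m, off_lattice N (c ^+ 2) (2 * m), off_lattice N c (m + N%:Z) & off_lattice N (- c) (m + N%:Z)].

Lemma edsW_Xcoord c m n : c \is a GRing.unit -> off_lattice N c m -> off_lattice N (c ^+ n) (m *+ n) -> (0 < n)%N ->
  (Xcoord D c m - Xcoord D (c ^+ n) (m *+ n)) * edsW D c m n ^+ 2 = edsW D c m n.+1 * edsW D c m n.-1.
Proof.
move=> Uc g gn n0; have Un : c ^+ n \is a GRing.unit by rewrite unitrX.
have t0 := vtheta_neq0 D Uc g; have tn := vtheta_neq0 D Un gn; have T0 := dvtheta_neq0 D.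
rewrite -opprB Xcoord_sub // /edsW.
have -> : c ^+ n * c = c ^+ n.+1 by rewrite exprSr.
have -> : c ^+ n / c = c ^+ n.-1 by rewrite -{1}(prednK n0) exprSr mulrK.
have -> : m *+ n + m = m *+ n.+1 by rewrite mulrSr.
have -> : m *+ n - m = m *+ n.-1 by rewrite -{1}(prednK n0) mulrSr addrK.
have e1 : ('C(n.+1, 2) + 'C(n.-1, 2) = 2 * 'C(n, 2) + 1)%N.
  by have := bin2sq n.+1; have := bin2sq n.-1; have := bin2sq n; nia.
have e2 : (n.+1 ^ 2 + n.-1 ^ 2 = 2 * (n ^ 2) + 2)%N by rewrite -!mulnn; nia.
move: ('C(n.+1, 2)) ('C(n.-1, 2)) ('C(n, 2)) (n.+1 ^ 2)%N (n.-1 ^ 2)%N (n ^ 2)%N e1 e2.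
move=> p p' q x x' y e1 e2; set C := cst D c; set r := dvtheta D / vtheta D c m.
set t1 := vtheta D (c ^+ n.+1) _; set t2 := vtheta D (c ^+ n.-1) _; set t := vtheta D _ (m *+ n).
transitivity (C ^+ (p + p') * r ^+ (x + x') * (t1 * t2) / dvtheta D ^+ 2); last first.
  rewrite !exprD; move: (C ^+ p) (C ^+ p') (r ^+ x) (r ^+ x') => ? ? ? ?; field.
  by rewrite T0.
rewrite e1 e2 (exprD C) (exprD r) mulnC (mulnC 2 y) !exprM.
move: (C ^+ q) (r ^+ y) => ? ?; rewrite /r expr1; field.
by rewrite T0 t0 tn.
Qed.

Notation phi := (intr : {rmorphism int -> F}).
Notation a := (alpha D).
Notation b := (beta D).
Notation hp := (homog_poly phi a b).

Lemma edsW4 c m : c \is a GRing.unit -> off_lattice N c m -> off_lattice N (c ^+ 2) (2 * m) ->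
  edsW D c m 4 = Ycoord D (c ^+ 2) (2 * m) * Ycoord D c m ^+ 4.
Proof.
move=> Uc g g2; have U2 : c ^+ 2 \is a GRing.unit by rewrite unitrX.
have t0 := vtheta_neq0 D Uc g; have t2 := vtheta_neq0 D U2 g2; have T0 := dvtheta_neq0 D.
rewrite /edsW /Ycoord -[(4 ^ 2)%N]/16%N -['C(4, 2)]/6%N cstX.
have -> : (c ^+ 2) ^+ 2 = c ^+ 4 by rewrite -exprM.
have -> : 2 * (2 * m) = m *+ 4 by rewrite -mulr_natl; ring.
by field; rewrite t0 t2 T0.
Qed.

Lemma regular_pt_Y c m : regular_pt c m -> Ycoord D c m != 0.
Proof.
case=> Uc g g2 _ _; have U2 : c ^+ 2 \is a GRing.unit by rewrite unitrX.
by rewrite /Ycoord !mulf_neq0 ?invr_eq0 ?expf_neq0 ?dvtheta_neq0 ?cst_neq0 ?vtheta_neq0.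
Qed.

Definition is_divpol n G := hp (divpol_deg n) (divpol_lead n)%:R G /\
  forall c m, regular_pt c m -> edsW D c m n = G.[Xcoord D c m] * (if odd n then 1 else Ycoord D c m).

Lemma edsW_odd c m n : c \is a GRing.unit -> off_lattice N c m -> (0 < n)%N ->
  edsW D c m (2 * n + 1) = edsW D c m n.+2 * edsW D c m n ^+ 3 - edsW D c m n.-1 * edsW D c m n.+1 ^+ 3.
Proof.
have [e1 e2] : (n.+1 + n = 2 * n + 1)%N /\ (n.+1 - n = 1)%N by lia.
move=> Uc g n0; have := edsW_rec D N0 nz2 (a := n.+1) (b := n) Uc g (leqnSn n) n0.
by rewrite e1 e2 edsW1 // mulr1 => ->; rewrite -pred_Sn; ring.
Qed.

Lemma edsW_even c m n : c \is a GRing.unit -> off_lattice N c m -> (1 < n)%N ->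
  edsW D c m (2 * n) * Ycoord D c m =
  edsW D c m n * (edsW D c m n.+2 * edsW D c m n.-1 ^+ 2 - edsW D c m n.-2 * edsW D c m n.+1 ^+ 2).
Proof.
have e : (1 < n -> [/\ n.+1 + n.-1 = 2 * n, n.+1 - n.-1 = 2, n.-1.+1 = n, n.-1 <= n.+1 & 0 < n.-1])%N.
  by split; lia.
move=> Uc g /e[e1 e2 e3 e4 e5]; have := edsW_rec D N0 nz2 (a := n.+1) (b := n.-1) Uc g e4 e5.
by rewrite e1 e2 e3 edsW2 // => ->; rewrite -pred_Sn; ring.
Qed.

Lemma divpol_deg_lead_odd n : (1 < n)%N ->
  (if odd n then (divpol_deg n.+2 + divpol_deg n * 3 = divpol_deg (2 * n + 1))%N /\ (3 * 2 + (divpol_deg n.-1 + divpol_deg n.+1 * 3) = divpol_deg (2 * n + 1))%N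
   else (3 * 2 + (divpol_deg n.+2 + divpol_deg n * 3) = divpol_deg (2 * n + 1))%N /\ (divpol_deg n.-1 + divpol_deg n.+1 * 3 = divpol_deg (2 * n + 1))%N) /\
  (divpol_lead (2 * n + 1))%:R = (if odd n then (divpol_lead n.+2)%:R * (divpol_lead n)%:R ^+ 3 - 4%:R ^+ 2 * ((divpol_lead n.-1)%:R * (divpol_lead n.+1)%:R ^+ 3)
   else 4%:R ^+ 2 * ((divpol_lead n.+2)%:R * (divpol_lead n)%:R ^+ 3) - (divpol_lead n.-1)%:R * (divpol_lead n.+1)%:R ^+ 3) :> F.
Proof.
move=> n1; have [s En] : exists s, n = (odd n + 2 * s.+1)%N by exists (n./2.-1); lia.
rewrite divpol_deg_odd /divpol_lead; case: (odd n) En => En.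
  have -> : n.+2 = (2 * s.+2 + 1)%N by lia.
  have -> : n.-1 = (2 * s.+1)%N by lia.
  have -> : n.+1 = (2 * s.+2)%N by lia.
  have -> : n = (2 * s.+1 + 1)%N by lia.
  rewrite !divpol_deg_odd !divpol_deg_even; split; first by split; nia.
  by do ![case: ifP => ?]; try lia; rewrite !mul2n !doubleK !addn1 -!mul2n; ring.
have -> : n.+2 = (2 * s.+2)%N by lia.
have -> : n.-1 = (2 * s + 1)%N by lia.
have -> : n.+1 = (2 * s.+1 + 1)%N by lia.
have -> : n = (2 * s.+1)%N by lia.
rewrite !divpol_deg_odd !divpol_deg_even; split; first by split; nia.
by do ![case: ifP => ?]; try lia; rewrite !mul2n !doubleK !addn1 -!mul2n; ring.
Qed.

Lemma divpol_deg_lead_even n : (2 < n)%N ->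
  [/\ (divpol_deg n.+2 + divpol_deg n.-1 * 2 = divpol_deg (2 * n) - divpol_deg n)%N,
     (divpol_deg n.-2 + divpol_deg n.+1 * 2 = divpol_deg (2 * n) - divpol_deg n)%N, (divpol_deg n + (divpol_deg (2 * n) - divpol_deg n) = divpol_deg (2 * n))%N &
  (divpol_lead (2 * n))%:R = (divpol_lead n)%:R * ((divpol_lead n.+2)%:R * (divpol_lead n.-1)%:R ^+ 2 - (divpol_lead n.-2)%:R * (divpol_lead n.+1)%:R ^+ 2) :> F].
Proof.
move=> n1; have [s En] : exists s, n = (odd n + 2 * s.+1)%N by exists (n./2.-1); lia.
rewrite divpol_deg_even /divpol_lead; case: (odd n) En => En.
  have -> : n.-2 = (2 * s + 1)%N by lia.
  have -> : n.+2 = (2 * s.+2 + 1)%N by lia.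
  have -> : n.-1 = (2 * s.+1)%N by lia.
  have -> : n.+1 = (2 * s.+2)%N by lia.
  have -> : n = (2 * s.+1 + 1)%N by lia.
  rewrite !divpol_deg_odd !divpol_deg_even; split; try nia.
  by do ![case: ifP => ?]; try lia; rewrite !mul2n !doubleK !addn1 -!mul2n; ring.
case: s En => [|s] En; first by lia.
have -> : n.-2 = (2 * s.+1)%N by lia.
have -> : n.+2 = (2 * s.+3)%N by lia.
have -> : n.-1 = (2 * s.+1 + 1)%N by lia.
have -> : n.+1 = (2 * s.+2 + 1)%N by lia.
have -> : n = (2 * s.+2)%N by lia.
rewrite !divpol_deg_odd !divpol_deg_even; split; try nia.
by do ![case: ifP => ?]; try lia; rewrite !mul2n !doubleK !addn1 -!mul2n; ring.
Qed.

Lemma divpol_odd n G1 G2 G3 G4 : (1 < n)%N -> is_divpol n.+2 G1 -> is_divpol n G2 ->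
  is_divpol n.-1 G3 -> is_divpol n.+1 G4 -> exists G, is_divpol (2 * n + 1) G.
Proof.
have o3 : (0 < n)%N -> odd n.-1 = ~~ odd n by lia.
have o5 : odd (2 * n + 1) by lia.
move=> n1 [h1 w1] [h2 w2] [h3 w3] [h4 w4]; have n0 := ltnW n1; have o3' := o3 n0.
have H1 := homog_polyM h1 (homog_polyXn 3 h2); have H2 := homog_polyM h3 (homog_polyXn 3 h4).
have HC := homog_polyXn 2 (homog_poly_cubic phi a b).
have [a0 b0] := divpol_deg_lead_odd n1.
exists (if odd n then (G1 * G2 ^+ 3) - cubic a b ^+ 2 * (G3 * G4 ^+ 3)
        else cubic a b ^+ 2 * (G1 * G2 ^+ 3) - (G3 * G4 ^+ 3)); split.
  rewrite {}b0; case: (odd n) a0 => -[e e'].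
    by have H3 := homog_polyM HC H2; rewrite e in H1; rewrite e' in H3; apply: homog_polyB.
  by have H3 := homog_polyM HC H1; rewrite e in H3; rewrite e' in H2; apply: homog_polyB.
move=> c m ok; have [Uc g g2 g3 g4] := ok.
rewrite o5 mulr1 edsW_odd // (w1 _ _ ok) (w2 _ _ ok) (w3 _ _ ok) (w4 _ _ ok) o3' /= negbK.
have YC : (cubic a b).[Xcoord D c m] = Ycoord D c m ^+ 2 by rewrite cubicE Ycoord_sqr.
by case: (odd n) => /=; rewrite hornerD hornerN (hornerM (cubic a b ^+ 2)) (hornerM G1) (hornerM G3)
   !horner_exp YC; ring.
Qed.

Lemma divpol_even n G0 G1 G2 G3 G4 : (2 < n)%N -> is_divpol n G0 -> is_divpol n.+2 G1 -> is_divpol n.-1 G2 ->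
  is_divpol n.-2 G3 -> is_divpol n.+1 G4 -> exists G, is_divpol (2 * n) G.
Proof.
have o2 : (2 < n)%N -> odd n.-1 = ~~ odd n by lia.
have o3 : (2 < n)%N -> odd n.-2 = odd n by lia.
have o5 : odd (2 * n) = false by lia.
move=> n2 [h0 w0] [h1 w1] [h2 w2] [h3 w3] [h4 w4]; exists (G0 * (G1 * G2 ^+ 2 - G3 * G4 ^+ 2)); split.
  have H1 := homog_polyM h1 (homog_polyXn 2 h2); have H2 := homog_polyM h3 (homog_polyXn 2 h4).
  have [e e' e0 ->] := divpol_deg_lead_even n2.
  by rewrite e in H1; rewrite e' in H2; apply: eq_homog_poly (homog_polyM h0 (homog_polyB H1 H2)) _ _.
move=> c m ok; have [Uc g g2 g3 g4] := ok; have Y0 := regular_pt_Y ok.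
apply: (mulIf Y0); rewrite edsW_even // ?(ltnW n2) //.
rewrite (w0 _ _ ok) (w1 _ _ ok) (w2 _ _ ok) (w3 _ _ ok) (w4 _ _ ok) o2 // o3 // o5 /= negbK.
rewrite (hornerM G0) hornerD hornerN (hornerM G1) (hornerM G3) !horner_exp.
by case: (odd n) => /=; ring.
Qed.

Lemma divpol3 : exists G, is_divpol 3 G.
Proof.
exists (3%:R * 'X^4 - (4%:R * (a + b))%:P * 'X^3 + (6%:R * (a * b))%:P * 'X^2 - ((a * b) ^+ 2)%:P).
have ha := homoga phi a b; have hb := homogb phi a b; have hX k := homog_polyXn k (homog_polyX phi a b).
split.
  have h1 := homog_polyM (homog_poly_nat phi a b 3) (hX 4%N).
  have h2 := homog_polyM (homog_polyC (homogM (homog_nat phi a b 4) (homogD ha hb)) isT) (hX 3%N).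
  have h3 := homog_polyM (homog_polyC (homogM (homog_nat phi a b 6) (homogM ha hb)) isT) (hX 2%N).
  have h4 := homog_polyC (homogX 2 (homogM ha hb)) isT.
  apply: eq_homog_poly (homog_polyB (homog_polyD (homog_polyB h1 h2) h3) h4) _ _ => //.
  by rewrite !mul0r !subr0 addr0 expr1n mulr1.
move=> c m ok; have [Uc g g2 g3 g4] := ok.
have := edsW_Xcoord (n := 2) Uc g; rewrite -[m *+ 2]mulr_natl => /(_ g2 isT).
rewrite /= edsW1 // edsW2 // !mulr1 => <-.
have t0 := vtheta_neq0 D Uc g.
have t2 : vtheta D (c ^+ 2) (2 * m) != 0 by apply: vtheta_neq0 => //; rewrite unitrX.
rewrite mulrBl Xcoord_dbl // Ycoord_sqr //; move: (Xcoord D c m) a b => x u v.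
by rewrite -!polyC_natr !(hornerD, hornerN, hornerCM, hornerXn, hornerC); ring.
Qed.

Lemma divpol4 : exists G, is_divpol 4 G.
Proof.
exists (2%:R * ('X^2 - (a * b)%:P) * ('X^2 - (2%:R * a)%:P * 'X + (a * b)%:P) *
   ('X^2 - (2%:R * b)%:P * 'X + (a * b)%:P)).
have ha := homoga phi a b; have hb := homogb phi a b; have hX := homog_polyXn 2 (homog_polyX phi a b).
split.
  have h0 := homog_polyC (homogM ha hb) isT.
  have h1 := homog_polyM (homog_poly_nat phi a b 2) (homog_polyB hX h0).
  have h2 := homog_polyD (homog_polyB hX (homog_polyM (homog_polyC (homogM (homog_nat phi a b 2) ha) isT) (homog_polyX phi a b))) h0.
  have h3 := homog_polyD (homog_polyB hX (homog_polyM (homog_polyC (homogM (homog_nat phi a b 2) hb) isT) (homog_polyX phi a b))) h0.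
  apply: eq_homog_poly (homog_polyM (homog_polyM h1 h2) h3) _ _ => //.
  by rewrite !mul0r !subr0 addr0 expr1n !mulr1.
move=> c m ok; have [Uc g g2 g3 g4] := ok.
rewrite edsW4 // [Ycoord D c m ^+ 4]exprSr mulrA Ycoord_dbl //; move: (Xcoord D c m) a b => x u v.
by rewrite -!polyC_natr !hornerM !(hornerD, hornerN, hornerCM, hornerXn, hornerC, hornerX).
Qed.

(* The elliptic divisibility sequence of the theta quotients [edsW], as polynomials in X. *)
Lemma divpol_exists n : exists G, is_divpol n G.
Proof.
elim/ltn_ind: n => n IH.
have [n5|] := leqP 5 n; last first.
  case: n {IH} => [|[|[|[|[|//]]]]] _.
  - exists 0; split=> [|c m _]; last by rewrite edsW0 horner0 mul0r.
    by apply: eq_homog_poly (homog_poly_nat phi a b 0) _ _.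
  - exists 1; split=> [|c m [Uc g _ _ _]]; last by rewrite edsW1 // hornerC mulr1.
    by apply: eq_homog_poly (homog_poly_nat phi a b 1) _ _.
  - exists 1; split=> [|c m [Uc g _ _ _]]; last by rewrite edsW2 // hornerC mul1r.
    by apply: eq_homog_poly (homog_poly_nat phi a b 1) _ _.
  - exact: divpol3.
  - exact: divpol4.
have [[G0 h0] [G1 h1] [G2 h2] [G4 h4]] : [/\ exists G, is_divpol n./2 G, exists G, is_divpol n./2.+2 G,
    exists G, is_divpol n./2.-1 G & exists G, is_divpol n./2.+1 G].
  by split; apply: IH; lia.
have [o|e] := boolP (odd n).
  by rewrite (_ : n = 2 * n./2 + 1)%N; [apply: (divpol_odd _ h1 h0 h2 h4)|]; lia.
have [G3 h3] : exists G, is_divpol n./2.-2 G by apply: IH; lia.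
by rewrite (_ : n = 2 * n./2)%N; [apply: (divpol_even _ h0 h1 h2 h3 h4)|]; lia.
Qed.
End EDS.

Lemma alpha_beta_theta (R : idomainType) N (F : fieldType) (D : theta_datum R N F) : (0 < N)%N -> (2%:R : R) != 0 ->
  2%:R * dvtheta D = - (theta2 D * (theta4 D * theta3 D)) -> alpha D = theta3 D ^+ 4 / 4%:R /\ beta D = theta4 D ^+ 4 / 4%:R.
Proof.
move=> N0 nz2 E; have nz := two_neq0 D.
have four_neq0 : (4%:R : F) != 0 by rewrite (_ : 4%:R = 2%:R * 2%:R :> F) ?mulf_neq0 //; ring.
have := theta2_neq0 D nz2; have := theta3_neq0 D N0; have := theta4_neq0 D N0 => h4 h3 h2.
have ET : dvtheta D = - (theta2 D * (theta4 D * theta3 D)) / 2%:R by rewrite -E [2%:R * _]mulrC mulfK.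
by split; [rewrite alphaE ET|rewrite betaE ET]; field; rewrite ?h2 ?h3 ?h4 ?nz ?four_neq0.
Qed.

Section TwoVar.
Variable k : fieldType.
Variable N : nat.
Hypothesis N0 : (0 < N)%N.
Hypothesis nz2 : (2%:R : k) != 0.
Notation A := (fps k).
Notation t := (fpsC (fpsX 1) : fps A).
Definition fps_lift : {rmorphism fps k -> fps A} := fmap (@fpsC k).
Definition at_t0 : {rmorphism fps A -> fps k} := fmap (@const_coef k).

Lemma at_t0K x : at_t0 (fps_lift x) = x.
Proof. by apply: fpsP. Qed.
Lemma at_t0_t x : at_t0 (t * x) = 0.
Proof. by rewrite rmorphM /at_t0 /= fmap_fpsC /const_coef /= rmorph0 mul0r. Qed.

Lemma t_neq0 : t != 0.
Proof. by rewrite -(rmorph0 (@fpsC A)) (inj_eq (@fpsC_inj A)) fpsX_neq0. Qed.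

Lemma two_neq0_fps : (2%:R : A) != 0.
Proof. by rewrite -(rmorph_nat (@fpsC k)) -(rmorph0 (@fpsC k)) (inj_eq (@fpsC_inj k)). Qed.

Lemma fpsC_expz (c : k) (n : int) : c \is a GRing.unit -> fpsC (c ^ n) = fpsC c ^ n.
Proof.
move=> Uc; case: n => m; first by rewrite -!exprnP rmorphXn.
rewrite NegzE -!invr_expz -!exprnP; apply: (mulrI (x := fpsC c ^+ m.+1)).
  by rewrite unitrX // rmorph_unit.
by rewrite divrr ?unitrX ?rmorph_unit // -rmorphXn -rmorphM divrr ?unitrX // rmorph1.
Qed.

Lemma fps_lift_theta c m : c \is a GRing.unit -> fps_lift (theta N c m) = theta N (fpsC c) m.
Proof.
move=> Uc; rewrite /fps_lift /= fmap_fpsum; apply: eq_fpsum => [n|//] /=.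
have U' : - c \is a GRing.unit by rewrite unitrN.
by rewrite -(rmorphN (@fpsC k)) -fpsC_expz.
Qed.

Lemma t_expansion_lead D n (B : nat -> fps A) (a : fps A) (y : nat -> fps k) M :
  M != 0 -> (forall s, (s <= D)%N -> at_t0 (B s) = M) -> at_t0 a = M -> (n <= D)%N ->
  a * t ^+ (2 * n) = \sum_(s < D.+1) fps_lift (y s) * B s * t ^+ (2 * s) -> y n = 1.
Proof.
move=> M0 HB Ha nD E.
suff H s : (s <= n)%N -> y s = (s == n)%:R by rewrite H // eqxx.
elim/ltn_ind: s => s IH sn.
have sD : (s < D.+1)%N by rewrite ltnS (leq_trans sn).
have [Z EZ] : exists Z, \sum_(i < D.+1) fps_lift (y i) * B i * t ^+ (2 * i) =
   t ^+ (2 * s) * (fps_lift (y s) * B s + t * Z).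
  exists (\sum_(i < D.+1 | (s < i)%N) fps_lift (y i) * B i * t ^+ (2 * (i - s)).-1).
  rewrite (bigID (fun i : 'I_D.+1 => (s < i)%N)) /= addrC; symmetry; rewrite mulrDr.
  congr (_ + _); last first.
    rewrite mulrA mulr_sumr; apply: eq_bigr => i lt.
    have -> : t ^+ (2 * i) = t ^+ (2 * s) * t * t ^+ (2 * (i - s)).-1.
      by rewrite -exprSr -exprD; congr (_ ^+ _); lia.
    by ring.
  rewrite (bigD1 (Ordinal sD)) /= ?ltnn // big1 ?addr0; first by ring.
  move=> i /andP[le ne]; rewrite IH; last 2 first.
  - by move: ne; rewrite -val_eqE /=; lia.
  - by move: ne le sn; rewrite -val_eqE /=; lia.
  have -> : (nat_of_ord i == n) = false by move: ne le sn; rewrite -val_eqE /=; lia.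
  by rewrite rmorph0 !mul0r.
rewrite EZ (_ : (2 * n)%N = (2 * s + 2 * (n - s))%N) in E; last by lia.
rewrite exprD mulrCA in E.
have /(mulfI (expf_neq0 _ t_neq0)) E' : t ^+ (2 * s) * (a * t ^+ (2 * (n - s))) =
   t ^+ (2 * s) * (fps_lift (y s) * B s + t * Z) by [].
have := congr1 at_t0 E'; rewrite rmorphD at_t0_t addr0 !rmorphM at_t0K HB //.
case: (eqVneq s n) => [->|ne].
  by rewrite subnn muln0 expr0 rmorph1 mulr1 Ha -{1}[M]mul1r => /(mulIf M0).
have -> : t ^+ (2 * (n - s)) = t * t ^+ (2 * (n - s)).-1.
  by rewrite -exprS; congr (_ ^+ _); move: ne; lia.
rewrite at_t0_t mulr0 => /esym/eqP; rewrite mulf_eq0 (negPf M0) orbF => /eqP ->.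
by [].
Qed.

Notation TH c m := (theta N (c : k) m).
Definition alphaS : fps k := fpsC 4%:R^-1 * TH (-1) N%:Z ^+ 4.
Definition betaS : fps k := fpsC 4%:R^-1 * TH 1 N%:Z ^+ 4.

Lemma dtheta_null_prod : 2%:R * dtheta k N = - (TH (-1) 0 * (TH 1 N%:Z * TH (-1) N%:Z)).
Proof. by rewrite theta_null_prod // dtheta_prod // mulrN mulrA. Qed.

Lemma dtheta_neq0 : dtheta k N != 0.
Proof. by rewrite dtheta_prod // oppr_eq0 mulf_neq0 ?fpsX_neq0 ?expf_neq0 ?euler_neq0 ?nome_coef0. Qed.

Lemma four_neq0 : (4%:R : k) != 0.
Proof. by rewrite (_ : 4%:R = 2%:R * 2%:R :> k) ?mulf_neq0 //; ring. Qed.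

Lemma tcoefM2 (f g : fps A) : tcoef 2 (f * g) =
  tcoef 0 f * tcoef 2 g + tcoef 1 f * tcoef 1 g + tcoef 2 f * tcoef 0 g.
Proof.
apply: fpsP => n; rewrite -[LHS]/(fcoef (fcoef (f * g) n) 2) (fcoefM f g) fcoef_sum.
rewrite (fcoefD (_ + _)) (fcoefD (tcoef 0 f * _)) !(fcoefM (tcoef _ f)).
rewrite -!big_split; apply: eq_bigr => i _; rewrite (fcoefM (fcoef f i)) !big_ord_recl big_ord0 /=.
by rewrite addr0 addrA.
Qed.
Lemma tcoefM1 (f g : fps A) : tcoef 1 (f * g) = tcoef 0 f * tcoef 1 g + tcoef 1 f * tcoef 0 g.
Proof.
apply: fpsP => n; rewrite -[LHS]/(fcoef (fcoef (f * g) n) 1) (fcoefM f g) fcoef_sum.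
rewrite (fcoefD (tcoef 0 f * _)) !(fcoefM (tcoef _ f)).
rewrite -!big_split; apply: eq_bigr => i _; rewrite (fcoefM (fcoef f i)) !big_ord_recl big_ord0 /=.
by rewrite addr0.
Qed.
Lemma tcoefM0 (f g : fps A) : tcoef 0 (f * g) = tcoef 0 f * tcoef 0 g.
Proof. exact: (rmorphM at_t0). Qed.
Lemma tcoefB i (f g : fps A) : tcoef i (f - g) = tcoef i f - tcoef i g.
Proof. exact: fpsP. Qed.
Lemma tcoef_fps_lift i x : tcoef i (fps_lift x) = if i == 0 then x else 0.
Proof. by apply: fpsP => n /=; case: ifP. Qed.

Lemma tcoef_tS i f : tcoef i.+1 (t * f) = tcoef i f.
Proof.
apply: fpsP => n; rewrite -[LHS]/(fcoef (fcoef (t * f) n) i.+1) fcoefCM fcoefXM.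
by rewrite ltnS ltn0 subSS subn0.
Qed.

Lemma onept_exp2 (n : int) : 2%:R * fcoef (onept k ^ n) 2 = n%:~R ^+ 2 - n%:~R.
Proof.
have S (m : int) : 2%:R * fcoef (onept k ^ (m + 1)) 2 = 2%:R * fcoef (onept k ^ m) 2 + 2%:R * m%:~R.
  rewrite exprzDr ?onept_unit // expr1z fcoefM !big_ord_recl big_ord0 /=.
  have [_ E1] := onept_exp k m; rewrite /bump /= E1 !addr0 !add0r mulr0 add0r mulr1 mulr1.
  by rewrite addrC mulrDr.
elim: n => [|n IH|n IH].
- by rewrite expr0z mulr0 expr0n subr0.
- have := S n; rewrite addrC -intS => ->; rewrite IH intS rmorphD /=; ring.
- have := S (- n.+1%:Z); rewrite (_ : - n.+1%:Z + 1 = - n%:Z); last by lia.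
  rewrite IH => /eqP; rewrite -subr_eq => /eqP <-.
  rewrite (_ : - n.+1%:Z = - n%:Z - 1) ?rmorphB /=; last by lia.
  ring.
Qed.

(* [theta (c (1 + t)) N] is an even function of [log (1 + t)]. *)
Lemma theta_onept_even (e : k) : e ^+ 2 = 1 -> [/\ tcoef 0 (theta N (fpsC e * onept k) N%:Z) = TH e N%:Z,
  tcoef 1 (theta N (fpsC e * onept k) N%:Z) = 0 &
  (8 * N ^ 2)%:R * tcoef 2 (theta N (fpsC e * onept k) N%:Z) = fderiv (TH e N%:Z)].
Proof.
move=> e2; have Ue : e \is a GRing.unit.
  by apply: contraT; rewrite unitfE negbK => /eqP e0; move: e2; rewrite e0 expr0n => /eqP; rewrite eq_sym oner_eq0.
have E n : (- (fpsC e * onept k)) ^ n = fpsC ((- e) ^ n) * onept k ^ n.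
  rewrite -mulNr -(rmorphN (@fpsC k)) exprzMl ?onept_unit ?rmorph_unit ?unitrN //.
  by rewrite fpsC_expz ?unitrN.
have px := @finite_fibers_theta_exp N N0 N%:Z.
have bN : bijective (fun n : int => - n) by exists (fun n : int => - n) => n; rewrite opprK.
have exN n : theta_exp N N%:Z (- n) = theta_exp N N%:Z n.
  by apply/eqP; rewrite -eqz_nat !theta_expE; apply/eqP; ring.
have eN n : (- e) ^ (- n) = (- e) ^ n.
  have e2N : (- e) ^+ 2 = 1 by rewrite sqrrN.
  have : (- e) ^ n * (- e) ^ n = 1.
    by rewrite -exprzDr ?unitrN // -mulr2n -mulr_natl -exprz_exp -exprnP e2N exp1rz.
  have ne : - e != 0 by rewrite -unitfE unitrN.
  by move=> H; rewrite -invr_expz; apply: (mulfI (expfz_neq0 n ne)); rewrite H mulfV ?expfz_neq0.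
split.
- rewrite tcoef_fpsum; apply: eq_fpsum => [n|//]; rewrite E fcoefCM.
  by have [-> _] := onept_exp k n; rewrite mulr1.
- rewrite tcoef_fpsum; apply: (fpsum_odd_eq0 nz2 bN px) => // n; rewrite !E !fcoefCM.
  have [_ ->] := onept_exp k n; have [_ ->] := onept_exp k (- n).
  by rewrite eN rmorphN /= mulrN.
have O : fpsum (fun n : int => (- e) ^ n * n%:~R) (theta_exp N N%:Z) = 0.
  by apply: (fpsum_odd_eq0 nz2 bN px) => // n; rewrite eN rmorphN /= mulrN.
rewrite tcoef_fpsum fderiv_fpsum.
rewrite -[RHS]addr0 -(mulr0 (fpsC (4 * N ^ 2)%:R)) -oppr0 -O -fpsumN -!fpsumZ.
rewrite -(rmorph_nat (@fpsC k)) -fpsumZ -fpsumD; apply: eq_fpsum => [n|//].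
rewrite E fcoefCM.
have -> : (8 * N ^ 2)%:R = (4 * N ^ 2)%:R * 2%:R :> k by rewrite -natrM; congr _%:R; lia.
have -> : (-e) ^ n *+ theta_exp N N%:Z n = (4 * N ^ 2)%:R * ((-e) ^ n * n%:~R ^+ 2).
  rewrite -mulr_natr [(theta_exp _ _ _)%:R]pmulrn theta_expE mulrCA; congr (_ * _).
  rewrite subrr addr0 !rmorphXn !rmorphM /= expr2 natrM natrX; ring.
rewrite -mulrA; transitivity ((4 * N ^ 2)%:R * ((-e)^n * (2%:R * fcoef (onept k ^ n) 2))); first by ring.
by rewrite onept_exp2; ring.
Qed.

Lemma theta_half_inv (c : A) : c \is a GRing.unit -> theta N c^-1 N%:Z = theta N c N%:Z.
Proof.
move=> Uc; have -> : N%:Z = - (- N%:Z) by rewrite opprK.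
rewrite theta_inv // opprK (_ : N%:Z = - N%:Z + (2 * N)%:Z) ?theta_shift //; last by lia.
by rewrite (_ : - (- N%:Z + (2 * N)%:Z) = - N%:Z) //; lia.
Qed.

Lemma theta_plucker (o : A) : o \is a GRing.unit ->
  theta N (-1) 0 ^+ 2 * theta N o 0 ^+ 2 =
  fpsC o * (theta N 1 N%:Z ^+ 2 * theta N (- o) N%:Z ^+ 2 - theta N (-1) N%:Z ^+ 2 * theta N o N%:Z ^+ 2).
Proof.
move=> Uo; have c1 : fpsC (1 : A) = 1 := rmorph1 _; have cN : fpsC (-1 : A) = -1 := rmorphN1 _.
have U1 := unitr1 A; have UN : (-1 : A) \is a GRing.unit by rewrite unitrN.
have e4v := theta_mul N0 N%:Z 0 U1 Uo; have e3v := theta_mul N0 N%:Z 0 UN Uo.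
have e40 := theta_mul N0 N%:Z 0 U1 U1; have e30 := theta_mul N0 N%:Z 0 UN U1.
have e_o0 := theta_mul N0 0 0 Uo U1; have e43 := theta_mul N0 N%:Z N%:Z U1 UN.
rewrite addr0 ?subr0 !mul1r in e4v; rewrite addr0 ?subr0 !mulN1r in e3v.
rewrite addr0 ?subr0 !mul1r invr1 in e40.
rewrite addr0 ?subr0 mulr1 divr1 in e30; rewrite ?subr0 mulr1 divr1 in e_o0.
rewrite subrr mul1r mul1r invrN1 c1 mul1r in e43.
rewrite (_ : N%:Z + N%:Z = 0 + (2 * N)%:Z) ?theta_shift // in e43; last by lia.
rewrite invrN1 cN mulN1r opprK in e43.
rewrite c1 mul1r in e40; rewrite c1 mul1r in e4v; rewrite cN in e30; rewrite cN in e3v.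
rewrite theta_half_inv // in e4v; rewrite -invrN theta_half_inv ?unitrN // in e3v.
move: e4v e3v e40 e30 e_o0 e43.
move: (theta N o N%:Z) (theta N (- o) N%:Z) (theta N 1 N%:Z) (theta N (-1) N%:Z) (theta N o 0) (theta N (-1) 0).
move: (theta_odd N 1 N%:Z) (theta_even N o 0) (theta_even N 1 N%:Z) (theta_odd N o 0) (theta_odd N (-1) N%:Z) (theta_even N (-1) N%:Z) (theta_even N 1 0) (theta_odd N 1 0).
move: (fpsC o) => ? ? ? ? ? ? ? ? ? x1 x2 x3 x4 x5 x6 e4v e3v e40 e30 e_o0 e43.
by rewrite !expr2 e4v e3v e40 e30 e_o0 e43; ring.
Qed.

Lemma heat_theta : TH (-1) 0 ^+ 2 * dtheta k N ^+ 2 * (4 * N ^ 2)%:R =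
  TH 1 N%:Z * TH (-1) N%:Z * (TH 1 N%:Z * fderiv (TH (-1) N%:Z) - TH (-1) N%:Z * fderiv (TH 1 N%:Z)).
Proof.
have Uo := onept_unit k; have P := theta_plucker Uo.
have c1 : (1 : A) = fpsC 1 by rewrite rmorph1.
have cN : (-1 : A) = fpsC (-1) by rewrite rmorphN1.
have E1 m : theta N (1 : A) m = fps_lift (TH 1 m) by rewrite c1 fps_lift_theta ?unitr1.
have EN m : theta N (-1 : A) m = fps_lift (TH (-1) m) by rewrite cN fps_lift_theta ?unitrN ?unitr1.
rewrite !E1 !EN in P.
have oE : fpsC 1 * onept k = onept k by rewrite -c1 mul1r.
have oN : fpsC (-1) * onept k = - onept k by rewrite -cN mulN1r.
have s1 : (1 : k) ^+ 2 = 1 by rewrite expr1n.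
have sN : (-1 : k) ^+ 2 = 1 by rewrite sqrrN expr1n.
have [a0 a1 a2] := theta_onept_even s1; have [b0 b1 b2] := theta_onept_even sN.
rewrite {}oE in a0 a1 a2; rewrite {}oN in b0 b1 b2.
move: a0 a1 a2 b0 b1 b2 P.
have [E [Eth E0]] := @theta_simple_zero k N N0 (fpsX 1) erefl; rewrite -dtheta_prod // in E0.
rewrite -/(onept k) in Eth; rewrite Eth.
move: (theta N (onept k) N%:Z) (theta N (- onept k) N%:Z) => f g.
rewrite [fpsC (onept k)](_ : _ = 1 + t); last by rewrite /onept rmorphD rmorph1.
move: (TH (-1) 0) (TH 1 N%:Z) (TH (-1) N%:Z) (dtheta k N) E0 => h2 h4 h3 T E0 a0 a1 a2 b0 b1 b2 P.
have := congr1 (tcoef 2) P.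
have -> : fps_lift h2 ^+ 2 * (t * E) ^+ 2 = t * (t * (E * E * (fps_lift h2 * fps_lift h2))) by ring.
have E0' : tcoef 0 E = T := E0.
rewrite mulrDl mul1r tcoefD !tcoef_tS 3!tcoefM0 E0' tcoef_fps_lift /= !expr2 !tcoefB.
rewrite !tcoefM2 !tcoefM1 !tcoefM0 !tcoef_fps_lift /= a0 a1 b0 b1 !(mul0r, mulr0, add0r, addr0) ?subr0 ?addr0.
move=> Q; rewrite -a2 -b2.
transitivity (T * T * (h2 * h2) * (4 * N ^ 2)%:R); first by ring.
have -> : (8 * N ^ 2)%:R = (4 * N ^ 2)%:R * 2%:R :> fps k by rewrite -natrM; congr _%:R; lia.
by rewrite Q; move: ((4 * N ^ 2)%:R : fps k) => z; ring.
Qed.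

Lemma fderivC (c : k) : fderiv (fpsC c) = 0.
Proof. by apply: fpsP => -[|n] /=; rewrite ?mulr0n // mul0rn. Qed.
Lemma fderivZ (c : k) x : fderiv (fpsC c * x) = fpsC c * fderiv x.
Proof. by rewrite fderivM fderivC mul0r add0r. Qed.
Lemma fderivX n (x : fps k) : fderiv (x ^+ n.+1) = n.+1%:R * x ^+ n * fderiv x.
Proof.
elim: n => [|n IH]; first by rewrite expr0 mulr1 mul1r.
by rewrite exprS fderivM IH [x ^+ n.+1]exprS [in RHS]mulrS; ring.
Qed.

Lemma theta_half_neq0 (c : k) : c != 0 -> TH c N%:Z != 0.
Proof. by move=> c0; apply: (theta_neq0 N0); rewrite ?unitfE ?(ndvdN N0). Qed.

Lemma jacobi_theta : TH (-1) N%:Z ^+ 4 - TH 1 N%:Z ^+ 4 = TH (-1) 0 ^+ 4.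
Proof.
have [F [iota Fr]] := frac_exists (fps k).
have := jacobi_quartic (theta_datum_fps N0 nz2 Fr (oner_neq0 F)) N0 nz2; rewrite /theta2 /theta3 /theta4 /=.
by move=> H; apply: (proj1 Fr); rewrite rmorphB !rmorphXn.
Qed.

(* The heat equation turns [S d/dS] into the second derivative in the elliptic variable. *)
Lemma alphaS_betaS_deriv : betaS * fderiv alphaS - alphaS * fderiv betaS = (16 * N ^ 2)%:R * (alphaS * betaS * (alphaS - betaS)).
Proof.
have h3 : TH (-1) N%:Z != 0 by apply: theta_half_neq0; rewrite oppr_eq0 oner_eq0.
have h4 : TH 1 N%:Z != 0 by apply: theta_half_neq0; rewrite oner_eq0.
have H := heat_theta; have J := jacobi_theta; have T := dtheta_null_prod.
rewrite /alphaS /betaS !fderivZ !fderivX.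
have c4 : fpsC 4%:R^-1 * 4%:R = 1 :> fps k.
  by rewrite -(rmorph_nat (@fpsC k)) -rmorphM mulVf ?four_neq0 // rmorph1.
move: c4 J T H h3 h4; move: (fderiv (TH 1 N%:Z)) (fderiv (TH (-1) N%:Z)) => d4 d3.
move: (fpsC _) (TH (-1) 0) (TH (-1) N%:Z) (TH 1 N%:Z) (dtheta k N) => c a2 a3 a4 T c4 J E H h3 h4.
have W : a2 ^+ 4 * a3 * a4 * (N ^ 2)%:R = a4 * d3 - a3 * d4.
  apply: (mulfI (mulf_neq0 h4 h3)); rewrite -H.
  transitivity (a2 ^+ 2 * (- (a2 * (a4 * a3))) ^+ 2 * (N ^ 2)%:R); first by ring.
  by rewrite -E natrM; ring.
transitivity (c * c * 4%:R * (a3 ^+ 3 * a4 ^+ 3) * (a4 * d3 - a3 * d4)); first by ring.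
rewrite -W -mulrBr J; move: ((N ^ 2)%:R : fps k) (natrM (fps k) 16 (N ^ 2)%N) => z ->.
transitivity (c * c * (c * 4%:R) * 4%:R * (a3 ^+ 4 * a4 ^+ 4 * a2 ^+ 4 * z)).
  by rewrite c4; ring.
by ring.
Qed.

Lemma alpha_beta_rmorph (R : idomainType) (F : fieldType) (D : theta_datum R N F) (psi : {rmorphism fps k -> F}) :
  (2%:R : R) != 0 -> theta2 D = psi (TH (-1) 0) -> theta3 D = psi (TH (-1) N%:Z) -> theta4 D = psi (TH 1 N%:Z) ->
  dvtheta D = psi (dtheta k N) -> alpha D = psi alphaS /\ beta D = psi betaS.
Proof.
move=> two_R e2 e3 e4 eD; have [||-> ->] := alpha_beta_theta (D := D) N0 => //.
  by rewrite e2 e3 e4 eD -!rmorphM -rmorphN -dtheta_null_prod rmorphM rmorph_nat.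
have Q : psi (fpsC 4%:R^-1) = 4%:R^-1 by rewrite -[LHS]/((psi \o @fpsC k) _) fmorphV rmorph_nat.
rewrite e3 e4 /alphaS /betaS; move: (TH _ _) (TH _ _) => x y.
by split; rewrite (rmorphM psi (fpsC _)) (rmorphXn psi) Q mulrC.
Qed.

Section Hasse.
Variable ell : nat.
Hypothesis pl : prime ell.
Hypothesis l2 : (2 < ell)%N.
Hypothesis chl : ell \in [pchar k].

Lemma odd_ell : odd ell. Proof. by case: (even_prime pl) l2 => [->|]. Qed.

Lemma onept_ell : onept k ^+ ell = 1 + fpsX ell.
Proof.
have chA : ell \in [pchar A] by apply: (rmorph_pchar (@fpsC k)).
by rewrite /onept exprDn_pchar ?pnatE // expr1n -fpsXM mul1n.
Qed.

Lemma regular_onept : regular_pt N (onept k) 0.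
Proof.
have o2 : onept k ^+ 2 != 1.
  rewrite -subr_eq0 (_ : _ - 1 = fpsX 1 * (2%:R + fpsX 1)); last by rewrite /onept; ring.
  rewrite mulf_neq0 ?fpsX_neq0 //; apply/eqP => /(congr1 (fun f => fcoef f 0)) /eqP.
  by rewrite fcoefD -(rmorph_nat (@fpsC k)) /= addr0 (negPf nz2).
split; rewrite ?onept_unit // ?add0r ?(ndvdN N0) //.
by rewrite /onept -subr_eq0 addrAC subrr add0r fpsX_neq0.
Qed.

Section AtOrigin.
Variables (F : fieldType) (iota : {rmorphism fps A -> F}).
Hypothesis Fr : is_frac iota.
Let psi : {rmorphism fps k -> F} := iota \o fps_lift.

Lemma psi_neq0 x : x != 0 -> psi x != 0.
Proof.
by apply: contraNneq; rewrite -(rmorph0 psi) => /(proj1 Fr)/(congr1 at_t0); rewrite !at_t0K => ->.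
Qed.
Let D := theta_datum_fps N0 two_neq0_fps Fr (psi_neq0 dtheta_neq0).
Let vthetaE c m : vtheta D c m = iota (theta N c m). Proof. by []. Qed.

Let cN : (-1 : A) = fpsC (-1). Proof. by rewrite rmorphN1. Qed.
Let theta2E : theta2 D = psi (TH (-1) 0).
Proof. by rewrite /theta2 vthetaE cN -fps_lift_theta ?unitrN ?unitr1. Qed.

Lemma alpha_beta_lift : alpha D = psi alphaS /\ beta D = psi betaS.
Proof.
have c1 : (1 : A) = fpsC 1 by rewrite rmorph1.
apply: alpha_beta_rmorph => //; first exact: two_neq0_fps.
- by rewrite /theta3 vthetaE cN -fps_lift_theta ?unitrN ?unitr1.
- by rewrite /theta4 vthetaE c1 -fps_lift_theta ?unitr1.
Qed.

Local Notation d := (divpol_deg ell).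
Lemma divpol_origin : exists2 y : nat -> fps k, forall s, homog intr alphaS betaS s (y s) &
  edsW D (onept k) 0 ell = \sum_(i < d.+1) psi (y (d - i)%N) * Xcoord D (onept k) 0 ^+ i.
Proof.
have [G [[sG _ hG] wG]] := divpol_exists D N0 two_neq0_fps ell.
have /choice[y Hy] : forall s, exists z : fps k,
    homog intr alphaS betaS s z /\ ((s <= d)%N -> G`_(d - s) = psi z).
  move=> s; have [sD|sD] := leqP s d; last by exists 0; split=> //; exact: homog0.
  have [Ea Eb] := alpha_beta_lift.
  have := hG (d - s)%N (leq_subr _ _); rewrite subKn // Ea Eb => h.
  have [z [hz Ez]] := @homog_lift _ _ _ (intr : {rmorphism int -> fps k}) _ psi _ _ _ _
    (fun c => esym (rmorph_int psi c)) h.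
  by exists z.
exists y => [s|]; first by have [] := Hy s.
rewrite (wG _ _ regular_onept) odd_ell mulr1 (horner_coef_wide _ sG).
by apply: eq_bigr => -[i lt] _; have [_ <-] := Hy (d - i)%N; rewrite ?leq_subr ?subKn.
Qed.

Lemma origin_clear_denominators (v e e2 h t' m c : F) (Y : nat -> F) n : v != 0 -> e != 0 -> h != 0 -> t' != 0 ->
  c * (v * v ^+ (2 * n) * e2) * (t' / (v * e)) ^+ (2 * d).+1 / t' =
    \sum_(i < d.+1) Y (d - i)%N * ((t' * m / (v * e * h)) ^+ 2) ^+ i ->
  c * e2 * (t' * h) ^+ (2 * d) * v ^+ (2 * n) =
    \sum_(s < d.+1) Y s * (e * (t' * m) ^+ (2 * (d - s)) * (e * h) ^+ (2 * s)) * v ^+ (2 * s).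
Proof.
move=> v0 e0 h0 t0 /(congr1 (fun z => z * (e * (v * e * h) ^+ (2 * d)))).
rewrite /= mulr_suml (reindex_inj rev_ord_inj) /=; set rhs := \sum_(i < _) _ => E.
transitivity rhs.
  rewrite -E exprS expr_div_n !exprMn.
  have [vP eP] : v ^+ (2 * d) != 0 /\ e ^+ (2 * d) != 0 by rewrite !expf_neq0.
  move: (v ^+ (2 * d)) (e ^+ (2 * d)) vP eP => p p' p0 p0'.
  move: (v ^+ _) (t' ^+ _) (h ^+ _) => *; field.
  by rewrite v0 e0 t0 p0 p0'.
apply: eq_bigr => -[s sd] _ /=; rewrite subSS subKn // -exprM.
rewrite (_ : 2 * d = 2 * (d - s) + 2 * s)%N; last by clear -sd; lia.
rewrite [(v * e * h) ^+ (_ + _)]exprD expr_div_n [(v * e * h) ^+ (2 * s)]exprMn [(v * e) ^+ (2 * s)]exprMn.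
rewrite [(e * h) ^+ _]exprMn.
have nz : (v * e * h) ^+ (2 * (d - s)) != 0 by rewrite expf_neq0 // !mulf_neq0.
move: ((v * e * h) ^+ (2 * (d - s))) nz => w w0; move: ((t' * m) ^+ _) (v ^+ _) (e ^+ _) (h ^+ _) => *.
by field.
Qed.

(* The leading coefficients in [t] of both sides of [divpol_origin] determine the coefficient of
   degree [ell.-1./2]. *)
Lemma hasse_coef (y : nat -> fps k) :
  edsW D (onept k) 0 ell = \sum_(i < d.+1) psi (y (d - i)%N) * Xcoord D (onept k) 0 ^+ i -> y ell.-1./2 = 1.
Proof.
have Ed : (ell ^ 2 = (2 * d).+1)%N.
  rewrite (_ : ell = 2 * ell./2 + 1)%N ?divpol_deg_odd; last by have := odd_ell; lia.
  by rewrite -mulnn; nia.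
have fl0 : fcoef (fpsX ell : A) 0 = 0 by rewrite fpsX_coef0 // prime_gt0.
have [E1 [Eth1 E1z]] := @theta_simple_zero k N N0 (fpsX 1) erefl; rewrite -dtheta_prod // in E1z.
have [E2 [Eth2 E2z]] := @theta_simple_zero k N N0 (fpsX ell) fl0; rewrite -dtheta_prod // in E2z.
rewrite -/(onept k) in Eth1; pose thm := theta N (- onept k) 0; set n := ell.-1./2.
have h20 : TH (-1) 0 != 0 by apply: (theta_neq0 N0); rewrite ?unitrN ?unitr1 // => _; apply: N1_neq1.
have athm : at_t0 thm = TH (-1) 0.
  rewrite /at_t0 /thm /= fmap_fpsum; apply: eq_fpsum => [i|//] /=.
  by rewrite !opprK exp1rz; have [] := onept_exp k i.
have t0 : iota t != 0 by rewrite (iota_eq0 Fr) t_neq0.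
have e10 : iota E1 != 0.
  by rewrite (iota_eq0 Fr); apply: contraNneq dtheta_neq0 => H; rewrite -E1z H /const_coef rmorph0.
have [T0 h0] := (psi_neq0 dtheta_neq0, psi_neq0 h20).
have EX : Xcoord D (onept k) 0 = (psi (dtheta k N) * iota thm / (iota t * iota E1 * psi (TH (-1) 0))) ^+ 2.
  rewrite /Xcoord theta2E !vthetaE Eth1 (rmorphM iota) -/thm -[dvtheta D]/(psi (dtheta k N)); field.
  by rewrite t0 e10 h0.
have tl : fpsC (fpsX ell) = t * t ^+ (2 * n).
  by rewrite -exprS -rmorphXn -fpsXM mul1n; congr (fpsC (fpsX _)); rewrite /n; have := odd_ell; lia.
rewrite EX /edsW mul0rn !vthetaE onept_ell Eth1 Eth2 Ed tl -[dvtheta D]/(psi (dtheta k N)).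
rewrite -[cst D _]/(iota (fpsC (onept k))) !(rmorphM iota) (rmorphXn iota _ t).
move/(origin_clear_denominators (Y := psi \o y) t0 e10 h0 T0) => W.
pose M := dtheta k N * (dtheta k N * TH (-1) 0) ^+ (2 * d).
pose B s := E1 * (fps_lift (dtheta k N) * thm) ^+ (2 * (d - s)) * (E1 * fps_lift (TH (-1) 0)) ^+ (2 * s).
pose a := fpsC (onept k) ^+ 'C(ell, 2) * E2 * (fps_lift (dtheta k N) * fps_lift (TH (-1) 0)) ^+ (2 * d).
apply: (@t_expansion_lead d n B a y M) => //.
- by rewrite /M mulf_neq0 ?expf_neq0 ?mulf_neq0 ?dtheta_neq0.
- move=> s sD; rewrite /B !(rmorphM at_t0) !(rmorphXn at_t0) !(rmorphM at_t0) !at_t0K athm.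
  by rewrite [at_t0 E1]E1z /M -mulrA -exprD -mulnDr subnK.
- rewrite /a !(rmorphM at_t0) !(rmorphXn at_t0) !(rmorphM at_t0) !at_t0K [at_t0 E2]E2z.
  have -> : at_t0 (fpsC (onept k)) = 1 by apply: fpsP => -[|i] /=; rewrite /const_coef /= ?addr0.
  by rewrite expr1n mul1r.
- by rewrite /n; have := odd_ell; rewrite -mulnn in Ed; nia.
apply: (proj1 Fr); rewrite (rmorph_sum iota) /a.
rewrite (rmorphM iota) !(rmorphXn iota) (rmorphM iota (_ * _)) (rmorphM iota (_ ^+ _)) !(rmorphXn iota).
rewrite (rmorphM iota (fps_lift _)) W; apply: eq_bigr => -[s sD] _ /=.
by rewrite /B !(rmorphM iota) !(rmorphXn iota) !(rmorphM iota).
Qed.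
End AtOrigin.

Lemma hasse : homog (intr : {rmorphism int -> fps k}) alphaS betaS ell.-1./2 1.
Proof.
have [F [iota Fr]] := frac_exists (fps A); have [y hy W] := divpol_origin Fr.
by rewrite -(hasse_coef W).
Qed.
End Hasse.

End TwoVar.

(** * Quadratic characters and Gauss sums *)

Definition pred_half n := n.-1./2.
Lemma pred_halfE n : odd n -> n = (2 * pred_half n).+1. Proof. by rewrite /pred_half; lia. Qed.

Section PrimeField.
Variable p : nat.
Hypothesis pp : prime p.

Lemma Fp_nat_eq0 (n : nat) : ((n%:R : 'F_p) == 0) = (p %| n)%N.
Proof. by rewrite -(dvdn_pcharf (pchar_Fp pp)). Qed.
Lemma Fp_int_eq0 (z : int) : ((z%:~R : 'F_p) == 0) = (p%:Z %| z)%Z.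
Proof.
case: z => n; first by rewrite -pmulrn Fp_nat_eq0.
by rewrite NegzE mulrNz oppr_eq0 -pmulrn Fp_nat_eq0 // rpredN.
Qed.
Lemma eq_Fp_nat (n m : nat) : n = m %[mod p] -> n%:R = m%:R :> 'F_p.
Proof.
by move=> E; rewrite (divn_eq n p) (divn_eq m p) E !natrD !natrM (pchar_Fp_0 pp) !mulr0 ?add0r.
Qed.
Lemma ltn_Fp (x : 'F_p) : (x < p)%N. Proof. by apply: leq_trans (ltn_ord x) _; rewrite Fp_cast. Qed.
End PrimeField.

Section OddPrime.
Variable p : nat.
Hypotheses (pp : prime p) (op : odd p).

Local Notation halfp := (pred_half p).
Let halfpE : p = (2 * halfp).+1 := pred_halfE op.
Let halfp_gt0 : (0 < halfp)%N. Proof. by have := halfpE; have := prime_gt1 pp; lia. Qed.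
Lemma Fp_exp_pred_half (x : 'F_p) : x != 0 -> x ^+ halfp = 1 \/ x ^+ halfp = -1.
Proof.
move=> x0; have : x ^+ (halfp + halfp) = 1.
  have -> : (halfp + halfp)%N = p.-1 by have := halfpE; lia.
  apply: (mulfI x0); rewrite mulr1 -exprS prednK ?prime_gt0 //; have := expf_card x; rewrite card_Fp //.
rewrite exprD -expr2 => /eqP; rewrite sqrf_eq1.
by case/orP => /eqP ->; [left|right].
Qed.
Lemma Fp_oppr1_neq1 : (-1 : 'F_p) != 1.
Proof.
rewrite eq_sym -subr_eq0 opprK -[1 + 1]/(2%:R) Fp_nat_eq0 //; apply/negP => /dvdn_leq.
by have := op; have := prime_gt1 pp; case: p => [|[|[|q]]] //= _ _ /(_ isT).
Qed.

Lemma exists_nonresidue : exists x : 'F_p, x != 0 /\ x ^+ halfp = -1.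
Proof.
apply: contrapT => nx; pose s : seq 'F_p := filter (predC1 0) (enum 'F_p).
have roots : all halfp.-unity_root s.
  apply/allP => x; rewrite mem_filter unity_rootE => /andP[/= x0 _].
  by case: (Fp_exp_pred_half x0) => [->//|E]; case: nx; exists x.
have := max_unity_roots halfp_gt0 roots (filter_uniq _ (enum_uniq _)).
rewrite size_enum_predC1 card_Fp //.
by have := halfpE; have := halfp_gt0; lia.
Qed.

(* The squares of [1, ..., halfp] are all the roots of [x ^+ halfp = 1]. *)
Lemma euler_criterion (x : 'F_p) : x != 0 -> (exists y, y ^+ 2 = x) <-> x ^+ halfp = 1.
Proof.
have sqr_halfp (y : 'F_p) : y != 0 -> (y ^+ 2) ^+ halfp = 1.
  by move=> y0; rewrite -exprM mulnC exprM; case: (Fp_exp_pred_half y0) => ->; rewrite ?expr1n ?sqrrN ?expr1n.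
move=> x0; split=> [[y E]|E].
  by rewrite -E sqr_halfp //; apply: contra x0 => /eqP y0; rewrite -E y0 expr0n.
apply: contrapT => nx; pose ys := x :: [seq (i%:R : 'F_p) ^+ 2 | i <- iota 1 halfp].
have := @max_unity_roots _ halfp ys halfp_gt0; rewrite /= size_map size_iota ltnn => H.
have nz i : i \in iota 1 halfp -> (i%:R : 'F_p) != 0.
  rewrite mem_iota Fp_nat_eq0 // => /andP[i0 il]; apply/negP => /dvdn_leq; have := halfpE; lia.
suff : false by []; apply: H.
  rewrite unity_rootE E eqxx /=; apply/allP => _ /mapP[i /nz i0 ->].
  by rewrite unity_rootE sqr_halfp.
rewrite map_inj_in_uniq ?iota_uniq ?andbT; first by apply/negP => /mapP[i _ Ei]; apply: nx; exists i%:R.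
move=> i j; rewrite !mem_iota => iI jI /eqP; rewrite eqf_sqr => /orP[]/eqP Eij.
  have : (i%:R - j%:R : 'F_p) == 0 by rewrite Eij subrr.
  wlog ij : i j iI jI Eij / (j <= i)%N.
    by case: (leqP j i) => [|/ltnW] h w; [exact: w|symmetry; apply: w => //; rewrite -Eij subrr].
  by rewrite -natrB // Fp_nat_eq0 // => /dvdnP[[|z] Ez]; have := halfpE; [lia|nia].
have : (i%:R + j%:R : 'F_p) == 0 by rewrite Eij addNr.
by rewrite -natrD Fp_nat_eq0 // => /dvdnP[[|z] Ez]; have := halfpE; [lia|nia].
Qed.

Section Character.
Variable R : comNzRingType.
Definition quadchar (x : 'F_p) : R := if x == 0 then 0 else if x ^+ halfp == 1 then 1 else -1.
Lemma quadchar0 : quadchar 0 = 0. Proof. by rewrite /quadchar eqxx. Qed.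
Lemma quadchar1 : quadchar 1 = 1. Proof. by rewrite /quadchar oner_eq0 expr1n eqxx. Qed.
Lemma quadcharM x y : quadchar (x * y) = quadchar x * quadchar y.
Proof.
rewrite /quadchar mulf_eq0; have [//|x0] := eqVneq x 0; first by rewrite mul0r.
have [_|y0] := eqVneq y 0; first by rewrite mulr0.
rewrite exprMn; case: (Fp_exp_pred_half x0) => ->; case: (Fp_exp_pred_half y0) => ->.
all: by rewrite ?mulrNN ?mul1r ?mulr1 ?eqxx ?(negPf Fp_oppr1_neq1) ?mulrNN ?mul1r ?mulr1.
Qed.
Lemma quadchar_sqr x : x != 0 -> quadchar x * quadchar x = 1.
Proof. by rewrite /quadchar => /negPf->; case: ifP => _; rewrite ?mulr1 // mulrNN mulr1. Qed.

Lemma legendre_quadchar (z : int) : quadchar z%:~R = (legendre z p)%:~R.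
Proof.
rewrite /quadchar /legendre Fp_int_eq0 //; case: ifP => [_|nd]; first by rewrite mulr0z.
have x0 : (z%:~R : 'F_p) != 0 by rewrite Fp_int_eq0 ?nd.
have -> : ((z%:~R : 'F_p) ^+ halfp == 1) = [exists x : 'I_p, (p%:Z %| x%:Z ^+ 2 - z)%Z].
  apply/eqP/existsP => [/(euler_criterion x0)[y Ey]|[x Ex]].
    by exists (Ordinal (ltn_Fp pp y)); rewrite /= -Fp_int_eq0 // rmorphB rmorphXn /= -pmulrn natr_Zp Ey subrr.
  apply/(euler_criterion x0); exists (x : nat)%:R.
  by apply/eqP; rewrite -subr_eq0 pmulrn -rmorphXn -rmorphB Fp_int_eq0.
by case: ifP => _; rewrite ?mulr1z ?mulrNz ?mulr1z.
Qed.
End Character.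

Lemma rmorph_quadchar (R S : comNzRingType) (f : {rmorphism R -> S}) x : f (quadchar R x) = quadchar S x.
Proof. by rewrite /quadchar; do 2?case: ifP => _; rewrite ?rmorph0 ?rmorph1 ?rmorphN1. Qed.

Lemma legendre_eq_mod (a b : int) : (p%:Z %| a - b)%Z -> legendre a p = legendre b p.
Proof.
by rewrite -[LHS]intz -[RHS]intz -!legendre_quadchar -Fp_int_eq0 // rmorphB subr_eq0 => /eqP->.
Qed.
Lemma legendreM (a b : int) : legendre (a * b) p = legendre a p * legendre b p.
Proof. by rewrite -[LHS]intz -legendre_quadchar rmorphM quadcharM !legendre_quadchar !intz. Qed.
Lemma legendre1 : legendre 1 p = 1.
Proof. by rewrite -[LHS]intz -legendre_quadchar rmorph1 quadchar1. Qed.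
Lemma legendre_sqrM (d : nat) (a : int) : coprime d p -> legendre ((d ^ 2)%:Z * a) p = legendre a p.
Proof.
move=> cd; rewrite -mulnn PoszM !legendreM -[legendre d p]intz -legendre_quadchar quadchar_sqr ?mul1r //.
by rewrite -pmulrn Fp_nat_eq0 // -prime_coprime // coprime_sym.
Qed.
Lemma legendre_eq0 (a : int) : (legendre a p == 0) = (p%:Z %| a)%Z.
Proof. by rewrite /legendre; case: ifP => // _; case: ifP. Qed.
Lemma eq_legendre_sqr (a b : int) : legendre (- a) p = legendre (- b) p -> ~~ (p%:Z %| b)%Z ->
  exists u : nat, coprime u p /\ (p%:Z %| (u ^ 2)%:Z * a - b)%Z.
Proof.
move=> E nb; have na : ~~ (p%:Z %| a)%Z.
  by have := legendre_eq0 (- a); rewrite E legendre_eq0 !rpredN (negPf nb) => <-.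
have a0 : (a%:~R : 'F_p) != 0 by rewrite Fp_int_eq0.
have b0 : (b%:~R : 'F_p) != 0 by rewrite Fp_int_eq0.
have ab0 : (a%:~R * b%:~R : 'F_p) != 0 by rewrite mulf_neq0.
have : quadchar int (a%:~R * b%:~R) = 1.
  rewrite -mulrNN quadcharM -!rmorphN !legendre_quadchar E -legendre_quadchar quadchar_sqr //.
  by rewrite rmorphN oppr_eq0.
rewrite /quadchar (negPf ab0); case: ifP => // /eqP/(euler_criterion ab0)[y Ey] _.
have y0 : y != 0 by apply: contraNneq ab0 => y0; rewrite -Ey y0 expr0n.
pose u := y / a%:~R; have u0 : u != 0 by rewrite mulf_neq0 // invr_eq0.
exists (u : nat); split; first by rewrite coprime_sym prime_coprime // -Fp_nat_eq0 // natr_Zp.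
have uE : ((u : nat)%:Z)%:~R = u :> 'F_p by rewrite -pmulrn natr_Zp.
rewrite -Fp_int_eq0 // rmorphB rmorphM -mulnn PoszM rmorphM /= uE subr_eq0; apply/eqP.
by rewrite -expr2 /u expr_div_n Ey expr2 invfM -mulrA; field.
Qed.

Section GaussSum.
Variables (k : fieldType) (eta : k).
Hypothesis etaP : p.-primitive_root eta.
Hypothesis k2 : (2%:R : k) != 0.
Local Notation chi := (quadchar k).

Definition addchar (x : 'F_p) : k := eta ^+ x.
Lemma addchar_nat n : addchar n%:R = eta ^+ n.
Proof. by rewrite /addchar val_Fp_nat // (prim_expr_mod etaP). Qed.
Lemma addcharD x y : addchar (x + y) = addchar x * addchar y.
Proof. by rewrite -[x]natr_Zp -[y]natr_Zp -natrD !addchar_nat exprD. Qed.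
Lemma addchar0 : addchar 0 = 1. Proof. by rewrite (addchar_nat 0). Qed.
Lemma sum_addchar (z : 'F_p) : \sum_x addchar (x * z) = if z == 0 then p%:R else 0.
Proof.
case: eqVneq => [->|z0].
  by under eq_bigr do rewrite mulr0 addchar0; rewrite sumr_const card_Fp.
have psz : addchar z != 1.
  by rewrite /addchar -[1](expr0 eta) (eq_prim_root_expr etaP) mod0n modn_small ?ltn_Fp.
have S : \sum_x addchar (x * z) = addchar z * \sum_x addchar (x * z).
  rewrite [LHS](reindex (fun x => x + 1)) /=; last by exists (fun x => x - 1) => x _; rewrite ?addrK ?subrK.
  by rewrite mulr_sumr; apply: eq_bigr => x _; rewrite mulrDl mul1r addcharD mulrC.
apply/eqP; have : (addchar z - 1) * \sum_x addchar (x * z) == 0 by rewrite mulrBl mul1r -S subrr.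
by rewrite mulf_eq0 subr_eq0 (negPf psz).
Qed.

Definition gauss_sum (M : 'F_p) : k := \sum_x addchar (- x * M) * chi (- x).
Lemma gauss_sumE M : M != 0 -> gauss_sum M = chi M * gauss_sum 1.
Proof.
move=> M0; rewrite /gauss_sum [in RHS](reindex (fun x => x * M)) /=; last first.
  by exists (fun x => x / M) => x _; rewrite ?mulfK ?mulfVK.
rewrite mulr_sumr; apply: eq_bigr => x _; rewrite mulr1 -!mulNr quadcharM mulrCA; congr (_ * _).
by rewrite mulrCA quadchar_sqr // mulr1.
Qed.
Lemma sum_quadchar : \sum_x chi x = 0.
Proof.
have [a [a0 Ea]] := exists_nonresidue.
have ca : chi a = -1 by rewrite /quadchar (negPf a0) Ea (negPf Fp_oppr1_neq1).
have S : \sum_x chi x = - \sum_x chi x.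
  rewrite {1}(reindex (fun x => a * x)) /=; last by exists (fun x => a^-1 * x) => x _; rewrite ?mulKf ?mulVKf.
  by rewrite -sumrN; apply: eq_bigr => x _; rewrite quadcharM ca mulN1r.
apply/eqP; have : 2%:R * \sum_x chi x == 0 by rewrite mulr_natl mulr2n {1}S addNr.
by rewrite mulf_eq0 (negPf k2).
Qed.
Lemma gauss_sum1_sqr : gauss_sum 1 * gauss_sum 1 = chi (-1) * p%:R.
Proof.
rewrite /gauss_sum.
have -> : \sum_x addchar (- x * 1) * chi (- x) = \sum_x addchar x * chi x.
  rewrite (reindex (fun x => - x)) /=; last by exists (fun x => - x) => x _; rewrite opprK.
  by apply: eq_bigr => x _; rewrite opprK mulr1.
rewrite mulr_suml (eq_bigr (fun x => \sum_z chi z * (addchar (x * (1 + z)) * (chi x * chi x)))); last first.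
  move=> x _; have [->|x0] := eqVneq x 0.
    by rewrite quadchar0 mulr0 mul0r big1 // => z _; rewrite mul0r !mulr0.
  rewrite mulr_sumr (reindex (fun z => x * z)) /=; last by exists (fun z => x^-1 * z) => z _; rewrite ?mulKf ?mulVKf.
  by apply: eq_bigr => z _; rewrite quadcharM mulrDr mulr1 addcharD; ring.
rewrite exchange_big /=.
have H z : \sum_x chi z * (addchar (x * (1 + z)) * (chi x * chi x)) =
   chi z * (if 1 + z == 0 then p%:R else 0) - chi z.
  rewrite -mulr_sumr -sum_addchar (bigD1 0) //= quadchar0 mulr0 mulr0 add0r [in RHS](bigD1 0) //= mul0r addchar0.
  rewrite mulrDr mulr1 addrAC subrr add0r; congr (_ * _).
  by apply: eq_bigr => x x0; rewrite quadchar_sqr // mulr1.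
rewrite (eq_bigr _ (fun z _ => H z)) sumrB sum_quadchar subr0 (bigD1 (-1)) //= subrr eqxx big1 ?addr0 // => z zn.
by rewrite addrC addr_eq0 (negPf zn) mulr0.
Qed.
Lemma quadchar_neq0 x : x != 0 -> chi x != 0.
Proof. by move/quadchar_sqr => E; apply: contra_eq_neq (E k) => ->; rewrite mul0r eq_sym oner_eq0. Qed.
Lemma gauss_sum_neq0 M : M != 0 -> gauss_sum M != 0.
Proof.
move=> M0; rewrite gauss_sumE // mulf_neq0 ?quadchar_neq0 //; have := gauss_sum1_sqr.
apply: contra_eq_neq => ->; rewrite mul0r eq_sym mulf_neq0 ?(prim_root_natf_neq0 etaP) //.
by rewrite quadchar_neq0 // oppr_eq0 oner_eq0.
Qed.
End GaussSum.
End OddPrime.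

Section Residue.
Variable N : nat.
Hypothesis N1 : (1 < N)%N.

Lemma Zp_nat_eq0 (n : nat) : ((n%:R : 'Z_N) == 0) = (N %| n)%N.
Proof. by rewrite -val_eqE /= val_Zp_nat. Qed.
Lemma Zp_int_eq0 (i : int) : ((i%:~R : 'Z_N) == 0) = (N%:Z %| i)%Z.
Proof.
case: i => n; first by rewrite -pmulrn Zp_nat_eq0.
by rewrite NegzE rmorphN oppr_eq0 /= -pmulrn Zp_nat_eq0 // dvdzE abszN.
Qed.
Lemma Zp_int_surj (x : 'Z_N) : ((x : nat)%:Z)%:~R = x.
Proof. by rewrite -pmulrn natr_Zp. Qed.
Lemma Zp_dvd_sub (i : int) : (N%:Z %| i - ((i%:~R : 'Z_N) : nat)%:Z)%Z.
Proof. by rewrite -Zp_int_eq0 rmorphB /= Zp_int_surj subrr. Qed.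
Lemma ltn_Zp (x : 'Z_N) : (x < N)%N. Proof. by apply: leq_trans (ltn_ord x) _; rewrite Zp_cast. Qed.
Lemma val_ZpN (x : 'Z_N) : x != 0 -> (- x : 'Z_N) = (N - x)%N :> nat.
Proof.
move=> x0; have : x != 0 :> nat by []; have := ltn_Zp x; rewrite /=; move: (nat_of_ord x) => y yN y0.
by rewrite Zp_cast // modn_small //; lia.
Qed.
End Residue.

Section HalfSystem.
Variables (N r : nat).
Hypothesis N1 : (1 < N)%N.
Hypothesis Nr : N = (2 * r).+1.

Definition in_half (x : 'Z_N) : bool := (0 < x <= r)%N.
Lemma in_halfN x : x != 0 -> in_half (- x) = ~~ in_half x.
Proof.
move=> x0; rewrite /in_half val_ZpN //; have : x != 0 :> nat by [].
by have := ltn_Zp N1 x; lia.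
Qed.
Lemma in_half_nat n : (n < N)%N -> in_half n%:R = (0 < n <= r)%N.
Proof. by move=> nN; rewrite /in_half val_Zp_nat // modn_small. Qed.

Lemma prod_half (R : comNzRingType) (g : 'Z_N -> R) :
  \prod_(1 <= i < r.+1) g i%:R = \prod_(x | in_half x) g x.
Proof.
rewrite (eq_bigr (fun x : 'Z_N => g (x : nat)%:R)); last by move=> x _; rewrite natr_Zp.
rewrite -(big_mkord (fun i => (0 < i <= r)%N) (fun i => g i%:R)) Zp_cast //.
rewrite (big_nat_widen _ _ N); last by rewrite Nr; lia.
by rewrite (big_nat_widenl _ 0) //; apply: eq_bigl => i; rewrite /= ltnS andbC.
Qed.

(* Multiplication by a unit permutes the pairs [{x, - x}]; the sign [s] does not depend on [g]. *)
Lemma prod_half_mul (m : 'Z_N) : m \is a GRing.unit -> exists s : bool,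
  forall (R : comNzRingType) (g : 'Z_N -> R),
  ((forall x, x != 0 -> g (- x) = - g x) ->
   \prod_(1 <= i < r.+1) g (m * i%:R) = (-1) ^+ s * \prod_(1 <= i < r.+1) g i%:R) /\
  ((forall x, x != 0 -> g (- x) = g x) ->
   \prod_(1 <= i < r.+1) g (m * i%:R) = \prod_(1 <= i < r.+1) g i%:R).
Proof.
move=> um; pose A := [set y : 'Z_N | ~~ in_half (m^-1 * y) && in_half y].
exists (odd #|A|) => R g.
have m0 y : (m^-1 * y == 0) = (y == 0).
  by apply/eqP/eqP => [/(congr1 (fun z => m * z))|->]; rewrite ?mulr0 // mulVKr.
have S : \prod_(1 <= i < r.+1) g (m * i%:R) =
   (\prod_(y | in_half (m^-1 * y) && in_half y) g y) * \prod_(y in A) g (- y).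
  rewrite (prod_half (fun x => g (m * x))) (reindex_onto (fun y => m^-1 * y) (fun x => m * x)); last first.
    by move=> x _; rewrite mulKr.
  rewrite (eq_big (fun y => in_half (m^-1 * y)) g); last 2 first.
  - by move=> y; rewrite mulVKr // eqxx andbT.
  - by move=> y _; rewrite mulVKr.
  rewrite (bigID in_half) /=; congr (_ * _).
  rewrite (reindex_onto (fun y => - y) (fun y => - y)); last by move=> y _; rewrite opprK.
  apply: eq_bigl => y; rewrite inE opprK eqxx andbT mulrN.
  have [->|y0] := eqVneq y 0; first by rewrite mulr0 oppr0.
  by rewrite !in_halfN ?m0 // negbK.
have E : \prod_(1 <= i < r.+1) g i%:R =
   (\prod_(y | in_half (m^-1 * y) && in_half y) g y) * \prod_(y in A) g y.
  rewrite (prod_half g) (bigID (fun y => in_half (m^-1 * y))) /=.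
  by congr (_ * _); apply: eq_bigl => y; rewrite ?inE andbC.
have A0 y : y \in A -> y != 0 by rewrite inE => /andP[_]; apply: contraTneq => ->.
split=> h; rewrite S E.
  have -> : \prod_(y in A) g (- y) = (-1) ^+ #|A| * \prod_(y in A) g y.
    by rewrite -prodr_const -big_split; apply: eq_bigr => y yA; rewrite /= h ?A0 // mulN1r.
  by rewrite signr_odd mulrCA.
by congr (_ * _); apply: eq_bigr => y yA; rewrite h ?A0.
Qed.
End HalfSystem.

Record prime_idempotent (N p : nat) (e : 'Z_N) : Prop := PrimeIdempotent {
  pi_gt1 : (1 < N)%N; pi_prime : prime p; pi_dvd : (p %| N)%N; pi_coprime : coprime p (N %/ p);
  pi_idem : e * e = e; pi_torsion : p%:R * e = 0; pi_fix : forall x, p%:R * x = 0 -> e * x = x }.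
Arguments pi_fix {N p e} _ [x].

Definition prime_divisor N p := prime p && (p %| N)%N.
Definition idem N p : 'Z_N := ((N %/ p) * (egcdn (N %/ p) p).1)%:R.

Lemma idemP N p : (1 < N)%N -> squarefree N -> prime_divisor N p -> prime_idempotent p (idem N p).
Proof.
move=> N1 sqN /andP[pp pN]; rewrite /idem; set m := (N %/ p)%N; have Em : (p * m)%N = N by rewrite mulnC divnK.
have cop : coprime p m.
  by rewrite prime_coprime //; apply: contra (sqN p pp) => d; rewrite -Em -mulnn dvdn_pmul2l ?prime_gt0.
have m0 : (0 < m)%N by case: m cop Em => // _; rewrite muln0 => E; rewrite -E in N1.
case: (egcdnP p m0) => u z Eu _ /=; rewrite gcdnC (eqP cop) mulnC in Eu.
have eM (x : 'Z_N) : p%:R * x = 0 -> (m * u)%:R * x = x.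
  by move=> px; rewrite Eu natrD natrM mulrDl mul1r -mulrA px mulr0 add0r.
have pe : p%:R * (m * u)%:R = 0 :> 'Z_N.
  by apply/eqP; rewrite -natrM Zp_nat_eq0 // mulnA Em dvdn_mulr.
by split=> //; exact: eM.
Qed.
Lemma idem_orth N p q : (1 < N)%N -> squarefree N -> prime_divisor N p -> prime_divisor N q -> p != q ->
  idem N p * idem N q = 0.
Proof.
move=> N1 sqN hp hq pq; have p0 := pi_torsion (idemP N1 sqN hp); have q0 := pi_torsion (idemP N1 sqN hq).
have [[pp _] [qq _]] := (andP hp, andP hq).
have cpq : coprime p q by rewrite prime_coprime // dvdn_prime2.
have [u v E _] := egcdnP q (prime_gt0 pp); rewrite (eqP cpq) in E.
have : (u * p)%:R * (idem N p * idem N q) = 0 by rewrite natrM -mulrA [p%:R * _]mulrA p0 mul0r mulr0.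
by rewrite E natrD natrM mulrDl mul1r -mulrA [q%:R * _]mulrCA q0 !mulr0 add0r.
Qed.

Section Local.
Variables (N p : nat) (e : 'Z_N).
Hypothesis eP : prime_idempotent p e.
Let N1 := pi_gt1 eP.
Let pp := pi_prime eP.
Let pN := pi_dvd eP.
Let ee := pi_idem eP.
Let pe := pi_torsion eP.

Definition red_Fp (x : 'Z_N) : 'F_p := (x : nat)%:R.
Definition lift_Fp (x : 'F_p) : 'Z_N := (x : nat)%:R * e.

Lemma red_Fp_nat n : red_Fp n%:R = n%:R.
Proof. by rewrite /red_Fp val_Zp_nat //; apply: eq_Fp_nat; rewrite ?modn_dvdm. Qed.
Lemma red_FpD x y : red_Fp (x + y) = red_Fp x + red_Fp y.
Proof. by rewrite -[x]natr_Zp -[y]natr_Zp -natrD !red_Fp_nat natrD. Qed.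
Lemma red_FpM x y : red_Fp (x * y) = red_Fp x * red_Fp y.
Proof. by rewrite -[x]natr_Zp -[y]natr_Zp -natrM !red_Fp_nat natrM. Qed.
Lemma red_FpN x : red_Fp (- x) = - red_Fp x.
Proof. by apply: (addrI (red_Fp x)); rewrite -red_FpD !subrr -[RHS](red_Fp_nat 0). Qed.
Lemma red_Fp_int (z : int) : red_Fp z%:~R = z%:~R.
Proof. by case: z => n; rewrite ?NegzE ?mulrNz -!pmulrn ?red_FpN red_Fp_nat. Qed.
Lemma red_Fp_idem : red_Fp e = 1.
Proof.
have m0 : ((N %/ p)%:R : 'F_p) != 0 by rewrite Fp_nat_eq0 // -prime_coprime ?(pi_coprime eP).
apply: (mulIf m0); rewrite mul1r -red_Fp_nat -red_FpM (pi_fix eP) // -natrM mulnC divnK //.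
by apply/eqP; rewrite Zp_nat_eq0.
Qed.
Lemma red_Fp_eq0 x : red_Fp x = 0 -> e * x = 0.
Proof.
move/eqP; rewrite Fp_nat_eq0 // => /dvdnP[q Eq].
by rewrite -[x]natr_Zp Eq natrM mulrCA [e * _]mulrC pe mulr0.
Qed.
Lemma lift_Fp_nat n : lift_Fp n%:R = n%:R * e.
Proof. by rewrite /lift_Fp val_Fp_nat // {2}(divn_eq n p) natrD natrM mulrDl -mulrA pe mulr0 add0r. Qed.
Lemma lift_FpD x y : lift_Fp (x + y) = lift_Fp x + lift_Fp y.
Proof. by rewrite -[x]natr_Zp -[y]natr_Zp -natrD !lift_Fp_nat natrD mulrDl. Qed.
Lemma lift_FpM x y : lift_Fp (x * y) = lift_Fp x * lift_Fp y.
Proof. by rewrite -[x]natr_Zp -[y]natr_Zp -natrM !lift_Fp_nat natrM mulrACA ee. Qed.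
Lemma lift_Fp1 : lift_Fp 1 = e. Proof. by rewrite (lift_Fp_nat 1) mul1r. Qed.
Lemma lift_Fp0 : lift_Fp 0 = 0. Proof. by rewrite (lift_Fp_nat 0) mul0r. Qed.
Lemma lift_FpN x : lift_Fp (- x) = - lift_Fp x.
Proof. by apply: (addrI (lift_Fp x)); rewrite -lift_FpD !subrr lift_Fp0. Qed.
Lemma idem_lift_Fp x : e * lift_Fp x = lift_Fp x. Proof. by rewrite /lift_Fp mulrCA ee. Qed.
Lemma lift_FpK : cancel lift_Fp red_Fp.
Proof. by move=> x; rewrite red_FpM red_Fp_idem mulr1 red_Fp_nat natr_Zp. Qed.
Lemma red_FpK x : lift_Fp (red_Fp x) = e * x.
Proof. by rewrite lift_Fp_nat natr_Zp mulrC. Qed.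
Lemma pi_unit C : e * C = C -> C != 0 -> exists C', e * C' = C' /\ C * C' = e.
Proof.
move=> eC C0; have r0 : red_Fp C != 0 by apply: contra C0 => /eqP/red_Fp_eq0; rewrite eC => ->.
exists (lift_Fp (red_Fp C)^-1); rewrite idem_lift_Fp; split=> //.
by rewrite -[C in C * _]eC -red_FpK -lift_FpM mulfV // lift_Fp1.
Qed.

(* The residue that is [x] modulo [p] and [1] modulo [N / p]. *)
Definition crt_unit (x : 'F_p) : 'Z_N := (1 - e) + lift_Fp x.
Lemma crt_unitM x y : crt_unit x * crt_unit y = crt_unit (x * y).
Proof.
rewrite /crt_unit lift_FpM.
have -> : (1 - e + lift_Fp x) * (1 - e + lift_Fp y) =
  1 - e - e + e * e + lift_Fp x - e * lift_Fp x + lift_Fp y - e * lift_Fp y + lift_Fp x * lift_Fp y by ring.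
by rewrite !idem_lift_Fp ee; ring.
Qed.
Lemma crt_unit_unit x : x != 0 -> crt_unit x \is a GRing.unit.
Proof.
have c1 : crt_unit 1 = 1 by rewrite /crt_unit lift_Fp1 subrK.
by move=> x0; apply/unitrP; exists (crt_unit x^-1); rewrite !crt_unitM mulVf ?mulfV // c1.
Qed.
Lemma red_crt_unit x : red_Fp (crt_unit x) = x.
Proof. by rewrite /crt_unit !red_FpD red_FpN -[1]/(1%:R) red_Fp_nat red_Fp_idem lift_FpK subrr add0r. Qed.
Lemma crt_unit_mul0 x y : red_Fp y = 0 -> crt_unit x * y = y.
Proof.
move=> y0; have ey := red_Fp_eq0 y0.
by rewrite /crt_unit mulrDl mulrBl mul1r ey subr0 /lift_Fp -mulrA ey mulr0 addr0.
Qed.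

Hypothesis oddN : odd N.
Let op : odd p := dvdn_odd pN oddN.

Lemma sum_half_ndvd r : N = (2 * r).+1 -> (\sum_(1 <= i < r.+1) ~~ (p %| i)%N = pred_half p * (N %/ p))%N.
Proof.
move=> Nr; have oq : odd (N %/ p) by apply: dvdn_odd (dvdn_div pN) oddN.
have Np := divnK pN; have hE := pred_halfE op; have := odd_double_half (N %/ p); rewrite oq => qE.
have Ed : (r %/ p)%N = (N %/ p)./2.
  have -> : r = ((N %/ p)./2 * p + pred_half p)%N.
    by move: Np hE qE; move: (N %/ p)%N (_./2) (pred_half p) => q t h; nia.
  by rewrite divnMDl ?prime_gt0 // (divn_small (_ : pred_half p < p)%N) ?addn0 //; lia.
have S : (\sum_(1 <= i < r.+1) ~~ (p %| i)%N + r %/ p = r)%N.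
  rewrite divn_count_dvd -big_split /= (eq_bigr (fun=> 1%N)) => [|i _]; last by case: (p %| i)%N.
  by rewrite sum_nat_const_nat; lia.
rewrite Ed in S; move: S Np hE qE; move: (N %/ p)%N (_./2) (pred_half p) (\sum_(_ <= _ < _) _)%N => q t h s; nia.
Qed.

(* The sign of [prod_half_mul] is read off an odd function with values in [F_p]. *)
Lemma prod_half_crt_unit r (R : comNzRingType) (g : 'Z_N -> R) x : N = (2 * r).+1 -> x != 0 ->
  (forall x, x != 0 -> g (- x) = - g x) ->
  \prod_(1 <= i < r.+1) g (crt_unit x * i%:R) = quadchar R x * \prod_(1 <= i < r.+1) g i%:R.
Proof.
move=> Nr x0 og; have [s Hs] := prod_half_mul N1 Nr (crt_unit_unit x0).
rewrite ((Hs R g).1 og); congr (_ * _).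
pose h (y : 'Z_N) : 'F_p := if red_Fp y == 0 then (if in_half r y then 1 else -1) else red_Fp y.
have oh y : y != 0 -> h (- y) = - h y.
  move=> y0; rewrite /h red_FpN oppr_eq0 in_halfN //; case: ifP => // _.
  by case: (in_half r y); rewrite ?opprK.
have hM i : h (crt_unit x * i%:R) = x ^+ (~~ (p %| i)%N) * h i%:R.
  rewrite /h red_FpM red_crt_unit mulf_eq0 (negPf x0) /= red_Fp_nat Fp_nat_eq0 //.
  have [d|//] := boolP (p %| i)%N; rewrite expr0 mul1r crt_unit_mul0 // red_Fp_nat.
  by apply/eqP; rewrite Fp_nat_eq0.
have h0 : \prod_(1 <= i < r.+1) h i%:R != 0.
  rewrite prodf_seq_neq0; apply/allP => i _; rewrite /= /h; case: ifP => [_|/negbT //].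
  by case: (in_half r _); rewrite ?oppr_eq0 oner_eq0.
have : x ^+ pred_half p = (-1) ^+ s.
  have := (Hs _ h).1 oh; rewrite (eq_bigr _ (fun i _ => hM i)) big_split /= => /(mulIf h0) <-.
  rewrite prodrXr (sum_half_ndvd Nr) exprM.
  have oq : odd (N %/ p) by apply: dvdn_odd (dvdn_div pN) oddN.
  by case: (Fp_exp_pred_half pp op x0) => ->; rewrite ?expr1n // -signr_odd oq.
rewrite /quadchar (negPf x0) => ->; case: s {Hs}; rewrite ?expr0 ?eqxx // expr1.
by rewrite (negPf (Fp_oppr1_neq1 pp op)).
Qed.
End Local.

(* Gauss's lemma for 3. *)
Lemma quadchar3 (p : nat) (R : comNzRingType) (b : nat) : prime p -> (3 < p)%N ->
  (p = 6 * b + 1)%N \/ (p = 6 * b - 1)%N -> quadchar R (3%:R : 'F_p) = (-1) ^+ b.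
Proof.
move=> pp p3 pb; have p1 := prime_gt1 pp; have op : odd p by case: (even_prime pp) p3 => [->|].
have pr := pred_halfE op; set r := pred_half p in pr.
have eP : prime_idempotent p (1 : 'Z_p).
  by split=> //; rewrite ?divnn ?prime_gt0 ?coprimen1 // ?mul1r ?mulr1 //; first apply/eqP; rewrite ?Zp_nat_eq0 // => x; rewrite mul1r.
have n3 : (3%:R : 'F_p) != 0 by rewrite Fp_nat_eq0 //; apply/negP => /dvdn_leq; lia.
pose g (x : 'Z_p) : R := if in_half r x then 1 else -1.
have og x : x != 0 -> g (- x) = - g x.
  by move=> x0; rewrite /g (in_halfN p1 pr x0); case: (in_half r x); rewrite ?opprK.
have g1 : \prod_(1 <= i < r.+1) g i%:R = 1.
  by rewrite big_nat big1 // => i ir; rewrite /g in_half_nat ?ifT //; lia.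
have := prod_half_crt_unit eP op pr n3 og; rewrite g1 mulr1 => <-.
rewrite /crt_unit subrr (lift_Fp_nat eP) add0r mulr1.
have gE i : (0 < i < r.+1)%N -> g (3%:R * i%:R) = if (r < 3 * i < p)%N then -1 else 1.
  move=> ir; rewrite /g -natrM; case: (ltnP (3 * i) p) => l3.
    by rewrite in_half_nat // andbT [(r < _)%N]ltnNge muln_gt0 (andP ir).1; case: (3 * i <= r)%N.
  have n0 : (3 * i != p)%N by apply/negP => /eqP E; have := pp; rewrite -E => /primePns; lia.
  rewrite andbF (_ : (3 * i)%:R = (3 * i - p)%:R :> 'Z_p) ?in_half_nat ?ifT //; try lia.
  by apply/eqP; rewrite -subr_eq0 -natrB ?leq_subr // subKn // Zp_nat_eq0.
rewrite big_nat (eq_bigr _ gE) -big_nat.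
have [u [v [Ev uv u0 vr]]] : exists u v,
    [/\ (v = u + b)%N, (forall i, (r < 3 * i < p)%N = (u <= i < v)%N), (0 < u)%N & (v <= r.+1)%N].
  by case: pb => pb; [exists b.+1, (b.+1 + b)%N | exists b, (b + b)%N]; split=> //; try (by move=> i; lia); lia.
have ur : (u <= r.+1)%N by lia.
rewrite (big_cat_nat u0 ur) (big_cat_nat _ vr) /=; last by lia.
rewrite big_nat big1 => [|i il]; last by rewrite uv ifF //; lia.
rewrite mul1r [X in _ * X]big_nat [X in _ * X]big1 => [|i il]; last by rewrite uv ifF //; lia.
rewrite mulr1 big_nat (eq_bigr (fun=> -1)) => [|i il]; last by rewrite uv ifT //; lia.
by rewrite -big_nat prodr_const_nat Ev addKn.
Qed.

(** * Torsion points and their symmetries *)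

Lemma XYcoord_shiftz (R : idomainType) (N : nat) (F : fieldType) (D : theta_datum R N F) (c : R) m z :
  (2%:R : R) != 0 -> c \is a GRing.unit -> off_lattice N c m ->
  Xcoord D c (m + (2 * N)%:Z * z) = Xcoord D c m /\ Ycoord D c (m + (2 * N)%:Z * z) = Ycoord D c m.
Proof.
move=> nz2 Uc; have gs m' t : off_lattice N c m' -> off_lattice N c (m' + (2 * N)%:Z * t).
  by move=> g h; apply: g; move: h; rewrite rpredDr // dvdz_mulr.
have H (n : nat) m' : off_lattice N c m' -> Xcoord D c (m' + (2 * N)%:Z * n%:Z) = Xcoord D c m' /\
    Ycoord D c (m' + (2 * N)%:Z * n%:Z) = Ycoord D c m'.
  move=> g; elim: n => [|n [IX IY]]; first by rewrite mulr0 addr0.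
  have -> : m' + (2 * N)%:Z * n.+1%:Z = m' + (2 * N)%:Z * n%:Z + (2 * N)%:Z by rewrite intS; ring.
  by have g' := gs m' n%:Z g; rewrite Xcoord_shift // Ycoord_shift.
move=> g; case: z => n; first exact: H.
rewrite NegzE; have [EX EY] := H n.+1 _ (gs m (- n.+1%:Z) g).
have e : m + (2 * N)%:Z * - n.+1%:Z + (2 * N)%:Z * n.+1%:Z = m by ring.
by rewrite e in EX EY.
Qed.

(* Everything that the N-torsion of the Tate curve is built from: [F] is the fraction field of
   [k[[S]]] and [k] contains the roots of unity that are needed. *)
Record tate_setup (k F : fieldType) (ell N : nat) := TateSetup {
  ts_iota : {rmorphism fps k -> F}; ts_frac : is_frac ts_iota;
  ts_ell_prime : prime ell; ts_ell_gt3 : (3 < ell)%N; ts_pchar : ell \in [pchar k];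
  ts_N_gt1 : (1 < N)%N; ts_N_coprime6 : coprime N 6;
  ts_xi : k; ts_xiP : (N ^ 2).-primitive_root ts_xi;
  ts_omega : k; ts_omegaP : (ell.-1).-primitive_root ts_omega }.
Arguments ts_frac {k F ell N} t.

Section Points.
Variables (k F : fieldType) (ell N : nat) (S : tate_setup k F ell N).
Local Notation iota := (ts_iota S).
Local Notation xi := (ts_xi S).
Local Notation N1 := (ts_N_gt1 S).

Lemma ts_N_gt0 : (0 < N)%N. Proof. exact: ltnW N1. Qed.
Local Notation N0 := ts_N_gt0.
Lemma ts_N_odd : odd N.
Proof. by rewrite -coprimen2; apply: coprime_dvdr (ts_N_coprime6 S). Qed.
Lemma ts_N_neq0 : (N%:R : k) != 0.
Proof. by have := prim_root_natf_neq0 (ts_xiP S); rewrite natrX expf_eq0. Qed.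
Lemma ts_two_neq0 : (2%:R : k) != 0.
Proof.
rewrite -(dvdn_pcharf (ts_pchar S)); apply: contraL (ts_ell_gt3 S) => /(dvdn_leq (isT : 0 < 2)%N) h.
by rewrite -leqNgt (leq_trans h).
Qed.
Local Notation k2 := ts_two_neq0.
Lemma iota_dtheta_neq0 : iota (dtheta k N) != 0.
Proof. by rewrite (iota_eq0 (ts_frac S)) dtheta_neq0 // N0. Qed.

Definition tate_theta := theta_datum_fps N0 k2 (ts_frac S) iota_dtheta_neq0.
Local Notation D := tate_theta.
Definition zeta := xi ^+ (8 * N).

Lemma zetaP : N.-primitive_root zeta.
Proof.
have -> : N = (N ^ 2 %/ gcdn (8 * N) (N ^ 2))%N.
  have -> : gcdn (8 * N) (N ^ 2) = N; last by rewrite -mulnn mulnK ?N0.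
  rewrite -mulnn -muln_gcdl (eqP (_ : coprime 8 N)) ?mul1n //.
  by rewrite (_ : 8 = 2 ^ 3)%N // coprimeXl // coprime2n ts_N_odd.
exact: exp_prim_root (ts_xiP S) _.
Qed.
Lemma zeta_neq0 : zeta != 0.
Proof. by rewrite (prim_root_eq0 zetaP) -lt0n N0. Qed.
Lemma zeta_eq1 (i : int) : (zeta ^ i == 1) = (N%:Z %| i)%Z.
Proof.
case: i => n; first by rewrite -exprnP -(prim_order_dvd zetaP).
by rewrite NegzE -invr_expz invr_eq1 -exprnP -(prim_order_dvd zetaP) dvdzE abszN.
Qed.
Lemma zetaX_unit (i : int) : zeta ^ i \is a GRing.unit.
Proof. by rewrite unitfE expfz_neq0 ?zeta_neq0. Qed.

Local Notation nz i j := (~~ ((N%:Z %| i)%Z && (N%:Z %| j)%Z)).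

Lemma dvdz_2N (j : int) : ((2 * N)%:Z %| 2 * j)%Z = (N%:Z %| j)%Z.
Proof. by rewrite PoszM dvdz_mul2l. Qed.

Lemma off_lattice_zeta i j : nz i j -> off_lattice N (zeta ^ i) (2 * j).
Proof. by move=> h d; rewrite zeta_eq1; apply: contra h => ->; rewrite dvdz_2N in d. Qed.

Lemma dvdz_double (i : int) : (N%:Z %| 2 * i)%Z = (N%:Z %| i)%Z.
Proof. by rewrite !dvdzE abszM Gauss_dvdr // coprimen2 ts_N_odd. Qed.

Lemma off_lattice_half (c : k) j : off_lattice N c (2 * j + N%:Z).
Proof.
move=> /dvdzP[z E]; exfalso; have := ts_N_odd; rewrite PoszM mulrCA in E.
by move: (z * N%:Z) E => w; clear; lia.
Qed.

Lemma regular_pt_zeta i j : nz i j -> regular_pt N (zeta ^ i) (2 * j).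
Proof.
move=> h; split; try exact: off_lattice_half; rewrite ?zetaX_unit //; first exact: off_lattice_zeta.
have -> : (zeta ^ i) ^+ 2 = zeta ^ (2 * i) by rewrite mulrC -exprz_exp.
by apply: off_lattice_zeta; rewrite !dvdz_double.
Qed.

Notation V := ('Z_N * 'Z_N)%type.
Definition torsX (a : V) : F := if a == 0 then 0 else Xcoord D (zeta ^ ((a.1 : nat)%:Z)) (2 * (a.2 : nat)%:Z).
Definition torsY (a : V) : F := if a == 0 then 0 else Ycoord D (zeta ^ ((a.1 : nat)%:Z)) (2 * (a.2 : nat)%:Z).

Definition int_point (i j : int) : V := (i%:~R, j%:~R).
Lemma int_point_eq0 i j : (int_point i j == 0) = ~~ nz i j.
Proof. by rewrite negbK -(Zp_int_eq0 N1 i) -(Zp_int_eq0 N1 j). Qed.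

Lemma int_pointE (a : V) : a = int_point (a.1 : nat)%:Z (a.2 : nat)%:Z.
Proof. by case: a => x y; rewrite /int_point /= !Zp_int_surj. Qed.

Lemma int_point_ex (a : V) : a != 0 -> exists i j, nz i j /\ a = int_point i j.
Proof. by rewrite {1}[a]int_pointE int_point_eq0 negbK => h; do 2!eexists; split; [exact: h | exact: int_pointE]. Qed.

Lemma tors_int_point i j : nz i j ->
  Xcoord D (zeta ^ i) (2 * j) = torsX (int_point i j) /\ Ycoord D (zeta ^ i) (2 * j) = torsY (int_point i j).
Proof.
move=> h; rewrite /torsX /torsY int_point_eq0 negbK (negPf h) /int_point /=.
have /dvdzP[z Ez] := Zp_dvd_sub N1 j; pose j' := ((j%:~R : 'Z_N) : nat); rewrite -/j' in Ez *.
have -> : zeta ^ ((i%:~R : 'Z_N) : nat)%:Z = zeta ^ i.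
  have := Zp_dvd_sub N1 i; rewrite -zeta_eq1 expfzDr ?zeta_neq0 // -invr_expz => /eqP E.
  by rewrite -[LHS]mul1r -E mulfVK // expfz_neq0 ?zeta_neq0.
have -> : 2 * j'%:Z = 2 * j + (2 * N)%:Z * (- z).
  by rewrite (_ : j'%:Z = j - z * N%:Z) ?PoszM; [ring|rewrite -Ez; ring].
by have [-> ->] := XYcoord_shiftz D (- z) k2 (zetaX_unit i) (off_lattice_zeta h).
Qed.

Lemma torsX0 : torsX 0 = 0. Proof. by rewrite /torsX eqxx. Qed.
Lemma torsY0 : torsY 0 = 0. Proof. by rewrite /torsY eqxx. Qed.

Lemma int_pointD i j i' j' : int_point i j + int_point i' j' = int_point (i + i') (j + j').
Proof. by rewrite /int_point !rmorphD. Qed.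
Lemma int_pointN i j : - int_point i j = int_point (- i) (- j).
Proof. by rewrite /int_point !rmorphN. Qed.

Lemma torsXYN a : torsX (- a) = torsX a /\ torsY (- a) = - torsY a.
Proof.
have [->|] := eqVneq a 0; first by rewrite oppr0 torsX0 torsY0 oppr0.
move=> /int_point_ex[i [j [h ->]]]; rewrite int_pointN.
have h' : nz (- i) (- j) by rewrite !rpredN.
have [<- <-] := tors_int_point h; have [<- <-] := tors_int_point h'.
by rewrite mulrN -invr_expz Xcoord_inv ?Ycoord_inv ?zetaX_unit ?k2 //; exact: off_lattice_zeta.
Qed.

Lemma torsY_neq0 a : a != 0 -> torsY a != 0.
Proof.
move=> /int_point_ex[i [j [h ->]]]; have [_ <-] := tors_int_point h.
exact: (regular_pt_Y D (regular_pt_zeta h)).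
Qed.

Local Notation a_ := (alpha D).
Local Notation b_ := (beta D).
Lemma torsY_sqr a : torsY a ^+ 2 = 4%:R * (torsX a * (torsX a - a_) * (torsX a - b_)).
Proof.
have [->|] := eqVneq a 0; first by rewrite torsX0 torsY0 expr0n !mul0r mulr0.
move=> /int_point_ex[i [j [h ->]]]; have [<- <-] := tors_int_point h.
by rewrite Ycoord_sqr ?N0 ?k2 ?zetaX_unit //; apply: off_lattice_zeta.
Qed.

Lemma zetaD i i' : zeta ^ (i + i') = zeta ^ i * zeta ^ i'. Proof. exact: expfzDr zeta_neq0. Qed.
Lemma zetaB i i' : zeta ^ (i - i') = zeta ^ i / zeta ^ i'. Proof. by rewrite zetaD invr_expz. Qed.

Lemma torsX_eq a b : a != 0 -> b != 0 -> torsX a = torsX b -> a = b \/ a = - b.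
Proof.
move=> a0 b0 E; have [->|] := eqVneq a b; first by left.
have [->|] := eqVneq a (- b); first by right.
rewrite -addr_eq0 -[a == b]subr_eq0.
have [i [j [h Ea]]] := int_point_ex a0; have [i' [j' [h' Eb]]] := int_point_ex b0.
move: E; rewrite {}Ea {}Eb int_pointN !int_pointD !int_point_eq0 !negbK => /eqP.
have [<- _] := tors_int_point h; have [<- _] := tors_int_point h'.
rewrite -subr_eq0 => E n2 n1; exfalso; move: E; apply/negP; have U := zetaX_unit.
rewrite (Xcoord_sub D k2 (U i) (U i') (off_lattice_zeta h) (off_lattice_zeta h')) oppr_eq0.
rewrite -zetaD -zetaB -mulrDr -mulrBr.
rewrite !mulf_neq0 ?invr_eq0 ?expf_neq0 ?mulf_neq0 ?dvtheta_neq0 ?cst_neq0 ?U //.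
all: by apply: vtheta_neq0; rewrite ?U //; exact: off_lattice_zeta.
Qed.

Lemma torsX_add a b : a != 0 -> b != 0 -> a - b != 0 -> a + b != 0 ->
  (torsX a - torsX b) ^+ 2 * (torsX (a - b) - torsX (a + b)) = torsY a * torsY b /\
  a_ * (torsX a - torsX b) ^+ 2 * (torsX (a + b) + torsX (a - b)) =
  (a_ * b_ - torsX a * torsX b) ^+ 2 + a_ ^+ 2 * (torsX a - torsX b) ^+ 2 -
  (a_ * (torsX a + torsX b) - a_ * b_ - torsX a * torsX b) ^+ 2.
Proof.
move=> /int_point_ex[i [j [h ->]]] /int_point_ex[i' [j' [h' ->]]].
rewrite int_pointN !int_pointD !int_point_eq0 !negbK => h1 h2.
have [<- <-] := tors_int_point h; have [<- <-] := tors_int_point h'.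
have [<- _] := tors_int_point h1; have [<- _] := tors_int_point h2.
have g1 := off_lattice_zeta h1; have g2 := off_lattice_zeta h2.
rewrite mulrBr zetaB in g1; rewrite mulrDr zetaD in g2; rewrite zetaB zetaD [2 * (j - _)]mulrBr [2 * (j + _)]mulrDr.
have [U U'] := (zetaX_unit i, zetaX_unit i'); have [g g'] := (off_lattice_zeta h, off_lattice_zeta h').
split; first exact: (Xcoord_add_sub D k2 U U' g g' g2 g1).
exact: (Xcoord_add_sum D N0 k2 U U' g g' g2 g1 (@off_lattice_half _ j)).
Qed.

Lemma int_pair_dbl_neq0 (a : V) : a != 0 -> a + a != 0.
Proof.
move=> /int_point_ex[i [j [h ->]]]; rewrite int_pointD !int_point_eq0 negbK.
have D2 (x : int) : x + x = 2 * x by ring.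
by rewrite !D2 !dvdz_double.
Qed.

Lemma tors_dbl a : a != 0 -> torsX (a + a) * torsY a ^+ 2 = (torsX a ^+ 2 - a_ * b_) ^+ 2 /\
  torsY (a + a) * torsY a ^+ 3 = 2%:R * (torsX a ^+ 2 - a_ * b_) *
    (torsX a ^+ 2 - 2%:R * a_ * torsX a + a_ * b_) * (torsX a ^+ 2 - 2%:R * b_ * torsX a + a_ * b_).
Proof.
move=> a0; have := int_pair_dbl_neq0 a0; move: a0 => /int_point_ex[i [j [h ->]]].
rewrite int_pointD int_point_eq0 negbK => h2.
have [<- <-] := tors_int_point h; have [<- <-] := tors_int_point h2.
have D2 : 2 * (j + j) = 2 * (2 * j) by ring.
have Z2 : zeta ^ (i + i) = (zeta ^ i) ^+ 2 by rewrite zetaD.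
have g2 := off_lattice_zeta h2; rewrite D2 Z2 in g2; rewrite D2 Z2.
have U := zetaX_unit i; have g := off_lattice_zeta h.
have t1 := vtheta_neq0 D U g.
have t2 : vtheta D ((zeta ^ i) ^+ 2) (2 * (2 * j)) != 0 by apply: vtheta_neq0; rewrite ?unitrX.
split; first exact: (Xcoord_dbl N0 k2 U t1 t2).
exact: (Ycoord_dbl D N0 k2 U g (@off_lattice_half _ j) (@off_lattice_half _ j) g2).
Qed.

Lemma torsion_divpol : exists G : {poly F}, homog_poly (intr : {rmorphism int -> F}) a_ b_ (divpol_deg N) N%:R G /\
  forall a, a != 0 -> G.[torsX a] = 0.
Proof.
have [G [hG wG]] := divpol_exists D N0 k2 N; exists G; split.
  by move: hG; rewrite /divpol_lead ts_N_odd.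
move=> a /int_point_ex[i [j [h ->]]]; have [<- _] := tors_int_point h.
have := wG _ _ (regular_pt_zeta h); rewrite ts_N_odd mulr1 => <-.
rewrite /edsW (_ : vtheta D _ _ = 0) ?mulr0 ?mul0r //=.
have T10 := vtheta10 D; rewrite /= in T10.
have -> : (zeta ^ i) ^+ N = 1.
  by rewrite exprnP exprz_exp mulrC -exprz_exp -exprnP (prim_expr_order zetaP) exp1rz.
have -> : 2 * j *+ N = 0 + (2 * N)%:Z * j by rewrite add0r -mulr_natr PoszM natz; ring.
by rewrite theta_shiftz ?unitr1 ?N0 // rmorphM T10 mulr0.
Qed.
End Points.

Section NewtonIdentities.
Variable F : fieldType.

Lemma deriv_prod_XsubC (rs : seq F) : let G := \prod_(r <- rs) ('X - r%:P) in
  G^`() = \sum_(r <- rs) G %/ ('X - r%:P).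
Proof.
elim: rs => [|r rs IH] /=; first by rewrite !big_nil derivC.
rewrite !big_cons derivM derivXsubC mul1r mulKp ?polyXsubC_eq0 // IH; congr (_ + _).
rewrite mulr_sumr; apply: eq_big_seq => s s_rs.
have /dvdpP[Q EQ] : 'X - s%:P %| \prod_(j <- rs) ('X - j%:P).
  by rewrite (big_rem s) //= dvdp_mulr.
by rewrite EQ mulrA !mulpK ?polyXsubC_eq0.
Qed.

Lemma divp_XsubC_coef (G : {poly F}) r d j : (size G <= d.+1)%N -> root G r ->
  (G %/ ('X - r%:P))`_j = \sum_(l < d - j) G`_(j.+1 + l) * r ^+ l.
Proof.
move=> sG /factor_theorem[Q EQ]; rewrite EQ mulpK ?polyXsubC_eq0 //.
have [Q0|Q0] := eqVneq Q 0.
  rewrite Q0 mul0r coef0 big1 // => l _; by rewrite coef0 mul0r.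
have sQ : (size Q <= d)%N.
  by move: sG; rewrite EQ size_Mmonic ?monicXsubC // size_XsubC addn2.
have rec i : Q`_i = (Q * ('X - r%:P))`_i.+1 + r * Q`_i.+1.
  by rewrite mulrBr coefB coefMX coefMC /= mulrC subrK.
move: (Q * _) rec => P rec.
move En : (d - j)%N => n; elim: n j En => [|n IH] j Ej.
  by rewrite big_ord0 nth_default // (leq_trans sQ) // -subn_eq0 Ej.
rewrite big_ord_recl addn0 expr0 mulr1 rec (IH j.+1); last by lia.
rewrite mulr_sumr; congr (_ + _); apply: eq_bigr => l _ /=.
by rewrite /bump /= exprS add1n addSnnS; ring.
Qed.

Section PowerSums.
Variables (rs : seq F) (l : F) (G : {poly F}).
Hypothesis defG : G = l *: \prod_(r <- rs) ('X - r%:P).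
Hypothesis szG : (size G <= (size rs).+1)%N.
Local Notation d := (size rs).

Lemma root_scaled_prod r : r \in rs -> root G r.
Proof.
have [l0|l0] := eqVneq l 0; first by rewrite defG l0 scale0r root0.
by rewrite defG rootZ // root_prod_XsubC.
Qed.

Lemma newton_identity_lt j : j.+1%:R * G`_j.+1 =
  \sum_(i < d - j) G`_(j.+1 + i) * \sum_(r <- rs) r ^+ i.
Proof.
have := congr1 (fun p : {poly F} => (l *: p)`_j) (deriv_prod_XsubC rs).
rewrite /= -derivZ -defG coef_deriv mulr_natl => ->.
rewrite scaler_sumr coef_sum.
rewrite (eq_big_seq (fun r => \sum_(i < d - j) G`_(j.+1 + i) * r ^+ i)) => [|r r_rs].
  by rewrite exchange_big; apply: eq_bigr => i _; rewrite mulr_sumr.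
by rewrite -divpZl -defG (divp_XsubC_coef j szG) // root_scaled_prod.
Qed.

Lemma newton_identity_ge m : \sum_(i < d.+1) G`_i * \sum_(r <- rs) r ^+ (m + i) = 0.
Proof.
rewrite (eq_bigr (fun i : 'I_d.+1 => \sum_(r <- rs) G`_i * r ^+ i * r ^+ m)) => [|i _]; last first.
  by rewrite mulr_sumr; apply: eq_bigr => r _; rewrite addnC exprD mulrA.
rewrite exchange_big big_seq big1 // => r r_rs /=.
by rewrite -mulr_suml -(horner_coef_wide _ szG) (rootP (root_scaled_prod r_rs)) mul0r.
Qed.
End PowerSums.

Variables (k : fieldType) (cst : {rmorphism k -> F}) (a b : F).
Lemma homog_power_sum (rs : seq F) (l : k) G : l != 0 ->
  homog_poly cst a b (size rs) (cst l) G -> G = cst l *: \prod_(r <- rs) ('X - r%:P) ->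
  forall m, homog cst a b m (\sum_(r <- rs) r ^+ m).
Proof.
move=> l0 [szG lG hG] defG; set d := size rs in szG lG hG *.
have homog_divl m x : homog cst a b m (cst l * x) -> homog cst a b m x.
  have ll : cst l != 0 by rewrite fmorph_eq0.
  by move=> h; rewrite -[x](mulKf ll) -fmorphV; apply: homogZ.
elim/ltn_ind=> m IH; apply: homog_divl.
have [lt_md|le_dm] := ltnP m d.
  have [j_m dj] : ((d.-1 - m).+1 + m = d)%N /\ (d - (d.-1 - m) = m.+1)%N by lia.
  have := newton_identity_lt defG szG (d.-1 - m); rewrite dj big_ord_recr /= j_m lG => /eqP.
  rewrite [X in _ == X]addrC -subr_eq => /eqP <-; set j := (d.-1 - m)%N in j_m *.
  apply: homogB.
    have {1}-> : m = (0 + (d - j.+1))%N by lia.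
    by apply: homogM; [exact: homog_nat | apply: hG; lia].
  apply: homog_sum => -[i lt_im] _ /=; have {1}-> : m = ((d - (j.+1 + i)) + i)%N by lia.
  by apply: homogM; [apply: hG; lia | apply: IH].
have := newton_identity_ge defG szG (m - d); rewrite big_ord_recr /= subnK // lG => /eqP.
rewrite addrC addr_eq0 => /eqP ->.
apply/homogN/homog_sum => -[i lt_id] _ /=; have {1}-> : m = ((d - i) + (m - d + i))%N by lia.
by apply: homogM; [apply: hG; lia | apply: IH; lia].
Qed.
End NewtonIdentities.

Section RatioEvaluation.
Variables (k F : fieldType) (cst : {rmorphism k -> F}) (lam : F).
Definition ratio_eval (p : {poly k}) : F := (map_poly cst p).[lam].
Lemma ratio_eval_zmod : zmod_morphism ratio_eval.
Proof. by move=> p q; rewrite /ratio_eval rmorphB hornerD hornerN. Qed.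
Lemma ratio_eval_monoid : monoid_morphism ratio_eval.
Proof. by split=> [|p q]; rewrite /ratio_eval ?rmorph1 ?hornerC // rmorphM hornerM. Qed.
HB.instance Definition _ := GRing.isZmodMorphism.Build _ _ ratio_eval ratio_eval_zmod.
HB.instance Definition _ := GRing.isMonoidMorphism.Build _ _ ratio_eval ratio_eval_monoid.
Lemma ratio_evalM p q : ratio_eval (p * q) = ratio_eval p * ratio_eval q. Proof. exact: rmorphM. Qed.
Lemma ratio_evalX p n : ratio_eval (p ^+ n) = ratio_eval p ^+ n. Proof. exact: rmorphXn. Qed.
Hypothesis trans : forall p, p != 0 -> ratio_eval p != 0.

Lemma ratio_eval_inj : injective ratio_eval.
Proof.
move=> p q E; apply/eqP; rewrite -subr_eq0; apply/negPn/negP => /trans.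
by rewrite ratio_eval_zmod E subrr eqxx.
Qed.

Lemma integral_ratio_eval x p q : p != 0 -> x * ratio_eval p = ratio_eval q -> integralOver ratio_eval x -> exists r, x = ratio_eval r.
Proof.
move=> p0 E [P mP rP].
pose g := gcdp p q; have g0 : g != 0 by rewrite gcdp_eq0 negb_and p0.
have Ep : p = (p %/ g) * g by rewrite divpK // dvdp_gcdl.
have Eq : q = (q %/ g) * g by rewrite divpK // dvdp_gcdr.
set u := p %/ g in Ep; set v := q %/ g in Eq.
have cuv : coprimep u v by rewrite coprimep_div_gcd ?p0.
have u0 : u != 0 by apply: contraNneq p0 => z; rewrite Ep z mul0r.
have E' : x * ratio_eval u = ratio_eval v.
  by apply: (mulIf (trans g0)); rewrite -mulrA -!ratio_evalM -Ep -Eq.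
have [n sP] : exists n, size P = n.+1.
  by exists (size P).-1; rewrite prednK // size_poly_gt0 monic_neq0.
have H : ratio_eval (\sum_(i < n.+1) P`_i * v ^+ i * u ^+ (n - i)) = 0.
  rewrite -(mul0r (ratio_eval u ^+ n)) -(rootP rP) rmorph_sum (@horner_coef_wide _ n.+1) ?size_map_poly //; last first.
    by rewrite (leq_trans (size_poly _ _)) // sP.
  rewrite mulr_suml; apply: eq_bigr => -[i le] _ /=.
  by rewrite !ratio_evalM !ratio_evalX -E' coef_map exprMn -!mulrA -exprD subnKC.
have {}H := ratio_eval_inj (etrans H (esym (rmorph0 ratio_eval))).
have Pn : P`_n = 1 by have := mP; rewrite monicE lead_coefE sP => /eqP.
rewrite big_ord_recr /= subnn expr0 mulr1 Pn mul1r in H.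
have dv : u %| v ^+ n.
  rewrite (_ : v ^+ n = - \sum_(i < n) P`_i * v ^+ i * u ^+ (n - i)); last first.
    by apply/eqP; rewrite -addr_eq0 addrC H.
  rewrite dvdpNr; apply: (big_ind (fun z => u %| z)) => [|a b|[i le] _]; [exact: dvdp0|exact: dvdp_add|].
  by rewrite /= dvdp_mull // -(subnSK le) exprS dvdp_mulr.
have /size_poly1P[c c0 Ec] : size u == 1%N.
  by rewrite -coprimepp (coprimep_dvdl dv) // coprimep_expr.
exists (c^-1 *: v); rewrite -mul_polyC ratio_evalM -E' Ec mulrCA -ratio_evalM -polyCM mulVf //.
by rewrite rmorph1 mulr1.
Qed.

(* [x = a r(b/a) = b r'(a/b)] forces [r] to be linear. *)
Lemma ratio_eval_linear (a b : F) r r' : a != 0 -> b != 0 -> lam = b / a ->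
  a * ratio_eval r = b * (map_poly cst r').[a / b] -> exists c1 c2, a * ratio_eval r = cst c1 * a + cst c2 * b.
Proof.
move=> a0 b0 El E; set m := size r'.
pose Rv := \poly_(i < m.+1) r'`_(m - i).
have l0 : lam != 0 by rewrite El mulf_neq0 ?invr_eq0.
have ER : (map_poly cst r').[a / b] * lam ^+ m = ratio_eval Rv.
  rewrite /ratio_eval (@horner_coef_wide _ m.+1) ?(leq_trans (size_poly _ _)) //.
  rewrite (@horner_coef_wide _ m.+1 (map_poly cst Rv)); last first.
    by rewrite (leq_trans (size_poly _ _)) // size_poly.
  rewrite mulr_suml [RHS](reindex_inj rev_ord_inj) /=; apply: eq_bigr => -[i le] _ /=.
  rewrite !coef_map coef_poly subSS ltnS leq_subr subKn // -mulrA; congr (_ * _).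
  rewrite -{1}(subnK (le : (i <= m)%N)) exprD mulrCA -exprMn El (_ : a / b * (b / a) = 1) ?expr1n ?mulr1 //.
  by field; rewrite a0 b0.
have Q : ratio_eval (r * 'X^m) = ratio_eval ('X * Rv).
  rewrite !ratio_evalM -ER /ratio_eval map_polyX map_polyXn hornerX hornerXn -/(ratio_eval r).
  by apply: (mulfI a0); rewrite [LHS]mulrA E El; field.
have {}Q := ratio_eval_inj Q.
have sr : (size r <= 2)%N.
  have [->|r0] := eqVneq r 0; first by rewrite size_poly0.
  have := congr1 (fun p : {poly k} => size p) Q; rewrite /= size_Mmonic ?monicXn // size_polyXn.
  have [R0|R0] := eqVneq Rv 0.
    by rewrite R0 mulr0 size_poly0; have := r0; rewrite -size_poly_gt0; lia.
  rewrite mulrC size_mulX //; have : (size Rv <= m.+1)%N by exact: size_poly.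
  by move: (size r) (size Rv) (m) => u v w; clear; lia.
exists r`_0, r`_1; rewrite /ratio_eval (@horner_coef_wide _ 2) ?(leq_trans (size_poly _ _)) //.
rewrite !big_ord_recl big_ord0 /= !coef_map expr0 mulr1 expr1 addr0 El; field.
exact: a0.
Qed.
End RatioEvaluation.

Lemma homog_swap (k F : fieldType) (cst : {rmorphism k -> F}) (a b : F) n x :
  homog cst a b n x -> homog cst b a n x.
Proof.
elim=> {n x} [n|c|||n x y _ h _ h'|m n x y _ h _ h'].
- exact: homog0.
- exact: homogC.
- exact: homogb.
- exact: homoga.
- exact: homogD.
- exact: homogM.
Qed.

Lemma homog_root_integral (k F : fieldType) (cst : {rmorphism k -> F}) (a b x : F) d (l : k) G :
  a != 0 -> l != 0 -> homog_poly cst a b d (cst l) G -> G.[x] = 0 -> integralOver (ratio_eval cst (b / a)) (x / a).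
Proof.
move=> a0 l0 [sG lG hG] Gx.
have /choice[p Hp] : forall i, exists p, (i <= d)%N -> G`_i = a ^+ (d - i) * ratio_eval cst (b / a) p.
  move=> i; have [le|//] := leqP i d; last by exists 0.
  by have [p [_ E]] := homog_dehomogenize a0 (hG i le); exists p.
have cl : cst l != 0 by rewrite fmorph_eq0.
pose P := \poly_(i < d.+1) (if i == d then 1 else l^-1%:P * p i).
have Pd : P`_d = 1 by rewrite coef_poly ltnSn eqxx.
have sP : size P = d.+1 by rewrite size_poly_eq // eqxx oner_eq0.
exists P; first by rewrite monicE lead_coefE sP Pd.
apply/rootP; rewrite (@horner_coef_wide _ d.+1) ?(leq_trans (size_poly _ _)) ?sP //.
apply: (mulfI (mulf_neq0 cl (expf_neq0 d a0))); transitivity G.[x]; last by rewrite Gx mulr0.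
rewrite (horner_coef_wide _ sG) mulr_sumr.
apply: eq_bigr => -[i le] _ /=; rewrite coef_map /= coef_poly le; have le' : (i <= d)%N by [].
have ad : a ^+ d = a ^+ (d - i) * a ^+ i by rewrite -exprD subnK.
have ai : a ^+ i != 0 by rewrite expf_neq0.
have C c : ratio_eval cst (b / a) c%:P = cst c by rewrite /ratio_eval map_polyC hornerC.
case: eqP => [E|_].
  rewrite E lG (_ : ratio_eval _ _ 1 = 1); last by rewrite /ratio_eval rmorph1 hornerC.
  have ad0 : a ^+ d != 0 by rewrite expf_neq0.
  by rewrite mul1r expr_div_n; move: (a ^+ d) (x ^+ d) ad0 => u w u0; field.
rewrite ratio_evalM C Hp // ad expr_div_n fmorphV; field.
by rewrite ai cl.
Qed.

Record torsion_model (k F : fieldType) (V : finZmodType) (N ell : nat) := TorsionModel {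
  tm_const : {rmorphism k -> F};
  tm_a : F; tm_b : F; tm_X : V -> F; tm_Y : V -> F; tm_root : k;
  tm_N_gt1 : (1 < N)%N; tm_N_odd : odd N; tm_N_neq0 : (N%:R : k) != 0;
  tm_two_neq0 : (2%:R : k) != 0;
  tm_ell_gt3 : (3 < ell)%N; tm_ell_odd : odd ell; tm_ell_eq0 : ell%:R = 0 :> k;
  tm_rootP : (ell.-1).-primitive_root tm_root;
  tm_card : #|V| = (N * N)%N;
  tm_double_inj : forall v : V, v + v = 0 -> v = 0;
  tm_a_neq0 : tm_a != 0; tm_b_neq0 : tm_b != 0;
  tm_X0 : tm_X 0 = 0; tm_Y0 : tm_Y 0 = 0;
  tm_XN : forall v : V, tm_X (- v) = tm_X v;
  tm_YN : forall v : V, tm_Y (- v) = - tm_Y v;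
  tm_Y_neq0 : forall v : V, v != 0 -> tm_Y v != 0;
  tm_Y_sqr : forall v, tm_Y v ^+ 2 = 4%:R * (tm_X v * (tm_X v - tm_a) * (tm_X v - tm_b));
  tm_X_eq : forall v w : V, v != 0 -> w != 0 -> tm_X v = tm_X w -> v = w \/ v = - w;
  tm_X_add : forall v w : V, v != 0 -> w != 0 -> v - w != 0 -> v + w != 0 ->
    (tm_X v - tm_X w) ^+ 2 * (tm_X (v - w) - tm_X (v + w)) = tm_Y v * tm_Y w /\
    tm_a * (tm_X v - tm_X w) ^+ 2 * (tm_X (v + w) + tm_X (v - w)) =
    (tm_a * tm_b - tm_X v * tm_X w) ^+ 2 + tm_a ^+ 2 * (tm_X v - tm_X w) ^+ 2 -
    (tm_a * (tm_X v + tm_X w) - tm_a * tm_b - tm_X v * tm_X w) ^+ 2;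
  tm_dbl : forall v : V, v != 0 ->
    tm_X (v + v) * tm_Y v ^+ 2 = (tm_X v ^+ 2 - tm_a * tm_b) ^+ 2 /\
    tm_Y (v + v) * tm_Y v ^+ 3 = 2%:R * (tm_X v ^+ 2 - tm_a * tm_b) *
      (tm_X v ^+ 2 - 2%:R * tm_a * tm_X v + tm_a * tm_b) *
      (tm_X v ^+ 2 - 2%:R * tm_b * tm_X v + tm_a * tm_b);
  tm_divpol : exists G, homog_poly tm_const tm_a tm_b (divpol_deg N) N%:R G /\
    forall v : V, v != 0 -> G.[tm_X v] = 0;
  tm_hasse : homog tm_const tm_a tm_b ell.-1./2 1;
  tm_transc : forall p, p != 0 -> ratio_eval tm_const (tm_b / tm_a) p != 0;
  tm_transcV : forall p, p != 0 -> ratio_eval tm_const (tm_a / tm_b) p != 0 }.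
Arguments tm_double_inj {k F V N ell} t [v].
Arguments tm_Y_neq0 {k F V N ell} t [v].
Arguments tm_X_eq {k F V N ell} t [v w].
Arguments tm_X_add {k F V N ell} t [v w].
Arguments tm_dbl {k F V N ell} t [v].

Section TorsionModel.
Variables (k F : fieldType) (V : finZmodType) (N ell : nat) (T : torsion_model k F V N ell).
Local Notation cst := (tm_const T).
Local Notation a := (tm_a T).
Local Notation b := (tm_b T).
Local Notation X := (tm_X T).
Local Notation Y := (tm_Y T).
Local Notation om := (tm_root T).
Local Notation omP := (tm_rootP T).
Local Notation hmg := (homog cst a b).
Let ell_gt3 := tm_ell_gt3 T.
Let ell_odd := tm_ell_odd T.
Let hasse : hmg ell.-1./2 1 := tm_hasse T.

Lemma tm_two_neq0F : (2%:R : F) != 0.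
Proof. by rewrite -(rmorph_nat cst) fmorph_eq0 (tm_two_neq0 T). Qed.

Lemma XY_inj v w : X v = X w -> Y v = Y w -> v = w.
Proof.
have [->|v0] := eqVneq v 0.
  by rewrite (tm_Y0 T) => _ E; apply: contraTeq isT => w0; have := tm_Y_neq0 T (v := w); rewrite -E eqxx eq_sym w0 => /(_ isT).
have [->|w0] := eqVneq w 0; first by rewrite (tm_Y0 T) => _ E; have := tm_Y_neq0 T v0; rewrite E eqxx.
move=> EX EY; case: (tm_X_eq T v0 w0 EX) => // Ev; exfalso; have := tm_Y_neq0 T w0.
have : Y w + Y w = 0 by rewrite -{1}EY Ev (tm_YN T) addNr.
by rewrite -mulr2n -mulr_natl => /eqP; rewrite mulf_eq0 (negPf tm_two_neq0F) /= => ->.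
Qed.

Definition half_set := [set v : V | (enum_rank v < enum_rank (- v))%N].
Lemma half_setN (v : V) : v != 0 -> (- v \in half_set) = (v \notin half_set).
Proof.
move=> v0; rewrite !inE opprK -leqNgt [RHS]leq_eqVlt.
have -> // : (nat_of_ord (enum_rank (- v)) == enum_rank v) = false.
apply: contraNF v0 => /eqP E; have E' : - v = v by apply/enum_rank_inj/val_inj.
by apply/eqP/(tm_double_inj T); rewrite -{1}E' addNr.
Qed.
Lemma half_set_neq0 (v : V) : v \in half_set -> v != 0.
Proof. by apply: contraTneq => ->; rewrite inE oppr0 ltnn. Qed.

Lemma sum_half_set (E : V -> F) : \sum_v E v = E 0 + (\sum_(v in half_set) E v + \sum_(v in half_set) E (- v)).
Proof.
rewrite (bigD1 0) //=; congr (_ + _); rewrite (bigID (mem half_set)) /=; congr (_ + _).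
  by apply: eq_bigl => v; case h: (v \in half_set); rewrite ?andbF // andbT half_set_neq0.
rewrite (reindex_inj (@oppr_inj _)) /=; apply: eq_bigl => v.
have [->|v0] := eqVneq v 0; first by rewrite oppr0 eqxx /= ; symmetry; apply/negbTE/negP => /half_set_neq0; rewrite eqxx.
by rewrite oppr_eq0 v0 /= half_setN // negbK.
Qed.

Lemma card_half_set : #|half_set| = divpol_deg N.
Proof.
pose H' := [set v : V | - v \in half_set]; have H'E v : (v \in H') = (- v \in half_set) by rewrite inE.
have z0 : 0 \notin half_set by apply/negP => /half_set_neq0; rewrite eqxx.
have E : (#|V| = 1 + (#|half_set| + #|half_set|))%N.
  have NH : #|H'| = #|half_set|.
    rewrite -(card_imset (mem half_set) (@oppr_inj V)); apply: eq_card => v; rewrite H'E.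
    by apply/idP/imsetP => [h|[w h ->]]; [exists (- v); rewrite ?opprK|rewrite opprK].
  rewrite -cardsT (_ : [set: V] = 0 |: (half_set :|: H')); last first.
    apply/setP => v; rewrite in_setT in_setU1 in_setU H'E.
    by have [//|v0] := eqVneq v 0; rewrite half_setN // orbN.
  rewrite cardsU1 cardsU (_ : half_set :&: H' = set0) ?cards0 ?subn0 ?NH; last first.
    apply/setP => v; rewrite in_setI in_set0 H'E.
    by case h: (v \in half_set) => //=; rewrite half_setN ?h // half_set_neq0.
  by rewrite in_setU H'E oppr0 (negPf z0).
move: E; rewrite (tm_card T) (_ : N = 2 * N./2 + 1)%N ?divpol_deg_odd; last by have := tm_N_odd T; lia.
by clear; nia.
Qed.

Lemma X_half_inj : {in half_set &, injective X}.
Proof.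
move=> v w hv hw E; case: (tm_X_eq T (half_set_neq0 hv) (half_set_neq0 hw) E) => // Ev.
by move: hv; rewrite Ev half_setN ?half_set_neq0 // hw.
Qed.

Lemma divpol_prod_roots G : homog_poly cst a b (divpol_deg N) N%:R G ->
  (forall v : V, v != 0 -> G.[X v] = 0) ->
  G = N%:R *: \prod_(r <- [seq X v | v in half_set]) ('X - r%:P).
Proof.
move=> [sG lG _] rG; have N0 : (N%:R : F) != 0.
  by rewrite -(rmorph_nat cst) fmorph_eq0 (tm_N_neq0 T).
have sz : size [seq X v | v in half_set] = divpol_deg N.
  by rewrite size_map -cardE card_half_set.
have sG' : size G = (divpol_deg N).+1.
  by apply/eqP; rewrite eqn_leq sG ltnNge; apply: contra N0 => le; rewrite -lG nth_default.
have lc : lead_coef G = N%:R by rewrite lead_coefE sG'.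
rewrite -lc; apply: all_roots_prod_XsubC; first by rewrite sz.
  by apply/allP => r /imageP[v hv ->]; apply/rootP/rG/half_set_neq0.
rewrite uniq_rootsE map_inj_in_uniq ?enum_uniq // => v w; rewrite !mem_enum.
exact: X_half_inj.
Qed.

Lemma homog_psum_half m : hmg m (\sum_(v in half_set) X v ^+ m).
Proof.
have [G [hG rG]] := tm_divpol T.
have := @homog_power_sum F k cst a b [seq X v | v in half_set] N%:R G (tm_N_neq0 T).
rewrite size_map -cardE card_half_set rmorph_nat => /(_ hG (divpol_prod_roots hG rG) m).
by rewrite big_map big_enum.
Qed.

Lemma homog_psum m n : (odd n -> \sum_v X v ^+ m * Y v ^+ n = 0) /\
  (~~ odd n -> hmg (m + 3 * n./2) (\sum_v X v ^+ m * Y v ^+ n)).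
Proof.
split=> on; rewrite sum_half_set.
  rewrite -big_split /= big1 ?addr0 => [|v _]; last first.
    by rewrite (tm_XN T) (tm_YN T) exprNn -signr_odd on expr1 mulN1r mulrN addrN.
  by rewrite (tm_Y0 T) expr0n; case: n on => // n _; rewrite mulr0.
have nE : n = (2 * n./2)%N by lia.
have E v : X v ^+ m * Y v ^+ n = ('X^m * cubic a b ^+ n./2).[X v].
  by rewrite hornerM hornerXn horner_exp cubicE -(tm_Y_sqr T) -exprM -nE.
have hp : homog_poly cst a b (m + 3 * n./2) (1 * 4%:R ^+ n./2) ('X^m * cubic a b ^+ n./2).
  apply: homog_polyM; last exact: homog_polyXn (homog_poly_cubic _ _ _).
  by have := homog_polyXn m (homog_polyX cst a b); rewrite mul1n expr1n.
have S : hmg (m + 3 * n./2) (\sum_(v in half_set) ('X^m * cubic a b ^+ n./2).[X v]).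
  have := @homog_sum_roots _ _ cst a b _ [seq v <- enum V | v \in half_set] X _ _ _ _ hp.
  rewrite big_filter big_enum_cond /=; apply => i; rewrite big_filter big_enum_cond; exact: homog_psum_half.
apply: homogD; last first.
  have S1 : \sum_(v in half_set) X v ^+ m * Y v ^+ n = \sum_(v in half_set) ('X^m * cubic a b ^+ n./2).[X v].
    by apply: eq_bigr => v _; exact: E.
  have S2 : \sum_(v in half_set) X (- v) ^+ m * Y (- v) ^+ n = \sum_(v in half_set) ('X^m * cubic a b ^+ n./2).[X v].
    by apply: eq_bigr => v _; rewrite E (tm_XN T).
  by rewrite S1 S2; apply: homogD.
rewrite (tm_X0 T) (tm_Y0 T); case: m {E hp S} => [|m]; last by rewrite exprS !mul0r; apply: homog0.
case: n nE {on} => [|n] nE; last by rewrite [0 ^+ n.+1]exprS mul0r mulr0; apply: homog0.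
by rewrite !expr0 mulr1; apply: (homog_nat _ _ _ 1).
Qed.

Record coords := Coords {cA : F; cB : F; cX : V -> F; cY : V -> F}.

Inductive polyfun : (coords -> F) -> Prop :=
| polyfunC c : polyfun (fun=> cst c)
| polyfunA : polyfun cA
| polyfunB : polyfun cB
| polyfunX v : polyfun (fun e => cX e v)
| polyfunY v : polyfun (fun e => cY e v)
| polyfunD P Q : polyfun P -> polyfun Q -> polyfun (fun e => P e + Q e)
| polyfunM P Q : polyfun P -> polyfun Q -> polyfun (fun e => P e * Q e).

Lemma polyfun1 : polyfun (fun=> 1).
Proof. by have := polyfunC 1; rewrite rmorph1. Qed.
Lemma polyfunN P : polyfun P -> polyfun (fun e => - P e).
Proof.
move=> h; have := polyfunM (polyfunC (-1)) h; congr polyfun; apply: funext => e.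
by rewrite rmorphN1 mulN1r.
Qed.
Lemma polyfun_sub P Q : polyfun P -> polyfun Q -> polyfun (fun e => P e - Q e).
Proof. by move=> hP hQ; apply: polyfunD => //; apply: polyfunN. Qed.
Lemma polyfun_sum (I : Type) (r : seq I) (P : I -> coords -> F) :
  (forall i, polyfun (P i)) -> polyfun (fun e => \sum_(i <- r) P i e).
Proof.
move=> h; elim: r => [|i r IH].
  by have := polyfunC 0; congr polyfun; apply: funext => e; rewrite big_nil rmorph0.
by have := polyfunD (h i) IH; congr polyfun; apply: funext => e; rewrite big_cons.
Qed.
Lemma polyfun_prod (I : Type) (r : seq I) (P : I -> coords -> F) :
  (forall i, polyfun (P i)) -> polyfun (fun e => \prod_(i <- r) P i e).
Proof.
move=> h; elim: r => [|i r IH].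
  by have := polyfun1; congr polyfun; apply: funext => e; rewrite big_nil.
by have := polyfunM (h i) IH; congr polyfun; apply: funext => e; rewrite big_cons.
Qed.
Lemma polyfunXn P n : polyfun P -> polyfun (fun e => P e ^+ n).
Proof.
move=> h; elim: n => [|n IH]; first by have := polyfun1; congr polyfun.
by have := polyfunM h IH; congr polyfun; apply: funext => e; rewrite exprS.
Qed.

Record monomial := Monomial {mon_c : k; mon_a : nat; mon_b : nat; mon_X : V -> nat; mon_Y : V -> nat}.
Definition mon_eval (t : monomial) (e : coords) : F :=
  cst (mon_c t) * cA e ^+ mon_a t * cB e ^+ mon_b t * \prod_v (cX e v ^+ mon_X t v * cY e v ^+ mon_Y t v).

Lemma polyfun_monomials P : polyfun P -> exists s : seq monomial, forall e, P e = \sum_(t <- s) mon_eval t e.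
Proof.
pose z (_ : V) := 0%N.
have pz e : \prod_v (cX e v ^+ z v * cY e v ^+ z v) = 1 by rewrite big1 // => v _; rewrite !expr0 mulr1.
elim=> {P} [c|||v|v|P Q _ [s hs] _ [s' hs']|P Q _ [s hs] _ [s' hs']].
- by exists [:: Monomial c 0 0 z z] => e; rewrite big_seq1 /mon_eval /= pz !expr0 !mulr1.
- by exists [:: Monomial 1 1 0 z z] => e; rewrite big_seq1 /mon_eval /= pz rmorph1 !expr0 expr1 mul1r !mulr1.
- by exists [:: Monomial 1 0 1 z z] => e; rewrite big_seq1 /mon_eval /= pz rmorph1 !expr0 expr1 !mul1r !mulr1.
- exists [:: Monomial 1 0 0 (fun w => (w == v)%N : nat) z] => e; rewrite big_seq1 /mon_eval /= rmorph1 !expr0 !mul1r.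
  rewrite (bigD1 v) //= eqxx expr1 expr0 mulr1 big1 ?mulr1 // => w /negPf ->.
  by rewrite !expr0 mulr1.
- exists [:: Monomial 1 0 0 z (fun w => (w == v)%N : nat)] => e; rewrite big_seq1 /mon_eval /= rmorph1 !expr0 !mul1r.
  rewrite (bigD1 v) //= eqxx expr1 expr0 mul1r big1 ?mulr1 // => w /negPf ->.
  by rewrite !expr0 mulr1.
- by exists (s ++ s') => e; rewrite big_cat hs hs'.
- exists [seq Monomial (mon_c t * mon_c t') (mon_a t + mon_a t') (mon_b t + mon_b t') (fun v => mon_X t v + mon_X t' v)%N
     (fun v => mon_Y t v + mon_Y t' v)%N | t <- s, t' <- s'] => e.
  rewrite hs hs' big_allpairs_dep big_distrl /=; apply: eq_bigr => t _.
  rewrite big_distrr /=; apply: eq_bigr => t' _; rewrite /mon_eval /= rmorphM !exprD.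
  rewrite [in RHS](eq_bigr (fun v => (cX e v ^+ mon_X t v * cY e v ^+ mon_Y t v) *
     (cX e v ^+ mon_X t' v * cY e v ^+ mon_Y t' v))); last by move=> v _; rewrite /= !exprD; ring.
  by rewrite [in RHS]big_split /=; ring.
Qed.

Definition act (c : F) (f : V -> V) (e : coords) : coords :=
  Coords (c ^+ 2 * cA e) (c ^+ 2 * cB e) (fun v => c ^+ 2 * cX e (f v)) (fun v => c ^+ 3 * cY e (f v)).

Lemma polyfun_act c f P : polyfun P -> polyfun (fun e => P (act (cst c) f e)).
Proof.
have hc n : polyfun (fun=> cst c ^+ n) by have := polyfunC (c ^+ n); rewrite rmorphXn.
elim=> {P} [d|||v|v|P Q _ h _ h'|P Q _ h _ h'] /=.
- exact: polyfunC.
- by apply: polyfunM; [exact: hc|exact: polyfunA].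
- by apply: polyfunM; [exact: hc|exact: polyfunB].
- by apply: polyfunM; [exact: hc|exact: polyfunX].
- by apply: polyfunM; [exact: hc|exact: polyfunY].
- exact: polyfunD.
- exact: polyfunM.
Qed.

Lemma act_comp c f c' f' e : act c' f' (act c f e) = act (c * c') (f \o f') e.
Proof. by rewrite /act /=; congr Coords; try apply: funext => v; rewrite exprMn; ring. Qed.

Lemma act1_id e : act 1 id e = e.
Proof. by case: e => A B x y; rewrite /act /= !expr1n !mul1r; congr Coords; apply: funext => v; rewrite mul1r. Qed.

Definition base := Coords a b X Y.
Definition omega (i : nat) : F := cst (om ^+ i).

Definition twisted_sum (j : nat) (P : coords -> F) : F :=
  \sum_(i < ell.-1) omega i ^+ j * \sum_(f : {ffun V -> V}) P (act (omega i) f base).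

Lemma sum_omega (w : nat) :
  \sum_(i < ell.-1) omega i ^+ w = if (ell.-1 %| w)%N then ell.-1%:R else 0.
Proof.
under eq_bigr do rewrite /omega -rmorphXn /= exprAC.
rewrite -rmorph_sum /= (prim_order_dvd omP); case: eqVneq => [->|ne].
  by under eq_bigr do rewrite expr1n; rewrite sumr_const card_ord rmorph_nat.
by rewrite sum_expr_unity_root ?rmorph0 // exprAC (prim_expr_order omP) expr1n.
Qed.

Definition weight (t : monomial) : nat := (2 * (mon_a t + mon_b t) + \sum_v (2 * mon_X t v + 3 * mon_Y t v))%N.

Lemma mon_eval_act t c f e : mon_eval t (act c f e) = c ^+ weight t *
  (cst (mon_c t) * cA e ^+ mon_a t * cB e ^+ mon_b t * \prod_v (cX e (f v) ^+ mon_X t v * cY e (f v) ^+ mon_Y t v)).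
Proof.
have -> : c ^+ weight t = (c ^+ 2) ^+ mon_a t * (c ^+ 2) ^+ mon_b t * \prod_v c ^+ (2 * mon_X t v + 3 * mon_Y t v)%N.
  by rewrite prodrXr -!exprM -!exprD /weight mulnDr.
rewrite /mon_eval /= [(_ * cA e) ^+ _]exprMn [(_ * cB e) ^+ _]exprMn.
rewrite (eq_bigr (fun v => c ^+ (2 * mon_X t v + 3 * mon_Y t v)%N * (cX e (f v) ^+ mon_X t v * cY e (f v) ^+ mon_Y t v))).
  by rewrite big_split /=; ring.
move=> v _; rewrite [(_ * cX e _) ^+ _]exprMn [(_ * cY e _) ^+ _]exprMn -!exprM (exprD c (2 * _)).
by ring.
Qed.

Definition homog_class (j : nat) (x : F) := exists n, (ell.-1 %| 2 * n + j)%N /\ hmg n x.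

Lemma homog_raise n m x : hmg n x -> hmg (n + m * ell.-1./2) x.
Proof.
move=> h; elim: m => [|m IH]; first by rewrite mul0n addn0.
by rewrite mulSn addnCA -[x]mul1r; apply: homogM.
Qed.

Lemma predn_ell_half : ell.-1 = (2 * ell.-1./2)%N. Proof. by lia. Qed.

Lemma mod_eq_add h n n' : (n = n' %[mod h])%N -> exists q q', (n + q * h = n' + q' * h)%N.
Proof.
move=> E; exists (n' %/ h)%N, (n %/ h)%N.
by rewrite {1}(divn_eq n h) {2}(divn_eq n' h) E; lia.
Qed.

Lemma homog_common n n' x y : (n = n' %[mod ell.-1./2])%N -> hmg n x -> hmg n' y ->
  exists m, [/\ (m = n %[mod ell.-1./2])%N, hmg m x & hmg m y].
Proof.
move=> /mod_eq_add[q [q' E]] hx hy; exists (n + q * ell.-1./2)%N.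
split; [by rewrite addnC modnMDl|exact: homog_raise|by rewrite E; apply: homog_raise].
Qed.

Lemma dvdn_eqn_mod_half j n n' : (ell.-1 %| 2 * n + j)%N ->
  (ell.-1 %| 2 * n' + j)%N = (n' == n %[mod ell.-1./2])%N.
Proof.
rewrite {1 2}predn_ell_half /dvdn => /eqP E; have h0 : (0 < ell.-1./2)%N by lia.
transitivity (2 * n' + j == 2 * n + j %[mod 2 * ell.-1./2])%N; first by rewrite E.
by rewrite eqn_modDr -!muln_modr eqn_pmul2l.
Qed.

Lemma homog_classD j x y : homog_class j x -> homog_class j y -> homog_class j (x + y).
Proof.
move=> [n [dn hx]] [n' [dn' hy]].
have /eqP E : (n == n' %[mod ell.-1./2])%N by rewrite -(dvdn_eqn_mod_half _ dn').
have [m [Em hx' hy']] := homog_common E hx hy; exists m; split; last exact: homogD.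
by rewrite (dvdn_eqn_mod_half _ dn); apply/eqP.
Qed.

Lemma twisted_sum_monomial j t : homog_class j (twisted_sum j (mon_eval t)) \/ twisted_sum j (mon_eval t) = 0.
Proof.
have E : twisted_sum j (mon_eval t) = (if (ell.-1 %| j + weight t)%N then ell.-1%:R else 0) *
    (cst (mon_c t) * a ^+ mon_a t * b ^+ mon_b t * \prod_v \sum_u (X u ^+ mon_X t v * Y u ^+ mon_Y t v)).
  rewrite -sum_omega /twisted_sum mulr_suml; apply: eq_bigr => i _; rewrite exprD -mulrA; congr (_ * _).
  rewrite bigA_distr_bigA mulr_sumr mulr_sumr; apply: eq_bigr => f _.
  by rewrite mon_eval_act.
rewrite {}E; case: ifP => dv; last by right; rewrite mul0r.
have [/existsP[v ov]|] := boolP [exists v, odd (mon_Y t v)].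
  by right; rewrite (bigD1 v) //= (proj1 (homog_psum _ _) ov) mul0r !mulr0.
rewrite negb_exists => /forallP ev; left.
exists (0 + (mon_a t + mon_b t + \sum_v (mon_X t v + 3 * (mon_Y t v)./2)))%N; split; last first.
  apply: homogM; first exact: homog_nat.
  apply: homogM; last by apply: homog_prod => v; apply: (proj2 (homog_psum _ _)).
  apply: homogM; last by have := homogX (mon_b t) (homogb cst a b); rewrite mul1n.
  by apply: homogZ; have := homogX (mon_a t) (homoga cst a b); rewrite mul1n.
rewrite add0n [(2 * _)%N]mulnDr big_distrr /= (eq_bigr (fun v => 2 * mon_X t v + 3 * mon_Y t v)%N).
  by rewrite -/(weight t) addnC.
by move=> v _; have := ev v; lia.
Qed.

Lemma twisted_sum_sum j (s : seq monomial) :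
  twisted_sum j (fun e => \sum_(t <- s) mon_eval t e) = \sum_(t <- s) twisted_sum j (mon_eval t).
Proof.
rewrite /twisted_sum exchange_big; apply: eq_bigr => i _.
by rewrite -mulr_sumr exchange_big.
Qed.

Lemma twisted_sum_homog j P : polyfun P -> twisted_sum j P != 0 -> homog_class j (twisted_sum j P).
Proof.
move=> /polyfun_monomials[s hs]; have -> : P = (fun e => \sum_(t <- s) mon_eval t e) by apply: funext.
rewrite twisted_sum_sum; elim: s {hs} => [|t s IH]; first by rewrite big_nil eqxx.
rewrite big_cons; have [h|->] := twisted_sum_monomial j t; last by rewrite add0r.
by have [->|/IH h'] := eqVneq (\sum_(t <- s) twisted_sum j (mon_eval t)) 0; [rewrite addr0|move=> _; apply: homog_classD].
Qed.

(* [f], combined with the weight action of [om ^ i], preserves all polynomial relations between the coordinates. *)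
Definition preserves (i : nat) (f : V -> V) := forall P, polyfun P -> P (act (omega i) f base) = 0 -> P base = 0.

Lemma act_independence (s : seq {ffun V -> V}) (c : {ffun V -> V} -> F) : uniq s ->
  (forall P, polyfun P -> \sum_(f <- s) c f * P (act 1 f base) = 0) -> forall f, f \in s -> c f = 0.
Proof.
elim: s c => [|f0 s IH] c //= /andP[nf us] Hc.
have Hs f : f \in s -> c f = 0.
  move=> fs; have nef : f != f0 by apply: contraNneq nf => <-.
  have [v nv] : exists v, f v != f0 v.
    by apply/existsP; apply: contraNT nef; rewrite negb_exists => /forallP h; apply/eqP/ffunP => v; apply/eqP; have := h v; rewrite negbK.
  have K P : polyfun P -> c f * (P (act 1 f base) - P (act 1 f0 base)) = 0.
    move=> hP; apply: (IH (fun f => c f * (P (act 1 f base) - P (act 1 f0 base)))) => // Q hQ.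
    have E1 := Hc _ (polyfunM hP hQ); have E2 := Hc _ hQ; rewrite !big_cons in E1 E2.
    transitivity (c f0 * (P (act 1 f0 base) * Q (act 1 f0 base)) +
       \sum_(j <- s) c j * (P (act 1 j base) * Q (act 1 j base)) - P (act 1 f0 base) *
       (c f0 * Q (act 1 f0 base) + \sum_(j <- s) c j * Q (act 1 j base))); last first.
      by rewrite E1 E2 mulr0 subrr.
    rewrite mulrDr mulr_sumr opprD addrACA -sumrB [X in X + _](_ : _ = 0) ?add0r; last by ring.
    by apply: eq_bigr => g _; ring.
  apply: contraTeq isT => cf /=; have := K _ (polyfunX v); have := K _ (polyfunY v); move/eqP.
  rewrite mulf_eq0 (negPf cf) subr_eq0 /= !expr1n !mul1r => /eqP EY /eqP.
  rewrite mulf_eq0 (negPf cf) subr_eq0 /= => /eqP EX.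
  by rewrite (XY_inj EX EY) eqxx in nv.
move=> f; rewrite inE => /orP[/eqP ->|/Hs //].
have := Hc _ polyfun1; rewrite big_cons mulr1 big_seq big1 ?addr0 // => g fpsum.
by rewrite Hs // mul0r.
Qed.

Lemma exists_test_polyfun : exists E, [/\ polyfun E, E base != 0 &
  forall i f, (i < ell.-1)%N -> ~ preserves i f -> E (act (omega i) f base) = 0].
Proof.
have test (p : 'I_ell.-1 * {ffun V -> V}) : exists P, [/\ polyfun P, P base != 0 &
    ~ preserves p.1 p.2 -> P (act (omega p.1) p.2 base) = 0].
  have [r|nr] := pselect (preserves p.1 p.2).
    by exists (fun=> 1); split; [exact: polyfun1|exact: oner_neq0|].
  have [P [hP [P0 Pn]]] : exists P, polyfun P /\ P (act (omega p.1) p.2 base) = 0 /\ P base <> 0.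
    by apply: contrapT => nex; apply: nr => P hP E; apply: contrapT => ne; apply: nex; exists P.
  by exists P; split=> //; apply/eqP.
have [Pc HP] := choice test.
exists (fun e => \prod_(p : 'I_ell.-1 * {ffun V -> V}) Pc p e); split.
- by apply: polyfun_prod => p; have [] := HP p.
- by apply/prodf_neq0 => p _; have [] := HP p.
move=> i f li nr; rewrite (bigD1 (Ordinal li, [ffun v => f v])) //=.
have [_ _ /=] := HP (Ordinal li, [ffun v => f v]).
have -> : ([ffun v => f v] : {ffun V -> V}) = f :> (V -> V) by apply: funext => v; rewrite ffunE.
by move=> ->; rewrite ?mul0r.
Qed.

Lemma sum_twisted_sum P : \sum_(j < ell.-1) twisted_sum j P =
  ell.-1%:R * \sum_(f : {ffun V -> V}) P (act 1 f base).
Proof.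
have l1 : (0 < ell.-1)%N by move: ell_gt3; lia.
have om0 : omega 0 = 1 by rewrite /omega expr0 rmorph1.
rewrite /twisted_sum exchange_big (bigD1 (Ordinal l1)) //= [X in _ + X]big1 ?addr0.
  under eq_bigr do rewrite om0 expr1n mul1r.
  by rewrite sumr_const card_ord mulr_natl.
move=> i ni; rewrite -mulr_suml sum_expr_unity_root ?mul0r //.
  by rewrite /omega -rmorphXn exprAC (prim_expr_order omP) expr1n rmorph1.
rewrite /omega fmorph_eq1 -(prim_order_dvd omP); apply: contra ni => dv.
by apply/eqP/val_inj => /=; apply: contraTeq dv => i0; rewrite gtnNdvd // lt0n.
Qed.

Lemma exists_separating : exists j P, [/\ polyfun P, twisted_sum j P != 0 &
  forall i f, (i < ell.-1)%N -> ~ preserves i f -> P (act (omega i) f base) = 0].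
Proof.
have [E [hE E0 Enr]] := exists_test_polyfun.
apply: contrapT => nx; have Z j P : polyfun P -> twisted_sum j (fun e => E e * P e) = 0.
  move=> hP; apply/eqP; apply: contrapT => /negP ne; apply: nx; exists j, (fun e => E e * P e).
  by split=> // [|i f li nr]; [exact: polyfunM|rewrite Enr ?mul0r].
have l1 : (ell.-1%:R : F) != 0.
  rewrite -(rmorph_nat cst) fmorph_eq0 -subn1 natrB ?(leq_trans _ ell_gt3) //.
  by rewrite (tm_ell_eq0 T) sub0r oppr_eq0 oner_eq0.
suff sum0 P : polyfun P -> \sum_(f <- enum {ffun V -> V}) E (act 1 f base) * P (act 1 f base) = 0.
  have := @act_independence _ (fun f => E (act 1 f base)) (enum_uniq _) sum0 [ffun v => v].
  have -> : act 1 [ffun v => v] base = base.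
    by rewrite -[RHS]act1_id; congr act; apply: funext => v; rewrite ffunE.
  by rewrite mem_enum => /(_ isT) /eqP; rewrite (negPf E0).
move=> hP; apply: (mulfI l1); rewrite mulr0 big_enum -(sum_twisted_sum (fun e => E e * P e)).
by rewrite big1 // => j _; apply: Z.
Qed.

Lemma weight2_quotient P : polyfun P ->
  (forall i f, (i < ell.-1)%N -> preserves i f -> P (act (omega i) f base) = omega i ^+ 2 * P base) ->
  exists n x y, [/\ x != 0, hmg n x, hmg n.+1 y & P base * x = y].
Proof.
move=> hP fx; have [j [E [hE E0 En]]] := exists_separating.
have EP : P base * twisted_sum j E = twisted_sum (j + (ell - 3)) (fun e => E e * P e).
  rewrite /twisted_sum mulr_sumr; apply: eq_bigr => -[i li] _ /=.
  rewrite mulrCA exprD -mulrA; congr (_ * _); rewrite !mulr_sumr; apply: eq_bigr => f _.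
  have [r|nr] := pselect (preserves i f); last by rewrite En // mul0r !mulr0.
  have k1 : omega i ^+ ell.-1 = 1 by rewrite /omega -rmorphXn exprAC (prim_expr_order omP) expr1n rmorph1.
  have e2 : (ell.-1 = (ell - 3) + 2)%N by have := ell_gt3; lia.
  rewrite fx // -[LHS]mul1r -k1 e2 (exprD _ (ell - 3)).
  by ring.
have [n [dn hx]] := twisted_sum_homog hE E0.
have [P0|P0] := eqVneq (P base) 0.
  by exists n, (twisted_sum j E), 0; split=> //; [exact: homog0|rewrite P0 mul0r].
have S0 : twisted_sum (j + (ell - 3)) (fun e => E e * P e) != 0 by rewrite -EP mulf_neq0.
have [n' [dn' hy]] := twisted_sum_homog (polyfunM hE hP) S0.
have /eqP Em : (n.+1 == n' %[mod ell.-1./2])%N.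
  rewrite -(dvdn_eqn_mod_half _ dn').
  have -> : (2 * n.+1 + (j + (ell - 3)) = 2 * n + j + ell.-1)%N by have := ell_gt3; lia.
  by rewrite dvdn_addl.
have [q [q' E']] := mod_eq_add Em.
exists (n + q * ell.-1./2)%N, (twisted_sum j E), (twisted_sum (j + (ell - 3)) (fun e => E e * P e)); split=> //.
  exact: homog_raise.
by rewrite -addSn E'; apply: homog_raise.
Qed.

Lemma omega_neq0 i : omega i != 0.
Proof.
rewrite /omega fmorph_eq0 expf_neq0 //; apply: contra_eq_neq (prim_expr_order omP) => ->.
by rewrite expr0n gtn_eqF ?(eq_sym 0) ?oner_eq0 //; have := ell_gt3; lia.
Qed.
Lemma omegaD i j : omega (i + j) = omega i * omega j.
Proof. by rewrite /omega exprD rmorphM. Qed.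

Lemma polyfun_nat n : polyfun (fun=> n%:R).
Proof. by have := polyfunC n%:R; rewrite rmorph_nat. Qed.

Lemma preserves_comp i f j g : preserves i f -> preserves j g -> preserves (i + j) (f \o g).
Proof.
move=> hf hg P hP; rewrite omegaD -act_comp => E; apply: hg => //.
exact: (hf _ (polyfun_act (om ^+ j) g hP) E).
Qed.

Lemma preserves_id : preserves 0 id.
Proof. by move=> P hP; rewrite /omega expr0 rmorph1 act1_id. Qed.

Lemma preserves_iter i f n : preserves i f -> preserves (n * i) (iter n f).
Proof.
move=> h; elim: n => [|n IH]; first exact: preserves_id.
by have := preserves_comp h IH; rewrite mulSn; congr (preserves _ _); apply: funext => v.
Qed.

Lemma preserves_inj i f : preserves i f -> injective f.
Proof.
move=> h v w E; apply: XY_inj.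
  have := h _ (polyfun_sub (polyfunX v) (polyfunX w)); rewrite /= E subrr => /(_ erefl) /eqP.
  by rewrite subr_eq0 => /eqP.
have := h _ (polyfun_sub (polyfunY v) (polyfunY w)); rewrite /= E subrr => /(_ erefl) /eqP.
by rewrite subr_eq0 => /eqP.
Qed.

Lemma preserves_period i f : preserves i f -> exists n, (iter n.+1 f =1 id) /\ omega (n.+1 * i) = 1.
Proof.
move=> h; pose s := perm (preserves_inj h); have o0 : (0 < #[s]%g * ell.-1)%N.
  by rewrite muln_gt0 order_gt0; have := ell_gt3; lia.
exists (#[s]%g * ell.-1).-1; rewrite prednK //; split=> [v|].
  have E n : iter n f v = (s ^+ n)%g v.
    by rewrite permX; elim: n => //= n ->; rewrite permE.
  by rewrite E expgM expg_order expg1n perm1.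
by rewrite /omega mulnAC exprM exprAC (prim_expr_order omP) expr1n -?exprM ?expr1n rmorph1.
Qed.

Lemma preserves_zero i f P : preserves i f -> polyfun P -> P base = 0 -> P (act (omega i) f base) = 0.
Proof.
move=> h hP P0; have [n [En kn]] := preserves_period h.
refine (preserves_iter (n := n) h (polyfun_act (om ^+ i) f hP) _).
rewrite -/(omega i) act_comp -omegaD -mulSnr kn (_ : _ \o _ = id) ?act1_id //.
by apply: funext => v; rewrite /= -iterSr En.
Qed.

Lemma preserves_inv i f : preserves i f -> exists j g, [/\ preserves j g, cancel f g, cancel g f & omega (i + j) = 1].
Proof.
move=> h; have [n [En kn]] := preserves_period h; exists (n * i)%N, (iter n f); split.
- exact: preserves_iter.
- by move=> v; rewrite -iterSr En.
- by move=> v; rewrite -iterS En.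
- by rewrite -mulSn.
Qed.

Ltac polyfun_auto := repeat first [exact: polyfunX | exact: polyfunY | exact: polyfunA | exact: polyfunB | exact: polyfun_nat
  | apply: polyfunXn | apply: polyfun_sub | apply: polyfunD | apply: polyfunN | apply: polyfunM ].

Section PreservesAdditive.
Variables (i : nat) (f : V -> V).
Hypothesis fP : preserves i f.
Let K := omega i.
Let K0 : K != 0. Proof. exact: omega_neq0. Qed.

Lemma preserves0 : f 0 = 0.
Proof.
have := preserves_zero fP (polyfunY 0) (tm_Y0 T); rewrite /= -/K => /eqP.
rewrite mulf_eq0 expf_eq0 (negPf K0) andbF /= => E.
by apply/eqP; apply: contraTT E; exact: (tm_Y_neq0 T).
Qed.

Lemma preserves_neq0 v : v != 0 -> f v != 0.
Proof. by apply: contra => /eqP E; apply/eqP/(preserves_inj fP); rewrite E preserves0. Qed.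

Lemma preservesN v : f (- v) = - f v.
Proof.
have h1 : polyfun (fun e => cX e (- v) - cX e v) by polyfun_auto.
have h2 : polyfun (fun e => cY e (- v) + cY e v) by polyfun_auto.
have := preserves_zero fP h1; rewrite /= (tm_XN T) subrr => /(_ erefl) /eqP.
rewrite -mulrBr mulf_eq0 expf_eq0 (negPf K0) andbF /= subr_eq0 => /eqP EX.
have := preserves_zero fP h2; rewrite /= (tm_YN T) addNr => /(_ erefl) /eqP.
rewrite -mulrDr mulf_eq0 expf_eq0 (negPf K0) andbF /= addr_eq0 => /eqP EY.
by apply: XY_inj; rewrite ?(tm_XN T) ?(tm_YN T).
Qed.

Lemma preservesDbl v : f (v + v) = f v + f v.
Proof.
have [->|v0] := eqVneq v 0; first by rewrite addr0 preserves0 addr0.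
have fv0 := preserves_neq0 v0; have [d1 d2] := tm_dbl T v0; have [f1 f2] := tm_dbl T fv0.
have h1 : polyfun (fun e => cX e (v + v) * cY e v ^+ 2 - (cX e v ^+ 2 - cA e * cB e) ^+ 2) by polyfun_auto.
have h2 : polyfun (fun e => cY e (v + v) * cY e v ^+ 3 - 2%:R * (cX e v ^+ 2 - cA e * cB e) *
    (cX e v ^+ 2 - 2%:R * cA e * cX e v + cA e * cB e) * (cX e v ^+ 2 - 2%:R * cB e * cX e v + cA e * cB e)) by polyfun_auto.
have := preserves_zero fP h1; have := preserves_zero fP h2; rewrite /= d1 d2 !subrr => /(_ erefl) T2 /(_ erefl) T1.
have yf := tm_Y_neq0 T fv0; apply: XY_inj.
  apply: (mulIf (expf_neq0 2 yf)); rewrite f1.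
  apply: (mulfI (expf_neq0 8 K0)); apply/eqP; rewrite -subr_eq0 -[X in _ == X]T1 -/K.
  by apply/eqP; ring.
apply: (mulIf (expf_neq0 3 yf)); rewrite f2.
apply: (mulfI (expf_neq0 12 K0)); apply/eqP; rewrite -subr_eq0 -[X in _ == X]T2 -/K.
by apply/eqP; ring.
Qed.

Lemma preserves_add_or_opp v w : v != 0 -> w != 0 -> v - w != 0 -> v + w != 0 ->
  f (v + w) = f v + f w \/ f (v + w) = - (f v + f w).
Proof.
move=> v0 w0 n1 n2; have [fv fw] := (preserves_neq0 v0, preserves_neq0 w0).
have m1 : f v - f w != 0.
  by apply: contra n1; rewrite !subr_eq0 => /eqP/(preserves_inj fP)/eqP.
have m2 : f v + f w != 0.
  by apply: contra n2; rewrite !addr_eq0 -preservesN => /eqP/(preserves_inj fP)/eqP.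
have [d1 d2] := tm_X_add T v0 w0 n1 n2; have [e1 e2] := tm_X_add T fv fw m1 m2.
have h1 : polyfun (fun e => (cX e v - cX e w) ^+ 2 * (cX e (v - w) - cX e (v + w)) - cY e v * cY e w) by polyfun_auto.
have h2 : polyfun (fun e => cA e * (cX e v - cX e w) ^+ 2 * (cX e (v + w) + cX e (v - w)) -
  ((cA e * cB e - cX e v * cX e w) ^+ 2 + cA e ^+ 2 * (cX e v - cX e w) ^+ 2 -
  (cA e * (cX e v + cX e w) - cA e * cB e - cX e v * cX e w) ^+ 2)) by polyfun_auto.
have := preserves_zero fP h1; have := preserves_zero fP h2; rewrite /= d1 d2 !subrr => /(_ erefl) T2 /(_ erefl) T1.
have D0 : X (f v) - X (f w) != 0.
  rewrite subr_eq0; apply/eqP => /(tm_X_eq T fv fw) [E|E].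
    by rewrite E subrr eqxx in m1.
  by rewrite E addNr eqxx in m2.
have D2 := expf_neq0 2 D0.
have E1 : X (f (v - w)) - X (f (v + w)) = X (f v - f w) - X (f v + f w).
  apply: (mulfI D2); rewrite e1; apply: (mulfI (expf_neq0 6 K0)); apply/eqP.
  by rewrite -subr_eq0 -[X in _ == X]T1 -/K; apply/eqP; ring.
have E2 : X (f (v + w)) + X (f (v - w)) = X (f v + f w) + X (f v - f w).
  apply: (mulfI (mulf_neq0 (tm_a_neq0 T) D2)); rewrite e2; apply: (mulfI (expf_neq0 8 K0)); apply/eqP.
  by rewrite -subr_eq0 -[X in _ == X]T2 -/K; apply/eqP; ring.
have EX : X (f (v + w)) = X (f v + f w).
  apply: (mulfI tm_two_neq0F); transitivity (X (f (v + w)) + X (f (v - w)) - (X (f (v - w)) - X (f (v + w)))); first by ring.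
  by rewrite E1 E2; ring.
exact: (tm_X_eq T (preserves_neq0 n2) m2 EX).
Qed.

Lemma preservesD v w : f (v + w) = f v + f w.
Proof.
have [->|v0] := eqVneq v 0; first by rewrite preserves0 !add0r.
have [->|w0] := eqVneq w 0; first by rewrite preserves0 !addr0.
have [/eqP|n1] := eqVneq (v - w) 0; first by rewrite subr_eq0 => /eqP ->; rewrite preservesDbl.
have [/eqP|n2] := eqVneq (v + w) 0.
  by rewrite addr_eq0 => /eqP ->; rewrite addNr preserves0 preservesN addNr.
have [/eqP|n3] := eqVneq (v + w + w) 0.
  rewrite -addrA addr_eq0 => /eqP ->; rewrite opprD addrNK preservesN -opprD preservesN preservesDbl opprD addrNK //.
have [//|E] := preserves_add_or_opp v0 w0 n1 n2; exfalso.
have Nw : - w != 0 by rewrite oppr_eq0.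
have := @preserves_add_or_opp (v + w) (- w) n2 Nw; rewrite opprK addrK => /(_ n3 v0).
rewrite preservesN E opprD => -[] E'.
  have /(tm_double_inj T) Z : (f v + f w) + (f v + f w) = 0 by rewrite {1}E' subrK -opprD addNr.
  by have := preserves_neq0 n2; rewrite E Z oppr0 eqxx.
move: E'; rewrite !opprD !opprK -addrA -{1}[f v]addr0 => /addrI /esym /(tm_double_inj T) E'.
by have := preserves_neq0 w0; rewrite E' eqxx.
Qed.
End PreservesAdditive.

Lemma fixed_sum_integral (M : {set V}) (a' b' : F) G n x y : 0 \notin M ->
  a' != 0 -> x != 0 -> homog cst a' b' n x -> homog cst a' b' n.+1 y ->
  (\sum_(v in M) X v) * x = y ->
  homog_poly cst a' b' (divpol_deg N) (cst N%:R) G -> (forall v : V, v != 0 -> G.[X v] = 0) ->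
  (forall p, p != 0 -> ratio_eval cst (b' / a') p != 0) ->
  exists r, \sum_(v in M) X v = a' * ratio_eval cst (b' / a') r.
Proof.
set s := \sum_(v in M) X v => M0 a0 x0 hx hy E hG rG tr.
have [p [_ Ep]] := homog_dehomogenize a0 hx; have [q [_ Eq]] := homog_dehomogenize a0 hy.
have p0 : p != 0 by apply: contraNneq x0 => z; rewrite Ep z rmorph0 horner0 mulr0.
have int : integralOver (ratio_eval cst (b' / a')) (s / a').
  rewrite /s mulr_suml; apply: big_ind => [|u w|v vM].
  - exact: integral0.
  - exact: integral_add.
  - by apply: (homog_root_integral a0 (tm_N_neq0 T) hG); apply: rG; apply: contraNneq M0 => <-.
have [|r Er] := integral_ratio_eval tr p0 _ int (q := q); last first.
  by exists r; rewrite -Er mulrC divfK.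
apply: (mulfI (expf_neq0 n.+1 a0)); rewrite -[RHS]Eq -E Ep -/(ratio_eval cst (b' / a') p) exprS.
by move: (ratio_eval _ _ p) (a' ^+ n) => u w; field.
Qed.

Lemma fixed_sum_linear (M : {set V}) : 0 \notin M ->
  (forall i f, (i < ell.-1)%N -> preserves i f -> f @: M = M) ->
  exists c1 c2, \sum_(v in M) X v = cst c1 * a + cst c2 * b.
Proof.
move=> M0 hM; pose P e := \sum_(v <- enum M) cX e v.
have PE e : P e = \sum_(v in M) cX e v by rewrite /P big_enum.
have hP : polyfun P by apply: polyfun_sum => v; exact: polyfunX.
have [|n [x [y [x0 hx hy]]]] := weight2_quotient hP.
  move=> i f li fP; rewrite !PE /= -mulr_sumr -{2}(hM i f li fP) big_imset //.
  by move=> v w _ _; apply: (preserves_inj fP).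
rewrite PE /= => E; have [G [hG rG]] := tm_divpol T; rewrite -(rmorph_nat cst) in hG.
have hG' : homog_poly cst b a (divpol_deg N) (cst N%:R) G.
  by case: hG => ? ? h; split=> // i le; apply/homog_swap/h.
have [r Er] := fixed_sum_integral M0 (tm_a_neq0 T) x0 hx hy E hG rG (tm_transc T).
have [r' Er'] := fixed_sum_integral M0 (tm_b_neq0 T) x0 (homog_swap hx) (homog_swap hy) E hG' rG (tm_transcV T).
have [|c1 [c2 Ec]] := ratio_eval_linear (tm_transc T) (r := r) (r' := r') (tm_a_neq0 T) (tm_b_neq0 T) erefl.
  by rewrite -Er Er'.
by exists c1, c2; rewrite Er Ec.
Qed.
End TorsionModel.

Record diff_torsion_model (k F : fieldType) (V : finZmodType) (N ell : nat) := DiffTorsionModel {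
  dtm_model :> torsion_model k F V N ell;
  dtm_D : F -> F; dtm_c : k;
  dtm_DD : forall x y, dtm_D (x + y) = dtm_D x + dtm_D y;
  dtm_DM : forall x y, dtm_D (x * y) = dtm_D x * y + x * dtm_D y;
  dtm_DC : forall c, dtm_D (tm_const dtm_model c) = 0;
  dtm_D_ab : let a := tm_a dtm_model in let b := tm_b dtm_model in
    b * dtm_D a - a * dtm_D b = tm_const dtm_model dtm_c * (a * b * (a - b)) }.
Arguments dtm_DD {k F V N ell} d x y.
Arguments dtm_DM {k F V N ell} d x y.
Arguments dtm_DC {k F V N ell} d c.

Section RationalFunctions.
Variables (k F : fieldType) (V : finZmodType) (N ell : nat) (T : torsion_model k F V N ell).
Local Notation coords := (coords F V).
Local Notation cst := (tm_const T).
Local Notation symmetry := (preserves T 0).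
Local Notation polyfun := (polyfun T).
Definition coords_at (f : V -> V) : coords :=
  Coords (tm_a T) (tm_b T) (tm_X T \o f) (tm_Y T \o f).

Lemma coords_atE f : coords_at f = act 1 f (base T).
Proof.
by rewrite /coords_at /act /= !expr1n !mul1r; congr Coords; apply: funext => v; rewrite mul1r.
Qed.

Lemma symmetry_polyfun f P : symmetry f -> polyfun P ->
  P (coords_at id) = 0 <-> P (coords_at f) = 0.
Proof.
have om0 : omega T 0 = 1 by rewrite /omega expr0 rmorph1.
rewrite -[coords_at id]/(base T) coords_atE -om0 => hf hP; split; first exact: (preserves_zero hf hP).
exact: (hf P hP).
Qed.

Inductive ratfun : (coords -> F) -> Prop :=
| ratfun_polyfun P : polyfun P -> ratfun P
| ratfunD P Q : ratfun P -> ratfun Q -> ratfun (fun e => P e + Q e)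
| ratfunM P Q : ratfun P -> ratfun Q -> ratfun (fun e => P e * Q e)
| ratfunV P : ratfun P -> ratfun (fun e => (P e)^-1).

Lemma symmetry_polyfun_neq0 f P : symmetry f -> polyfun P -> (P (coords_at id) != 0) = (P (coords_at f) != 0).
Proof. by move=> Gf hP; congr (~~ _); apply/eqP/eqP => /(symmetry_polyfun Gf hP). Qed.

Lemma ratfun_frac P : ratfun P -> exists A B, [/\ polyfun A, polyfun B, B (coords_at id) != 0 &
  forall f, symmetry f -> P (coords_at f) = A (coords_at f) / B (coords_at f)].
Proof.
elim=> {P} [P h|P Q _ [A [B [hA hB B0 E]]] _ [A' [B' [hA' hB' B0' E']]]
  |P Q _ [A [B [hA hB B0 E]]] _ [A' [B' [hA' hB' B0' E']]]|P _ [A [B [hA hB B0 E]]]].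
- exists P, (fun=> 1); split=> //; [exact: polyfun1|exact: oner_neq0|].
  by move=> f _; rewrite divr1.
- exists (fun e => A e * B' e + A' e * B e), (fun e => B e * B' e); split.
  + by apply: polyfunD; apply: polyfunM.
  + exact: polyfunM.
  + by rewrite mulf_neq0.
  + move=> f Gf; rewrite E // E' // addf_div // -(symmetry_polyfun_neq0 Gf) //.
- exists (fun e => A e * A' e), (fun e => B e * B' e); split; try exact: polyfunM; first by rewrite mulf_neq0.
  by move=> f Gf; rewrite E // E' // mulf_div.
- have [A0|A0] := eqVneq (A (coords_at id)) 0.
    exists (fun=> 0), (fun=> 1); split; [|exact: polyfun1|exact: oner_neq0|].
      by have := polyfunC T 0; rewrite rmorph0.
    by move=> f Gf; rewrite E // ((symmetry_polyfun Gf hA).1 A0) !mul0r invr0.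
  by exists B, A; split=> // f Gf; rewrite E // invf_div.
Qed.

Lemma ratfun_zero P f : ratfun P -> symmetry f -> P (coords_at id) = 0 -> P (coords_at f) = 0.
Proof.
move=> /ratfun_frac[A [B [hA hB B0 E]]] Gf; rewrite (E _ Gf) E; last exact: preserves_id.
move=> /eqP.
rewrite mulf_eq0 invr_eq0 (negPf B0) orbF => /eqP /(symmetry_polyfun Gf hA) ->.
by rewrite mul0r.
Qed.

Definition uniform (Z : (V -> V) -> F) :=
  exists P, ratfun P /\ forall f, symmetry f -> P (coords_at f) = Z f.

Lemma eq_uniform Z Z' : (forall f, symmetry f -> Z f = Z' f) -> uniform Z -> uniform Z'.
Proof. by move=> E [P [hP EP]]; exists P; split=> // f hf; rewrite EP ?E. Qed.

Lemma uniform_zero Z f : uniform Z -> symmetry f -> Z id = 0 -> Z f = 0.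
Proof.
move=> [P [hP E]] hf; rewrite -!E //; last exact: preserves_id.
exact: ratfun_zero.
Qed.

Lemma uniform_polyfun P : polyfun P -> uniform (P \o coords_at).
Proof. by exists P; split=> //; apply: ratfun_polyfun. Qed.
Lemma uniformC c : uniform (fun=> cst c). Proof. exact: uniform_polyfun (polyfunC T c). Qed.
Lemma uniform_nat n : uniform (fun=> n%:R).
Proof. by rewrite -(rmorph_nat cst); apply: uniformC. Qed.
Lemma uniform_a : uniform (fun=> tm_a T). Proof. exact: uniform_polyfun (polyfunA T). Qed.
Lemma uniform_b : uniform (fun=> tm_b T). Proof. exact: uniform_polyfun (polyfunB T). Qed.
Lemma uniformX v : uniform (fun f => tm_X T (f v)).
Proof. exact: uniform_polyfun (polyfunX T v). Qed.
Lemma uniformY v : uniform (fun f => tm_Y T (f v)).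
Proof. exact: uniform_polyfun (polyfunY T v). Qed.
Lemma uniformD Z W : uniform Z -> uniform W -> uniform (fun f => Z f + W f).
Proof.
move=> [P [hP EP]] [Q [hQ EQ]]; exists (fun e => P e + Q e).
by split=> [|f hf]; [exact: ratfunD | rewrite EP ?EQ].
Qed.
Lemma uniformM Z W : uniform Z -> uniform W -> uniform (fun f => Z f * W f).
Proof.
move=> [P [hP EP]] [Q [hQ EQ]]; exists (fun e => P e * Q e).
by split=> [|f hf]; [exact: ratfunM | rewrite EP ?EQ].
Qed.
Lemma uniformV Z : uniform Z -> uniform (fun f => (Z f)^-1).
Proof.
move=> [P [hP EP]]; exists (fun e => (P e)^-1).
by split=> [|f hf]; [exact: ratfunV | rewrite EP].
Qed.
Lemma uniformN Z : uniform Z -> uniform (fun f => - Z f).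
Proof.
by move=> hZ; apply: eq_uniform (uniformM (uniformC (-1)) hZ) => f _; rewrite rmorphN1 mulN1r.
Qed.
Lemma uniformB Z W : uniform Z -> uniform W -> uniform (fun f => Z f - W f).
Proof. by move=> hZ hW; apply: uniformD => //; apply: uniformN. Qed.
Lemma uniformXn n Z : uniform Z -> uniform (fun f => Z f ^+ n).
Proof.
move=> hZ; elim: n => [|n IH]; first exact: (uniform_nat 1).
by apply: eq_uniform (uniformM hZ IH) => f _; rewrite exprS.
Qed.
Lemma uniform_sum (I : Type) (r : seq I) (Z : I -> (V -> V) -> F) :
  (forall i, uniform (Z i)) -> uniform (fun f => \sum_(i <- r) Z i f).
Proof.
move=> h; elim: r => [|i r IH].
  by apply: eq_uniform (uniform_nat 0) => f _; rewrite big_nil.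
by apply: eq_uniform (uniformD (h i) IH) => f _; rewrite big_cons.
Qed.
Lemma uniform_prod (I : Type) (r : seq I) (Z : I -> (V -> V) -> F) :
  (forall i, uniform (Z i)) -> uniform (fun f => \prod_(i <- r) Z i f).
Proof.
move=> h; elim: r => [|i r IH].
  by apply: eq_uniform (uniform_nat 1) => f _; rewrite big_nil.
by apply: eq_uniform (uniformM (h i) IH) => f _; rewrite big_cons.
Qed.
Lemma uniform_horner (p : {poly F}) Z :
  (forall i, uniform (fun=> p`_i)) -> uniform Z -> uniform (fun f => p.[Z f]).
Proof.
move=> hp hZ; apply: eq_uniform (uniform_sum (index_enum 'I_(size p)) _).
  by move=> f _; rewrite horner_coef.
by move=> i; apply: uniformM => //; apply: uniformXn.
Qed.
Lemma homog_uniform n x : homog cst (tm_a T) (tm_b T) n x -> uniform (fun=> x).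
Proof.
elim=> {n x} [n|c|||n x y _ hx _ hy|m n x y _ hx _ hy].
- exact: (uniform_nat 0).
- exact: uniformC.
- exact: uniform_a.
- exact: uniform_b.
- exact: uniformD.
- exact: uniformM.
Qed.
End RationalFunctions.

Section Derivation.
Variables (k F : fieldType) (V : finZmodType) (N ell : nat) (T : diff_torsion_model k F V N ell).
Local Notation cst := (tm_const T).
Local Notation a := (tm_a T).
Local Notation b := (tm_b T).
Local Notation X := (tm_X T).
Local Notation Y := (tm_Y T).
Local Notation D := (dtm_D T).
Local Notation C := (cst (dtm_c T)).
Local Notation DD := (dtm_DD T).
Local Notation DM := (dtm_DM T).
Local Notation uniform := (uniform T).

Lemma derivation_ratio : D (b / a) = - (C * (b * (a - b)) / a).
Proof.
have a0 := tm_a_neq0 T; apply: (mulIf a0); apply: (mulfI a0).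
have -> : a * (D (b / a) * a) = a * D b - b * D a.
  by have := DM (b / a) a; rewrite divfK // => ->; field.
by rewrite -opprB dtm_D_ab; field.
Qed.

Lemma derivation_map_horner (p : {poly k}) x :
  D (map_poly cst p).[x] = (map_poly cst p^`()).[x] * D x.
Proof.
rewrite (derivation_horner DD DM) deriv_map -[RHS]add0r; congr (_ + _).
rewrite -[RHS](horner0 x); congr (_.[x]); apply/polyP => i.
by rewrite (coef_map_id0 _ _ (derivation0 DD)) coef_map (dtm_DC T) coef0.
Qed.

(* Differentiating [1 = a ^ n p(b / a)] expresses [D a] rationally. *)
Lemma uniform_Da : uniform (fun=> D a).
Proof.
have a0 := tm_a_neq0 T; have [p [_ Ep]] := homog_dehomogenize a0 (tm_hasse T).
set n := ell.-1./2 in Ep; set l := b / a in Ep.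
have n0 : (n%:R : F) != 0.
  rewrite -(rmorph_nat cst) fmorph_eq0; apply/negP => /eqP n0.
  have : (2 * n).+1 = ell by rewrite /n; have := tm_ell_gt3 T; have := tm_ell_odd T; lia.
  move/(congr1 (fun m => m%:R : k)); rewrite (tm_ell_eq0 T) -natr1 natrM n0 mulr0 add0r => /eqP.
  by rewrite oner_eq0.
have -> : D a = a ^+ n.+1 * (map_poly cst p^`()).[l] * (C * (b * (a - b)) / a) / n%:R.
  have := congr1 D Ep; rewrite (derivation1 DM) DM (derivationX DM) derivation_map_horner.
  rewrite derivation_ratio => /eqP; rewrite eq_sym addr_eq0 => /eqP E.
  have an : a ^+ n = a * a ^+ n.-1 by rewrite -exprS prednK // /n; have := tm_ell_gt3 T; lia.
  apply: (mulfI n0); transitivity (a * (n%:R * a ^+ n.-1 * D a * (map_poly cst p).[l])).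
    transitivity (n%:R * D a * (a ^+ n * (map_poly cst p).[l])); first by rewrite -Ep mulr1.
    by rewrite an; ring.
  by rewrite E exprS; field; rewrite a0 n0.
have ua := uniform_a T; have ub := uniform_b T.
apply: uniformM; last exact/uniformV/uniform_nat.
apply: uniformM; last first.
  apply: uniformM; last exact: uniformV.
  by apply: uniformM; [exact: uniformC | apply: uniformM => //; apply: uniformB].
apply: uniformM; first exact: uniformXn.
apply: uniform_horner; last by apply: uniformM => //; apply: uniformV.
by move=> i; rewrite coef_map; apply: uniformC.
Qed.

Lemma uniform_Db : uniform (fun=> D b).
Proof.
have a0 := tm_a_neq0 T; have -> : D b = (b * D a - C * (a * b * (a - b))) / a.
  by rewrite -dtm_D_ab; field.
have ua := uniform_a T; have ub := uniform_b T.
apply: uniformM; last exact: uniformV.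
apply: uniformB; first exact: uniformM ub uniform_Da.
by apply: uniformM; [exact: uniformC | apply: uniformM; [apply: uniformM | apply: uniformB]].
Qed.

Lemma homog_uniform_D n x : homog cst a b n x -> uniform (fun=> D x).
Proof.
elim=> {n x} [n|c|||n x y _ hx _ hy|m n x y hx hDx hy hDy].
- by rewrite (derivation0 DD); apply: (uniform_nat T 0).
- by rewrite dtm_DC; apply: (uniform_nat T 0).
- exact: uniform_Da.
- exact: uniform_Db.
- by rewrite DD; apply: uniformD.
- rewrite DM; apply: uniformD; apply: uniformM => //.
    exact: homog_uniform hy.
  exact: homog_uniform hx.
Qed.

Lemma divpol_deriv_neq0 G v : homog_poly cst a b (divpol_deg N) N%:R G ->
  (forall v : V, v != 0 -> G.[X v] = 0) -> v != 0 -> G^`().[X v] != 0.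
Proof.
move=> hG rG v0; rewrite (divpol_prod_roots hG rG) derivZ hornerZ mulf_neq0 //.
  by rewrite -(rmorph_nat cst) fmorph_eq0 (tm_N_neq0 T).
have := separable_prod_XsubC [seq X v | v in half_set V].
rewrite map_inj_in_uniq ?enum_uniq => [|x y]; last first.
  by rewrite !mem_enum; apply: (X_half_inj (T := T)).
rewrite separable_poly.unlock => /idP cop; apply: (coprimep_root cop); rewrite root_prod_XsubC.
have [vH|vH] := boolP (v \in half_set V); first exact: image_f.
by rewrite -(tm_XN T v); apply: image_f; rewrite (half_setN T).
Qed.

Lemma uniform_DX v : uniform (fun f => D (X (f v))).
Proof.
have [->|v0] := eqVneq v 0.
  apply: eq_uniform (uniform_nat T 0) => f hf.
  by rewrite (preserves0 hf) (tm_X0 T) (derivation0 DD).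
have [G [hG rG]] := tm_divpol T; have [szG _ cG] := hG.
apply: (eq_uniform (Z := fun f => - (map_poly D G).[X (f v)] / G^`().[X (f v)])) => [f hf|].
  have w0 := preserves_neq0 hf v0; apply: (mulIf (divpol_deriv_neq0 hG rG w0)).
  rewrite divfK ?divpol_deriv_neq0 //; apply/eqP; rewrite eq_sym -addr_eq0 addrC mulrC -(derivation_horner DD DM).
  by rewrite (rG _ w0) (derivation0 DD).
apply: uniformM; [apply/uniformN | apply/uniformV]; apply: uniform_horner (uniformX T v) => i.
  rewrite (coef_map_id0 _ _ (derivation0 DD)); have [le|lt] := leqP i (divpol_deg N).
    exact: homog_uniform_D (cG i le).
  by rewrite (homog_poly_out hG lt) (derivation0 DD); apply: (uniform_nat T 0).
rewrite coef_deriv -mulr_natr; apply: uniformM (uniform_nat T _).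
have [le|lt] := leqP i.+1 (divpol_deg N); first exact: homog_uniform (cG _ le).
by rewrite (homog_poly_out hG lt); apply: (uniform_nat T 0).
Qed.

Lemma uniform_DY v : uniform (fun f => D (Y (f v))).
Proof.
have [->|v0] := eqVneq v 0.
  apply: eq_uniform (uniform_nat T 0) => f hf.
  by rewrite (preserves0 hf) (tm_Y0 T) (derivation0 DD).
have uX := uniformX T v; have ua := uniform_a T; have ub := uniform_b T.
apply: (eq_uniform (Z := fun f => 4%:R * (D (X (f v)) * (X (f v) - a) * (X (f v) - b) +
   X (f v) * (D (X (f v)) - D a) * (X (f v) - b) +
   X (f v) * (X (f v) - a) * (D (X (f v)) - D b)) / (2%:R * Y (f v)))) => [f hf|]; last first.
  apply: uniformM; last exact: uniformV (uniformM (uniform_nat T 2) (uniformY T v)).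
  apply: uniformM; first exact: uniform_nat.
  have uD := uniform_DX v; have uDa := uniform_Da; have uDb := uniform_Db.
  by do ![apply: uniformD | apply: uniformM | apply: uniformN | exact].
have y0 : 2%:R * Y (f v) != 0.
  by apply: mulf_neq0; [exact: (tm_two_neq0F T) | exact: (tm_Y_neq0 T (preserves_neq0 hf v0))].
have := congr1 D (tm_Y_sqr T (f v)); rewrite (derivationX DM) /= expr1 !DM !(derivationB DD) => E.
apply: (mulfI y0); rewrite E mulrC divfK // -(rmorph_nat cst) dtm_DC.
by ring.
Qed.

Lemma uniform_D Z : uniform Z -> uniform (fun f => D (Z f)).
Proof.
move=> [P [hP EP]]; apply: (eq_uniform (Z := fun f => D (P (coords_at T f)))) => [f hf|].
  by rewrite EP.
have uR Q : ratfun T Q -> uniform (Q \o coords_at T) by exists Q.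
elim: hP => {P Z EP} [P|P Q hP hDP hQ hDQ|P Q hP hDP hQ hDQ|P hP hDP].
- elim=> {P} [c|||v|v|P Q hP hDP hQ hDQ|P Q hP hDP hQ hDQ] /=.
  + by rewrite dtm_DC; apply: (uniform_nat T 0).
  + exact: uniform_Da.
  + exact: uniform_Db.
  + exact: uniform_DX.
  + exact: uniform_DY.
  + by apply: eq_uniform (uniformD hDP hDQ) => f _; rewrite DD.
  + have uP := uniform_polyfun hP; have uQ := uniform_polyfun hQ.
    by apply: eq_uniform (uniformD (uniformM hDP uQ) (uniformM uP hDQ)) => f _; rewrite DM.
- by apply: eq_uniform (uniformD hDP hDQ) => f _; rewrite DD.
- have uP := uR _ hP; have uQ := uR _ hQ.
  by apply: eq_uniform (uniformD (uniformM hDP uQ) (uniformM uP hDQ)) => f _; rewrite DM.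
- have uP := uniformXn 2 (uniformV (uR _ hP)).
  by apply: eq_uniform (uniformN (uniformM hDP uP)) => f _; rewrite (derivationV _ DD DM).
Qed.
End Derivation.

(** * The shear and the Weyl elements *)

Section PolynomialsInMonomial.
Variables (k : fieldType) (M : nat).
Hypothesis M0 : (0 < M)%N.
Definition poly_at (p : {poly k}) : fps k := (map_poly (@fpsC k) p).[fpsX M].

Lemma poly_atM p q : poly_at (p * q) = poly_at p * poly_at q. Proof. by rewrite /poly_at rmorphM hornerM. Qed.
Lemma poly_atX p n : poly_at (p ^+ n) = poly_at p ^+ n. Proof. by rewrite /poly_at rmorphXn horner_exp. Qed.
Lemma fcoef_poly_at p n : fcoef (poly_at p) n = if (M %| n)%N then p`_(n %/ M) else 0.
Proof.
rewrite /poly_at (@horner_coef_wide _ (size p)) ?(leq_trans (size_poly _ _)) // fcoef_sum.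
rewrite (eq_bigr (fun i : 'I_(size p) => p`_i * (n == M * i)%:R)) => [|i _]; last by rewrite coef_map -fpsXM fcoefCM.
case: (boolP (M %| n)%N) => [/dvdnP[m ->]|nd]; last first.
  by rewrite big1 // => i _; case: eqP => [E|_]; [rewrite E dvdn_mulr in nd|rewrite mulr0].
rewrite mulnK //; have [le|lt] := leqP (size p) m.
  rewrite nth_default // big1 // => i _; rewrite [(m * M)%N]mulnC eqn_pmul2l //.
  by rewrite gtn_eqF ?mulr0 // (leq_trans (ltn_ord i)).
rewrite (bigD1 (Ordinal lt)) //= mulnC eqxx mulr1 big1 ?addr0 // => i ne.
by rewrite eqn_pmul2l // -val_eqE /= eq_sym in ne *; rewrite (negPf ne) mulr0.
Qed.
Lemma fcoef_poly_at_mul p i : fcoef (poly_at p) (M * i) = p`_i.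
Proof. by rewrite fcoef_poly_at dvdn_mulr // mulKn. Qed.
Lemma feqm_poly_at m (p q : {poly k}) : (forall i, (i < m)%N -> p`_i = q`_i) -> feqm (m * M) (poly_at p) (poly_at q).
Proof.
move=> H n lt; rewrite !fcoef_poly_at; case: ifP => // /dvdnP[i E]; rewrite E mulnK //; apply: H.
by move: lt; rewrite E ltn_pmul2r.
Qed.
Lemma feqm_fpsum_poly (I : eqType) (w : I -> k) (y : I -> nat) (s : seq I) m : uniq s -> (forall i, (y i < m)%N -> i \in s) ->
  feqm (m * M) (fpsum w (fun i => M * y i)%N) (poly_at (\sum_(i <- s) (w i)%:P * 'X^(y i))).
Proof.
move=> us hs e lt; rewrite (@fpsumE _ _ _ _ e s) // => [|i Ei]; last first.
  by apply: hs; move: lt; rewrite -Ei mulnC ltn_pmul2r.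
rewrite fcoef_poly_at coef_sum; case: ifP => [/dvdnP[i ->]|nd].
  rewrite mulnK // big_mkcond; apply: eq_bigr => j _; rewrite coefCM coefXn mulnC eqn_pmul2r // eq_sym.
  by case: eqP => _; rewrite ?mulr1 ?mulr0.
by rewrite big1 // => j /eqP Ej; rewrite -Ej dvdn_mulr in nd.
Qed.
End PolynomialsInMonomial.

Lemma feqm_unitI (k : fieldType) n (u x y : fps k) : u \is a GRing.unit ->
  feqm n (u * x) (u * y) -> feqm n x y.
Proof.
move=> Uu h; rewrite -[x](mulKr Uu) -[y](mulKr Uu).
by apply: feqmM => //; apply: feqm_refl.
Qed.

Section QExpansion.
Variables (k : fieldType) (N : nat).
Hypothesis N0 : (0 < N)%N.
Hypothesis nz2 : (2%:R : k) != 0.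
Local Notation M := (4 * N ^ 2)%N.
Let M0 : (0 < M)%N. Proof. by rewrite muln_gt0 expn_gt0 N0. Qed.
Local Notation em := (@poly_at k M).

Lemma theta_exp0E n : (theta_exp N 0 n)%:Z = (N ^ 2)%:Z * ((2 * n - 1) * (2 * n - 1)).
Proof. by rewrite theta_expE -mulnn PoszM; ring. Qed.
Lemma theta_exp0_oblong n : theta_exp N 0 n = (N ^ 2 + M * `|(n * (n - 1))%R|)%N.
Proof.
apply/eqP; rewrite -eqz_nat theta_exp0E PoszD PoszM gez0_abs; last by nia.
by rewrite [(4 * _)%N%:Z]PoszM; apply/eqP; ring.
Qed.
Lemma theta_expN_sqr n : theta_exp N N%:Z n = (M * `|n| ^ 2)%N.
Proof. by apply/eqP; rewrite -eqz_nat theta_expE PoszM abszX2 -mulnn !PoszM; apply/eqP; ring. Qed.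

(* The theta series at [m = 0] divided by its leading monomial. *)
Definition theta0 (w : int -> k) : fps k := fpsum w (fun n => M * `|(n * (n - 1))%R|)%N.
Lemma fpsum_theta0 w : fpsum w (theta_exp N 0) = fpsX (N ^ 2)%N * theta0 w.
Proof.
rewrite fpsX_fpsum => [|e]; first by apply: eq_fpsum => // n; rewrite theta_exp0_oblong.
have [s hs] := finite_fibers_theta_exp N0 0 (N ^ 2 + e)%N.
by exists s => n En; apply: hs; rewrite theta_exp0_oblong En.
Qed.

Lemma feqm_theta0 w : feqm (5 * M) (theta0 w) (em ((w 0 + w 1)%:P + (w 2 + w (-1))%:P * 'X^2)).
Proof.
have -> : (w 0 + w 1)%:P + (w 2 + w (-1))%:P * 'X^2 =
    \sum_(n <- [:: 0; 1; 2; -1]) (w n)%:P * 'X^(`|(n * (n - 1))%R|).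
  by rewrite !big_cons big_nil /= !polyCD expr0; ring.
apply: feqm_fpsum_poly => // n h; have : n * (n - 1) < 5 by rewrite -(gez0_abs (_ : 0 <= n * (n - 1))) //; nia.
by rewrite !inE; nia.
Qed.
Lemma feqm_thetaN w : feqm (5 * M) (fpsum w (theta_exp N N%:Z))
  (em ((w 0)%:P + (w 1 + w (-1))%:P * 'X + (w 2 + w (-2))%:P * 'X^4)).
Proof.
rewrite (eq_fpsum (w' := w) (x' := fun n => M * `|n| ^ 2)%N) => // [|n]; last exact: theta_expN_sqr.
have -> : (w 0)%:P + (w 1 + w (-1))%:P * 'X + (w 2 + w (-2))%:P * 'X^4 =
    \sum_(n <- [:: 0; 1; -1; 2; -2]) (w n)%:P * 'X^(`|n| ^ 2).
  by rewrite !big_cons big_nil /= !polyCD expr0 expr1; ring.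
by apply: feqm_fpsum_poly => // n h; rewrite !inE; nia.
Qed.

Local Notation tau c := (theta0 (fun n : int => (- c : k) ^ n)).
Local Notation dtau := (theta0 (fun n : int => (-1 : k) ^ n * n%:~R)).
Definition quartic (x y z : k) : {poly k} := x%:P + y%:P * 'X^2 + z%:P * 'X^4.

Lemma coef_quarticM x y z x' y' z' i : (i < 5)%N -> (quartic x y z * quartic x' y' z')`_i =
  (quartic (x * x') (x * y' + y * x') (x * z' + y * y' + z * x'))`_i.
Proof.
have E : quartic x y z * quartic x' y' z' = quartic (x * x') (x * y' + y * x') (x * z' + y * y' + z * x') +
  'X^5 * ((y * z' + z * y')%:P * 'X + (z * z')%:P * 'X^3).
  by rewrite /quartic !polyCD !polyCM; ring.
by move=> lt; rewrite E coefD coefXnM lt addr0.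
Qed.

Lemma feqm_quarticM a b x y z x' y' z' : feqm (5 * M) a (em (quartic x y z)) -> feqm (5 * M) b (em (quartic x' y' z')) ->
  feqm (5 * M) (a * b) (em (quartic (x * x') (x * y' + y * x') (x * z' + y * y' + z * x'))).
Proof.
move=> ha hb; apply: feqm_trans (feqmM ha hb) _; rewrite -poly_atM //.
by apply: feqm_poly_at => // i; apply: coef_quarticM.
Qed.

Lemma feqm_tau c : c != 0 -> feqm (5 * M) (tau c) (em (quartic (1 - c) (c ^+ 2 - c^-1) 0)).
Proof.
move=> c0; have := feqm_theta0 (fun n : int => (- c) ^ n).
by rewrite expr0z expr1z -exprnP sqrrN exprN1 invrN /quartic mul0r addr0.
Qed.
Lemma feqm_dtau : feqm (5 * M) dtau (em (quartic (-1) 3%:R 0)).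
Proof.
have := feqm_theta0 (fun n : int => (-1) ^ n * n%:~R).
rewrite expr0z expr1z -exprnP sqrrN exprN1 invrN invr1 /quartic mul0r addr0.
rewrite mulr0 add0r mulr1 expr1n mul1r rmorphN1 mulrNN mulr1.
by rewrite (_ : 2%:~R + 1 = 3%:R) //; ring.
Qed.

Lemma tau_unit c : c != 0 -> c != 1 -> tau c \is a GRing.unit.
Proof.
move=> c0 c1; apply: fps_unit_coef0; rewrite unitfE (feqm_tau c0) ?muln_gt0 ?expn_gt0 ?N0 //.
by rewrite fcoef_poly_at // dvdn0 div0n /quartic !coefD !coefCM coefC !coefXn !mulr0 !addr0 subr_eq0 eq_sym.
Qed.

Definition xseries (c : k) : fps k := dtau ^+ 2 * tau (- c) ^+ 2 / (tau c ^+ 2 * tau (-1) ^+ 2).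

Lemma feqm_xseries c : c != 0 -> c != 1 -> feqm (5 * M) (xseries c)
  (em (quartic ((1 + c) ^+ 2 / (4%:R * (1 - c) ^+ 2)) (c + c^-1 + 2%:R) (c + c^-1 + 2%:R * (c ^+ 2 + c ^- 2) - 2%:R))).
Proof.
move=> c0 c1; have m1 : (-1 : k) != 0 by rewrite oppr_eq0 oner_eq0.
have Uc := tau_unit c0 c1; have U1 := tau_unit m1 (N1_neq1 nz2).
have U : tau c ^+ 2 * tau (-1) ^+ 2 \is a GRing.unit by rewrite unitrM !unitrX.
apply: (feqm_unitI U); rewrite /xseries mulrCA mulrV // mulr1.
have cN0 : - c != 0 by rewrite oppr_eq0.
rewrite !expr2.
have h1 := feqm_quarticM feqm_dtau feqm_dtau; have h2 := feqm_quarticM (feqm_tau cN0) (feqm_tau cN0).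
have h3 := feqm_quarticM (feqm_tau c0) (feqm_tau c0); have h4 := feqm_quarticM (feqm_tau m1) (feqm_tau m1).
apply: feqm_trans (feqm_quarticM h1 h2) _; apply: feqm_sym.
set P := quartic ((1 + c) ^+ 2 / _) _ _.
apply: feqm_trans (feqm_quarticM (feqm_quarticM h3 h4) (@feqm_refl _ _ (em P))) _.
have d0 : 1 - c != 0 by rewrite subr_eq0 eq_sym.
have n4 : (4%:R : k) != 0 by rewrite (_ : 4%:R = 2%:R * 2%:R :> k) ?mulf_neq0 //; ring.
have C0 : c^-1 * c = 1 by rewrite mulVf.
rewrite /P; set P1 := quartic _ _ _; set P2 := quartic _ _ _; suff -> : P1 = P2 by apply: feqm_refl.
by rewrite /P1 /P2; congr quartic; rewrite ?invrN ?invr1; field; rewrite ?c0 ?d0 ?n4 ?oppr_eq0 ?oner_eq0.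
Qed.

Lemma coef_thetaN_pow4 (w : int -> k) x : w 0 = 1 -> w 1 + w (-1) = 2%:R * x -> w 2 + w (-2) = 2%:R -> x ^+ 2 = 1 ->
  let g := fpsum w (theta_exp N N%:Z) ^+ 4 in fcoef g (M * 4) = fcoef g (M * 2).
Proof.
move=> w0 w1 w2 x2 g.
have h : feqm (5 * M) g (em ((1 + (2%:R * x)%:P * 'X + 2%:R%:P * 'X^4) ^+ 4)).
  by rewrite poly_atX //; apply: feqmX; have := feqm_thetaN w; rewrite w0 w1 w2 polyC1.
have E : (1 + (2%:R * x)%:P * 'X + 2%:R%:P * 'X^4) ^+ 4 =
  1 + (8%:R * x)%:P * 'X + 24%:R%:P * 'X^2 + (32%:R * x)%:P * 'X^3 + 24%:R%:P * 'X^4 +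
  'X^5 * ((48%:R * x)%:P + 96%:R%:P * 'X + (64%:R * x)%:P * 'X^2 + 24%:R%:P * 'X^3 + (96%:R * x)%:P * 'X^4
   + 96%:R%:P * 'X^5 + 32%:R%:P * 'X^7 + (64%:R * x)%:P * 'X^8 + 16%:R%:P * 'X^11).
  have X2 : x%:P ^+ 2 = 1 by rewrite -polyC_exp x2 polyC1.
  rewrite !polyCM !polyC_natr.
  move: (x%:P) X2 => y Y2; have Y3 : y ^+ 3 = y by rewrite exprS Y2 mulr1.
  have Y4 : y ^+ 4 = 1 by rewrite (exprM y 2 2) Y2 expr1n.
  transitivity (1 + 8%:R * y * 'X + 24%:R * y ^+ 2 * 'X^2 + 32%:R * y ^+ 3 * 'X^3 + (8%:R + 16%:R * y ^+ 4) * 'X^4 +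
    'X^5 * (48%:R * y + 96%:R * y ^+ 2 * 'X + 64%:R * y ^+ 3 * 'X^2 + 24%:R * 'X^3 + 96%:R * y * 'X^4 +
     96%:R * y ^+ 2 * 'X^5 + 32%:R * 'X^7 + 64%:R * y * 'X^8 + 16%:R * 'X^11)); first by ring.
  by rewrite Y2 Y3 Y4; ring.
have lt i : (i < 5)%N -> (M * i < 5 * M)%N by move=> li; rewrite mulnC ltn_pmul2r.
by rewrite !h ?lt // !fcoef_poly_at_mul // E !coefD !coefCM !coefXnM !coef1 !coefX !coefXn /= ?mulr0 ?mulr1 ?addr0 ?add0r.
Qed.
Lemma coef_alphaS : fcoef (alphaS k N) (M * 4) = fcoef (alphaS k N) (M * 2).
Proof.
rewrite /alphaS !fcoefCM; congr (_ * _); apply: (@coef_thetaN_pow4 (fun n : int => (- - 1) ^ n) 1) => //.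
- by rewrite opprK !exp1rz mulr1.
- by rewrite opprK !exp1rz.
- exact: expr1n.
Qed.
Lemma coef_betaS : fcoef (betaS k N) (M * 4) = fcoef (betaS k N) (M * 2).
Proof.
rewrite /betaS !fcoefCM; congr (_ * _); apply: (@coef_thetaN_pow4 (fun n : int => (- 1) ^ n) (-1)) => //.
- by rewrite expr1z exprN1 invrN1; ring.
- by rewrite -invr_expz -exprnP sqrrN expr1n invr1.
- by rewrite sqrrN expr1n.
Qed.

Variables (F : fieldType) (iota : {rmorphism fps k -> F}) (Fr : is_frac iota).
Variable T0 : iota (dtheta k N) != 0.
Let DD := theta_datum_fps N0 nz2 Fr T0.

Lemma Xcoord_xseries c : c != 0 -> c != 1 -> Xcoord DD c 0 = iota (xseries c).
Proof.
move=> c0 c1; have m1 : (-1 : k) != 0 by rewrite oppr_eq0 oner_eq0.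
have Uc := tau_unit c0 c1; have U1 := tau_unit m1 (N1_neq1 nz2).
have U : tau c ^+ 2 * tau (-1) ^+ 2 \is a GRing.unit by rewrite unitrM !unitrX.
have nz (u : fps k) : u \is a GRing.unit -> iota u != 0.
  by move=> Uu; rewrite (iota_eq0 Fr); apply: contraTneq Uu => ->; rewrite unitr0.
have X0 : iota (fpsX (N ^ 2)%N) != 0 by rewrite (iota_eq0 Fr) fpsX_neq0.
have E : iota (xseries c) * (iota (tau c) ^+ 2 * iota (tau (-1)) ^+ 2) = iota dtau ^+ 2 * iota (tau (- c)) ^+ 2.
  by rewrite -!(rmorphXn iota) -!(rmorphM iota) /xseries mulrVK.
rewrite /Xcoord /theta2 -[vtheta DD _ _]/(iota (theta N _ _)) -[vtheta DD c 0]/(iota (theta N c 0)) -[vtheta DD (-1) 0]/(iota (theta N (-1) 0)).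
rewrite -[dvtheta DD]/(iota (dtheta k N)) /theta /dtheta !fpsum_theta0 !(rmorphM iota (fpsX (N ^ 2)%N)).
apply: (mulIf (mulf_neq0 (expf_neq0 2 (nz _ Uc)) (expf_neq0 2 (nz _ U1)))); rewrite E; field.
by rewrite X0 !nz.
Qed.

Lemma sum_prim_root_expr p m (eta : k) : p.-primitive_root eta -> ~~ (p %| m)%N -> \sum_(1 <= j < p) (eta ^+ j) ^+ m = -1.
Proof.
move=> etaP nd; have p0 := prim_order_gt0 etaP; rewrite (eq_bigr (fun j => (eta ^+ m) ^+ j)) => [|j _]; last exact: exprAC.
have : \sum_(j < p) (eta ^+ m) ^+ j = 0.
  apply: sum_expr_unity_root; last by rewrite -(prim_order_dvd etaP).
  by rewrite exprAC (prim_expr_order etaP) expr1n.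
by rewrite -(big_mkord xpredT (fun j => (eta ^+ m) ^+ j)) big_ltn // expr0 addrC => /eqP; rewrite addr_eq0 => /eqP.
Qed.

(* The coefficients of [S ^ (8 N ^ 2)] and [S ^ (16 N ^ 2)] agree for [alpha] and [beta], but not for the sum. *)
Lemma sum_Xcoord_neq_alpha_beta p (eta : k) c1 c2 : p.-primitive_root eta -> odd p -> (p%:R : k) != 0 -> (1 < p)%N ->
  \sum_(1 <= i < p) Xcoord DD (eta ^+ i) 0 <> iota (fpsC c1 * alphaS k N + fpsC c2 * betaS k N).
Proof.
move=> etaP op p0 p1; have e0 : eta != 0 by rewrite (prim_root_eq0 etaP) -lt0n ltnW.
have e1 j : (0 < j < p)%N -> eta ^+ j != 1 by move=> /andP[j0 jp]; rewrite -(prim_order_dvd etaP) gtnNdvd.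
rewrite (eq_big_nat _ _ (F2 := fun i => iota (xseries (eta ^+ i)))) => [|i ip]; last first.
  by apply: Xcoord_xseries; rewrite ?expf_neq0 ?e1.
rewrite -rmorph_sum => /(proj1 Fr) E.
have lt i : (i < 5)%N -> (M * i < 5 * M)%N by move=> li; rewrite mulnC ltn_pmul2r.
have S : \sum_(1 <= j < p) (2%:R * ((eta ^+ j) ^+ 2 + (eta ^+ j) ^- 2) - 4%:R) = 0.
  transitivity (\sum_(1 <= j < p) (fcoef (xseries (eta ^+ j)) (M * 4) - fcoef (xseries (eta ^+ j)) (M * 2))).
    rewrite !big_nat; apply: eq_bigr => j jp; rewrite !feqm_xseries ?lt ?expf_neq0 ?e1 // !fcoef_poly_at_mul //.
    by rewrite /quartic !coefD !coefCM !coefC !coefXn /= !mulr0 !mulr1 !addr0 !add0r; ring.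
  move: E; set X := \sum_(1 <= j < p) _; move: (alphaS k N) (betaS k N) coef_alphaS coef_betaS => u v Eu Ev E.
  by apply/eqP; rewrite sumrB -!fcoef_sum -/X E !fcoefD !fcoefCM Eu Ev subrr.
have nd2 : ~~ (p %| 2)%N by apply/negP => /(dvdn_leq (isT : (0 < 2)%N)) le; have := op; have -> : p = 2 by lia.
have S2 := sum_prim_root_expr etaP nd2.
have S3 : \sum_(1 <= j < p) (eta ^+ j) ^- 2 = -1.
  rewrite -(@sum_prim_root_expr p (p - 2) eta etaP); last first.
    by rewrite gtnNdvd //; lia.
  rewrite !big_nat; apply: eq_bigr => j _; have u0 : eta ^+ j != 0 by rewrite expf_neq0.
  apply: (mulIf (expf_neq0 2 u0)); rewrite mulVf ?expf_neq0 // -exprD subnK //.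
  by rewrite exprAC (prim_expr_order etaP) expr1n.
move: S; rewrite sumrB -mulr_sumr big_split /= S2 S3 sumr_const_nat -[_ *+ (p - 1)]mulr_natl natrB ?(ltnW p1) // => /eqP.
rewrite (_ : _ - _ = - (2%:R * 2%:R * p%:R)); last by ring.
by rewrite oppr_eq0 !mulf_eq0 (negPf nz2) (negPf p0).
Qed.
End QExpansion.

HB.saturate prod.

Section Plane.
Variable N : nat.
Local Notation V := (('Z_N * 'Z_N)%type : finZmodType).
Definition shear (t : 'Z_N) (v : V) : V := (v.1 + t * v.2, v.2).
Definition lower_shear (t : 'Z_N) (v : V) : V := (v.1, v.2 + t * v.1).
(* The matrix [0, 1; -1, 0] at the component of the idempotent [e], the identity elsewhere. *)
Definition weyl (e : 'Z_N) (v : V) : V := ((1 - e) * v.1 + e * v.2, (1 - e) * v.2 - e * v.1).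
Definition mu_torsion (p : nat) : {set V} := [set v : V | [&& v != 0, v.2 == 0 & p%:R * v.1 == 0]].

Lemma pair_mulrn (x y : 'Z_N) n : (x, y) *+ n = (n%:R * x, n%:R * y) :> V.
Proof.
elim: n => [|n IH]; first by rewrite mulr0n !mul0r.
by rewrite mulrS IH -[n.+1]add1n natrD !mulrDl !mul1r.
Qed.
Lemma pair_mulr (x y z : 'Z_N) : (x, y) *+ z = (z * x, z * y) :> V.
Proof. by rewrite pair_mulrn natr_Zp. Qed.

Lemma weylE e v : e * e = e -> weyl e v = shear e (lower_shear (- e) (shear e v)).
Proof.
move=> ee; rewrite /weyl /shear /lower_shear /=; congr pair.
  transitivity ((1 - e * e) * v.1 + (2%:R * e - e * e * e) * v.2); last by ring.
  by rewrite !ee; ring.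
by transitivity ((1 - e * e) * v.2 - e * v.1); [rewrite ee; ring | ring].
Qed.
Lemma sum_mu_torsion (W : nmodType) (X : V -> W) p : (1 < N)%N -> (0 < p)%N -> (p %| N)%N ->
  \sum_(v in mu_torsion p) X v = \sum_(1 <= i < p) X ((N %/ p * i)%:R, 0).
Proof.
move=> N1 p0 pN; set m := (N %/ p)%N; have Em : (m * p)%N = N by rewrite divnK.
have m0 : (0 < m)%N by rewrite divn_gt0 // dvdn_leq // ltnW.
pose h (i : nat) : V := ((m * i)%:R, 0).
have h_mu i : (0 < i < p)%N -> h i \in mu_torsion p.
  move=> /andP[i0 ip]; rewrite inE /= -natrM mulnA [(p * m)%N]mulnC Em Zp_nat_eq0 // dvdn_mulr // !andbT.
  apply/eqP => /(congr1 fst) /= /eqP; rewrite Zp_nat_eq0 // -Em dvdn_pmul2l // => /dvdn_leq; lia.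
rewrite big_add1 big_mkord (_ : mu_torsion p = [set h i.+1 | i : 'I_p.-1]); last first.
  apply/setP => v; apply/idP/imsetP => [|[i _ ->]]; last by apply: h_mu; have := ltn_ord i; lia.
  case: v => x y; rewrite inE /= => /and3P[v0 /eqP y0 px]; subst y.
  have : (N %| p * x)%N by rewrite -(Zp_nat_eq0 N1) natrM natr_Zp.
  rewrite -{1}Em mulnC dvdn_pmul2l // => /dvdnP[q Eq].
  have q0 : (0 < q)%N.
    rewrite lt0n; apply: contra v0 => /eqP q0; apply/eqP; congr pair; apply: val_inj.
    by rewrite /= Eq q0.
  have qp : (q < p)%N by have := ltn_Zp N1 x; rewrite Eq -[X in (_ < X)%N]Em mulnC ltn_pmul2l.
  have qp' : (q.-1 < p.-1)%N by lia.
  by exists (Ordinal qp') => //=; rewrite /h prednK // mulnC -Eq natr_Zp.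
rewrite big_imset //= => i j _ _ /(congr1 fst) /= E; apply: val_inj.
have := ltn_ord i; have := ltn_ord j => hj hi.
have : (m * i.+1)%N = (m * j.+1)%N.
  have := congr1 val E; rewrite /= !val_Zp_nat // !modn_small //; rewrite -Em ltn_pmul2l //; lia.
by move/eqP; rewrite eqn_pmul2l // eqSS => /eqP.
Qed.
End Plane.

Record shear_torsion_model (k F : fieldType) (N ell : nat) := ShearTorsionModel {
  stm_model :> diff_torsion_model k F ('Z_N * 'Z_N)%type N ell;
  stm_sigma : {rmorphism F -> F};
  stm_sigmaC : forall c, stm_sigma (tm_const stm_model c) = tm_const stm_model c;
  stm_sigma_a : stm_sigma (tm_a stm_model) = tm_a stm_model;
  stm_sigma_b : stm_sigma (tm_b stm_model) = tm_b stm_model;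
  stm_sigmaX : forall v, stm_sigma (tm_X stm_model v) = tm_X stm_model (shear 1 v);
  stm_sigmaY : forall v, stm_sigma (tm_Y stm_model v) = tm_Y stm_model (shear 1 v);
  stm_mu_sum : forall p c1 c2, prime p -> (p %| N)%N -> \sum_(v in mu_torsion N p) tm_X stm_model v <>
    tm_const stm_model c1 * tm_a stm_model + tm_const stm_model c2 * tm_b stm_model }.

Section Twist.
Variables (k F : fieldType) (N ell : nat) (T : shear_torsion_model k F N ell).
Local Notation V := (('Z_N * 'Z_N)%type : finZmodType).

Lemma preservesMn i f : preserves T i f -> forall (v : V) n, f (v *+ n) = f v *+ n.
Proof.
move=> h v; elim=> [|n IH]; first by rewrite !mulr0n (preserves0 h).
by rewrite !mulrS (preservesD h) IH.
Qed.
Lemma preserves_line i f (x e : 'Z_N) : preserves T i f ->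
  f (x * e, 0) = (x * (f (e, 0)).1, x * (f (e, 0)).2).
Proof. by move=> h; rewrite -pair_mulr -surjective_pairing -(preservesMn h) pair_mulr mulr0. Qed.
Lemma symmetry_comp f g : preserves T 0 f -> preserves T 0 g -> preserves T 0 (f \o g).
Proof. by move=> hf hg; have := preserves_comp hf hg; rewrite addn0. Qed.

Lemma preserves_shear t : preserves T 0 (shear t).
Proof.
have sigP : preserves T 0 (shear 1).
  move=> P hP; rewrite /omega expr0 rmorph1 => E; apply: (fmorph_inj (stm_sigma T)); rewrite rmorph0 -E {E}.
  elim: hP => {P} [d|||v|v|P Q _ h _ h'|P Q _ h _ h'] /=; rewrite ?expr1n ?mul1r.
  - exact: stm_sigmaC.
  - exact: stm_sigma_a.
  - exact: stm_sigma_b.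
  - exact: stm_sigmaX.
  - exact: stm_sigmaY.
  - by rewrite rmorphD h h'.
  - by rewrite rmorphM h h'.
rewrite -[t]natr_Zp; elim: (t : nat) => [|n IH].
  rewrite (_ : shear 0%:R = id); first exact: preserves_id.
  by apply: funext => -[x y]; rewrite /shear mul0r addr0.
have := symmetry_comp sigP IH; congr (preserves _ _); apply: funext => -[x y].
by rewrite /shear /= mul1r -addrA -[n.+1]addn1 natrD mulrDl mul1r.
Qed.

Arguments preserves_shear : clear implicits.

Section AtIdempotent.
Variables (p : nat) (e : 'Z_N).
Hypothesis eP : prime_idempotent p e.
Let ee := pi_idem eP.

Lemma exists_moving_mu : exists i f, preserves T i f /\ (f (e, 0)).2 != 0.
Proof.
apply: contrapT => nx.
have H i f : preserves T i f -> (f (e, 0)).2 = 0.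
  by move=> h; apply/eqP; apply: contrapT => /negP ne; apply: nx; exists i, f.
have [|i f _ hf|c1 [c2]] := @fixed_sum_linear _ _ _ _ _ T (mu_torsion N p); first by rewrite inE eqxx.
  apply/eqP; rewrite eqEcard card_imset ?leqnn ?andbT; last exact: preserves_inj hf.
  apply/subsetP => w /imsetP[[x y]]; rewrite inE => /and3P[v0 /= /eqP y0 /eqP px] ->; subst y.
  have fx : f (x, 0) = (x * (f (e, 0)).1, 0).
    by rewrite -{1}[x](pi_fix eP px) mulrC (preserves_line _ _ hf) (H i f hf) mulr0.
  by rewrite inE (preserves_neq0 hf v0) fx /= mulrA px mul0r.
exact: stm_mu_sum (pi_prime eP) (pi_dvd eP).
Qed.

(* Conjugating the shears by a symmetry that moves the line of [(e, 0)] gives transvections along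
   another line; a further conjugation by shears makes it the line of [(0, e)]. *)
Section Conjugate.
Variables (i j : nat) (f h : V -> V).
Hypotheses (hf : preserves T i f) (hh : preserves T j h) (fh : cancel f h) (hfK : cancel h f).
Hypothesis oij : omega T (i + j) = 1.
Local Notation A := (f (e, 0)).1.
Local Notation C := (f (e, 0)).2.
Local Notation alpha := (h (1, 0)).2.
Local Notation beta := (h (0, 1)).2.

Lemma moved_line x : f (x * e, 0) = (x * A, x * C). Proof. exact: preserves_line hf. Qed.
Lemma idem_moved : e * A = A /\ e * C = C.
Proof. by have := moved_line e; rewrite ee => E; split; rewrite {2}E. Qed.
Lemma inverse_snd (v : V) : (h v).2 = alpha * v.1 + beta * v.2.
Proof.
have -> : v = (1, 0) *+ v.1 + (0, 1) *+ v.2.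
  by rewrite !pair_mulr; case: v => x y /=; congr pair; rewrite ?mulr1 ?mulr0 ?addr0 ?add0r.
rewrite (preservesD hh) !(preservesMn hh) (surjective_pairing (h (1, 0))) (surjective_pairing (h (0, 1))).
by rewrite !pair_mulr /= !mulr1 !mulr0 !addr0 !add0r mulrC [_ * beta]mulrC.
Qed.
Lemma inverse_snd_moved : alpha * A + beta * C = 0.
Proof. by rewrite -inverse_snd fh. Qed.

Variable C' : 'Z_N.
Hypothesis CC' : C * C' = e.
Lemma idem_beta : e * beta = - (alpha * A * C').
Proof.
have : (alpha * A + beta * C) * C' = 0 by rewrite inverse_snd_moved mul0r.
by rewrite mulrDl -[beta * C * C']mulrA CC' => /eqP; rewrite addrC addr_eq0 mulrC => /eqP.
Qed.
Lemma alpha_inv : exists g, alpha * g = e.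
Proof.
pose w := f (0, 1); exists (e * w.1 - A * C' * w.2).
have : alpha * w.1 + beta * w.2 = 1 by rewrite -inverse_snd /w fh.
move/(congr1 (fun z => e * z)); rewrite mulr1 mulrDr mulrA [e * (beta * _)]mulrA idem_beta => E.
by rewrite -[RHS]E; ring.
Qed.

Lemma conjugate_shear s v : f (shear (s * e) (h v)) = (v.1 + s * (h v).2 * A, v.2 + s * (h v).2 * C).
Proof.
have -> : shear (s * e) (h v) = h v + (s * (h v).2 * e, 0) :> V.
  by rewrite [h v in RHS]surjective_pairing /shear; congr pair; rewrite ?addr0 // -!mulrA [e * _]mulrC.
by rewrite (preservesD hf) hfK moved_line; case: v.
Qed.

Lemma preserves_lower_shear_conjugate : preserves T 0 (lower_shear (- e)).
Proof.
have [eA eC] := idem_moved; have [g ag] := alpha_inv; pose s := - (g * C').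
have hs := preserves_comp (preserves_comp hf (preserves_shear (s * e))) hh.
have {}hs : preserves T 0 (f \o shear (s * e) \o h) by move: hs; rewrite /preserves addn0 oij /omega expr0 rmorph1.
have := symmetry_comp (symmetry_comp (preserves_shear (- (A * C'))) hs) (preserves_shear (A * C')).
congr (preserves _ _); apply: funext => v; rewrite /= conjugate_shear inverse_snd /shear /lower_shear /=.
have K : e * (alpha * (v.1 + A * C' * v.2) + beta * v.2) = alpha * e * v.1.
  rewrite mulrDr [e * (beta * _)]mulrA idem_beta -[RHS]addr0.
  have -> : e * (alpha * (v.1 + A * C' * v.2)) = alpha * e * v.1 + alpha * (e * A) * C' * v.2 by ring.
  by rewrite eA; ring.
set y := alpha * _ + _ in K *.
have yA : y * A = alpha * e * v.1 * A by rewrite -K -{1}eA; ring.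
have yC : y * C = alpha * e * v.1 * C by rewrite -K -{1}eC; ring.
rewrite -!mulrA [y * A]yA [y * C]yC; congr pair.
  transitivity (v.1 + s * alpha * e * v.1 * (A - A * (C * C'))); first by ring.
  by rewrite CC' [A * e]mulrC eA subrr mulr0 addr0.
transitivity (v.2 - (alpha * g) * (C * C') * e * v.1); first by rewrite /s; ring.
by rewrite ag CC' !ee mulNr.
Qed.
End Conjugate.

Lemma preserves_lower_shear : preserves T 0 (lower_shear (- e)).
Proof.
have [i [f [hf C0]]] := exists_moving_mu; have [j [h [hh fh hfK oij]]] := preserves_inv hf.
have [_ eC] := idem_moved hf; have [C' [_ CC']] := pi_unit eP eC C0.
exact (preserves_lower_shear_conjugate hf hh fh hfK oij CC').
Qed.

Lemma preserves_weyl : preserves T 0 (weyl e).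
Proof.
rewrite (_ : weyl e = shear e \o lower_shear (- e) \o shear e); last first.
  by apply: funext => v; rewrite weylE.
by apply: symmetry_comp (preserves_shear e); apply: symmetry_comp (preserves_shear e) preserves_lower_shear.
Qed.
End AtIdempotent.
End Twist.

(* Such a quotient is a non-constant power series with constant term 1, hence transcendental. *)
Lemma ratio_eval_fps_neq0 (k F : fieldType) (iota : {rmorphism fps k -> F}) (A B : fps k) p : is_frac iota ->
  fcoef A 0 != 0 -> fcoef B 0 = fcoef A 0 -> A != B -> p != 0 ->
  ratio_eval (iota \o @fpsC k) (iota B / iota A) p != 0.
Proof.
move=> Fr A0 BA AB p0; have UA : A \is a GRing.unit by apply: fps_unit_coef0; rewrite unitfE.
pose L := B / A; have EL : iota B / iota A = iota L.
  have nA : iota A != 0 by rewrite (iota_eq0 Fr); apply: contraNneq A0 => ->.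
  by apply: (mulIf nA); rewrite divfK // -rmorphM /L mulrVK.
rewrite {}EL.
have L0 : const_coef L = 1.
  have : const_coef L * const_coef A = const_coef B by rewrite -(rmorphM (@const_coef k)) /L mulrVK.
  by rewrite [const_coef B]BA -[X in _ = X]mul1r => /(mulIf A0).
have L1 : L - 1 != 0.
  by apply: contraNneq AB => /eqP; rewrite subr_eq0 => /eqP E; rewrite -[B](mulrVK UA) -/L E mul1r.
have Ev (q : {poly k}) : ratio_eval (iota \o @fpsC k) (iota L) q = iota (map_poly (@fpsC k) q).[L].
  by rewrite /ratio_eval map_poly_comp horner_map.
have [m [q /implyP/(_ p0) rq Ep]] := multiplicity_XsubC p 1.
rewrite Ev (iota_eq0 Fr) Ep rmorphM rmorphXn rmorphB /= map_polyX map_polyC /= hornerM horner_exp hornerXsubC.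
rewrite rmorph1 mulf_neq0 ?expf_neq0 //; apply: contra rq => /eqP E.
have := congr1 (@const_coef k) E; rewrite -(horner_map (@const_coef k)) /= L0 -map_poly_comp rmorph0.
rewrite (_ : map_poly _ q = q) => [/eqP//|]; last by apply: map_poly_id => x.
Qed.

Section TateModel.
Variables (k F : fieldType) (ell N : nat) (S : tate_setup k F ell N).
Local Notation V := ('Z_N * 'Z_N)%type.
Local Notation iota := (ts_iota S).
Local Notation Fr := (ts_frac S).
Local Notation xi := (ts_xi S).
Local Notation xiP := (ts_xiP S).
Local Notation N1 := (ts_N_gt1 S).
Local Notation N0 := (ts_N_gt0 S).
Local Notation k2 := (ts_two_neq0 S).
Local Notation W := (tate_theta S).
Local Notation a := (alpha W).
Local Notation b := (beta W).
Local Notation X := (torsX S).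
Local Notation Y := (torsY S).
Local Notation zeta := (zeta S).

Definition tate_const : {rmorphism k -> F} := iota \o @fpsC k.
Local Notation cF := tate_const.

Lemma alpha_beta_iota : a = iota (alphaS k N) /\ b = iota (betaS k N).
Proof. exact: (alpha_beta_rmorph N0 k2 (D := W) k2). Qed.

Lemma tate_hasse : homog cF a b ell.-1./2 1.
Proof.
have [-> ->] := alpha_beta_iota; rewrite -(rmorph1 iota).
apply: homog_map (hasse N0 k2 (ts_ell_prime S) (ltnW (ts_ell_gt3 S)) (ts_pchar S)) => c.
by exists c%:~R; rewrite !rmorph_int.
Qed.

Lemma tate_divpol : exists G, homog_poly cF a b (divpol_deg N) N%:R G /\ forall v : V, v != 0 -> G.[X v] = 0.
Proof.
have [G [[s e h] r]] := torsion_divpol S; exists G; split=> //; split=> // i le.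
by apply: (homog_map (psi := idfun)) (h i le) => c; exists c%:~R; rewrite !rmorph_int.
Qed.

Lemma theta_half_coef0 (c : k) : c != 0 -> fcoef (theta N c N%:Z) 0 = 1.
Proof.
move=> c0; have x0 : theta_exp N N%:Z 0 = 0%N by apply/eqP; rewrite -eqz_nat theta_expE; apply/eqP; ring.
rewrite -[X in fcoef _ X = _]x0 fcoef_fpsum1 //= => n; rewrite x0 => /eqP; rewrite -eqz_nat theta_expE subrr addr0.
by rewrite expf_eq0 /= !mulf_eq0 /= eqz_nat -leqn0 leqNgt N0 => /eqP.
Qed.
Lemma alphaS_coef0 : fcoef (alphaS k N) 0 = 4%:R^-1.
Proof.
have := theta_half_coef0 (_ : -1 != 0); rewrite oppr_eq0 oner_eq0 /alphaS => /(_ isT).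
by move: (theta N _ _) => x Ex; rewrite fcoefCM fcoef0_exp Ex expr1n mulr1.
Qed.
Lemma betaS_coef0 : fcoef (betaS k N) 0 = 4%:R^-1.
Proof.
have := theta_half_coef0 (oner_neq0 k); rewrite /betaS.
by move: (theta N _ _) => x Ex; rewrite fcoefCM fcoef0_exp Ex expr1n mulr1.
Qed.
Lemma alphaS_neq_betaS : alphaS k N != betaS k N.
Proof.
have : a - b != 0.
  rewrite alpha_sub_beta ?N0 ?k2 //.
  by rewrite !mulf_neq0 ?invr_eq0 ?mulf_neq0 ?expf_neq0 ?dvtheta_neq0 ?theta2_neq0 ?theta3_neq0 ?theta4_neq0 ?N0 ?k2.
by have [-> ->] := alpha_beta_iota; rewrite subr_eq0 (iota_eq Fr).
Qed.

Lemma tate_transc p : p != 0 -> ratio_eval cF (b / a) p != 0.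
Proof.
have [-> ->] := alpha_beta_iota; apply: ratio_eval_fps_neq0 Fr _ _ alphaS_neq_betaS.
  by rewrite alphaS_coef0 invr_eq0 (four_neq0 k2).
exact: etrans betaS_coef0 (esym alphaS_coef0).
Qed.
Lemma tate_transcV p : p != 0 -> ratio_eval cF (a / b) p != 0.
Proof.
have [-> ->] := alpha_beta_iota; have AB := alphaS_neq_betaS; rewrite eq_sym in AB.
apply: ratio_eval_fps_neq0 Fr _ _ AB; first by rewrite betaS_coef0 invr_eq0 (four_neq0 k2).
exact: etrans alphaS_coef0 (esym betaS_coef0).
Qed.

Definition tate_torsion_model : torsion_model k F V N ell.
Proof.
refine (@TorsionModel k F V N ell cF a b X Y (ts_omega S) N1 (ts_N_odd S) (ts_N_neq0 S) k2 (ts_ell_gt3 S)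
  (odd_ell (ts_ell_prime S) (ltnW (ts_ell_gt3 S))) (pcharf0 (ts_pchar S)) (ts_omegaP S) _ _
  (alpha_neq0 W N0 k2) (beta_neq0 W N0 k2) (torsX0 S) (torsY0 S) (fun v => (torsXYN S v).1) (fun v => (torsXYN S v).2)
  (@torsY_neq0 _ _ _ _ S) (torsY_sqr S) (@torsX_eq _ _ _ _ S) (@torsX_add _ _ _ _ S) (@tors_dbl _ _ _ _ S)
  tate_divpol tate_hasse tate_transc tate_transcV).
- by rewrite card_prod !card_ord Zp_cast // N1.
- by move=> v h; apply/eqP; apply: contraTT isT => /(int_pair_dbl_neq0 S); rewrite h eqxx.
Defined.

Definition tate_deriv : F -> F := fracder Fr (@fderiv k).
Lemma tate_deriv_iota x : tate_deriv (iota x) = iota (fderiv x).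
Proof. exact: (fracder_iota Fr (@fderivM k)). Qed.
Lemma tate_derivC c : tate_deriv (cF c) = 0.
Proof. by rewrite /= tate_deriv_iota fderivC rmorph0. Qed.
Lemma tate_deriv_ab : b * tate_deriv a - a * tate_deriv b = cF (16 * N ^ 2)%:R * (a * b * (a - b)).
Proof.
have [Ea Eb] := alpha_beta_iota; have := alphaS_betaS_deriv N0 k2; move: Ea Eb.
move: (alphaS k N) (betaS k N) => A B -> -> /(congr1 iota).
rewrite !tate_deriv_iota (rmorphB iota) !(rmorphM iota _ (fderiv _)) => ->.
rewrite (rmorphM iota _ (A * B * _)) (rmorphM iota (A * B)) (rmorphM iota A) (rmorphB iota).
by congr (_ * _); rewrite (rmorph_nat iota) (rmorph_nat cF).
Qed.

Definition tate_diff_model : diff_torsion_model k F V N ell :=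
  @DiffTorsionModel k F V N ell tate_torsion_model tate_deriv (16 * N ^ 2)%:R
    (fracderD Fr (@fderivD k) (@fderivM k)) (fracderM Fr (@fderivM k)) tate_derivC tate_deriv_ab.

Lemma xi_neq0 : xi != 0.
Proof. by rewrite (prim_root_eq0 xiP) expn_eq0 andbT -lt0n N0. Qed.

Lemma fscale_inj : injective (fscale xi : fps k -> fps k).
Proof.
move=> f g E; apply: fpsP => n; have /= := congr1 (fun h => fcoef h n) E.
by apply: mulfI; rewrite expf_neq0 // xi_neq0.
Qed.
Lemma tate_sigma_exists : exists s : {rmorphism F -> F}, forall x, s (iota x) = iota (fscale xi x).
Proof.
pose ph : {rmorphism fps k -> fps k} := fscale xi; have inj : injective ph := fscale_inj.
pose H1 := GRing.isZmodMorphism.Build _ _ (fracmap Fr ph) (fracmap_zmod Fr inj).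
pose H2 := GRing.isMonoidMorphism.Build _ _ (fracmap Fr ph) (fracmap_monoid Fr inj).
pose s : {rmorphism F -> F} := HB.pack (fracmap Fr ph) H1 H2.
by exists (s inj inj) => x; exact: (fracmap_iota Fr inj).
Qed.
Definition tate_sigma : {rmorphism F -> F} := projT1 (cid tate_sigma_exists).
Local Notation sig := tate_sigma.
Lemma tate_sigma_iota x : sig (iota x) = iota (fscale xi x).
Proof. exact: (projT2 (cid tate_sigma_exists)). Qed.

Lemma xi_expN2 (z : int) : xi ^ ((N ^ 2)%:Z * z) = 1.
Proof. by rewrite -exprz_exp -exprnP (prim_expr_order xiP) exp1rz. Qed.
Lemma xi_exp8N (z : int) : xi ^ (8 * N%:Z * z) = zeta ^ z.
Proof. by rewrite -exprz_exp -PoszM -exprnP. Qed.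

Lemma fscale_fpsum0 (w : int -> k) : fscale xi (fpsum w (theta_exp N 0)) = fpsum w (theta_exp N 0).
Proof.
rewrite fscale_fpsum; apply: eq_fpsum => [n|//].
by rewrite exprnP theta_exp0E xi_expN2 mul1r.
Qed.
Lemma fscale_fpsumN (w : int -> k) : fscale xi (fpsum w (theta_exp N N%:Z)) = fpsum w (theta_exp N N%:Z).
Proof.
rewrite fscale_fpsum; apply: eq_fpsum => [n|//].
by rewrite exprnP theta_expE (_ : _ ^+ 2 = (N ^ 2)%:Z * (4 * n * n)) ?xi_expN2 ?mul1r // -mulnn PoszM; ring.
Qed.

Lemma fscale_theta (c : k) (j : int) : c != 0 ->
  fscale xi (theta N c (2 * j)) = fpsC (xi ^ ((2 * j - N%:Z) ^+ 2)) * theta N (c * zeta ^ j) (2 * j).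
Proof.
move=> c0; rewrite /theta fscale_fpsum -fpsumZ; apply: eq_fpsum => [n|//]; have x0 := xi_neq0.
have -> : - (c * zeta ^ j) = (- c) * zeta ^ j by rewrite mulNr.
rewrite exprnP theta_expE expfzMl mulrCA [in RHS]mulrC -mulrA; congr (_ * _).
rewrite exprz_exp -xi_exp8N -expfzDr //.
rewrite (_ : _ ^+ 2 = (N ^ 2)%:Z * (4 * n * n - 4 * n) + (8 * N%:Z * (j * n) + (2 * j - N%:Z) ^+ 2)).
  by rewrite [LHS]expfzDr // xi_expN2 mul1r addrC.
by rewrite -mulnn PoszM; ring.
Qed.

Lemma tate_sigmaC c : sig (cF c) = cF c.
Proof.
rewrite -[cF c]/(iota (fpsC c)) tate_sigma_iota; apply: (congr1 iota); apply: fpsP => -[|n] /=; first by rewrite mul1r.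
by rewrite mulr0.
Qed.
Lemma sigma_vtheta (c : k) j : c != 0 -> sig (vtheta W c (2 * j)) = cF (xi ^ ((2 * j - N%:Z) ^+ 2)) * vtheta W (c * zeta ^ j) (2 * j).
Proof. by move=> c0; rewrite -[vtheta W c _]/(iota (theta N c (2 * j))) tate_sigma_iota fscale_theta // rmorphM. Qed.
Lemma sigma_dvtheta : sig (dvtheta W) = dvtheta W.
Proof. by rewrite -[dvtheta W]/(iota (dtheta k N)) tate_sigma_iota /dtheta fscale_fpsum0. Qed.
Lemma sigma_theta2 : sig (theta2 W) = theta2 W.
Proof. by rewrite /theta2 -[vtheta W _ _]/(iota (theta N (-1) 0)) tate_sigma_iota /theta fscale_fpsum0. Qed.
Lemma sigma_alpha_beta : sig a = a /\ sig b = b.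
Proof.
have H3 : sig (theta3 W) = theta3 W by rewrite /theta3 -[vtheta W _ _]/(iota (theta N (-1) N%:Z)) tate_sigma_iota /theta fscale_fpsumN.
have H4 : sig (theta4 W) = theta4 W by rewrite /theta4 -[vtheta W _ _]/(iota (theta N 1 N%:Z)) tate_sigma_iota /theta fscale_fpsumN.
rewrite (betaE W) (alphaE W); move: sigma_dvtheta sigma_theta2 H3 H4; move: (dvtheta W) (theta2 W) (theta3 W) (theta4 W) => t x2 x3 x4 e e2 e3 e4.
have alg y z w : sig y = y -> sig z = z -> sig w = w -> sig (t ^+ 2 * y ^+ 2 / (z ^+ 2 * w ^+ 2)) = t ^+ 2 * y ^+ 2 / (z ^+ 2 * w ^+ 2).
  move=> ey ez ew; rewrite (rmorphM sig) (fmorphV sig) (rmorphM sig (t ^+ 2)) (rmorphM sig (z ^+ 2)).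
  by rewrite !(rmorphXn sig) e ey ez ew.
by split; apply: alg.
Qed.
Lemma rmorph_Xfrac (s : {rmorphism F -> F}) t x xm xc ym yc u : u != 0 -> s t = t -> s x = x ->
  s xm = u * ym -> s xc = u * yc ->
  s (t ^+ 2 * xm ^+ 2 / (xc ^+ 2 * x ^+ 2)) = t ^+ 2 * ym ^+ 2 / (yc ^+ 2 * x ^+ 2).
Proof.
move=> u0 et ex em ec; rewrite (rmorphM s) (fmorphV s) (rmorphM s (t ^+ 2)) (rmorphM s (xc ^+ 2)).
rewrite !(rmorphXn s) et ex em ec !exprMn (invfM (u ^+ 2 * _)) (invfM (u ^+ 2)) (invfM (yc ^+ 2)).
have -> : t ^+ 2 * (u ^+ 2 * ym ^+ 2) * (u ^- 2 * yc ^- 2 * x ^- 2) =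
  (u ^+ 2 * u ^- 2) * (t ^+ 2 * ym ^+ 2 * (yc ^- 2 * x ^- 2)) by ring.
by rewrite mulfV ?expf_neq0 // mul1r.
Qed.
Lemma rmorph_Yfrac (s : {rmorphism F -> F}) d z t x2 x1 y2 y1 u : u != 0 -> s d = d -> s t = t ->
  s x2 = z * u ^+ 4 * y2 -> s x1 = u * y1 ->
  s (d * x2 * t ^+ 3 / x1 ^+ 4) = d * z * y2 * t ^+ 3 / y1 ^+ 4.
Proof.
move=> u0 ed et e2 e1; rewrite (rmorphM s) (fmorphV s) (rmorphM s (d * x2)) (rmorphM s d).
rewrite !(rmorphXn s) et ed e1 e2 !exprMn (invfM (u ^+ 4)).
have -> : d * (z * u ^+ 4 * y2) * t ^+ 3 * (u ^- 4 * y1 ^- 4) =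
  (u ^+ 4 * u ^- 4) * (d * z * y2 * t ^+ 3 * y1 ^- 4) by ring.
by rewrite mulfV ?expf_neq0 // mul1r.
Qed.
Lemma sigma_Xcoord (c : k) j : c != 0 -> sig (Xcoord W c (2 * j)) = Xcoord W (c * zeta ^ j) (2 * j).
Proof.
move=> c0; have cN0 : - c != 0 by rewrite oppr_eq0.
have u0 : cF (xi ^ ((2 * j - N%:Z) ^+ 2)) != 0 by rewrite fmorph_eq0 expfz_neq0 // xi_neq0.
have E := sigma_vtheta j cN0; rewrite mulNr in E.
exact: (rmorph_Xfrac u0 sigma_dvtheta sigma_theta2 E (sigma_vtheta j c0)).
Qed.
Lemma sigma_Ycoord (c : k) j : c != 0 -> sig (Ycoord W c (2 * j)) = Ycoord W (c * zeta ^ j) (2 * j).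
Proof.
move=> c0; have c20 : c ^+ 2 != 0 by rewrite expf_neq0.
have E2 : (c * zeta ^ j) ^+ 2 = c ^+ 2 * zeta ^ (2 * j).
  by rewrite exprMn; congr (_ * _); rewrite -[(_ ^ j) ^+ 2]/((zeta ^ j) ^ 2) exprz_exp mulrC.
pose u := cF (xi ^ ((2 * j - N%:Z) ^+ 2)).
have u0 : u != 0 by rewrite fmorph_eq0 expfz_neq0 // xi_neq0.
have Eu : cF (xi ^ ((2 * (2 * j) - N%:Z) ^+ 2)) = cF (zeta ^ j) * u ^+ 4.
  rewrite /u -(rmorphXn cF) -(rmorphM cF); apply: (congr1 cF).
  rewrite -xi_exp8N -[(xi ^ _) ^+ 4]/((xi ^ ((2 * j - N%:Z) ^+ 2)) ^ 4) exprz_exp -expfzDr ?xi_neq0 //.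
  rewrite -[LHS]mulr1 -(xi_expN2 3) -expfzDr ?xi_neq0 //; congr (_ ^ _); rewrite -mulnn PoszM; ring.
have E := sigma_vtheta (2 * j) c20; rewrite Eu -E2 in E.
rewrite [RHS]/Ycoord -[cst W (c * _)]/(cF (c * zeta ^ j)) (rmorphM cF).
exact: (rmorph_Yfrac u0 (tate_sigmaC c) sigma_dvtheta E (sigma_vtheta j c0)).
Qed.
Lemma sigma_torsXY (v : V) : sig (X v) = X (shear 1 v) /\ sig (Y v) = Y (shear 1 v).
Proof.
have z0 : zeta != 0 by rewrite /zeta expf_neq0 // xi_neq0.
have [->|v0] := eqVneq v 0.
  rewrite (_ : shear 1 0 = 0); last by rewrite /shear mulr0 addr0.
  by rewrite torsX0 torsY0 !(rmorph0 sig).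
have [i [j [nz ->]]] := int_point_ex S v0.
have nz' : ~~ ((N%:Z %| i + j)%Z && (N%:Z %| j)%Z).
  by apply: contra nz => /andP[d1 d2]; rewrite d2 andbT; move: d1; rewrite rpredDr.
have -> : shear 1 (@int_point N i j) = @int_point N (i + j) j by rewrite /shear /int_point /= mul1r rmorphD.
have [<- <-] := tors_int_point S nz; have [<- <-] := tors_int_point S nz'.
by rewrite sigma_Xcoord ?sigma_Ycoord ?expfz_neq0 // expfzDr.
Qed.

Lemma sum_mu_torsX p c1 c2 : prime p -> (p %| N)%N ->
  \sum_(v in mu_torsion N p) X v <> cF c1 * a + cF c2 * b.
Proof.
move=> pp pN; have p1 := prime_gt1 pp; rewrite sum_mu_torsion ?prime_gt0 ?N1 //.
set m := (N %/ p)%N; have Em : (m * p)%N = N by rewrite divnK.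
have etaP : p.-primitive_root (zeta ^+ m).
  have := exp_prim_root (zetaP S) m.
  have /gcdn_idPl -> : (m %| N)%N by rewrite -Em dvdn_mulr.
  have m0 : (0 < m)%N by rewrite divn_gt0 ?prime_gt0 // dvdn_leq ?N0.
  by have -> : (N %/ m)%N = p by rewrite -{1}Em mulKn.
rewrite (eq_big_nat _ _ (F2 := fun i => Xcoord W ((zeta ^+ m) ^+ i) 0)) => [|i /andP[i0 ip]]; last first.
  have nz : ~~ ((N%:Z %| (m * i)%:Z)%Z && (N%:Z %| 0)%Z).
    rewrite dvdz0 andbT dvdzE !absz_nat -{1}Em dvdn_pmul2l ?gtnNdvd //.
    by rewrite divn_gt0 ?prime_gt0 // dvdn_leq ?N0.
  rewrite (_ : (_, 0) = int_point N (m * i)%:Z 0); last by rewrite /int_point rmorph0.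
  by have [<- _] := tors_int_point S nz; rewrite mulr0 -exprnP exprM.
have -> : cF c1 * a + cF c2 * b = iota (fpsC c1 * alphaS k N + fpsC c2 * betaS k N).
  have [-> ->] := alpha_beta_iota; move: (alphaS k N) (betaS k N) => A B.
  by rewrite (rmorphD iota) (rmorphM iota _ A) (rmorphM iota _ B).
apply: (sum_Xcoord_neq_alpha_beta etaP) => //; first exact: dvdn_odd pN (ts_N_odd S).
exact: prim_root_natf_neq0 etaP.
Qed.

Definition tate_shear_model : shear_torsion_model k F N ell :=
  @ShearTorsionModel k F N ell tate_diff_model sig tate_sigmaC sigma_alpha_beta.1 sigma_alpha_beta.2
    (fun v => (sigma_torsXY v).1) (fun v => (sigma_torsXY v).2) sum_mu_torsX.
End TateModel.

(** * Eta quotients and local operators *)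

Section UniformFunctions.
Variables (k F : fieldType) (N ell : nat) (T : shear_torsion_model k F N ell).
Local Notation V := (('Z_N * 'Z_N)%type : finZmodType).

Definition uniform_fun (Psi : V -> F) := forall v, uniform T (fun f => Psi (f v)).

Lemma uniform_fun_lin (I : Type) (s : seq I) (c : I -> k) (x : I -> V) Psi f : uniform_fun Psi -> preserves T 0 f ->
  \sum_(i <- s) tm_const T (c i) * Psi (x i) = 0 -> \sum_(i <- s) tm_const T (c i) * Psi (f (x i)) = 0.
Proof.
move=> uP hf; apply: (uniform_zero (Z := fun f => \sum_(i <- s) tm_const T (c i) * Psi (f (x i))) _ hf).
by apply: uniform_sum => i; apply: uniformM; [exact: uniformC | exact: uP].
Qed.

Definition eta_factor (w : V) : F := tm_Y T w / (tm_X T w - tm_X T (w + w)).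
Definition eta_quot (v : V) : F := \prod_(1 <= i < (pred_half N).+1) eta_factor (v *+ i).

Lemma uniform_eta_quot : uniform_fun eta_quot.
Proof.
have uX w n : uniform T (fun f => tm_X T (f w *+ n)).
  by apply: eq_uniform (uniformX T (w *+ n)) => f hf; rewrite (preservesMn hf).
move=> v; apply: uniform_prod => i; apply: uniformM.
  by apply: eq_uniform (uniformY T (v *+ i)) => f hf; rewrite (preservesMn hf).
apply/uniformV/uniformB; first exact: uX.
by apply: eq_uniform (uX v (i + i)%N) => f _; rewrite mulrnDr.
Qed.

Lemma eta_factorN w : eta_factor (- w) = - eta_factor w.
Proof. by rewrite /eta_factor -opprD !tm_XN tm_YN mulNr. Qed.

Lemma eta_quot_scale p (e : 'Z_N) (x : 'F_p) (v : V) : prime_idempotent p e -> x != 0 ->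
  eta_quot (crt_unit e x * v.1, crt_unit e x * v.2) = quadchar F x * eta_quot v.
Proof.
move=> eP x0; pose g (y : 'Z_N) := eta_factor (y * v.1, y * v.2).
have og y : y != 0 -> g (- y) = - g y by move=> _; rewrite /g !mulNr -eta_factorN.
have := prod_half_crt_unit eP (tm_N_odd T) (pred_halfE (tm_N_odd T)) x0 og.
have -> : \prod_(1 <= i < (pred_half N).+1) g i%:R = eta_quot v.
  by apply: eq_bigr => i _; rewrite /g; case: v {og} @g => v1 v2 g; rewrite pair_mulrn.
by move=> <-; apply: eq_bigr => i _; rewrite pair_mulrn /g; congr (eta_factor (_, _)); ring.
Qed.
End UniformFunctions.

(* Chosen so that [24 * eta_shift N = -1] modulo [N]. *)
Definition eta_shift N := (\sum_(1 <= i < (pred_half N).+1) if (3 * i < N)%N then 0 else 3 * i)%N.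

Lemma eta_shift_sum N a b : (a + b = pred_half N)%N -> (3 * a < N)%N -> (N <= 3 * a.+1)%N ->
  (2 * eta_shift N = 3 * (b * (2 * a.+1 + b) - b))%N.
Proof.
have S x y : (\sum_(x <= i < x + y) 2 * i = y * (2 * x + y) - y)%N.
  elim: y => [|y IH]; first by rewrite addn0 big_geq.
  by rewrite addnS big_nat_recr ?leq_addr //= IH; nia.
move=> Eab l1 l2; rewrite /eta_shift -Eab (@big_cat_nat _ _ _ a.+1) ?ltnS ?leq_addr //=.
rewrite big_nat big1 ?add0n => [|i /andP[_ il]]; last by rewrite ifT //; lia.
rewrite big_nat (eq_bigr (fun i => 3 * i)%N) => [|i /andP[ia _]]; last by rewrite ifF //; apply/negbTE; lia.
by rewrite -big_nat -big_distrr /= -addSn -(S a.+1 b) -big_distrr /=; lia.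
Qed.
Lemma dvdn_eta_shift N : coprime N 6 -> (N %| 24 * eta_shift N + 1)%N.
Proof.
rewrite coprimen6 => /andP[n2 n3]; have oN : odd N by lia.
have rr := pred_halfE oN; have : (N %% 6 = 1)%N \/ (N %% 6 = 5)%N by clear rr; lia.
have Eh := divn_eq N 6; case=> E; rewrite E in Eh; set h := (N %/ 6)%N in Eh.
  have E0 : (2 * eta_shift N = 3 * (h * (2 * (2 * h).+1 + h) - h))%N by apply: eta_shift_sum; lia.
  have -> : (24 * eta_shift N + 1 = N * (30 * h + 1))%N by nia.
  exact: dvdn_mulr.
have E0 : (2 * eta_shift N = 3 * (h.+1 * (2 * (2 * h).+2 + h.+1) - h.+1))%N by apply: eta_shift_sum; lia.
have -> : (24 * eta_shift N + 1 = N * (30 * h + 29))%N by nia.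
exact: dvdn_mulr.
Qed.

Section TateModel.
Variables (k F : fieldType) (ell N : nat) (S : tate_setup k F ell N).
Local Notation V := ('Z_N * 'Z_N)%type.
Local Notation iota := (ts_iota S).
Local Notation N0 := (ts_N_gt0 S).
Local Notation N1 := (ts_N_gt1 S).
Local Notation k2 := (ts_two_neq0 S).
Local Notation T := (tate_shear_model S).
Local Notation W := (tate_theta S).
Local Notation zeta := (zeta S).
Local Notation cF := (tate_const S).
Local Notation r := (pred_half N).
Local Notation nome := (fpsX (8 * N ^ 2)%N : fps k).
Let rE : N = (2 * r).+1 := pred_halfE (ts_N_odd S).

Definition fold_count := (\sum_(1 <= i < r.+1) (N <= 3 * i)%N)%N.
Local Notation fold_sign := ((-1) ^+ fold_count).

Section AtRoot.
Variable c : k.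
Hypothesis cN : c ^+ N = 1.
Definition theta_power (n : nat) : F := vtheta W (c ^+ n) (2 * n%:Z).
Lemma root_unit : c \is a GRing.unit.
Proof. by apply/unitrP; exists (c ^+ N.-1); rewrite -exprSr -exprS prednK ?N0. Qed.
Lemma root_exp_unit n : c ^+ n \is a GRing.unit. Proof. by rewrite unitrX ?root_unit. Qed.
Lemma off_lattice_power n : ~~ (N %| n)%N -> ((2 * N)%:Z %| 2 * n%:Z)%Z -> c ^+ n != 1.
Proof. by move=> h; rewrite dvdzE abszM !absz_nat dvdn_pmul2l // (negPf h). Qed.
Lemma theta_power_neq0 n : ~~ (N %| n)%N -> theta_power n != 0.
Proof. by move=> h; apply: vtheta_neq0 (root_exp_unit n) (off_lattice_power h). Qed.
Lemma theta_power_shift n : theta_power (n + N) = - (theta_power n / cF c ^+ n).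
Proof.
rewrite /theta_power exprD cN mulr1 (_ : 2 * (n + N)%:Z = 2 * n%:Z + (2 * N)%:Z); last by rewrite PoszD PoszM; ring.
by rewrite (vtheta_shift W _ (root_exp_unit n)) -[cst W _]/(cF (c ^+ n)) rmorphXn.
Qed.
Lemma theta_power_sym n : (n <= N)%N -> theta_power (N - n) = theta_power n.
Proof.
move=> nN; have E : c ^+ (N - n) = (c ^+ n)^-1.
  by apply: (mulrI (root_exp_unit n)); rewrite mulrV ?root_exp_unit // -exprD subnKC.
rewrite /theta_power E (_ : 2 * (N - n)%:Z = - (2 * n%:Z) + (2 * N)%:Z); last by rewrite -subzn // PoszM; ring.
rewrite vtheta_shift ?unitrV ?root_exp_unit // vtheta_inv ?root_exp_unit //.
rewrite -[cst W (c ^- n)]/(cF (c ^- n)) -[cst W (c ^+ n)]/(cF (c ^+ n)).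
have nz : cF (c ^+ n) != 0 by rewrite fmorph_eq0 -unitfE root_exp_unit.
by rewrite fmorphV mulNr opprK invrK mulfVK.
Qed.

Lemma eta_factor_theta i : ~~ (N %| i)%N -> ~~ (N %| 2 * i)%N -> ~~ (N %| 3 * i)%N ->
  Ycoord W (c ^+ i) (2 * i%:Z) / (Xcoord W (c ^+ i) (2 * i%:Z) - Xcoord W (c ^+ (2 * i)) (2 * (2 * i)%:Z)) =
  dvtheta W * theta_power (2 * i) ^+ 3 / (theta_power i ^+ 3 * theta_power (3 * i)).
Proof.
move=> n1 n2 n3; rewrite /Ycoord.
rewrite (Xcoord_sub W k2 (root_exp_unit _) (root_exp_unit _) (off_lattice_power n1) (off_lattice_power n2)).
have t1 := theta_power_neq0 n1; have t2 := theta_power_neq0 n2; have t3 := theta_power_neq0 n3; have T0 := dvtheta_neq0 W.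
have -> : c ^+ i / c ^+ (2 * i) = (c ^+ i)^-1.
  have -> : c ^+ (2 * i) = c ^+ i * c ^+ i by rewrite mul2n -addnn exprD.
  by rewrite invrM ?root_exp_unit // mulrA mulrV ?root_exp_unit // mul1r.
have -> : 2 * i%:Z - 2 * (2 * i)%:Z = - (2 * i%:Z) by rewrite PoszM; ring.
rewrite (vtheta_inv W _ (root_exp_unit i)) -exprD (_ : i + 2 * i = 3 * i)%N; last lia.
have -> : 2 * i%:Z + 2 * (2 * i)%:Z = 2 * (3 * i)%:Z by rewrite !PoszM; ring.
have -> : (c ^+ i) ^+ 2 = c ^+ (2 * i) by rewrite -exprM mulnC.
have -> : 2 * (2 * i%:Z) = 2 * (2 * i)%:Z by rewrite PoszM; ring.
rewrite -/(theta_power i) -/(theta_power (2 * i)) -/(theta_power (3 * i)) -[cst W _]/(cF (c ^+ i)) -[cst W (c ^+ (2 * i))]/(cF (c ^+ (2 * i))).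
have -> : cF (c ^+ (2 * i)) = cF (c ^+ i) ^+ 2 by rewrite -rmorphXn -exprM mulnC.
have nz : cF (c ^+ i) != 0 by rewrite fmorph_eq0 -unitfE root_exp_unit.
move: (theta_power i) (theta_power (2 * i)) (theta_power (3 * i)) (dvtheta W) (cF (c ^+ i)) t1 t2 t3 T0 nz => x y z t d x0 y0 z0 t0 d0.
rewrite mulrN mulNr opprK; field.
by rewrite ?x0 ?y0 ?z0 ?t0 ?d0.
Qed.

Definition half_theta_prod := \prod_(1 <= i < r.+1) theta_power i.

Lemma ndvd_half_mul i m : (0 < i < r.+1)%N -> (0 < m < 4)%N -> ~~ (N %| m * i)%N.
Proof.
move=> ir m4; rewrite Gauss_dvdr.
  by apply/negP => /dvdn_leq; have := rE; lia.
by apply: coprime_dvdr (ts_N_coprime6 S); case: m m4 => [|[|[|[|m]]]].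
Qed.
Lemma half_theta_prod_neq0 : half_theta_prod != 0.
Proof.
rewrite /half_theta_prod prodf_seq_neq0; apply/allP => i; rewrite mem_index_iota => ir /=.
by apply: theta_power_neq0; rewrite -[i]mul1n ndvd_half_mul.
Qed.
Lemma half_theta_prod_fold (m : nat) : coprime N m -> \prod_(1 <= i < r.+1) theta_power ((m * i) %% N) = half_theta_prod.
Proof.
move=> cm; have um : (m%:R : 'Z_N) \is a GRing.unit by rewrite unitZpE ?N1.
have [s Hs] := prod_half_mul N1 rE um; have [_ H] := Hs F (fun x : 'Z_N => theta_power x).
rewrite -[RHS](_ : \prod_(1 <= i < r.+1) theta_power (i%:R : 'Z_N) = _); last first.
  rewrite /half_theta_prod !big_nat; apply: eq_bigr => i ir; rewrite val_Zp_nat ?N1 // modn_small //.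
  by have := rE; lia.
rewrite -H => [|x x0]; last first.
  have -> : (- x : 'Z_N) = (N - x)%N :> nat by apply: val_ZpN; rewrite ?N1.
  by rewrite theta_power_sym // ltnW // ltn_Zp ?N1.
by apply: eq_bigr => i _; rewrite -natrM val_Zp_nat ?N1.
Qed.
Lemma half_theta_prod2 : \prod_(1 <= i < r.+1) theta_power (2 * i) = half_theta_prod.
Proof.
rewrite -(@half_theta_prod_fold 2); last by rewrite coprimen2 (ts_N_odd S).
by rewrite !big_nat; apply: eq_bigr => i ir; rewrite modn_small //; have := rE; lia.
Qed.
Lemma half_theta_prod3 : \prod_(1 <= i < r.+1) theta_power (3 * i) * cF c ^+ eta_shift N = fold_sign * half_theta_prod.
Proof.
rewrite -(@half_theta_prod_fold 3); last exact: coprime_dvdr (ts_N_coprime6 S).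
rewrite /eta_shift -!prodrXr -!big_split /= !big_nat; apply: eq_bigr => i ir.
case: (ltnP (3 * i) N) => [lt|ge]; first by rewrite expr0 mulr1 mul1r modn_small.
have [E l2] : (3 * i = (3 * i - N) + N)%N /\ (3 * i - N < N)%N by have := rE; lia.
have -> : (3 * i %% N)%N = (3 * i - N)%N by rewrite {1}E modnDr modn_small.
rewrite {1 2}E theta_power_shift exprD -[cF c ^+ N]rmorphXn cN rmorph1 mulr1 expr1 mulN1r mulNr mulfVK //.
by rewrite expf_neq0 // fmorph_eq0 -unitfE root_unit.
Qed.
Lemma prod_eta_factor : \prod_(1 <= i < r.+1) (dvtheta W * theta_power (2 * i) ^+ 3 / (theta_power i ^+ 3 * theta_power (3 * i))) =
  dvtheta W ^+ r * fold_sign * cF c ^+ eta_shift N / half_theta_prod.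
Proof.
rewrite prodf_div [X in X / _]big_split [X in _ / X]big_split /= !prodrXl half_theta_prod2 -/half_theta_prod prodr_const_nat subn1 /=.
have P0 := half_theta_prod_neq0; have P3 := half_theta_prod3; set p3 := \prod_(1 <= i < r.+1) theta_power (3 * i) in P3 *.
have p30 : p3 != 0.
  rewrite /p3 prodf_seq_neq0; apply/allP => i; rewrite mem_index_iota => ir /=.
  by apply: theta_power_neq0; apply: ndvd_half_mul.
have -> : dvtheta W ^+ r * fold_sign * cF c ^+ eta_shift N / half_theta_prod = dvtheta W ^+ r * fold_sign * (p3 * cF c ^+ eta_shift N) / (half_theta_prod * p3).
  by field; rewrite P0 p30.
rewrite P3; transitivity (dvtheta W ^+ r * (fold_sign * fold_sign) / p3); last by field; rewrite P0 p30.
by rewrite -expr2 sqrr_sign; field; rewrite P0 p30.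
Qed.
End AtRoot.

Definition theta_order := (\sum_(1 <= i < r.+1) `|(2 * i)%:Z - N%:Z| ^ 2)%N.
Definition eta_const : F := fold_sign * dvtheta W ^+ r * iota (euler nome) / (iota (fpsX theta_order) * iota (euler nome) ^+ r).
Definition disc_const n : k := 4%:R^-1 ^+ n * fold_sign * (-1) ^+ r.
Lemma disc_const_neq0 n : disc_const n != 0.
Proof. by rewrite !mulf_neq0 ?signr_eq0 ?expf_neq0 ?invr_eq0 ?(four_neq0 k2). Qed.
Lemma iota_euler_neq0 : iota (euler nome) != 0.
Proof. by rewrite (iota_eq0 (ts_frac S)) euler_neq0 // nome_coef0 ?N0. Qed.
Lemma iota_fpsX_neq0 n : iota (fpsX n) != 0. Proof. by rewrite (iota_eq0 (ts_frac S)) fpsX_neq0. Qed.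

Lemma eta_quot_euler (j : nat) : eta_quot T (j%:R, 1) * iota (euler (fpsC (zeta ^+ j) * fpsX (8 * N))) = eta_const * cF zeta ^+ (j * eta_shift N).
Proof.
set c := zeta ^+ j; have cN : c ^+ N = 1.
  by rewrite /c -exprM mulnC exprM (prim_expr_order (zetaP S)) expr1n.
have -> : eta_quot T (j%:R, 1) = dvtheta W ^+ r * fold_sign * cF c ^+ eta_shift N / half_theta_prod c.
  rewrite -(prod_eta_factor cN) /eta_quot !big_nat; apply: eq_bigr => i ir.
  have n1 : ~~ (N %| i)%N by rewrite -[i]mul1n ndvd_half_mul.
  have n2 : ~~ (N %| 2 * i)%N by apply: ndvd_half_mul.
  have n3 : ~~ (N %| 3 * i)%N by apply: ndvd_half_mul.
  have Mn n : (j%:R, 1) *+ n = int_point N (j * n)%:Z n%:Z :> V.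
    by rewrite pair_mulrn /int_point -!pmulrn mulr1 -natrM mulnC.
  have nz n : ~~ (N %| n)%N -> ~~ ((N%:Z %| (j * n)%:Z)%Z && (N%:Z %| n%:Z)%Z).
    by move=> h; rewrite negb_and !dvdzE !absz_nat h orbT.
  have E n : zeta ^ (j * n)%:Z = c ^+ n by rewrite -exprnP exprM.
  rewrite -(eta_factor_theta cN n1 n2 n3) /eta_factor -mulrnDr addnn -mul2n !Mn.
  have [] := tors_int_point S (nz _ n1); rewrite E => -> ->.
  by have [] := tors_int_point S (nz _ n2); rewrite E => -> _.
have := congr1 iota (theta_half_prod N0 rE cN).
rewrite !(rmorphM iota) (rmorphXn iota) rmorph_prod -/theta_order.
rewrite (eq_bigr (theta_power c)) => [|i _]; last by rewrite /theta_power PoszM.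
rewrite -/(half_theta_prod c) /eta_const exprM => Eth; have P0 := half_theta_prod_neq0 cN; have E0 := iota_euler_neq0; have X0 := iota_fpsX_neq0 theta_order.
set eu := iota (euler (_ * _)) in Eth *.
apply: (mulIf P0); apply: (mulIf X0); apply: (mulIf (expf_neq0 r E0)).
transitivity (dvtheta W ^+ r * fold_sign * cF c ^+ eta_shift N * (iota (fpsX theta_order) * (iota (euler nome) ^+ r * eu))).
  by field; rewrite P0.
have -> : cF zeta ^+ j = cF c by rewrite -(rmorphXn cF).
by rewrite -Eth; field; rewrite X0 expf_neq0.
Qed.

Lemma discriminant_dtheta : tm_a T * tm_b T * (tm_a T - tm_b T) = cF 4%:R^-1 * dvtheta W ^+ 4.
Proof.
rewrite -[tm_a T]/(alpha W) -[tm_b T]/(beta W) (discriminantE W N0 k2).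
have E : 2%:R * dvtheta W = - (theta2 W * (theta3 W * theta4 W)).
  rewrite /theta2 /theta3 /theta4 -[dvtheta W]/(iota (dtheta k N)) -[vtheta W (-1) 0]/(iota (theta N (-1) 0)).
  rewrite -[vtheta W (-1) N]/(iota (theta N (-1) N%:Z)) -[vtheta W 1 N]/(iota (theta N 1 N%:Z)).
  have := congr1 iota (dtheta_null_prod N0 k2); rewrite (rmorphM iota) rmorph_nat => ->.
  by rewrite (rmorphN iota) !(rmorphM iota) [iota (theta N 1 _) * _]mulrC.
have T0 := dvtheta_neq0 W; have n4 : (4%:R : F) != 0 by rewrite -(rmorph_nat cF) fmorph_eq0 (four_neq0 k2).
have -> : (theta2 W * (theta3 W * theta4 W)) ^+ 2 = 4%:R * dvtheta W ^+ 2 by rewrite -sqrrN -E; ring.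
have -> : cF 4%:R^-1 = 4%:R^-1 by rewrite fmorphV rmorph_nat.
by field; rewrite ?T0 ?n4.
Qed.

Lemma eta_const_neq0 : eta_const != 0.
Proof.
rewrite /eta_const !mulf_neq0 ?signr_eq0 ?invr_eq0 ?mulf_neq0 ?expf_neq0 ?iota_euler_neq0 ?iota_fpsX_neq0 //.
exact: dvtheta_neq0.
Qed.

Lemma discriminant_eta_const n : (tm_a T * tm_b T * (tm_a T - tm_b T)) ^+ n * eta_const =
  iota (fpsC (disc_const n) * fpsX (r * N ^ 2 - theta_order + 4 * N ^ 2 * n) * euler nome ^+ (N + 12 * n)).
Proof.
have Sl : (theta_order <= r * N ^ 2)%N.
  rewrite /theta_order; apply: leq_trans (_ : \sum_(1 <= i < r.+1) N ^ 2 <= _)%N.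
    by rewrite !big_nat; apply: leq_sum => i ir; rewrite leq_sqr; have := rE; lia.
  by rewrite sum_nat_const_nat subn1.
have ET : dvtheta W = - (iota (fpsX (N ^ 2)) * iota (euler nome) ^+ 3).
  by rewrite -[dvtheta W]/(iota (dtheta k N)) (dtheta_prod k N0) (rmorphN iota) (rmorphM iota) (rmorphXn iota).
rewrite discriminant_dtheta /eta_const /disc_const ET.
rewrite (rmorphM iota) (rmorphM iota (fpsC _)) -[iota (fpsC _)]/(cF _) !(rmorphM cF) !(rmorphXn cF) rmorphN1 (rmorphXn iota).
have -> : iota (fpsX (r * N ^ 2 - theta_order + 4 * N ^ 2 * n)) = iota (fpsX (N ^ 2)) ^+ (r + 4 * n) / iota (fpsX theta_order).
  apply: (mulIf (iota_fpsX_neq0 theta_order)); rewrite divfK ?iota_fpsX_neq0 // -(rmorphM iota) -fpsXD -(rmorphXn iota) -fpsXM; congr (iota (fpsX _)).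
  by nia.
have X0 := iota_fpsX_neq0 theta_order; have E0 := iota_euler_neq0.
have -> : iota (euler nome) ^+ (N + 12 * n) = iota (euler nome) ^+ (3 * r + 1 + 12 * n) / iota (euler nome) ^+ r.
  apply: (mulIf (expf_neq0 r E0)); rewrite divfK ?expf_neq0 // -exprD; congr (_ ^+ _).
  by have := rE; lia.
move: X0 E0; move: (iota (fpsX theta_order)) (iota (fpsX (N ^ 2))) (iota (euler nome)) (cF 4%:R^-1) fold_sign => x y z u v x0 z0.
have -> : - (y * z ^+ 3) = -1 * (y * z ^+ 3) by rewrite mulN1r.
have -> : (-1 * (y * z ^+ 3)) ^+ 4 = y ^+ 4 * z ^+ 12 by ring.
rewrite [(u * _) ^+ n]exprMn [(y ^+ 4 * _) ^+ n]exprMn [(-1 * _) ^+ r]exprMn [(y * _) ^+ r]exprMn.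
rewrite -[(z ^+ 3) ^+ r]exprM -[(z ^+ 12) ^+ n]exprM -[(y ^+ 4) ^+ n]exprM.
have -> : z ^+ (3 * r + 1 + 12 * n) = z ^+ (3 * r) * z * z ^+ (12 * n) by rewrite !exprD expr1.
rewrite [y ^+ (r + _)]exprD.
by field; rewrite x0 expf_neq0.
Qed.
End TateModel.

Section LocalMaps.
Variable R : comNzRingType.
Definition local_map (e : R) (g : R * R -> R * R) := exists a b c d : R, forall v,
  g v = (v.1 + e * (a * v.1 + b * v.2), v.2 + e * (c * v.1 + d * v.2)).
Lemma local_map_comm e e' g h : e * e' = 0 -> local_map e g -> local_map e' h -> forall v, g (h v) = h (g v).
Proof.
move=> ee [a [b [c [d Eg]]]] [a' [b' [c' [d' Eh]]]] [x y]; rewrite !Eg !Eh /=.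
have H z w u : z - w = (e * e') * u -> z = w by rewrite ee mul0r => /eqP; rewrite subr_eq0 => /eqP.
congr pair; [apply: (H _ _ ((a * (a' * x + b' * y) + b * (c' * x + d' * y)) - (a' * (a * x + b * y) + b' * (c * x + d * y))))
  |apply: (H _ _ ((c * (a' * x + b' * y) + d * (c' * x + d' * y)) - (c' * (a * x + b * y) + d' * (c * x + d * y))))]; ring.
Qed.
Lemma local_map_comp e g h : local_map e g -> local_map e h -> local_map e (g \o h).
Proof.
move=> [a [b [c [d Eg]]]] [a' [b' [c' [d' Eh]]]].
exists (a + a' + e * (a * a' + b * c')), (b + b' + e * (a * b' + b * d')), (c + c' + e * (c * a' + d * c')), (d + d' + e * (c * b' + d * d')).
by move=> [x y]; rewrite /= Eg Eh /=; congr pair; ring.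
Qed.
End LocalMaps.

Section Operators.
Variables (k F : fieldType) (N ell : nat) (T : shear_torsion_model k F N ell).
Local Notation V := (('Z_N * 'Z_N)%type : finZmodType).
Hypothesis sqN : squarefree N.
Variable zeta : k.
Hypothesis zP : N.-primitive_root zeta.
Let N1 := tm_N_gt1 T.
Local Notation cst := (tm_const T).
Let orth p q := @idem_orth N p q N1 sqN.

Section AtPrime.
Variable p : nat.
Hypothesis hp : prime_divisor N p.
Let eP : prime_idempotent p (idem N p) := idemP N1 sqN hp.
Let pp := pi_prime eP.
Local Notation e := (idem N p).
Local Notation iN := (@lift_Fp N p e).

Definition local_root : k := zeta ^+ e.
Lemma local_rootP : p.-primitive_root local_root.
Proof.
have E : local_root ^+ p = 1.
  rewrite /local_root -exprM; apply/eqP; rewrite -(prim_order_dvd zP) -(Zp_nat_eq0 N1) mulnC natrM natr_Zp.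
  by rewrite (pi_torsion eP).
have [d dP] := prim_order_exists (prime_gt0 pp) E.
case/primeP: pp => _ H dp; case/orP: (H _ dp) => /eqP E1; last by rewrite -E1.
rewrite E1 in dP; have := prim_expr_order dP; rewrite expr1 /local_root => /eqP.
rewrite -(prim_order_dvd zP) -(Zp_nat_eq0 N1) natr_Zp => /eqP e0.
by have := red_Fp_idem eP; rewrite e0 /red_Fp /= => /eqP; rewrite eq_sym oner_eq0.
Qed.
Local Notation psi := (addchar local_root).

Definition shear_at (x : 'F_p) : V -> V := shear (iN x).
Definition weyl_at : V -> V := weyl e.
Definition pt_scale (m : 'Z_N) (v : V) : V := (m * v.1, m * v.2).

Lemma shear_local x : local_map e (shear_at x).
Proof. by exists 0, (x : nat)%:R, 0, 0 => -[u v]; rewrite /shear_at /shear /lift_Fp /=; congr pair; ring. Qed.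
Lemma weyl_local : local_map e weyl_at.
Proof. by exists (-1), 1, (-1), (-1) => -[u v]; rewrite /weyl_at /weyl /=; congr pair; ring. Qed.
Lemma crt_scale_local (x : 'F_p) : local_map e (pt_scale (crt_unit e x)).
Proof.
by exists (-1 + (x : nat)%:R), 0, 0, (-1 + (x : nat)%:R) => -[u v]; rewrite /pt_scale /crt_unit /lift_Fp /=; congr pair; ring.
Qed.
Lemma preserves_weyl_at : preserves T 0 weyl_at.
Proof. exact (preserves_weyl eP). Qed.

Lemma shear_weyl_shear (v : V) (x t : 'F_p) : e * v.1 = 0 -> e * v.2 = e -> x != 0 ->
  shear_at t (weyl_at (shear_at x v)) = pt_scale (crt_unit e (- x)) (shear_at (t - x^-1) v).
Proof.
case: v => v1 v2 /= h1 h2 x0;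
have Et : iN (t - x^-1) = iN t - iN x^-1 by rewrite (lift_FpD eP) // (lift_FpN eP).
have Ex : iN (- x) = - iN x by rewrite (lift_FpN eP).
rewrite /shear_at /weyl_at /weyl /pt_scale /crt_unit /shear Et Ex; cbn [fst snd].
have X2 y : iN y * v2 = iN y by rewrite /lift_Fp -mulrA h2.
have X1 y : iN y * v1 = 0 by rewrite /lift_Fp -mulrA h1 mulr0.
have Xe y : e * iN y = iN y by rewrite (idem_lift_Fp eP).
have XX : iN x * iN x^-1 = e by rewrite -(lift_FpM eP) // mulfV // (lift_Fp1 eP).
congr pair.
  transitivity (v1 - e * v1 + iN x * v2 - (e * iN x) * v2 + e * v2 +
     (iN t * v2 - (e * iN t) * v2 - (e * iN t) * v1 - (e * iN t) * iN x * v2)); first by ring.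
  rewrite !Xe h1 h2 X1 !X2 -mulrA X2.
  transitivity (v1 - e * v1 + iN t * v2 - (e * iN t) * v2 - iN x^-1 * v2 + (e * iN x^-1) * v2
     - iN x * v1 - iN x * iN t * v2 + (iN x * iN x^-1) * v2); last by ring.
  by rewrite XX !Xe h1 h2 X1 !X2 -mulrA X2; ring.
transitivity (v2 - e * v2 - e * v1 - (e * iN x) * v2); first by ring.
by rewrite Xe h1 mulrDl mulrBl mul1r mulNr; ring.
Qed.
Lemma shear_weyl0 (v : V) t : e * v.1 = 0 -> shear_at t (weyl_at v) = weyl_at v.
Proof.
case: v => v1 v2 /= h1; rewrite /shear_at /weyl_at /weyl /shear /=; congr pair.
have -> : iN t * ((1 - e) * v2 - e * v1) = (iN t - e * iN t) * v2 - iN t * (e * v1) by ring.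
by rewrite (idem_lift_Fp eP) // subrr mul0r h1 mulr0 subr0 addr0.
Qed.
Lemma shear_at0 v : shear_at 0 v = v.
Proof. by case: v => v1 v2; rewrite /shear_at /shear (lift_Fp0 eP) // mul0r addr0. Qed.

Definition char_op (M : 'Z_N) (B : V -> F) (v : V) : F :=
  \sum_(x : 'F_p) cst (psi (- x * red_Fp p M)) * B (shear_at x v).
Definition weyl_op (M : 'Z_N) (B : V -> F) (v : V) : F :=
  p%:R * B (weyl_at v) + cst (gauss_sum local_root (red_Fp p M)) * \sum_(x : 'F_p) B (shear_at x v).
Definition quad_equivariant (B : V -> F) := forall (x : 'F_p) w, x != 0 -> B (pt_scale (crt_unit e x) w) = cst (quadchar k x) * B w.

(* The sum over [t] turns the additive character sum at [p] into a Gauss sum, because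
   [shear_at t (weyl_at (shear_at x v))] and [shear_at _ v] span the same line. *)
Lemma sum_shear_char_op M B v : quad_equivariant B -> e * v.1 = 0 -> e * v.2 = e ->
  \sum_(t : 'F_p) \sum_(x : 'F_p) cst (psi (- x * red_Fp p M)) * B (shear_at t (weyl_at (shear_at x v))) = weyl_op M B v.
Proof.
move=> sB h1 h2; rewrite exchange_big /= (bigD1 0) //= /weyl_op; congr (_ + _).
  rewrite (eq_bigr (fun=> B (weyl_at v))) => [|t _]; last first.
    by rewrite shear_at0 shear_weyl0 // oppr0 mul0r (_ : psi 0 = 1) // (rmorph1 cst) mul1r.
  by rewrite sumr_const card_Fp // mulr_natl.
rewrite /gauss_sum rmorph_sum /= [in RHS](bigD1 0) //= oppr0 quadchar0 mulr0 rmorph0 add0r mulr_suml.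
apply: eq_bigr => x x0; rewrite mulr_sumr [RHS](reindex (fun t => t - x^-1)) /=; last first.
  by exists (fun t => t + x^-1) => t _; rewrite ?addrK ?subrK.
by apply: eq_bigr => t _; rewrite shear_weyl_shear // sB ?oppr_eq0 // rmorphM mulrA.
Qed.
End AtPrime.

Definition vertical_at (ps : seq nat) (v : V) := forall p, p \in ps -> idem N p * v.1 = 0 /\ idem N p * v.2 = idem N p.
Definition char_ops M ps (B : V -> F) := foldr (fun p B => char_op p M B) B ps.
Definition weyl_ops M ps (B : V -> F) := foldl (fun B p => weyl_op p M B) B ps.

Lemma char_ops_local M ps B q g : all (prime_divisor N) ps -> prime_divisor N q -> q \notin ps -> local_map (idem N q) g ->
  forall v, char_ops M ps B (g v) = char_ops M ps (B \o g) v.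
Proof.
elim: ps => [|p ps IH] //= /andP[hp hps] hq; rewrite inE negb_or => /andP[pq qps] lg v.
rewrite /char_op; apply: eq_bigr => x _; rewrite -IH //.
by rewrite (local_map_comm (orth hp hq _) (shear_local x) lg) // eq_sym.
Qed.
Lemma char_ops_lin M ps (I : Type) (s : seq I) (c : I -> F) (B : I -> V -> F) v :
  char_ops M ps (fun w => \sum_(i <- s) c i * B i w) v = \sum_(i <- s) c i * char_ops M ps (B i) v.
Proof.
elim: ps v => [|p ps IH] //= v; rewrite /char_op (eq_bigr _ (fun x _ => congr1 _ (IH _))).
under eq_bigr do rewrite mulr_sumr; rewrite exchange_big; apply: eq_bigr => i _.
by rewrite mulr_sumr; apply: eq_bigr => x _; rewrite mulrCA.
Qed.
Lemma char_opsZ M ps c (B : V -> F) v : char_ops M ps (fun w => c * B w) v = c * char_ops M ps B v.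
Proof.
have := char_ops_lin M ps [:: tt] (fun=> c) (fun=> B) v; rewrite big_seq1 => <-.
by congr (char_ops _ _ _ v); apply: funext => w; rewrite big_seq1.
Qed.
Lemma eq_char_ops M ps (B B' : V -> F) : B =1 B' -> char_ops M ps B =1 char_ops M ps B'.
Proof.
by move=> E; elim: ps => [|p ps IH] //= v; apply: eq_bigr => x _; rewrite IH.
Qed.

Lemma weyl_op_char_ops M ps p B v : all (prime_divisor N) ps -> prime_divisor N p -> p \notin ps ->
  weyl_op p M (char_ops M ps B) v = char_ops M ps (weyl_op p M B) v.
Proof.
move=> hps hp pps.
pose c (o : option 'F_p) : F := if o is Some _ then cst (gauss_sum (local_root p) (red_Fp p M)) else p%:R.
pose g (o : option 'F_p) : V -> V := if o is Some x then shear_at x else weyl_at p.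
have lg o : local_map (idem N p) (g o) by case: o => [x|]; [exact: shear_local|exact: weyl_local].
pose s := None :: map Some (index_enum 'F_p).
have E (B' : V -> F) w : weyl_op p M B' w = \sum_(o <- s) c o * B' (g o w).
  by rewrite /weyl_op /s big_cons big_map mulr_sumr.
rewrite E (@eq_char_ops M ps (weyl_op p M B) _ (fun w => E B w)) char_ops_lin.
by apply: eq_bigr => o _; rewrite (char_ops_local _ _ hps hp pps).
Qed.

Lemma weyl_ops_eq0 M ps (A : (V -> V) -> V -> F) v : uniq ps -> all (prime_divisor N) ps -> vertical_at ps v ->
  (forall p f g, p \in ps -> preserves T 0 f -> preserves T 0 g -> local_map (idem N p) g -> A f \o g =1 A (f \o g)) ->
  (forall p f, p \in ps -> preserves T 0 f -> quad_equivariant p (A f)) ->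
  (forall f, preserves T 0 f -> char_ops M ps (A f) v = 0) -> forall f, preserves T 0 f -> weyl_ops M ps (A f) v = 0.
Proof.
elim: ps A => [|p ps IH] A /=; first by move=> _ _ _ _ _; apply.
move=> /andP[pps ups] /andP[hp hps] fv cA sA H f rf.
have [v1 v2] := fv p (mem_head _ _).
apply: (IH (fun f => weyl_op p M (A f))) => // [q qps|q f' g qps rf' rg lg w|q f' qps rf' x w x0|f' rf'].
- by apply: fv; rewrite inE qps orbT.
- have hq := allP hps q qps; have npq : p != q by apply: contraNneq pps => ->.
  have o := orth hp hq npq; have qpps : q \in p :: ps by rewrite inE qps orbT.
  rewrite /= /weyl_op (local_map_comm o (weyl_local p) lg) -(cA q f' g qpps rf' rg lg (weyl_at p w)); congr (_ + _ * _).
  by apply: eq_bigr => x _; rewrite (local_map_comm o (shear_local x) lg) -(cA q f' g qpps rf' rg lg (shear_at x w)).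
- have hq := allP hps q qps; have npq : p != q by apply: contraNneq pps => ->.
  have o := orth hp hq npq; have qpps : q \in p :: ps by rewrite inE qps orbT.
  have lm := crt_scale_local x.
  rewrite /weyl_op (local_map_comm o (weyl_local p) lm) sA // mulrDr mulrCA; congr (_ + _).
  rewrite [RHS]mulrCA; congr (_ * _); rewrite mulr_sumr.
  by apply: eq_bigr => y _; rewrite (local_map_comm o (shear_local y) lm) sA.
have p1 := mem_head p ps.
rewrite -weyl_op_char_ops // -sum_shear_char_op //; last first.
  move=> x w x0; rewrite (char_ops_local _ _ hps hp pps (crt_scale_local x)) -char_opsZ.
  by apply: eq_char_ops => u; exact: sA.
rewrite big1 // => t _.
have rg : preserves T 0 (shear_at t \o weyl_at p).
  exact: symmetry_comp (@preserves_shear _ _ _ _ T _) (preserves_weyl_at hp).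
have lg := local_map_comp (shear_local t) (weyl_local p).
rewrite -[RHS](H _ (symmetry_comp rf' rg)) /char_op; apply: eq_bigr => x _; congr (_ * _).
rewrite -[shear_at t (weyl_at p _)]/((shear_at t \o weyl_at p) (shear_at x v)) (char_ops_local _ _ hps hp pps lg).
by apply: eq_char_ops => u; exact: (cA p f' _ p1 rf' rg lg).
Qed.
End Operators.

(** * Partitions *)

Section PartitionSeries.
Variable k : fieldType.
Variables (c : k) (a : nat).
Hypothesis a0 : (0 < a)%N.
Local Notation q := (fpsC c * fpsX a).

Lemma monomial_exp n : q ^+ n = fpsC (c ^+ n) * fpsX (a * n).
Proof. by rewrite exprMn -rmorphXn fpsXM. Qed.
Lemma monomial_coef0 : fcoef q 0 = 0. Proof. by rewrite fcoefCM fpsX_coef0 // mulr0. Qed.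
Lemma monomial_exp_feqm0 K n : (K <= a * n)%N -> feqm K (q ^+ n) 0.
Proof. by move=> le i iK; rewrite monomial_exp fcoefCM /= ltn_eqF ?mulr0 //; exact: leq_trans iK le. Qed.

Definition mult_weight (n : nat) (f : {ffun 'I_n -> 'I_n.+1}) := (\sum_(i < n) i.+1 * f i)%N.

Lemma euler_mul_partitions n : feqm (a * n.+1) (euler q * \sum_(f : {ffun 'I_n -> 'I_n.+1}) q ^+ mult_weight f) 1.
Proof.
have E1 : feqm (a * n.+1) (euler q) (\prod_(i < n) (1 - q ^+ i.+1)).
  apply: (@feqm_trans _ _ _ (\prod_(i < a * n.+1) (1 - q ^+ i.+1))).
    have := @feqm_qpochinf _ q q (a * n.+1) (a * n.+1) monomial_coef0 (leqnn _); rewrite -/(euler q).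
    by rewrite (eq_bigr (fun i : 'I_(a * n.+1) => 1 - q ^+ i.+1)) // => i _; rewrite exprSr.
  have le : (n <= a * n.+1)%N by nia.
  rewrite -(big_mkord xpredT (fun i => 1 - q ^+ i.+1)) (big_cat_nat _ le) //= big_mkord -[X in feqm _ _ X]mulr1.
  apply: feqmM => //; apply: feqm_prod1 => i; rewrite mem_index_iota => /andP[ni _].
  rewrite -[X in feqm _ _ X](subr0 (1 : fps k)); apply: feqmD => //; apply: feqmN; apply: monomial_exp_feqm0; nia.
apply: (@feqm_trans _ _ _ (\prod_(i < n) (1 - q ^+ i.+1) * \sum_(f : {ffun 'I_n -> 'I_n.+1}) q ^+ mult_weight f)).
  exact: feqmM.
rewrite (eq_bigr (fun f : {ffun 'I_n -> 'I_n.+1} => \prod_(i < n) (q ^+ (i.+1 * f i)))); last first.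
  by move=> f _; rewrite prodrXr.
rewrite -(bigA_distr_bigA (fun (i : 'I_n) (j : 'I_n.+1) => q ^+ (i.+1 * j))) -big_split /=.
rewrite (eq_bigr (fun i : 'I_n => 1 - q ^+ (i.+1 * n.+1))); last first.
  have S (x : fps k) : (1 - x) * \sum_(j < n.+1) x ^+ j = 1 - x ^+ n.+1.
    rewrite -[X in _ = X - _](expr1n _ n.+1) subrXX; congr (_ * _).
    by apply: eq_bigr => j _; rewrite expr1n mul1r.
  by move=> i _; rewrite exprM -S; congr (_ * _); apply: eq_bigr => j _; rewrite exprM.
rewrite -(big_mkord xpredT (fun i => 1 - q ^+ (i.+1 * n.+1))).
apply: feqm_prod1 => i _; rewrite -[X in feqm _ _ X](subr0 (1 : fps k)); apply: feqmD => //; apply: feqmN; apply: monomial_exp_feqm0; nia.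
Qed.

Lemma euler_partition_series : euler q * fpsum (fun n : nat => (partition_count n)%:R * c ^+ n) (fun n => a * n)%N = 1.
Proof.
have U := euler_unit monomial_coef0.
suff -> : fpsum (fun n : nat => (partition_count n)%:R * c ^+ n) (fun n => a * n)%N = (euler q)^-1 by rewrite divrr.
have H n i : (i < a * n.+1)%N -> fcoef (euler q)^-1 i = \sum_(f : {ffun 'I_n -> 'I_n.+1}) fcoef (q ^+ mult_weight f) i.
  move=> il; have := @euler_mul_partitions n; set S := \sum_(f : _) _ => h.
  have : feqm (a * n.+1) ((euler q)^-1 * (euler q * S)) ((euler q)^-1 * 1) by apply: feqmM.
  by rewrite mulKr // mulr1 => /(_ i il) <-; rewrite /S fcoef_sum.
apply: fpsP => e; have [/dvdnP[n En]|nd] := boolP (a %| e)%N; last first.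
  rewrite fcoef_fpsum0 => [|i Ei]; last by rewrite -Ei dvdn_mulr in nd.
  rewrite (H e); last by nia.
  rewrite big1 // => f _; rewrite monomial_exp fcoefCM /=; case: eqP => [E|]; last by rewrite mulr0.
  by rewrite E dvdn_mulr in nd.
rewrite En mulnC (@fcoef_fpsum1 _ _ _ (fun n => a * n)%N n) => [|i /eqP]; last by rewrite eqn_pmul2l // => /eqP.
rewrite (H n); last by rewrite ltn_pmul2l.
rewrite (eq_bigr (fun f => if mult_weight f == n then c ^+ n else 0)) => [|f _]; last first.
  by rewrite monomial_exp fcoefCM /= eqn_pmul2l // eq_sym; case: eqP => [->|_]; rewrite ?mulr1 ?mulr0.
rewrite -big_mkcond /= sumr_const mulr_natl; congr (_ *+ _).
by rewrite /partition_count; apply: eq_card => f; rewrite !inE.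
Qed.
End PartitionSeries.

(* The value at [d = 1] is the expansion of the product of the [a p U_p + b p V_p], where [v d]
   records the coefficient at index [mu / d ^ 2]. *)
Fixpoint uv_sum (R : comNzRingType) (a b : nat -> R) (ps : seq nat) (v : nat -> R) (d : nat) : R :=
  if ps is p :: ps' then a p * uv_sum a b ps' v d + b p * uv_sum a b ps' v (p * d) else v d.

Section UVSum.
Variable R : comNzRingType.
Implicit Types (a b v : nat -> R) (ps : seq nat) (d : nat).

Lemma uv_sum_rcons a b ps p v d :
  uv_sum a b (rcons ps p) v d = a p * uv_sum a b ps v d + b p * uv_sum a b ps v (p * d).
Proof.
elim: ps d => [|q ps IH] d //=; rewrite !IH mulnCA.
by move: (uv_sum _ _ _ _ _) (uv_sum _ _ _ _ _) (uv_sum _ _ _ _ _) (uv_sum _ _ _ _ _) => x y z w; ring.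
Qed.
Lemma eq_uv_sum (P : pred nat) a a' b b' ps v v' d : {in ps, a =1 a'} -> {in ps, b =1 b'} ->
  (forall d, P d -> v d = v' d) -> P d -> (forall p d, p \in ps -> P d -> P (p * d)%N) ->
  uv_sum a b ps v d = uv_sum a' b' ps v' d.
Proof.
move=> + + Ev; elim: ps d => [|p ps IH] d Ea Eb Pd hP /=; first exact: Ev.
have sub q : q \in ps -> q \in p :: ps by rewrite inE => ->; rewrite orbT.
have IH' d' : P d' -> uv_sum a b ps v d' = uv_sum a' b' ps v' d'.
  by move=> Pd'; apply: IH => // [q /sub/Ea //|q /sub/Eb //|q d'' /sub qps]; apply: hP.
by rewrite Ea ?Eb ?mem_head // !IH' // hP // mem_head.
Qed.
Lemma eq_uv_sum_val a b ps v v' d : v =1 v' -> uv_sum a b ps v d = uv_sum a b ps v' d.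
Proof. by move=> E; apply: (eq_uv_sum (P := xpredT)). Qed.
Lemma uv_sum_mull a b ps v q d : uv_sum a b ps v (q * d) = uv_sum a b ps (fun d => v (q * d)%N) d.
Proof. by elim: ps d => [|p ps IH] d //=; rewrite mulnCA !IH. Qed.
Lemma uv_sum0 a b ps d : uv_sum a b ps (fun=> 0) d = 0.
Proof. by elim: ps d => //= p ps IH d; rewrite !IH !mulr0 addr0. Qed.
Lemma uv_sum_scale c a b ps v d :
  \prod_(p <- ps) c p * uv_sum a b ps v d = uv_sum (fun p => c p * a p) (fun p => c p * b p) ps v d.
Proof. by elim: ps d => [|p ps IH] d /=; rewrite ?big_nil ?mul1r // big_cons -!IH; ring. Qed.

Lemma uv_sum_top a b ps v d :
  (forall c, (c %| d * \prod_(p <- ps) p)%N -> c != (d * \prod_(p <- ps) p)%N -> v c = 0) ->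
  all (fun p => 1 < p)%N ps -> (0 < d)%N ->
  uv_sum a b ps v d = \prod_(p <- ps) b p * v (d * \prod_(p <- ps) p)%N.
Proof.
elim: ps d => [|p ps IH] d h; first by rewrite !big_nil muln1 mul1r.
move=> /= /andP[p1 hps] d0; rewrite big_cons in h *; rewrite big_cons.
have P0 : (0 < \prod_(q <- ps) q)%N.
  by rewrite big_seq prodn_cond_gt0 // => q /(allP hps)/ltnW.
have Ed : (p * d * \prod_(q <- ps) q = d * (p * \prod_(q <- ps) q))%N by rewrite [(p * d)%N]mulnC mulnA.
have v0 c : (c %| d * \prod_(q <- ps) q)%N -> v c = 0.
  move=> dc; apply: h; first by apply: dvdn_trans dc _; rewrite mulnCA dvdn_mull.
  rewrite neq_ltn (@leq_ltn_trans (d * \prod_(q <- ps) q)%N) //; first by rewrite dvdn_leq // muln_gt0 d0.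
  by rewrite ltn_pmul2l // ltn_Pmull.
rewrite [X in a p * X](IH d) // => [|c dc _]; last exact: v0.
rewrite v0 // !mulr0 add0r (IH (p * d)%N) ?muln_gt0 ?d0 ?(ltnW p1) // => [|c]; last first.
  by rewrite Ed; apply: h.
by rewrite Ed mulrA.
Qed.
End UVSum.

Lemma rmorph_uv_sum (R R' : comNzRingType) (f : {rmorphism R -> R'}) (a b : nat -> R) ps v d :
  f (uv_sum a b ps v d) = uv_sum (f \o a) (f \o b) ps (f \o v) d.
Proof. by elim: ps d => [|p ps IH] d //=; rewrite rmorphD !rmorphM !IH. Qed.

Lemma foldl_opUV (lam : nat -> algC) ps (a : nat -> algC) n : uniq ps -> all prime ps ->
  foldl (fun b q => opUV q (lam q) b) a ps n =
  uv_sum (fun=> 1) lam ps (fun d => if (d ^ 2 %| (\prod_(p <- ps) p) * n)%N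
    then a ((\prod_(p <- ps) p) * n %/ d ^ 2)%N else 0) 1.
Proof.
elim/last_ind: ps n => [|ps q IH] n; first by rewrite /= big_nil mul1n exp1n dvd1n divn1.
rewrite rcons_uniq all_rcons => /andP[nq up] /andP[pq hps].
rewrite foldl_rcons uv_sum_rcons mul1r /opUV /opU /opV !IH // -cats1 big_cat big_seq1 /=.
set P := (\prod_(p <- ps) p)%N; rewrite mulnA uv_sum_mull; congr (_ + _ * _).
have cq : ~~ (q %| P)%N by rewrite -prime_coprime // coprime_prod_primes.
have q0 := prime_gt0 pq; case: ifP => [/dvdnP[m ->]|nd].
  rewrite mulnK //; apply: eq_uv_sum_val => d; rewrite expnMn.
  have -> : (P * q * (m * q) = q ^ 2 * (P * m))%N by rewrite -mulnn; lia.
  by rewrite dvdn_pmul2l ?expn_gt0 ?q0 // divnMl ?expn_gt0 ?q0.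
rewrite -[LHS](uv_sum0 (fun=> 1) lam ps 1); apply: eq_uv_sum_val => d; case: ifP => // dd.
have : (q ^ 2 %| P * q * n)%N by apply: dvdn_trans dd; rewrite expnMn dvdn_mulr.
by rewrite -mulnn mulnAC dvdn_pmul2r // Euclid_dvdM // nd orbF (negPf cq).
Qed.

(** * Expansions of the transformed forms *)

(* The signed integer with [6 * sixth p + 1 = p] or [- p]. *)
Definition sixth (p : nat) : int := if (p %% 6 == 1)%N then (p %/ 6)%:Z else - ((p.+1) %/ 6)%:Z.
Definition sixth_prod (ps : seq nat) : int := foldr (fun p B => 6 * sixth p * B + sixth p + B) 0 ps.

Lemma sixth_prodE ps : 6 * sixth_prod ps + 1 = \prod_(p <- ps) (6 * sixth p + 1).
Proof. by elim: ps => [|p ps IH]; rewrite ?big_nil // big_cons -IH /=; ring. Qed.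
Lemma sixth_abs p : coprime p 6 -> absz (6 * sixth p + 1) = p.
Proof. by rewrite coprimen6 => /andP[n2 n3]; rewrite /sixth; case: ifP => E; lia. Qed.
Lemma sixth_prod_abs ps : {in ps, forall p, coprime p 6} -> absz (6 * sixth_prod ps + 1) = (\prod_(p <- ps) p)%N.
Proof.
rewrite sixth_prodE; elim: ps => [|p ps IH] h; first by rewrite !big_nil.
rewrite !big_cons abszM sixth_abs ?h ?mem_head // IH // => q qps; apply: h.
by rewrite inE qps orbT.
Qed.
Lemma expN1_sixth_prod (k : fieldType) ps : (-1 : k) ^ sixth_prod ps = \prod_(p <- ps) (-1) ^ sixth p.
Proof.
have n0 : (-1 : k) != 0 by rewrite oppr_eq0 oner_eq0.
elim: ps => [|p ps IH]; first by rewrite big_nil expr0z.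
by rewrite big_cons -IH /= !expfzDr // -[6 * _ * _]mulrA expN1z6 mul1r.
Qed.

Lemma quadcharV (k : fieldType) p (x : 'F_p) : (quadchar k x)^-1 = quadchar k x.
Proof. by rewrite /quadchar; case: ifP => _; [rewrite invr0|case: ifP => _; rewrite ?invr1 ?invrN1]. Qed.
Lemma quadcharN12 (k : fieldType) p : prime p -> (3 < p)%N ->
  quadchar k ((-12)%:~R : 'F_p) = quadchar k (-1 : 'F_p) * (-1) ^ sixth p.
Proof.
move=> pp p3; have op : odd p by case: (even_prime pp) p3 => [->|].
have c6 : coprime p 6 by rewrite prime_coprime // (Euclid_dvdM 2 3) // !dvdn_prime2 //; lia.
have -> : ((-12)%:~R : 'F_p) = -1 * (3%:R * (2%:R * 2%:R)).
  by rewrite -!natrM mulN1r -[(-12)%:~R]/(- (12%:R)).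
have two0 : (2%:R : 'F_p) != 0 by rewrite Fp_nat_eq0 // dvdn_prime2 // gtn_eqF // ltnW.
rewrite !quadcharM // quadchar_sqr // mulr1; congr (_ * _).
move: c6; rewrite coprimen6 /sixth => /andP[n2 n3]; case: ifP => E.
  by rewrite -exprnP; apply: quadchar3 => //; left; lia.
by rewrite expN1zN -exprnP; apply: quadchar3 => //; right; lia.
Qed.

Section Evaluation.
Variables (k F : fieldType) (ell N : nat) (S : tate_setup k F ell N).
Hypothesis sqN : squarefree N.
Local Notation V := (('Z_N * 'Z_N)%type : finZmodType).
Local Notation T := (tate_shear_model S).
Local Notation iota := (ts_iota S).
Local Notation zeta := (zeta S).
Local Notation zP := (zetaP S).
Local Notation cF := (tate_const S).
Local Notation N_gt0 := (ts_N_gt0 S).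
Local Notation N1 := (ts_N_gt1 S).
Local Notation k2 := (ts_two_neq0 S).
Local Notation pdv := (prime_divisor N).
Local Notation e := (idem N).
Local Notation lift p := (@lift_Fp N p (e p)).
Local Notation red := (@red_Fp N).
Local Notation eta p := (local_root N zeta p).
Local Notation psi p := (addchar (eta p)).
Local Notation etaP hp := (local_rootP T sqN zP hp).
Local Notation chi := (quadchar k).
Local Notation orth := (idem_orth N1 sqN).

Lemma tate_constE c : cF c = iota (fpsC c). Proof. by []. Qed.

Definition zeta_char (x : 'Z_N) : k := zeta ^+ x.
Lemma zeta_char_nat n : zeta_char n%:R = zeta ^+ n.
Proof. by rewrite /zeta_char val_Zp_nat ?N1 // (prim_expr_mod zP). Qed.
Lemma zeta_charD x y : zeta_char (x + y) = zeta_char x * zeta_char y.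
Proof. by rewrite -[x]natr_Zp -[y]natr_Zp -natrD !zeta_char_nat exprD. Qed.
Lemma zeta_char0 : zeta_char 0 = 1. Proof. by rewrite (zeta_char_nat 0). Qed.
Lemma zeta_char_mulrn x n : zeta_char (x * n%:R) = zeta_char x ^+ n.
Proof. by rewrite -[x]natr_Zp -natrM !zeta_char_nat exprM. Qed.
Lemma zeta_char_neq0 x : zeta_char x != 0. Proof. by rewrite expf_neq0 ?zeta_neq0. Qed.

Section CharSeries.
Variable I : eqType.
Implicit Types (w : I -> k) (nu : I -> 'Z_N) (x : I -> nat).

Definition char_series w nu x (j : 'Z_N) : fps k := fpsum (fun i => w i * zeta_char (j * nu i)) x.

Lemma eq_char_series w w' nu x j : w =1 w' -> char_series w nu x j = char_series w' nu x j.
Proof. by move=> E; apply: eq_fpsum => // i; rewrite E. Qed.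
Lemma char_series_eq0 w nu x j : w =1 (fun=> 0) -> char_series w nu x j = 0.
Proof. by move=> w0; apply: fpsum_eq0 => i; rewrite w0 mul0r. Qed.
Lemma char_seriesZ c w nu x j : cF c * iota (char_series w nu x j) = iota (char_series (fun i => c * w i) nu x j).
Proof.
rewrite tate_constE -rmorphM -fpsumZ; congr (iota _).
by apply: eq_fpsum => // i; rewrite mulrA.
Qed.
Lemma char_seriesD w w' nu x j :
  iota (char_series w nu x j) + iota (char_series w' nu x j) = iota (char_series (fun i => w i + w' i) nu x j).
Proof.
by rewrite -rmorphD -fpsumD; apply: (congr1 iota); apply: eq_fpsum => // i; rewrite mulrDl.
Qed.

Variable p : nat.
Hypothesis hp : pdv p.
Let eP := idemP N1 sqN hp.
Lemma zeta_char_liftM (x : 'F_p) y : zeta_char (lift p x * y) = psi p (x * red p y).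
Proof.
have zl (z : 'F_p) : zeta_char (lift p z) = psi p z.
  by rewrite /lift_Fp -[e p]natr_Zp -natrM zeta_char_nat /addchar /local_root -exprM mulnC.
rewrite -zl (lift_FpM eP) (red_FpK eP) mulrA; congr (zeta_char (_ * _)).
by rewrite mulrC (idem_lift_Fp eP).
Qed.
Lemma char_series_filter w nu x j (M : 'F_p) :
  \sum_(z : 'F_p) cF (psi p (- z * M)) * iota (char_series w nu x (j + lift p z)) =
  iota (char_series (fun i => p%:R * (red p (nu i) == M)%:R * w i) nu x j).
Proof.
have pp := pi_prime eP; rewrite (eq_bigr (fun z => iota (fpsC (psi p (- z * M)) * char_series w nu x (j + lift p z)))).
  rewrite -rmorph_sum fpsum_lin; apply: (congr1 iota); apply: eq_fpsum => // i.
  transitivity (w i * zeta_char (j * nu i) * \sum_(z : 'F_p) psi p (z * (red p (nu i) - M))).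
    rewrite mulr_sumr; apply: eq_bigr => z _.
    rewrite [(j + _) * _]mulrDl zeta_charD zeta_char_liftM mulrBr (addcharD pp (etaP hp)) // mulNr; ring.
  rewrite (sum_addchar pp (etaP hp)) subr_eq0.
  by case: eqP => _; rewrite ?mulr1 ?mulr0 ?mul0r // mulrC mulrA.
by move=> z _; rewrite tate_constE -rmorphM.
Qed.
Lemma char_series_filter0 w nu x j :
  \sum_(z : 'F_p) iota (char_series w nu x (j + lift p z)) =
  iota (char_series (fun i => p%:R * (red p (nu i) == 0)%:R * w i) nu x j).
Proof.
rewrite -char_series_filter; apply: eq_bigr => z _.
by rewrite mulr0 (_ : psi p 0 = 1) // rmorph1 mul1r.
Qed.
Lemma char_op_series M Phi C w nu x j :
  (forall z, Phi (j + lift p z, 1) = C * iota (char_series w nu x (j + lift p z))) ->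
  char_op T zeta p M Phi (j, 1) = C * iota (char_series (fun i => p%:R * (red p (nu i) == red p M)%:R * w i) nu x j).
Proof.
move=> E; rewrite -char_series_filter mulr_sumr; apply: eq_bigr => z _.
by rewrite /shear_at /shear /= mulr1 E mulrCA.
Qed.
End CharSeries.

Section AtPrime.
Variable p : nat.
Hypothesis hp : pdv p.
Let eP := idemP N1 sqN hp.
Let pp := pi_prime eP.
Lemma odd_divisor : odd p. Proof. exact: dvdn_odd (pi_dvd eP) (ts_N_odd S). Qed.
Lemma divisor_coprime6 : coprime p 6. Proof. exact: coprime_dvdl (pi_dvd eP) (ts_N_coprime6 S). Qed.
Lemma divisor_gt3 : (3 < p)%N.
Proof. by have := prime_gt1 pp; have := divisor_coprime6; move: p => [|[|[|[|q]]]]. Qed.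
Lemma Fp24_neq0 : (24%:R : 'F_p) != 0.
Proof.
rewrite Fp_nat_eq0 // (_ : 24 = 2 * (2 * (2 * 3)))%N // !Euclid_dvdM // !dvdn_prime2 //.
by have := divisor_gt3; lia.
Qed.
Lemma divisor_neq0 (R : fieldType) (f : {rmorphism k -> R}) : (p%:R : R) != 0.
Proof. by rewrite -(rmorph_nat f) fmorph_eq0 (prim_root_natf_neq0 (etaP hp)). Qed.
Lemma gauss_sum_eta_neq0 (M : 'F_p) : M != 0 -> gauss_sum (eta p) M != 0.
Proof. by move=> M0; exact: (gauss_sum_neq0 pp odd_divisor (etaP hp) k2 M0). Qed.

Lemma quad_equivariant_eta_quot : quad_equivariant T p (eta_quot T).
Proof. by move=> x w x0; rewrite -[RHS]/(cF _ * _) (rmorph_quadchar cF); exact: eta_quot_scale. Qed.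
Lemma preserves_pt_scale f m (w : V) : preserves T 0 f -> f (pt_scale m w) = pt_scale m (f w).
Proof.
move=> hf; case: w => w1 w2; rewrite /pt_scale /= -(pair_mulr w1 w2 m) (preservesMn hf).
by case: (f (w1, w2)) => u1 u2; rewrite pair_mulr.
Qed.
Lemma quad_equivariant_comp B f : preserves T 0 f -> quad_equivariant T p B -> quad_equivariant T p (B \o f).
Proof. by move=> hf sB x w x0; rewrite /= preserves_pt_scale // sB. Qed.
Lemma quad_equivariantV B : quad_equivariant T p B -> quad_equivariant T p (fun v => (B v)^-1).
Proof.
by move=> sB x w x0; rewrite sB // invfM -fmorphV quadcharV.
Qed.
Lemma exists_nonresidue24 : exists M : 'Z_N, red p M != 0 /\ chi (24%:R * red p M) = -1.
Proof.
have [x [x0 Ex]] := exists_nonresidue pp odd_divisor.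
exists (lift p (x / 24%:R)); rewrite (lift_FpK eP); split.
  by rewrite mulf_neq0 // invr_eq0 Fp24_neq0.
by rewrite mulrCA mulfV ?Fp24_neq0 // mulr1 /quadchar (negPf x0) Ex (negPf (Fp_oppr1_neq1 pp odd_divisor)).
Qed.
End AtPrime.

Lemma nonres24_ex p : exists M : 'Z_N, pdv p -> red p M != 0 /\ chi (24%:R * red p M) = -1.
Proof.
have [hp|h] := boolP (pdv p); last by exists 0.
by have [M HM] := exists_nonresidue24 hp; exists M.
Qed.
Definition nonres24 p : 'Z_N := projT1 (cid (nonres24_ex p)).
Lemma nonres24P p : pdv p -> red p (nonres24 p) != 0 /\ chi (24%:R * red p (nonres24 p)) = -1.
Proof. exact: (projT2 (cid (nonres24_ex p))). Qed.
Definition nonres_gauss p : k := gauss_sum (eta p) (red p (nonres24 p)).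
Lemma nonres_gauss_neq0 p : pdv p -> nonres_gauss p != 0.
Proof. by move=> hp; apply: gauss_sum_eta_neq0 => //; case: (nonres24P hp). Qed.

Local Notation eps := ((eta_shift N)%:R : 'Z_N).
Lemma eta_shift24 : 24%:R * eps = -1.
Proof.
apply/eqP; rewrite -subr_eq0 opprK -[24%:R * _]natrM -[1]/(1%:R) -natrD Zp_nat_eq0 ?N1 //.
exact: dvdn_eta_shift (ts_N_coprime6 S).
Qed.
Definition pent_shift (n : int) : 'Z_N := (pent n)%:R - eps.
Lemma pent_shift24 n : 24%:R * pent_shift n = (6 * n - 1)%:~R ^+ 2.
Proof.
rewrite /pent_shift mulrBr eta_shift24 opprK -[24%:R * _]natrM natr1 pmulrn -rmorphXn; congr (_%:~R).
rewrite (_ : ((24 * pent n).+1)%:Z = 12 * (2 * (pent n)%:Z) + 1); last by move: (pent n); clear; lia.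
by rewrite (@pentE 1 isT); ring.
Qed.
Lemma red_pent_shift24 p n : pdv p -> 24%:R * red p (pent_shift n) = (6 * n - 1)%:~R ^+ 2.
Proof.
move=> hp; have eP := idemP N1 sqN hp.
by rewrite -(red_Fp_nat eP 24) -(red_FpM eP) pent_shift24 expr2 (red_FpM eP) (red_Fp_int eP).
Qed.
Lemma red_pent_shift_eq0 p n : pdv p -> (red p (pent_shift n) == 0) = (p%:Z %| 6 * n - 1)%Z.
Proof.
move=> hp; have [pp _] := andP hp; have := red_pent_shift24 n hp => E.
rewrite -Fp_int_eq0 // -[RHS]sqrf_eq0 -E mulf_eq0.
by rewrite (negPf (Fp24_neq0 hp)).
Qed.
Lemma red_pent_shift_nonres p n : pdv p -> (red p (pent_shift n) == red p (nonres24 p)) = false.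
Proof.
move=> hp; have [pp _] := andP hp; have op := odd_divisor hp; have [_ cM] := nonres24P hp.
apply/eqP => E; move: cM; rewrite -E red_pent_shift24 // expr2 quadcharM //.
have [->|x0] := eqVneq ((6 * n - 1)%:~R : 'F_p) 0.
  by rewrite quadchar0 mulr0 => /eqP; rewrite eq_sym oppr_eq0 oner_eq0.
rewrite quadchar_sqr // => /eqP; rewrite -subr_eq0 opprK -[1 + 1]/(2%:R) => /eqP E2.
by have := k2; rewrite E2 eqxx.
Qed.

Definition weyl_seq (qs : seq nat) (v : V) : V := foldl (fun v p => weyl_at p v) v qs.
Lemma preserves_weyl_seq qs : all pdv qs -> preserves T 0 (weyl_seq qs).
Proof.
elim: qs => [|p qs IH] /=; first by move=> _; exact: preserves_id.
by move=> /andP[hp hqs]; exact: symmetry_comp (IH hqs) (preserves_weyl_at sqN hp).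
Qed.
Lemma weyl_seq_local qs p g v : all pdv qs -> pdv p -> p \notin qs -> local_map (e p) g ->
  g (weyl_seq qs v) = weyl_seq qs (g v).
Proof.
elim: qs v => [|q qs IH] //= v /andP[hq hqs] hp; rewrite inE negb_or => /andP[pq pqs] lg.
by rewrite IH // (local_map_comm (orth hp hq pq) lg (weyl_local N q)).
Qed.

Lemma char_ops_sum M ps v : exists s : seq (k * V), forall B,
  char_ops T zeta M ps B v = \sum_(i <- s) cF i.1 * B i.2.
Proof.
elim: ps v => [|p ps IH] v; first by exists [:: (1, v)] => B; rewrite big_seq1 rmorph1 mul1r.
pose s (x : 'F_p) := projT1 (cid (IH (shear_at x v))).
exists (flatten [seq [seq (psi p (- x * red p M) * i.1, i.2) | i <- s x] | x <- index_enum 'F_p]) => B.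
rewrite /= /char_op big_flatten big_map; apply: eq_bigr => x _.
rewrite (projT2 (cid (IH (shear_at x v)))) -/(s x) mulr_sumr big_map; apply: eq_bigr => i _ /=.
by rewrite mulrA -[iota (fpsC (_ * _))]/(cF (_ * _)) rmorphM.
Qed.
Lemma char_ops_uniform M ps v Psi f : uniform_fun T Psi -> preserves T 0 f ->
  char_ops T zeta M ps Psi v = 0 -> char_ops T zeta M ps (Psi \o f) v = 0.
Proof.
move=> hu hf; have [s Es] := char_ops_sum M ps v; rewrite !Es => E.
exact: (uniform_fun_lin (x := snd) hu hf E).
Qed.

Local Notation killed qs j := (forall q, q \in qs -> e q * j = 0).
Lemma killed_lift qs q j (x : 'F_q) : all pdv qs -> pdv q -> q \notin qs -> killed qs j -> killed qs (j + lift q x).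
Proof.
move=> hqs hq nq fj r rq; rewrite mulrDr fj // add0r /lift_Fp mulrCA (orth (allP hqs r rq) hq) ?mulr0 //.
by apply: contraNneq nq => <-.
Qed.

Lemma char_ops_series (I : eqType) M ps qs j Phi C (w : I -> k) nu x : uniq ps -> all pdv ps -> all pdv qs ->
  {in ps, forall p, p \notin qs} -> killed qs j ->
  (forall j, killed qs j -> Phi (j, 1) = C * iota (char_series w nu x j)) ->
  char_ops T zeta M ps Phi (j, 1) =
  C * iota (char_series (fun i => \prod_(p <- ps) (p%:R * (red p (nu i) == red p M)%:R) * w i) nu x j).
Proof.
move=> up hps hqs; elim: ps up hps j => [|p ps IH] /= up hps j dj fj E.
  by rewrite E //; congr (_ * iota _); apply: eq_char_series => i; rewrite big_nil mul1r.
move: up hps => /andP[_ up] /andP[hp hps].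
rewrite (char_op_series hp M (w := fun i => \prod_(p <- ps) (p%:R * (red p (nu i) == red p M)%:R) * w i) (C := C)
  (nu := nu) (x := x)) => [|z].
  by congr (_ * iota _); apply: eq_char_series => i; rewrite big_cons mulrA.
apply: IH => // [q qps|]; first by apply: dj; rewrite inE qps orbT.
by apply: killed_lift => //; apply: dj; rewrite mem_head.
Qed.

Local Notation YY := (eta_quot T).
Local Notation KK := (eta_const S).
Local Notation pent_series w j := (char_series w pent_shift (fun n => 8 * N * pent n)%N j).

Lemma inv_eta_quot_pent j : KK * (YY (j, 1))^-1 = iota (pent_series (fun n : int => (-1) ^ n) j).
Proof.
have a0 : (0 < 8 * N)%N by rewrite muln_gt0 N_gt0.
have := eta_quot_euler S j; rewrite natr_Zp; set eu := euler _ => E.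
have E0 : iota eu != 0.
  by rewrite (iota_eq0 (ts_frac S)) euler_neq0 // fcoefCM fpsX_coef0 // mulr0.
have z0 : cF zeta ^+ (j * eta_shift N) != 0 by rewrite expf_neq0 // fmorph_eq0 zeta_neq0.
have Y0 : YY (j, 1) != 0.
  by apply: contra_eq_neq E => ->; rewrite mul0r eq_sym mulf_neq0 ?eta_const_neq0.
have zu : zeta ^+ j \is a GRing.unit by rewrite unitfE expf_neq0 // zeta_neq0.
have -> : KK * (YY (j, 1))^-1 = cF (zeta ^+ (j * eta_shift N))^-1 * iota eu.
  by apply: (mulIf Y0); rewrite mulfVK // fmorphV rmorphXn -mulrA [iota eu * _]mulrC E mulrC mulfK.
rewrite tate_constE -rmorphM /eu (@euler_pentagonal k 1 isT _ _ zu a0) -fpsumZ.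
apply: (congr1 iota); apply: eq_fpsum => // n.
rewrite mulrCA; congr (_ * _); rewrite /pent_shift mulrBr zeta_charD zeta_char_mulrn -/(zeta_char j) mulrC; congr (_ * _).
apply: (mulfI (zeta_char_neq0 (j * eps))); rewrite -zeta_charD subrr zeta_char0 zeta_char_mulrn /zeta_char -exprM mulfV //.
by rewrite expf_neq0 // zeta_neq0.
Qed.

Lemma weyl_op_inv_eta_quot p qs j : pdv p -> all pdv qs -> e p * j = 0 ->
  weyl_op T zeta p (nonres24 p) ((fun v => (YY v)^-1) \o weyl_seq qs) (j, 1) = 0.
Proof.
move=> hp hqs fj; pose Yi v := (YY v)^-1.
have uYi : uniform_fun T Yi by move=> v; apply/uniformV/uniform_eta_quot.
have X0 : char_op T zeta p (nonres24 p) (fun v => KK * Yi v) (j, 1) = 0.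
  have E z : KK * Yi (j + lift p z, 1) = 1 * iota (pent_series (fun n : int => (-1) ^ n) (j + lift p z)).
    by rewrite mul1r inv_eta_quot_pent.
  rewrite (char_op_series hp _ E) char_series_eq0 ?rmorph0 ?mulr0 // => n.
  by rewrite red_pent_shift_nonres // mulr0 mul0r.
apply: (@weyl_ops_eq0 _ _ _ _ T sqN zeta (nonres24 p) [:: p] (fun f => Yi \o f) (j, 1)) => //.
- by rewrite /= hp.
- by move=> q; rewrite inE => /eqP->; rewrite /= mulr1.
- by move=> q f; rewrite inE => /eqP-> hf; apply: quad_equivariant_comp => //; apply/quad_equivariantV/quad_equivariant_eta_quot.
- move=> f hf; apply: (@char_ops_uniform (nonres24 p) [:: p] (j, 1) Yi f uYi hf).
  by apply: (mulfI (eta_const_neq0 S)); rewrite mulr0 -[RHS]X0 -char_opsZ.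
- exact: preserves_weyl_seq.
Qed.

Lemma inv_eta_quot_weyl qs j : uniq qs -> all pdv qs -> killed qs j ->
  KK * (YY (weyl_seq qs (j, 1)))^-1 = cF (\prod_(p <- qs) (- nonres_gauss p)) *
   iota (pent_series (fun n : int => (all (fun p => p%:Z %| 6 * n - 1)%Z qs)%:R * (-1) ^ n) j).
Proof.
elim: qs j => [|p qs IH] j.
  move=> _ _ _; rewrite inv_eta_quot_pent big_nil (rmorph1 cF) mul1r; congr (iota _).
  by apply: eq_char_series => n; rewrite mul1r.
move=> /andP[npq uq] /andP[hp hqs] fj; pose Yi v := (YY v)^-1.
have := weyl_op_inv_eta_quot hp hqs (fj p (mem_head _ _)); have p0 := divisor_neq0 hp cF.
move/(congr1 (fun z => KK * z)); rewrite mulr0 /weyl_op mulrDr mulrCA => /eqP.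
rewrite addr_eq0 => /eqP E; apply: (mulfI p0); rewrite [LHS]E mulrCA mulr_sumr -/(nonres_gauss p).
pose w qs (n : int) : k := (all (fun p => p%:Z %| 6 * n - 1)%Z qs)%:R * (-1) ^ n.
rewrite (eq_bigr (fun x => cF (\prod_(q <- qs) - nonres_gauss q) * iota (pent_series (w qs) (j + lift p x)))).
  rewrite -mulr_sumr char_series_filter0 // big_cons -mulNr -rmorphN mulrA -rmorphM [RHS]mulrCA; congr (_ * _).
  rewrite -(rmorph_nat cF) char_seriesZ; congr (iota _); apply: eq_char_series => n; rewrite red_pent_shift_eq0 // /w /=.
  by case: (_ %| _)%Z; rewrite ?mulr1 // !mulr0 !mul0r mulr0.
move=> x _; rewrite /= /shear_at /shear /= mulr1 -/(Yi _) IH //; apply: killed_lift => // q qps; apply: fj.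
by rewrite inE qps orbT.
Qed.

Definition weyl_const p : k := - nonres_gauss p * (-1) ^ sixth p.
Definition gauss_const qs : k := \prod_(p <- qs) weyl_const p.
Lemma gauss_const_neq0 qs : all pdv qs -> gauss_const qs != 0.
Proof.
move=> /allP hq; rewrite /gauss_const prodf_seq_neq0; apply/allP => p pq /=; rewrite /weyl_const.
by rewrite mulf_neq0 ?expN1z_neq0 // oppr_eq0 nonres_gauss_neq0 ?hq.
Qed.
Definition pent_order qs := pent (- sixth_prod qs).
Local Notation dq qs := (\prod_(q <- qs) q)%N.

Lemma pdv_prime qs : all pdv qs -> all prime qs.
Proof. by apply: sub_all => p /andP[]. Qed.
Lemma abs_sixth_divisors qs : all pdv qs -> absz (6 * sixth_prod qs + 1) = dq qs.
Proof. by move=> /allP hq; apply: sixth_prod_abs => p /hq/divisor_coprime6. Qed.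
Lemma pent_sixth_scale qs m : all pdv qs ->
  pent (6 * sixth_prod qs * m - sixth_prod qs + m) = (dq qs ^ 2 * pent m + pent_order qs)%N.
Proof.
move=> hq; apply/eqP; rewrite -eqz_nat -(inj_eq (mulfI (_ : (2 : int) != 0))) //; apply/eqP.
rewrite PoszD mulrDr [in RHS]PoszM mulrCA !(@pentE 1 isT) -(abs_sixth_divisors hq) abszX2.
by move: (sixth_prod qs) => B; ring.
Qed.
Lemma pent_order24 qs : all pdv qs -> (24 * pent_order qs + 1 = dq qs ^ 2)%N.
Proof.
move=> hq; apply/eqP; rewrite -eqz_nat -(abs_sixth_divisors hq) abszX2 PoszD PoszM; apply/eqP.
have := @pentE 1 isT (- sixth_prod qs); rewrite -/(pent_order qs); move: (pent_order qs)%:Z (sixth_prod qs) => x B E.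
have -> : 24%:Z * x = 12 * (2 * x) by ring.
by rewrite E; ring.
Qed.

Lemma weyl_constE p (M : 'F_p) : pdv p -> M != 0 -> (weyl_const p * gauss_sum (eta p) M)^-1 =
  p%:R^-1 * chi (24%:R * M) * chi ((-12)%:~R : 'F_p).
Proof.
move=> hp M0; have [pp _] := andP hp; have op := odd_divisor hp; have [n0 chin] := nonres24P hp.
have chi24 : chi (red p (nonres24 p)) = - chi (24%:R : 'F_p).
  by apply: (mulfI (quadchar_neq0 k (Fp24_neq0 hp))); rewrite mulrN quadchar_sqr ?Fp24_neq0 // -quadcharM.
have G := gauss_sum1_sqr pp op (etaP hp) k2.
rewrite /weyl_const /nonres_gauss (gauss_sumE pp op _ n0) (gauss_sumE pp op _ M0) chi24 quadcharN12 ?divisor_gt3 // quadcharM //.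
move: G; set g := gauss_sum _ 1 => G.
have -> : - (- chi (24%:R : 'F_p) * g) * (-1) ^ sixth p * (chi M * g) = chi (24%:R : 'F_p) * chi M * (-1) ^ sixth p * (g * g) by ring.
rewrite G !invfM !quadcharV invr_expz expN1zN.
by move: (chi _) (chi _) (chi _) ((-1) ^ _) => x y z b; ring.
Qed.

(* The terms with [6 n - 1] divisible by [dq qs] form the pentagonal series of [q ^ (dq qs ^ 2)]. *)
Lemma inv_eta_quot_weyl_euler qs j : uniq qs -> all pdv qs -> killed qs j ->
  KK * (YY (weyl_seq qs (j, 1)))^-1 = cF (gauss_const qs * zeta_char (j * ((pent_order qs)%:R - eps))) *
   iota (fpsX (8 * N * pent_order qs) * euler (fpsC (zeta_char (j * (dq qs ^ 2)%:R)) * fpsX (8 * N * dq qs ^ 2))).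
Proof.
move=> uq hq fj; rewrite inv_eta_quot_weyl //; set B := sixth_prod qs.
have a0 : (0 < 8 * N)%N by rewrite muln_gt0 N_gt0.
have a1 : (0 < 8 * N * dq qs ^ 2)%N by rewrite !muln_gt0 N_gt0 prod_primes_gt0 ?pdv_prime.
have zu : zeta_char (j * (dq qs ^ 2)%:R) \is a GRing.unit by rewrite unitfE zeta_char_neq0.
pose h (m : int) : int := 6 * B * m - B + m.
have hE m : 6 * h m - 1 = (6 * B + 1) * (6 * m - 1) by rewrite /h; ring.
have Ball (n : int) : all (fun p => p%:Z %| 6 * n - 1)%Z qs = (6 * B + 1 %| 6 * n - 1)%Z.
  by rewrite dvdzE abs_sixth_divisors // dvdn_prod_primes ?pdv_prime.
have b0 : 6 * B + 1 != 0 by move: (B); clear; lia.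
rewrite /char_series -(@eq_fpsum _ _ (fun n => (all (fun p => p%:Z %| 6 * n - 1)%Z qs)%:R *
  ((-1) ^ n * zeta_char (j * pent_shift n))) _ (fun n => 8 * N * pent n)%N) => [|n|//]; last by rewrite mulrA.
rewrite (@fpsum_support _ _ _ h); last 4 first.
- by move=> m m' E; have := hE m; rewrite E hE => /(mulfI b0) E'; clear - E'; lia.
- move=> n; rewrite Ball => /dvdzP[z Ez].
  have [m Em] : exists m, z = 6 * m - 1.
    by exists (n - B * z); have : z = 6 * n - 1 - 6 * B * z by [rewrite Ez; ring]; move: (B); clear; lia.
  exists m; have := hE m; rewrite -Em => hm.
  have : 6 * h m - 1 = 6 * n - 1 by rewrite hm Ez mulrC.
  by move: (h m); clear; lia.
- by move=> m; rewrite Ball hE dvdz_mulr.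
- exact: (@finite_fibers_pent 1 isT).
rewrite (@euler_pentagonal k 1 isT _ _ zu a1) fpsX_fpsum; last exact: (@finite_fibers_pent 1 isT).
rewrite !tate_constE -!(rmorphM iota) -!fpsumZ; apply: (congr1 iota); apply: eq_fpsum => m; last first.
  by rewrite /= pent_sixth_scale // mulnDr addnC mulnA.
rewrite /= /pent_shift pent_sixth_scale // natrD -addrA mulrDr zeta_charD natrM [j * (_ * _)]mulrA.
rewrite (zeta_char_mulrn (j * (dq qs ^ 2)%:R)) /h !expfzDr ?oppr_eq0 ?oner_eq0 // expN1zN.
rewrite (_ : (-1) ^ (6 * B * m) = 1 :> k) ?mul1r /gauss_const; last by rewrite -mulrA expN1z6.
by rewrite big_split /= -expN1_sixth_prod; ring.
Qed.
End Evaluation.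

(* [p_shift], extended by 0 to negative arguments. *)
Definition p_shiftz (y : int) : nat := if (24 %| y + 1)%Z then p_int ((y + 1) %/ 24)%Z else 0.
Definition p_sqdiv (d : nat) (mu : int) : nat := if ((d ^ 2)%:Z %| mu)%Z then p_shiftz (mu %/ (d ^ 2)%:Z)%Z else 0.

Lemma p_shiftz24 (t : int) : p_shiftz (24 * t - 1) = p_int t.
Proof. by rewrite /p_shiftz subrK dvdz_mulr // mulKz. Qed.
Lemma p_sqdivM d y : (0 < d)%N -> p_sqdiv d (y * (d ^ 2)%:Z) = p_shiftz y.
Proof. by move=> d0; rewrite /p_sqdiv dvdz_mull // mulzK // eqz_nat -lt0n expn_gt0 d0. Qed.
Lemma p_sqdiv1 mu : p_sqdiv 1 mu = p_shiftz mu.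
Proof. by rewrite -(p_sqdivM mu (isT : 0 < 1)%N) mulr1. Qed.
Lemma p_sqdiv_neq0 d mu : (0 < d)%N -> p_sqdiv d mu != 0%N -> exists m : nat, mu = (24 * m%:Z - 1) * (d ^ 2)%:Z.
Proof.
move=> d0; rewrite /p_sqdiv; case: ifP => // /dvdzP[y ->].
rewrite mulzK ?eqz_nat -?lt0n ?expn_gt0 ?d0 // /p_shiftz; case: ifP => // /dvdzP[[u|u] Eu]; rewrite Eu mulzK //= => _.
by exists u; congr (_ * _); lia.
Qed.

Definition dvd_partitions (ell n0 : nat) (ps : seq nat) : Prop := forall m,
  (m == n0 %[mod ell])%N -> {in ps, forall p, (m == n0 %[mod p])%N} -> (ell %| partition_count m)%N.

Section PrimeCharacteristic.
Variables (k : fieldType) (ell : nat).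
Hypothesis chl : ell \in [pchar k].
Lemma natr_eq_mod (a b : nat) : ((a%:R : k) == b%:R) = (a == b %[mod ell])%N.
Proof.
wlog ab : a b / (a <= b)%N => [h|].
  by case/orP: (leq_total a b) => /h // E; rewrite eq_sym E eq_sym.
by rewrite eq_sym -subr_eq0 -natrB // -(dvdn_pcharf chl) -eqn_mod_dvd // eq_sym.
Qed.
Lemma indicator_eq_mod (a b : nat) : 1 - ((a%:R : k) - b%:R) ^+ ell.-1 = (a == b %[mod ell])%N%:R.
Proof.
have pl := pcharf_prime chl; rewrite -natr_eq_mod; case: eqVneq => [->|ne].
  by rewrite subrr expr0n; have := prime_gt1 pl; case: ell => [|[|l]] // _; rewrite subr0.
have x0 : (a%:R : k) - b%:R != 0 by rewrite subr_eq0.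
have E : ((a%:R : k) - b%:R) ^+ ell = a%:R - b%:R.
  by rewrite -(pFrobenius_autE chl) rmorphB /= !(pFrobenius_aut_nat chl).
apply/eqP; rewrite subr_eq0 eq_sym; apply/eqP/(mulfI x0).
by rewrite -exprS prednK ?prime_gt0 // E mulr1.
Qed.
End PrimeCharacteristic.

Section ResidueProjector.
Variables (k F : fieldType) (V : finZmodType) (N ell : nat) (T : diff_torsion_model k F V N ell).
Definition shift_deriv (c0 : k) (y : F) : F := dtm_D T y - tm_const T c0 * y.
(* [1 - (D - c0) ^ (ell - 1)] projects onto the exponents congruent to [c0] modulo [ell]. *)
Definition res_proj (c0 : k) (y : F) : F := y - iter ell.-1 (shift_deriv c0) y.

Lemma res_projZ c0 a y : res_proj c0 (tm_const T a * y) = tm_const T a * res_proj c0 y.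
Proof.
rewrite /res_proj mulrBr; congr (_ - _); elim: ell.-1 => //= m ->; rewrite /shift_deriv.
by rewrite dtm_DM dtm_DC mul0r add0r mulrBr; congr (_ - _); rewrite mulrCA.
Qed.
Lemma uniform_res_proj c0 Z : uniform T Z -> uniform T (fun f => res_proj c0 (Z f)).
Proof.
move=> hZ; apply: uniformB => //; elim: ell.-1 => //= m IH; apply: uniformB; first exact: uniform_D.
by apply: uniformM => //; apply: uniformC.
Qed.
End ResidueProjector.

(* [ls_power] discriminants turn the Euler product of the form into an [ell]-th power and leave
   room for an index shift by [ls_center]. *)
Record level_shift (ell N : nat) := LevelShift {
  ls_power : nat; ls_center : nat; ls_order : nat;
  ls_dvd : (ell %| N + 12 * ls_power)%N;
  ls_orderE : (pred_half N * N ^ 2 - theta_order N + 4 * N ^ 2 * ls_power = ls_order + 8 * N * ls_center)%N;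
  ls_center_ge : (N ^ 2 <= ls_center)%N }.

Lemma level_shift_exists ell N (t : int) : prime ell -> (3 < ell)%N -> (0 < N)%N ->
  exists (L : level_shift ell N) (s : nat), s%:Z - (ls_center L)%:Z = t.
Proof.
move=> pl l3 N0; have [u v Euv _] := egcdnP ell (isT : (0 < 12)%N).
have c12 : coprime 12 ell.
  by rewrite coprime_sym prime_coprime // !(Euclid_dvdM 2 6, Euclid_dvdM 2 3) // !dvdn_prime2 //; clear - l3; lia.
rewrite (eqP c12) in Euv; pose H := (N ^ 2 + absz t)%N; pose n := (N * u * ell.-1 + ell * (2 * H))%N.
have dn : (ell %| N + 12 * n)%N.
  have -> : (N + 12 * n = ell * (N * v * ell.-1 + N + 24 * H))%N.
    by rewrite /n; have := prime_gt0 pl; clear - Euv; case: ell Euv => //= l; nia.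
  exact: dvdn_mulr.
have le : (8 * N * H <= pred_half N * N ^ 2 - theta_order N + 4 * N ^ 2 * n)%N.
  have hn : (2 * H <= n)%N by rewrite /n (leq_trans _ (leq_addl _ _)) // leq_pmull // prime_gt0.
  apply: leq_trans (leq_addl _ _); apply: (@leq_trans (4 * N ^ 2 * (2 * H))%N); last by rewrite leq_mul2l hn orbT.
  by rewrite -mulnn; clear - N0; nia.
exists (LevelShift dn (esym (subnK le)) (leq_addr _ _)), (absz (t + H%:Z)) => /=.
by rewrite /H; clear; lia.
Qed.

Section Projection.
Variables (k F : fieldType) (ell N : nat) (S : tate_setup k F ell N).
Hypothesis sqN : squarefree N.
Variables (L : level_shift ell N) (n0 : nat).
Local Notation V := (('Z_N * 'Z_N)%type : finZmodType).
Local Notation T := (tate_shear_model S).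
Local Notation iota := (ts_iota S).
Local Notation zeta := (zeta S).
Local Notation cF := (tate_const S).
Local Notation N_gt0 := (ts_N_gt0 S).
Local Notation N1 := (ts_N_gt1 S).
Local Notation chl := (ts_pchar S).
Local Notation D := (tate_deriv S).
Local Notation pdv := (prime_divisor N).
Local Notation e := (idem N).
Local Notation lift p := (@lift_Fp N p (e p)).
Local Notation red := (@red_Fp N).
Local Notation eta p := (local_root N zeta p).
Local Notation killed qs j := (forall q, q \in qs -> e q * j = 0).
Local Notation eps := ((eta_shift N)%:R : 'Z_N).
Local Notation nome := (fpsX (8 * N ^ 2)%N : fps k).
Local Notation dq qs := (\prod_(q <- qs) q)%N.
Local Notation n := (ls_power L).
Local Notation H := (ls_center L).
Local Notation lead := (disc_const k N n).

Definition index_at (s : nat) : int := 24 * (s%:Z - H%:Z) - 1.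
Definition class_at (s : nat) : 'Z_N := eps + (s%:R - H%:R).
Definition exponent_at (s : nat) : nat := (ls_order L + 8 * N * s)%N.
Local Notation series w j := (char_series S w class_at exponent_at j).

Definition euler_power : F := iota (euler nome ^+ (N + 12 * n)).
Local Notation W := euler_power.
Lemma euler_power_neq0 : W != 0.
Proof. by rewrite /W (rmorphXn iota) expf_neq0 // iota_euler_neq0. Qed.
Lemma deriv_euler_power : D W = 0.
Proof.
rewrite /W tate_deriv_iota -(divnK (ls_dvd L)) exprM (derivationX (@fderivM k)).
by rewrite -(rmorph_nat (@fpsC k)) (pcharf0 chl) rmorph0 !mul0r rmorph0.
Qed.

Lemma finite_fibers_linear a b : (0 < b)%N -> finite_fibers (fun m : nat => a + b * m)%N.
Proof.
move=> b0 E; exists (seq.iota 0 E.+1) => m Em; rewrite mem_iota /= add0n ltnS -Em.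
by rewrite (leq_trans _ (leq_addl _ _)) // leq_pmull.
Qed.

Lemma class_at24 s : 24%:R * class_at s = (index_at s)%:~R.
Proof.
by rewrite mulrDr (eta_shift24 S) /index_at rmorphB rmorphM /= rmorphB /= -!pmulrn addrC mulrBr.
Qed.
Lemma red_class_at_eq0 p s : pdv p -> (red p (class_at s) == 0) = (p%:Z %| index_at s)%Z.
Proof.
move=> hp; have eP := idemP N1 sqN hp; rewrite -Fp_int_eq0 ?(pi_prime eP) // -(red_Fp_int eP) -class_at24.
by rewrite (red_FpM eP) mulf_eq0 (red_Fp_nat eP) (negPf (Fp24_neq0 S sqN hp)).
Qed.

Lemma pent_order_le qs : uniq qs -> all pdv qs -> (pent_order qs <= H)%N.
Proof.
move=> uq hq; apply: leq_trans (ls_center_ge L); have h24 := pent_order24 S sqN hq.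
have dN : (dq qs <= N)%N.
  apply: dvdn_leq; first exact: N_gt0.
  by rewrite dvdn_prod_primes ?(pdv_prime hq) //; apply: sub_all hq => p /andP[].
have : (dq qs ^ 2 <= N ^ 2)%N by rewrite leq_sqr.
by move: h24; move: (dq qs ^ 2)%N (N ^ 2)%N (pent_order qs); clear; lia.
Qed.

Lemma p_sqdiv_series qs j : uniq qs -> all pdv qs -> let d := dq qs in let h := pent_order qs in
  series (fun s => (p_sqdiv d (index_at s))%:R) j = fpsC (zeta_char S (j * (h%:R - eps)))^-1 *
  (fpsX (ls_order L + 8 * N * (H - h)) * fpsum (fun m : nat => (partition_count m)%:R * zeta_char S (j * (d ^ 2)%:R) ^+ m)
    (fun m => 8 * N * d ^ 2 * m)%N).
Proof.
move=> uq hq d h; have hH := pent_order_le uq hq; have h24 := pent_order24 S sqN hq.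
have d0 : (0 < d)%N by rewrite prod_primes_gt0 ?(pdv_prime hq).
have a0 : (0 < 8 * N)%N by rewrite muln_gt0 N_gt0.
have a1 : (0 < 8 * N * d ^ 2)%N by rewrite muln_gt0 a0 expn_gt0 d0.
pose f m := (H - h + d ^ 2 * m)%N.
have indexf m : index_at (f m) = (24 * m%:Z - 1) * (d ^ 2)%:Z.
  by rewrite /index_at /f -h24 !PoszD -subzn // !PoszM; ring.
have valf m : p_sqdiv d (index_at (f m)) = partition_count m by rewrite indexf p_sqdivM // p_shiftz24.
rewrite fpsX_fpsum; last exact (finite_fibers_linear 0 a1).
rewrite -fpsumZ /char_series.
rewrite -(@eq_fpsum _ _ (fun s => (`[< exists m, f m = s >])%:R * ((p_sqdiv d (index_at s))%:R * zeta_char S (j * class_at s)))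
  _ exponent_at) => [|s|//]; last first.
  case: asboolP => [_|nf]; rewrite ?mul1r //; have [->|nz] := eqVneq (p_sqdiv d (index_at s)) 0%N; first by rewrite !mul0r.
  have [m Em] := p_sqdiv_neq0 d0 nz; case: nf; exists m.
  by have := indexf m; rewrite -Em /index_at; clear; lia.
rewrite (@fpsum_support _ _ _ f) //; last 4 first.
- by move=> m m' /addnI/eqP; rewrite eqn_pmul2l ?expn_gt0 ?d0 // => /eqP.
- by move=> s /asboolP.
- by move=> m; apply/asboolP; exists m.
- exact: finite_fibers_linear.
apply: eq_fpsum => m; last by rewrite /= /exponent_at /f mulnDr addnA mulnA.
rewrite /= valf mulrCA; congr (_ * _).
have -> : class_at (f m) = eps - h%:R + (d ^ 2)%:R * m%:R by rewrite /class_at /f natrD natrM natrB //; ring.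
rewrite mulrDr zeta_charD mulrA zeta_char_mulrn; congr (_ * _).
apply: (mulfI (zeta_char_neq0 S (j * (h%:R - eps)))); rewrite mulfV ?zeta_char_neq0 // -zeta_charD -mulrDr.
by rewrite -[h%:R - _]opprB addNr mulr0 zeta_char0.
Qed.

Definition eta_form (v : V) : F := (tm_a T * tm_b T * (tm_a T - tm_b T)) ^+ n * eta_quot T v.

Lemma eta_form_weyl qs j : uniq qs -> all pdv qs -> killed qs j -> eta_form (weyl_seq qs (j, 1)) =
  W * iota (series (fun s => lead / gauss_const S sqN qs * (p_sqdiv (dq qs) (index_at s))%:R) j).
Proof.
move=> uq hq fj; have E := inv_eta_quot_weyl_euler S sqN uq hq fj; have G0 := gauss_const_neq0 S sqN hq.
have hH := pent_order_le uq hq; set d := dq qs in E *; set h := pent_order qs in E hH *.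
have a1 : (0 < 8 * N * d ^ 2)%N by rewrite !muln_gt0 N_gt0 prod_primes_gt0 ?(pdv_prime hq).
set z := zeta_char S (j * (_ - _)) in E; set c := zeta_char S (j * (d ^ 2)%:R) in E.
have z0 : z != 0 := zeta_char_neq0 S _; set eu := euler _ in E.
have X0 : eta_const S * (eta_quot T (weyl_seq qs (j, 1)))^-1 != 0.
  rewrite E mulf_neq0 ?fmorph_eq0 ?mulf_neq0 // (iota_eq0 (ts_frac S)) mulf_neq0 ?fpsX_neq0 //.
  by rewrite euler_neq0 // fcoefCM fpsX_coef0 // mulr0.
have Y0 : eta_quot T (weyl_seq qs (j, 1)) != 0 by apply: contraNneq X0 => ->; rewrite invr0 mulr0.
apply: (mulIf X0); rewrite /eta_form mulrACA mulfV // mulr1 discriminant_eta_const E -char_seriesZ (p_sqdiv_series j uq hq).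
rewrite -/d -/h -/z -/c /W !tate_constE -!(rmorphM iota); apply: (congr1 iota).
rewrite ls_orderE (_ : ls_order L + 8 * N * H = (ls_order L + 8 * N * (H - h)) + 8 * N * h)%N; last first.
  by rewrite -addnA -mulnDr subnK.
move: lead => l; rewrite [fpsX (_ + 8 * N * h)]fpsXD !fpsCM; have := euler_partition_series c a1; rewrite -/eu; set G := fpsum _ _ => EP.
have z1 : fpsC z^-1 * fpsC z = 1 by rewrite -fpsCM mulVf // rmorph1.
have g1 : fpsC (gauss_const S sqN qs)^-1 * fpsC (gauss_const S sqN qs) = 1 by rewrite -fpsCM mulVf // rmorph1.
set x1 := fpsX _; set x2 := fpsX _; set E0 := euler _ ^+ _; set g := gauss_const _ _ _ in g1 *.
transitivity (fpsC l * (x1 * x2) * E0 * (eu * G) * (fpsC z^-1 * fpsC z) * (fpsC g^-1 * fpsC g)).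
  by rewrite EP z1 g1 !mulr1.
ring.
Qed.

Lemma res_proj_fpsum (I : eqType) c0 (w : I -> k) (x : I -> nat) :
  res_proj T c0 (W * iota (fpsum w x)) = W * iota (fpsum (fun i => (1 - ((x i)%:R - c0) ^+ ell.-1) * w i) x).
Proof.
have shiftE v : shift_deriv T c0 (W * iota (fpsum v x)) = W * iota (fpsum (fun i => ((x i)%:R - c0) * v i) x).
  rewrite /shift_deriv dtm_DM -[dtm_D _]/D deriv_euler_power mul0r add0r tate_deriv_iota fderiv_fpsum mulrCA -mulrBr.
  rewrite -[tm_const _ c0]/(iota (fpsC c0)) -(rmorphM iota) -(rmorphB iota) -fpsumZ -fpsumN -fpsumD; congr (_ * iota _).
  by apply: eq_fpsum => // i; rewrite mulrBl mulr_natl.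
have iterE m : iter m (shift_deriv T c0) (W * iota (fpsum w x)) = W * iota (fpsum (fun i => ((x i)%:R - c0) ^+ m * w i) x).
  elim: m => [|m IH] /=; first by congr (_ * iota _); apply: eq_fpsum => // i; rewrite mul1r.
  by rewrite IH shiftE; congr (_ * iota _); apply: eq_fpsum => // i; rewrite exprS mulrA.
rewrite /res_proj iterE -mulrBr -(rmorphB iota) -fpsumN -fpsumD; congr (_ * iota _).
by apply: eq_fpsum => // i; rewrite mulrBl mul1r.
Qed.

Definition in_class (s : nat) : bool := (s == n0 + H %[mod ell])%N.
Lemma exponent_at_eq_mod s : (exponent_at s == exponent_at (n0 + H) %[mod ell])%N = in_class s.
Proof.
rewrite /exponent_at eqn_modDl /in_class -!(natr_eq_mod chl) !natrM.
have c0 : (8%:R * N%:R : k) != 0.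
  by rewrite mulf_neq0 ?(ts_N_neq0 S) // (natrX k 2 3) expf_neq0 // (ts_two_neq0 S).
by rewrite (inj_eq (mulfI c0)).
Qed.

Lemma in_classE s : in_class s = (ell%:Z %| s%:Z - H%:Z - n0%:Z)%Z.
Proof.
rewrite /in_class -eqz_nat -!modz_nat eqz_mod_dvd PoszD.
by rewrite (_ : s%:Z - (n0%:Z + H%:Z) = s%:Z - H%:Z - n0%:Z) //; ring.
Qed.

Definition proj_form (v : V) : F := res_proj T (exponent_at (n0 + H))%:R (eta_form v).
Definition proj_coef qs (s : nat) : k :=
  lead / gauss_const S sqN qs * ((in_class s)%:R * (p_sqdiv (dq qs) (index_at s))%:R).
Lemma proj_form_weyl qs j : uniq qs -> all pdv qs -> killed qs j ->
  proj_form (weyl_seq qs (j, 1)) = W * iota (series (proj_coef qs) j).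
Proof.
move=> uq hq fj; rewrite /proj_form eta_form_weyl // /char_series res_proj_fpsum; congr (_ * iota _).
apply: eq_fpsum => // s; rewrite (indicator_eq_mod chl) exponent_at_eq_mod /proj_coef.
by move: (_ / _) (in_class s)%:R (p_sqdiv _ _)%:R => x y z; ring.
Qed.
Lemma uniform_proj_form : uniform_fun T proj_form.
Proof.
move=> v; apply/uniform_res_proj/uniformM; last exact: uniform_eta_quot.
by apply: uniformXn; apply: uniformM; [apply: uniformM|apply: uniformB]; exact: uniform_a || exact: uniform_b.
Qed.
Lemma quad_equivariant_proj_form p : pdv p -> quad_equivariant T p proj_form.
Proof.
move=> hp x w x0; rewrite /proj_form -(res_projZ T); congr (res_proj _ _ _).
by rewrite /eta_form (quad_equivariant_eta_quot S sqN hp) // mulrCA.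
Qed.

Lemma series0_eq0 (w : nat -> k) : W * iota (series w 0) = 0 -> forall s, w s = 0.
Proof.
move=> /eqP; rewrite mulf_eq0 (negPf euler_power_neq0) /= (iota_eq0 (ts_frac S)) => /eqP E s.
have := congr1 (fun f => fcoef f (exponent_at s)) E; rewrite /char_series fcoef_fpsum1 => [|i]; last first.
  by move/addnI/eqP; rewrite eqn_pmul2l ?muln_gt0 ?N_gt0 // => /eqP.
by rewrite mul0r zeta_char0 mulr1.
Qed.

Definition expands_on (ps : seq nat) (Phi : V -> F) (c : seq nat -> nat -> k) := forall qs j, uniq qs -> all pdv qs ->
  {in qs, forall q, q \notin ps} -> killed ps j -> killed qs j ->
  Phi (weyl_seq qs (j, 1)) = W * iota (series (c qs) j).
Definition weyl_coef (M : 'Z_N) (c : seq nat -> nat -> k) p (qs : seq nat) s : k :=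
  p%:R * c (p :: qs) s + gauss_sum (eta p) (red p M) * (p%:R * (red p (class_at s) == 0)%:R * c qs s).

Lemma expands_on_weyl_op M ps p Phi c : all pdv ps -> pdv p -> p \notin ps -> expands_on ps Phi c ->
  expands_on (p :: ps) (weyl_op T zeta p M Phi) (weyl_coef M c p).
Proof.
move=> hps hp pps hPhi qs j uq hq dj fps fj.
have pqs : p \notin qs by apply/negP => /dj; rewrite mem_head.
have dj' q : q \in qs -> q \notin ps by move/dj; rewrite inE negb_or => /andP[].
have fpj : e p * j = 0 by apply: fps; rewrite mem_head.
have fps' : killed ps j by move=> q qps; apply: fps; rewrite inE qps orbT.
rewrite /weyl_op (weyl_seq_local S sqN _ hq hp pqs (weyl_local N p)) -[weyl_seq qs (weyl_at _ _)]/(weyl_seq (p :: qs) (j, 1)).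
rewrite hPhi //=; last 4 first.
- by rewrite pqs.
- by rewrite hp.
- by move=> q; rewrite inE => /predU1P[->|/dj'].
- by move=> q; rewrite inE => /predU1P[->|/fj].
rewrite (eq_bigr (fun x => W * iota (series (c qs) (j + lift p x)))).
  rewrite -mulr_sumr (char_series_filter0 S sqN hp) -(rmorph_nat cF) mulrCA [cF (gauss_sum _ _) * _]mulrCA.
  rewrite !char_seriesZ -mulrDr char_seriesD.
  by congr (_ * iota _); apply: eq_char_series => s; rewrite /weyl_coef mulrA.
move=> x _; rewrite (weyl_seq_local S sqN _ hq hp pqs (@shear_local N p x)) /shear_at /shear /= mulr1 hPhi //.
all: exact: (killed_lift S sqN).
Qed.
Lemma expands_on_weyl_ops M ps ps' Phi c : all pdv ps' -> uniq ps -> all pdv ps -> {in ps, forall p, p \notin ps'} ->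
  expands_on ps' Phi c -> expands_on (catrev ps ps') (weyl_ops T zeta M ps Phi) (foldl (weyl_coef M) c ps).
Proof.
elim: ps ps' Phi c => [|p ps IH] ps' Phi c //= hps' /andP[np up] /andP[hp hps] dj h.
apply: IH => //=; first by rewrite hp.
  move=> q qp; rewrite inE negb_or dj ?inE ?qp ?orbT // andbT.
  by apply: contraNneq np => <-.
by apply: expands_on_weyl_op => //; apply: dj; rewrite mem_head.
Qed.

Local Notation wc := (weyl_const S sqN).
Lemma foldl_weyl_coef M ps qs s : {in ps, forall p, red p (class_at s) = 0} ->
  {in ps, forall p, gauss_sum (eta p) (red p M) != 0} ->
  foldl (weyl_coef M) proj_coef ps qs s = \prod_(p <- ps) (gauss_sum (eta p) (red p M) * p%:R) *
    (lead * (gauss_const S sqN qs)^-1 * (in_class s)%:R *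
     uv_sum (fun=> 1) (fun p => (wc p * gauss_sum (eta p) (red p M))^-1) ps (fun d => (p_sqdiv d (index_at s))%:R) (dq qs)).
Proof.
elim/last_ind: ps qs => [|ps p IH] qs r0 g0.
  by rewrite /= big_nil mul1r /proj_coef mulrA.
have sub q : q \in ps -> q \in rcons ps p by move=> qps; rewrite mem_rcons inE qps orbT.
have pp : p \in rcons ps p by rewrite mem_rcons mem_head.
have {}IH qs' := IH qs' (sub_in1 sub r0) (sub_in1 sub g0).
rewrite foldl_rcons /weyl_coef !IH r0 // eqxx uv_sum_rcons -cats1 big_cat big_seq1.
rewrite {1}/gauss_const !big_cons -/(gauss_const _ _ qs) /=; have := g0 p pp.
move: (uv_sum _ _ _ _ _) (uv_sum _ _ _ _ _) (gauss_const _ _ _) (wc p) => x y G a.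
move: (gauss_sum _ _) (\prod_(q <- ps) _) => g w gn; rewrite !invfM.
by move: G^-1 a^-1 => G' a'; field.
Qed.

Definition residue_class : 'Z_N := eps + n0%:R.
Local Notation M0 := residue_class.

Lemma red_class_at_eq p s : pdv p -> (red p (class_at s) == red p M0) = (p%:Z %| s%:Z - H%:Z - n0%:Z)%Z.
Proof.
move=> hp; have eP := idemP N1 sqN hp; rewrite -subr_eq0 -(red_FpN eP) -(red_FpD eP).
rewrite -Fp_int_eq0 ?(pi_prime eP) // -(red_Fp_int eP); congr (red p _ == _).
by rewrite /class_at /residue_class !rmorphB /= -!pmulrn; ring.
Qed.
Lemma red_residue_class24 p : pdv p -> 24%:R * red p M0 = (24 * n0%:Z - 1)%:~R.
Proof.
move=> hp; have eP := idemP N1 sqN hp; rewrite -(red_Fp_nat eP 24) -(red_FpM eP) -(red_Fp_int eP); congr (red p _).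
by rewrite /residue_class mulrDr (eta_shift24 S) rmorphB rmorphM /= -!pmulrn addrC.
Qed.

Lemma proj_coef_eq0 ps s : dvd_partitions ell n0 ps -> {in ps, forall p, (p%:Z %| s%:Z - H%:Z - n0%:Z)%Z} ->
  proj_coef [::] s = 0.
Proof.
move=> hv dvs; rewrite /proj_coef big_nil p_sqdiv1 p_shiftz24; case Cs: (in_class s); last by rewrite mul0r mulr0.
case: (leqP H s) => Hs; last first.
  by rewrite (_ : s%:Z - H%:Z = Negz (H - s).-1) ?mulr0 //; lia.
rewrite subzn //= (_ : (partition_count _)%:R = 0) ?mulr0 //; apply/eqP; rewrite -(dvdn_pcharf chl); apply: hv.
  by move: Cs; rewrite /in_class -{1}(subnK Hs) eqn_modDr.
by move=> p /dvs; rewrite subzn // -eqz_mod_dvd !modz_nat eqz_nat.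
Qed.
Lemma char_ops_proj_form_eq0 ps j : uniq ps -> all pdv ps -> dvd_partitions ell n0 ps ->
  char_ops T zeta M0 ps proj_form (j, 1) = 0.
Proof.
move=> up hps hv; rewrite (@char_ops_series _ _ _ _ S sqN _ M0 ps [::] j _ W (proj_coef [::]) class_at exponent_at) //; last by move=> j' _; apply: (@proj_form_weyl [::]).
rewrite char_series_eq0 ?rmorph0 ?mulr0 // => s.
have [/allP hr|/allPn[p pps np]] := boolP (all (fun p => red p (class_at s) == red p M0) ps); last first.
  by rewrite (big_rem p pps) /= (negPf np) mulr0 !mul0r.
rewrite (proj_coef_eq0 hv) ?mulr0 // => p pps.
by rewrite -red_class_at_eq ?hr // (allP hps).
Qed.

Lemma weyl_ops_proj_form_eq0 ps : uniq ps -> all pdv ps -> dvd_partitions ell n0 ps ->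
  weyl_ops T zeta M0 ps proj_form (0, 1) = 0.
Proof.
move=> up hps hv.
apply: (@weyl_ops_eq0 _ _ _ _ T sqN zeta M0 ps (fun f => proj_form \o f) (0, 1) up hps _ _ _ _ id) => //.
- by move=> p pps; rewrite /= mulr0 mulr1.
- move=> p f pps hf; apply: quad_equivariant_comp => //.
  by apply: quad_equivariant_proj_form; apply: (allP hps).
- move=> f hf; apply: char_ops_uniform => //; [exact: uniform_proj_form|exact: char_ops_proj_form_eq0].
- exact: preserves_id.
Qed.

Lemma uv_sum_p_sqdiv_eq0 ps s : uniq ps -> all pdv ps -> dvd_partitions ell n0 ps ->
  {in ps, forall p, ~~ (p%:Z %| 24 * n0%:Z - 1)%Z} -> (ell%:Z %| s%:Z - H%:Z - n0%:Z)%Z -> {in ps, forall p, (p%:Z %| index_at s)%Z} ->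
  uv_sum (fun=> 1) (fun p => p%:R^-1 * (legendre (24 * n0%:Z - 1) p)%:~R * (legendre (-12) p)%:~R) ps
    (fun d => (p_sqdiv d (index_at s))%:R) 1 = 0 :> k.
Proof.
rewrite -in_classE => up hps hv nd Cs hs.
have M00 p : p \in ps -> red p M0 != 0.
  move=> pps; have hp := allP hps p pps; have [pp _] := andP hp; apply: contra (nd p pps) => /eqP r0.
  by rewrite -Fp_int_eq0 // -red_residue_class24 // r0 mulr0.
have EP : expands_on [::] proj_form proj_coef by move=> qs j uq hq _ _ fj; apply: proj_form_weyl.
have E := expands_on_weyl_ops M0 (isT : all pdv [::]) up hps (fun _ _ => isT) EP.
have: weyl_ops T zeta M0 ps proj_form (0, 1) = W * iota (series (foldl (weyl_coef M0) proj_coef ps [::]) 0).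
  by apply: (E [::] 0) => // q _; rewrite mulr0.
rewrite weyl_ops_proj_form_eq0 // => /esym/series0_eq0/(_ s).
have g0 p : p \in ps -> gauss_sum (eta p) (red p M0) != 0.
  by move=> pps; apply: (gauss_sum_eta_neq0 S sqN (allP hps p pps)); apply: M00.
rewrite foldl_weyl_coef // => [|p pps]; last by apply/eqP; rewrite red_class_at_eq0 ?hs // (allP hps).
rewrite /gauss_const !big_nil Cs !mulr1 invr1 mulr1 => /eqP; rewrite mulf_eq0.
suff /negPf-> : \prod_(p <- ps) (gauss_sum (eta p) (red p M0) * p%:R) != 0.
  rewrite /= mulf_eq0 (negPf (disc_const_neq0 S n)) /= => /eqP <-.
  apply: (eq_uv_sum (P := xpredT)) => // p pps; have hp := allP hps p pps; have [pp _] := andP hp.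
  have op := odd_divisor S sqN hp.
  by rewrite (weyl_constE S sqN hp (M00 p pps)) red_residue_class24 // !(legendre_quadchar pp op).
rewrite prodf_seq_neq0; apply/allP => p pps /=; rewrite mulf_neq0 ?g0 //.
exact: (divisor_neq0 S sqN (allP hps p pps) idfun).
Qed.

Lemma dvd_p_sqdiv p ps s : uniq (p :: ps) -> all pdv (p :: ps) -> dvd_partitions ell n0 ps ->
  (ell%:Z %| s%:Z - H%:Z - n0%:Z)%Z -> {in ps, forall q, (q%:Z %| s%:Z - H%:Z - n0%:Z)%Z} ->
  (ell %| p_sqdiv p (index_at s))%N.
Proof.
rewrite -in_classE => /= /andP[np up] /andP[hp hps] hv Cs hs; rewrite (dvdn_pcharf chl); apply/eqP.
have X0 : char_ops T zeta M0 ps (proj_form \o weyl_at p) (0, 1) = 0.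
  by apply: char_ops_uniform; [exact: uniform_proj_form|exact: preserves_weyl_at|exact: char_ops_proj_form_eq0].
rewrite (@char_ops_series _ _ _ _ S sqN _ M0 ps [:: p] 0 _ W (proj_coef [:: p]) class_at exponent_at) //= in X0; last 4 first.
- by rewrite hp.
- by move=> q qps; rewrite inE; apply: contraNneq np => <-.
- by move=> q _; rewrite mulr0.
- by move=> j fj; apply: (@proj_form_weyl [:: p]) => //=; rewrite hp.
have c0 : lead / gauss_const S sqN [:: p] != 0.
  apply: mulf_neq0; first exact: disc_const_neq0 S n.
  by rewrite invr_eq0; apply: gauss_const_neq0; rewrite /= hp.
have P0 : \prod_(q <- ps) (q%:R * (red q (class_at s) == red q M0)%:R) != 0 :> k.
  rewrite prodf_seq_neq0; apply/allP => q qps /=; have hq := allP hps q qps.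
  by rewrite red_class_at_eq // hs // mulr1; exact: (divisor_neq0 S sqN hq idfun).
have := series0_eq0 X0 s => /eqP; rewrite /proj_coef Cs mul1r big_seq1.
by rewrite mulf_eq0 (negPf P0) mulf_eq0 (negPf c0) => /eqP.
Qed.
End Projection.

(** * Congruence classes of partitions *)

Lemma prim_root_field_exists ell L : prime ell -> coprime ell L -> (0 < L)%N ->
  exists (k : fieldType) (g : k), ell \in [pchar k] /\ L.-primitive_root g.
Proof.
move=> pl cl L0; have t0 : (0 < totient L)%N by rewrite totient_gt0.
have [K chK cK] := pPrimePowerField pl t0; have cK0 : (0 < #|K|)%N by rewrite cK expn_gt0 prime_gt0.
have dL : (L %| #|K|.-1)%N.
  by have := Euler_exp_totient cl; rewrite -cK => /eqP; rewrite eqn_mod_dvd // subn1.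
have cK1 : (0 < #|K|.-1)%N.
  by rewrite -ltnS prednK // cK -{1}(expn0 ell) ltn_exp2l // prime_gt1.
have [g gP] : exists g : K, (#|K|.-1).-primitive_root g.
  suff /hasP[g _ gP] : has (#|K|.-1).-primitive_root (filter (predC1 0) (enum K)) by exists g.
  apply: has_prim_root; rewrite ?size_enum_predC1 //; last by apply: filter_uniq; exact: enum_uniq.
  apply/allP => x; rewrite mem_filter => /andP[/= x0 _].
  by rewrite unity_rootE; apply/eqP/(mulfI x0); rewrite mulr1 -exprS prednK ?expf_card.
exists K, (g ^+ (#|K|.-1 %/ L)); split=> //; have := exp_prim_root gP (#|K|.-1 %/ L).
have d' : (#|K|.-1 %/ L %| #|K|.-1)%N by rewrite -{2}(divnK dL) dvdn_mulr.
by rewrite (gcdn_idPl d') -{1}(divnK dL) mulKn // divn_gt0 // dvdn_leq.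
Qed.

Lemma tate_setup_exists ell N : prime ell -> (3 < ell)%N -> (1 < N)%N -> coprime N (6 * ell) ->
  exists k F : fieldType, inhabited (tate_setup k F ell N).
Proof.
move=> pl l3 N1; rewrite coprimeMr => /andP[cN6 cNl]; have N0 := ltnW N1.
have l0 : (0 < ell.-1)%N by rewrite -ltnS prednK ?prime_gt0 // prime_gt1.
have L0 : (0 < N ^ 2 * ell.-1)%N by rewrite muln_gt0 expn_gt0 N0.
have cL : coprime ell (N ^ 2 * ell.-1) by rewrite coprimeMr coprimeXr ?coprimenP ?prime_gt0 // coprime_sym.
have [k [g [chl gP]]] := prim_root_field_exists pl cL L0.
have root a b : (a * b = N ^ 2 * ell.-1)%N -> (0 < a)%N -> b.-primitive_root (g ^+ a).
  move=> E a0; have := exp_prim_root gP a; rewrite -E.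
  by have /gcdn_idPl -> : (a %| a * b)%N by [rewrite dvdn_mulr]; rewrite mulKn.
have xiP := root _ (N ^ 2)%N (mulnC _ _) l0; have N20 : (0 < N ^ 2)%N by rewrite expn_gt0 N0.
have [F [iota Fr]] := frac_exists (fps k); exists k, F; split.
exact: (@TateSetup k F ell N iota Fr pl l3 chl N1 cN6 _ xiP _ (root _ _ erefl N20)).
Qed.

Lemma squarefree_prod_primes ps : uniq ps -> all prime ps -> squarefree (\prod_(p <- ps) p).
Proof.
move=> ups pps p pp; apply/negP => d; have dp := dvdn_trans (dvdn_exp2l p (isT : 1 <= 2)%N) d.
have pin : p \in ps.
  move: dp; rewrite expn1 Euclid_dvd_prod // big_has => /hasP[q qps].
  by rewrite (dvdn_prime2 pp (allP pps q qps)) => /eqP->.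
move: d; rewrite (big_rem p pin) /= -mulnn dvdn_pmul2l ?prime_gt0 //; apply/negP.
rewrite -prime_coprime // coprime_prod_primes //; last by rewrite mem_rem_uniq // inE eqxx.
by apply/allP => q /mem_rem/(allP pps).
Qed.
Lemma coprime_prodl ps m : all (fun p => coprime p m) ps -> coprime (\prod_(p <- ps) p) m.
Proof. by elim: ps => [|p ps IH] /=; rewrite ?big_nil ?coprime1n // big_cons coprimeMl => /andP[-> /IH]. Qed.
Lemma coprime24 m : coprime m 6 -> coprime 24 m.
Proof. by move=> c; rewrite coprime_sym (coprimeMr m 6 4) c; apply: (@coprimeXr 2 m 2); apply: coprime_dvdr c. Qed.
Lemma dvdz24M (D : nat) x : coprime 24 D -> (D%:Z %| 24 * x)%Z = (D%:Z %| x)%Z.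
Proof. by move=> c; rewrite Gauss_dvdzr // coprimezE coprime_sym. Qed.
Lemma sqrn_mod24 m : coprime m 6 -> exists h, (m ^ 2 = 24 * h + 1)%N.
Proof.
rewrite -coprime_modl -(@modn_dvdm 24) // coprime_modl => c.
have A : all (fun r => coprime r 6 ==> (r ^ 2 %% 24 == 1)%N) (iota 0 24) by [].
have := implyP (allP A (m %% 24)%N _) c; rewrite mem_iota ltn_mod modnXm => /(_ isT)/eqP E.
by exists (m ^ 2 %/ 24)%N; rewrite mulnC [LHS](divn_eq _ 24) E.
Qed.
Lemma exists_dvd24_sub1 (D : nat) (M : int) : coprime 24 D -> (0 < D)%N ->
  exists n0 : nat, (D%:Z %| 24 * n0%:Z - 1 - M)%Z.
Proof.
move=> c D0; have [u v E _] := egcdnP D (isT : (0 < 24)%N); rewrite (eqP c) in E.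
have D0' : D%:Z != 0 by rewrite eqz_nat -lt0n.
have := modz_ge0 (M + 1) D0'; case Ew: ((M + 1) %% D%:Z)%Z => [w|//] _.
exists (u * w)%N; apply/dvdzP; exists (v%:Z * w%:Z - ((M + 1) %/ D%:Z)%Z).
have E1 : u%:Z * 24 = v%:Z * D%:Z + 1 by rewrite -!PoszM E PoszD.
have : M = ((M + 1) %/ D%:Z)%Z * D%:Z + w%:Z - 1 by rewrite -Ew -divz_eq addrK.
move: ((M + 1) %/ D%:Z)%Z => q ->.
by rewrite PoszM mulrA [24 * _]mulrC E1; ring.
Qed.
Lemma partition_count0 : partition_count 0 = 1%N.
Proof.
rewrite /partition_count; have -> : [set m : {ffun 'I_0 -> 'I_1} | (\sum_(i < 0) i.+1 * m i)%N == 0%N] = setT.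
  by apply/setP => m; rewrite !inE big_ord0.
by rewrite cardsT card_ffun !card_ord.
Qed.
Lemma p_sqdivN_sqr c m : (0 < m)%N -> (c %| m)%N -> p_sqdiv c (- (m ^ 2)%:Z) = (c == m).
Proof.
move=> m0 /dvdnP[q Eq]; move: m0; rewrite Eq muln_gt0 => /andP[q0 c0].
rewrite expnMn PoszM -mulNr p_sqdivM // /p_shiftz -{1}[c]mul1n eqn_pmul2r // eq_sym.
have [->|q1] := eqVneq q 1%N; first by rewrite addNr dvdz0 div0z /= partition_count0.
case: ifP => // /dvdzP[z Ez]; rewrite Ez mulzK //.
case: z Ez => // z; have : (1 < q)%N by rewrite ltn_neqAle eq_sym q1.
by rewrite -mulnn; clear; nia.
Qed.

Definition twist_sign (M : int) (p : nat) : int := legendre (-12) p * legendre M p.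

Section Classes.
Variables (ell : nat) (ps : seq nat).
Hypothesis pl : prime ell.
Hypothesis l3 : (3 < ell)%N.
Hypothesis ups : uniq ps.
Hypothesis pps : all prime ps.
Hypothesis cps : all (fun p => coprime p (6 * ell)) ps.
Local Notation N := (\prod_(p <- ps) p)%N.

Let ell_odd : odd ell. Proof. by case: (even_prime pl) l3 => [->|]. Qed.
Let cNl : coprime N ell. Proof. by have := coprime_prodl cps; rewrite coprimeMr => /andP[]. Qed.
Let cN6 : coprime N 6. Proof. by have := coprime_prodl cps; rewrite coprimeMr => /andP[]. Qed.
Let cl6 : coprime ell 6.
Proof. by rewrite prime_coprime // (Euclid_dvdM 2 3) // !dvdn_prime2 //; clear - l3; lia. Qed.
Let N_gt0 : (0 < N)%N := prod_primes_gt0 pps.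
Let divisor_coprime6 p : p \in ps -> coprime p 6.
Proof. by move=> /(allP cps); rewrite coprimeMr => /andP[]. Qed.
Let divisor_odd p : p \in ps -> odd p.
Proof. by move=> /divisor_coprime6 c; rewrite -coprimen2 (coprime_dvdr _ c). Qed.
Let dvdlN x : ((ell * N)%:Z %| x)%Z = (ell%:Z %| x)%Z && (N%:Z %| x)%Z.
Proof. by rewrite PoszM Gauss_dvdz // coprimezE coprime_sym cNl. Qed.
Let dvdN x : (N%:Z %| x)%Z = all (fun p => p%:Z %| x)%Z ps.
Proof. by rewrite dvdzE absz_nat dvdn_prod_primes. Qed.
Let c24lN : coprime 24 (ell * N). Proof. by rewrite coprimeMr !coprime24. Qed.

Lemma prime_divisors_prod : all (prime_divisor N) ps.
Proof. by apply/allP => p pin; rewrite /prime_divisor (allP pps) // (big_rem p pin) dvdn_mulr. Qed.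

Lemma dvd_uv_sum_residue (n0 : nat) (t : int) : dvd_partitions ell n0 ps ->
  {in ps, forall p, ~~ (p%:Z %| 24 * n0%:Z - 1)%Z} -> (ell%:Z %| t - n0%:Z)%Z -> (N%:Z %| 24 * t - 1)%Z ->
  (ell%:Z %| uv_sum (fun p => p%:Z) (twist_sign (24 * n0%:Z - 1)) ps (fun d => (p_sqdiv d (24 * t - 1))%:Z) 1)%Z.
Proof.
move=> hv nd dt; rewrite dvdN => /allP dN.
have [ps0|psn] := eqVneq ps [::].
  rewrite ps0 /= p_sqdiv1 p_shiftz24; case: t dt {dN} => // m; rewrite -eqz_mod_dvd !modz_nat eqz_nat => dm.
  by rewrite dvdzE !absz_nat hv // ps0.
have N1 : (1 < N)%N.
  case: ps psn pps => // p qs _ /= /andP[pp hqs]; rewrite big_cons.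
  by rewrite (leq_trans (prime_gt1 pp)) // leq_pmulr // prod_primes_gt0.
have [k [F [S]]] := tate_setup_exists pl l3 N1 (coprime_prodl cps).
have [L [s Es]] := level_shift_exists t pl l3 N_gt0.
have Ei : index_at L s = 24 * t - 1 by rewrite /index_at Es.
have := uv_sum_p_sqdiv_eq0 S (squarefree_prod_primes ups pps) (L := L) (s := s) ups prime_divisors_prod hv nd.
rewrite Ei Es => /(_ dt dN) U0; rewrite (dvdz_pcharf (ts_pchar S)) rmorph_uv_sum.
apply/eqP; rewrite -[RHS](mulr0 (\prod_(p <- ps) (p%:R : k))) -[in RHS]U0 uv_sum_scale.
apply: (eq_uv_sum (P := xpredT)) => //= p pin; rewrite -?pmulrn ?mulr1 //.
have p0 : (p%:R : k) != 0.
  rewrite -(dvdn_pcharf (ts_pchar S)) -prime_coprime // coprime_sym.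
  by have := allP cps p pin; rewrite coprimeMr => /andP[].
by rewrite /twist_sign rmorphM /=; field.
Qed.

Lemma dvd_p_sqdiv_prime p (n0 : nat) (t : int) : prime p -> p \notin ps -> coprime p (6 * ell) ->
  dvd_partitions ell n0 ps -> (ell%:Z %| t - n0%:Z)%Z -> (N%:Z %| t - n0%:Z)%Z -> (ell %| p_sqdiv p (24 * t - 1))%N.
Proof.
move=> pp np cp hv dt; rewrite dvdN => /allP dN.
have pps' : all prime (p :: ps) by rewrite /= pp.
have ups' : uniq (p :: ps) by rewrite /= np.
pose N' := (\prod_(q <- p :: ps) q)%N; have N'0 : (0 < N')%N := prod_primes_gt0 pps'.
have N'1 : (1 < N')%N by rewrite /N' big_cons (leq_trans (prime_gt1 pp)) // leq_pmulr.
have cN' : coprime N' (6 * ell) by apply: coprime_prodl; rewrite /= cp.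
have pdv : all (prime_divisor N') (p :: ps).
  by apply/allP => q qin; rewrite /prime_divisor (allP pps') // /N' (big_rem q qin) dvdn_mulr.
have [k [F [S]]] := tate_setup_exists pl l3 N'1 cN'.
have [L [s Es]] := level_shift_exists t pl l3 N'0.
have := dvd_p_sqdiv S (squarefree_prod_primes ups' pps') (L := L) (s := s) ups' pdv hv.
by rewrite /index_at Es; apply.
Qed.

Definition class_vanishes (M : int) :=
  forall m : nat, ((ell * N)%:Z %| 24 * m%:Z - 1 - M)%Z -> (ell %| partition_count m)%N.

Lemma class_vanishes_residue M : class_vanishes M ->
  exists n0 : nat, ((ell * N)%:Z %| 24 * n0%:Z - 1 - M)%Z /\ dvd_partitions ell n0 ps.
Proof.
move=> vM; have [|n0 h] := exists_dvd24_sub1 M c24lN; first by rewrite muln_gt0 N_gt0 prime_gt0.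
exists n0; split=> // m ml mp; apply: vM.
have -> : 24 * m%:Z - 1 - M = 24 * (m%:Z - n0%:Z) + (24 * n0%:Z - 1 - M) by ring.
rewrite rpredD // dvdz_mull // dvdlN dvdN; apply/andP; split; first by rewrite -eqz_mod_dvd !modz_nat eqz_nat.
by apply/allP => p pin; rewrite -eqz_mod_dvd !modz_nat eqz_nat mp.
Qed.

Lemma class_vanishes_prime p M M' : prime p -> p \notin ps -> coprime p (6 * ell) -> class_vanishes M ->
  ((ell * N)%:Z %| (p ^ 2)%:Z * M' - M)%Z -> class_vanishes M'.
Proof.
move=> pp np cp vM hM m hm; have [n0 [h0 hv]] := class_vanishes_residue vM.
have p6 : coprime p 6 by move: cp; rewrite coprimeMr => /andP[].
have [h Eh] := sqrn_mod24 p6; pose t : int := (p ^ 2)%:Z * m%:Z - h%:Z.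
have Et : 24 * t - 1 = (24 * m%:Z - 1) * (p ^ 2)%:Z by rewrite /t Eh PoszD PoszM; ring.
have : ((ell * N)%:Z %| 24 * (t - n0%:Z))%Z.
  have -> : 24 * (t - n0%:Z) = (p ^ 2)%:Z * (24 * m%:Z - 1 - M') + ((p ^ 2)%:Z * M' - M) - (24 * n0%:Z - 1 - M).
    have -> : 24 * (t - n0%:Z) = (24 * t - 1) - (24 * n0%:Z - 1) by ring.
    by rewrite Et; ring.
  by rewrite rpredB // rpredD // dvdz_mull.
rewrite dvdz24M // dvdlN => /andP[dl dN].
have := dvd_p_sqdiv_prime pp np cp hv dl dN.
by rewrite Et p_sqdivM ?prime_gt0 // p_shiftz24.
Qed.

Lemma class_vanishes_sqr r M M' : coprime r (6 * ell * N) -> (0 < r)%N -> class_vanishes M ->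
  ((ell * N)%:Z %| (r ^ 2)%:Z * M' - M)%Z -> class_vanishes M'.
Proof.
elim/ltn_ind: r M M' => r IH M M' cr r0 vM hM.
have [r1|r1] := leqP r 1.
  have E : r = 1%N by lia.
  rewrite E mul1r in hM; move=> m hm; apply: vM.
  have -> : 24 * m%:Z - 1 - M = (24 * m%:Z - 1 - M') + (M' - M) by ring.
  exact: rpredD.
pose p := pdiv r; pose r' := (r %/ p)%N; have pp : prime p := pdiv_prime r1.
have Er : r = (r' * p)%N by rewrite divnK // pdiv_dvd.
have r'0 : (0 < r')%N by move: r0; rewrite Er muln_gt0 => /andP[].
move: cr; rewrite Er coprimeMl => /andP[cr' cp].
have [cpl cpN] : coprime p (6 * ell) /\ coprime p N by move: cp; rewrite coprimeMr => /andP[].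
have np : p \notin ps by apply/negP => /(allP prime_divisors_prod)/andP[_]; apply/negP; rewrite -prime_coprime.
apply: (IH r' _ ((r' ^ 2)%:Z * M')) => //.
- by rewrite Er ltn_Pmulr // prime_gt1.
- apply: (class_vanishes_prime pp np cpl vM); move: hM; rewrite Er expnMn PoszM.
  by rewrite [(r' ^ 2)%:Z * _]mulrC mulrA.
- by rewrite subrr dvdz0.
Qed.

Lemma class_vanishes_legendre M mu : class_vanishes M -> legendre (- mu) ell = legendre (- M) ell ->
  exists M', [/\ class_vanishes M', (ell%:Z %| mu - M')%Z & (N%:Z %| M' - M)%Z].
Proof.
move=> vM E; have [dM|nM] := boolP (ell%:Z %| M)%Z.
  exists M; split; rewrite ?subrr ?dvdz0 // rpredB //.
  by have := legendre_eq0 ell (- mu); rewrite E legendre_eq0 !rpredN dM => <-.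
have [u [cu hu]] := eq_legendre_sqr pl ell_odd E nM.
have c6N : coprime ell (6 * N) by rewrite coprimeMr cl6 coprime_sym.
pose r := chinese ell (6 * N) u 1.
have rl : r = u %[mod ell] by exact: chinese_modl.
have r6 : r = 1 %[mod 6 * N] by exact: chinese_modr.
have crl : coprime r ell by rewrite -coprime_modl rl coprime_modl.
have cr : coprime r (6 * ell * N).
  by rewrite -mulnA mulnCA coprimeMr crl -coprime_modl r6 coprime_modl coprime1n.
have r0 : (0 < r)%N.
  by rewrite lt0n; apply: contraTneq crl => ->; rewrite /coprime gcd0n gtn_eqF // prime_gt1.
pose M' := zchinese ell%:Z N%:Z mu M.
have clN : coprimez ell%:Z N%:Z by rewrite coprimezE coprime_sym cNl.
have Ml : (ell%:Z %| M' - mu)%Z by rewrite -eqz_mod_dvd; apply/eqP; exact: zchinese_modl.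
have MN : (N%:Z %| M' - M)%Z by rewrite -eqz_mod_dvd; apply/eqP; exact: zchinese_modr.
exists M'; split=> //; last by rewrite -opprB rpredN.
apply: (class_vanishes_sqr cr r0 vM); rewrite dvdlN; apply/andP; split.
  have -> : (r ^ 2)%:Z * M' - M = (r ^ 2)%:Z * (M' - mu) + ((r%:Z - u%:Z) * ((r%:Z + u%:Z) * mu) + ((u ^ 2)%:Z * mu - M)).
    by rewrite -!mulnn !PoszM; ring.
  by rewrite rpredD ?dvdz_mull // rpredD // dvdz_mulr // -eqz_mod_dvd !modz_nat rl.
have -> : (r ^ 2)%:Z * M' - M = (r ^ 2)%:Z * (M' - M) + (r%:Z - 1) * ((r%:Z + 1) * M) by rewrite -mulnn PoszM; ring.
apply: rpredD; first exact: dvdz_mull.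
apply: dvdz_mulr; have : ((6 * N)%:Z %| r%:Z - 1)%Z by rewrite -eqz_mod_dvd -[1]/(1%:Z) !modz_nat r6.
by apply: dvdz_trans; rewrite PoszM dvdz_mull.
Qed.

Lemma dvd_uv_sum_class M mu : class_vanishes M -> {in ps, forall p, ~~ (p%:Z %| M)%Z} -> (24 %| mu + 1)%Z ->
  (N%:Z %| mu)%Z -> legendre (- mu) ell = legendre (- M) ell ->
  (ell%:Z %| uv_sum (fun p => p%:Z) (twist_sign M) ps (fun d => (p_sqdiv d mu)%:Z) 1)%Z.
Proof.
move=> vM nM /dvdzP[t Et] dN E; have Emu : mu = 24 * t - 1 by rewrite mulrC -Et addrK.
have [M' [vM' hl hN]] := class_vanishes_legendre vM E.
have [n0 [h0 hv]] := class_vanishes_residue vM'; move: h0; rewrite dvdlN => /andP[h0l h0N].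
have dM p : p \in ps -> (p%:Z %| 24 * n0%:Z - 1 - M)%Z.
  have : (N%:Z %| 24 * n0%:Z - 1 - M)%Z.
    have -> : 24 * n0%:Z - 1 - M = (24 * n0%:Z - 1 - M') + (M' - M) by ring.
    exact: rpredD.
  by rewrite dvdN => /allP; apply.
have nd : {in ps, forall p, ~~ (p%:Z %| 24 * n0%:Z - 1)%Z}.
  move=> p pin; apply: contra (nM p pin) => d.
  have -> : M = (24 * n0%:Z - 1) - (24 * n0%:Z - 1 - M) by ring.
  by rewrite rpredB ?dM.
have tl : (ell%:Z %| t - n0%:Z)%Z.
  rewrite -(dvdz24M _ (coprime24 cl6)).
  have -> : 24 * (t - n0%:Z) = (mu - M') - (24 * n0%:Z - 1 - M') by rewrite Emu; ring.
  exact: rpredB.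
have := dvd_uv_sum_residue hv nd tl; rewrite -Emu => /(_ dN); congr (_ %| _)%Z.
apply: (eq_uv_sum (P := xpredT)) => // p pin; rewrite /twist_sign; congr (_ * _).
by apply: legendre_eq_mod (dM p pin); [exact: allP pps p pin | exact: divisor_odd].
Qed.

Lemma absz_twist_sign M p : p \in ps -> ~~ (p%:Z %| M)%Z -> absz (twist_sign M p) = 1%N.
Proof.
move=> pin nM; have pp := allP pps p pin.
have n12 : ~~ (p%:Z %| -12)%Z.
  rewrite dvdzE /= (Euclid_dvdM 3 4) // (Euclid_dvdM 2 2) // !dvdn_prime2 //.
  by have := divisor_coprime6 pin; rewrite coprimen6; clear; lia.
by rewrite /twist_sign /legendre (negPf nM) (negPf n12); do 2! case: ifP => _.
Qed.

Lemma legendre_class_neq1 M : class_vanishes M -> {in ps, forall p, ~~ (p%:Z %| M)%Z} -> legendre (- M) ell != 1.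
Proof.
move=> vM nM; apply/eqP => E; pose mu : int := - (N ^ 2)%:Z; have [h Eh] := sqrn_mod24 cN6.
have d24 : (24 %| mu + 1)%Z by rewrite /mu Eh PoszD PoszM opprD addrNK rpredN dvdz_mulr.
have dN : (N%:Z %| mu)%Z by rewrite /mu rpredN -mulnn PoszM dvdz_mulr.
have El : legendre (- mu) ell = legendre (- M) ell.
  by rewrite E /mu opprK -[(N ^ 2)%:Z]mulr1 (legendre_sqrM pl ell_odd _ cNl) (legendre1 pl ell_odd).
have := dvd_uv_sum_class vM nM d24 dN El; rewrite uv_sum_top //; last first.
- by apply: sub_all pps => p /prime_gt1.
- by move=> c; rewrite mul1n => dc ne; rewrite p_sqdivN_sqr // (negPf ne).
rewrite mul1n p_sqdivN_sqr // eqxx mulr1 dvdzE absz_nat (big_morph _ abszM (erefl (absz 1))) big_seq big1 => [|p pin].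
  by rewrite dvdn1 gtn_eqF // prime_gt1.
by rewrite absz_twist_sign // nM.
Qed.
End Classes.

(** * The congruence for the coefficients *)

Lemma jacobi_prime z p : prime p -> jacobi z p = legendre z p.
Proof. by move=> pp; rewrite /jacobi primes_prime // big_seq1 logn_prime // eqxx expr1. Qed.

Lemma prod_primes_squarefree Q : (0 < Q)%N -> squarefree Q -> (\prod_(p <- primes Q) p)%N = Q.
Proof.
move=> Q0 sq; rewrite [in RHS](prod_prime_decomp Q0) prime_decompE big_map /= !big_seq.
apply: eq_bigr => p pQ; have : (0 < logn p Q)%N by rewrite logn_gt0.
have : ~~ (1 < logn p Q)%N by move: pQ; rewrite mem_primes => /and3P[pp _ _]; rewrite -pfactor_dvdn // sq.
by case: (logn p Q) => [|[|l]].
Qed.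
Lemma all_prime_primes Q : all prime (primes Q).
Proof. by apply/allP => p; rewrite mem_primes => /andP[]. Qed.
Lemma primes_coprime Q m : coprime Q m -> all (fun p => coprime p m) (primes Q).
Proof. by move=> cQ; apply/allP => p; rewrite mem_primes => /and3P[_ _ /coprime_dvdl]; apply. Qed.

Section LocalIntegers.
Variable ell : nat.

Lemma in_OellD x y : in_Oell ell x -> in_Oell ell y -> in_Oell ell (x + y).
Proof.
move=> [m [cm hm]] [m' [cm' hm']]; exists (m * m')%N; split; first by rewrite coprimeMl cm.
rewrite natrM mulrDr; apply: rpredD; first by rewrite mulrAC rpredM // rpred_nat.
by rewrite -mulrA rpredM // rpred_nat.
Qed.
Lemma in_OellM x y : in_Oell ell x -> in_Oell ell y -> in_Oell ell (x * y).
Proof.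
move=> [m [cm hm]] [m' [cm' hm']]; exists (m * m')%N; split; first by rewrite coprimeMl cm.
by rewrite natrM mulrACA rpredM.
Qed.
Lemma cong_mod_refl x : cong_mod ell x x.
Proof. by exists 1%N; rewrite coprime1n subrr mul0r mulr0 rpred0. Qed.
Lemma cong_mod_trans y x z : cong_mod ell x y -> cong_mod ell y z -> cong_mod ell x z.
Proof. by move=> xy yz; rewrite /cong_mod -(subrKA y) mulrDl; apply: in_OellD. Qed.
Lemma cong_mod_opUV lam q a b : in_Oell ell lam -> (forall n, cong_mod ell (a n) (b n)) ->
  forall n, cong_mod ell (opUV q lam a n) (opUV q lam b n).
Proof.
move=> hl hab n; rewrite /cong_mod /opUV opprD addrACA -mulrBr mulrDl -mulrA; apply: in_OellD; first exact: hab.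
by apply: in_OellM => //; rewrite /opV; case: ifP => _; [exact: hab | exact: cong_mod_refl].
Qed.
Lemma cong_mod_foldl_opUV (lam : nat -> algC) ps a b : {in ps, forall q, in_Oell ell (lam q)} ->
  (forall n, cong_mod ell (a n) (b n)) ->
  forall n, cong_mod ell (foldl (fun c q => opUV q (lam q) c) a ps n) (foldl (fun c q => opUV q (lam q) c) b ps n).
Proof.
elim: ps a b => [|q ps IH] a b hl hab //=; apply: IH => [p pps|]; first by apply: hl; rewrite inE pps orbT.
by apply: cong_mod_opUV => //; apply: hl; rewrite mem_head.
Qed.
End LocalIntegers.

Lemma in_Oell_lambda ell beta0 q : prime q -> coprime q ell -> in_Oell ell (lambda_coef beta0 q).
Proof.
move=> qp cq; exists q; split=> //; have q0 : (q%:R : algC) != 0 by rewrite pnatr_eq0 -lt0n prime_gt0.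
by rewrite /lambda_coef !mulrA mulfV // mul1r -rmorphM rpred_int.
Qed.

Definition f_coeff (ell : nat) (delta : int) (n : nat) : nat := if jacobi (- n%:Z) ell == delta then p_shift n else 0.

Lemma f_coeff_sqdiv ell delta d mu : prime ell -> odd ell -> coprime d (6 * ell) -> (d ^ 2 %| mu)%N ->
  f_coeff ell delta (mu %/ d ^ 2) =
  if (legendre (- mu%:Z) ell == delta) && (24 %| mu.+1)%N then p_sqdiv d mu else 0%N.
Proof.
move=> pl ol; rewrite coprimeMr => /andP[d6 dl] dd; have Emu := divnK dd.
rewrite /p_sqdiv dvdzE !absz_nat dd divz_nat; move: Emu; move: (mu %/ d ^ 2)%N => y Emu.
have -> : legendre (- mu%:Z) ell = legendre (- y%:Z) ell.
  by rewrite -Emu PoszM mulrC -mulrN legendre_sqrM.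
have [h Eh] := sqrn_mod24 d6.
have -> : (24 %| mu.+1)%N = (24 %| y.+1)%N.
  rewrite -Emu Eh (_ : (y * (24 * h + 1)).+1 = y.+1 + 24 * (y * h))%N; last by clear; lia.
  by rewrite dvdn_addl // dvdn_mulr.
rewrite /f_coeff jacobi_prime // /p_shiftz -[y%:Z + 1]PoszD addn1 dvdzE !absz_nat divz_nat /p_shift.
by case: eqP => //= _; case: ifP.
Qed.

Section Annihilation.
Variables (ell Q : nat) (beta0 : int).
Hypothesis pl : prime ell.
Hypothesis l3 : (3 < ell)%N.
Hypothesis Q0 : (0 < Q)%N.
Hypothesis sqQ : squarefree Q.
Hypothesis cQ : coprime Q (6 * ell).
Hypothesis coprimeM : gcdz Q%:Z (24 * beta0 - 1) = 1.
Hypothesis vanishing : forall n : int, (ell %| p_int (ell%:Z * Q%:Z * n + beta0))%N.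
Local Notation M := (24 * beta0 - 1).
Let ol : odd ell. Proof. by case: (even_prime pl) l3 => [->|]. Qed.
Let prodQ := prod_primes_squarefree Q0 sqQ.
Let pps := all_prime_primes Q.
Let cps := primes_coprime cQ.

Lemma class_vanishes_beta : class_vanishes ell (primes Q) M.
Proof.
move=> m; have [c6 cl] := andP (etrans (esym (coprimeMr _ _ _)) cQ).
rewrite prodQ (_ : 24 * m%:Z - 1 - M = 24 * (m%:Z - beta0)); last by ring.
have cl6 : coprime ell 6 by rewrite prime_coprime // (Euclid_dvdM 2 3) // !dvdn_prime2 //; clear - l3; lia.
rewrite dvdz24M ?coprimeMr ?coprime24 // => /dvdzP[z Ez]; have := vanishing z.
by rewrite -PoszM mulrC -Ez subrK.
Qed.
Lemma primes_ndvd_beta : {in primes Q, forall p, ~~ (p%:Z %| M)%Z}.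
Proof.
move=> p pQ; apply/negP => d; move: pQ; rewrite mem_primes => /and3P[pp _ dQ].
by have := dvdz_gcd p%:Z Q%:Z M; rewrite coprimeM d !dvdzE !absz_nat dQ dvdn1 gtn_eqF // prime_gt1.
Qed.

Local Notation delta := (jacobi (- M) ell).
Lemma jacobi_beta : delta = 0 \/ delta = -1.
Proof.
have := legendre_class_neq1 pl l3 (primes_uniq Q) pps cps class_vanishes_beta primes_ndvd_beta.
by rewrite jacobi_prime // /legendre; case: ifP => _; [left | case: ifP => // _; right].
Qed.

Lemma dvd_uv_sum_f_coeff mu : (Q %| mu)%N -> (ell%:Z %| uv_sum (fun p => p%:Z) (twist_sign M) (primes Q)
  (fun d => (if (d ^ 2 %| mu)%N then f_coeff ell delta (mu %/ d ^ 2) else 0%N)%:Z) 1)%Z.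
Proof.
move=> dQ; pose good := (legendre (- mu%:Z) ell == delta) && (24 %| mu.+1)%N.
rewrite (@eq_uv_sum _ (fun d => coprime d (6 * ell)) _ (fun p => p%:Z) _ (twist_sign M) _ _
  (fun d => if good then (p_sqdiv d mu%:Z)%:Z else 0)) //; last 3 first.
- move=> d cd; case: ifP => dd; first by rewrite f_coeff_sqdiv // -/good; case: ifP.
  by rewrite /p_sqdiv dvdzE !absz_nat dd; case: ifP.
- exact: coprime1n.
- by move=> p d pin cd; rewrite coprimeMl (allP cps).
have [/andP[/eqP El d24]|_] := boolP good; last by rewrite uv_sum0 dvdz0.
apply: (dvd_uv_sum_class pl l3 (primes_uniq Q) pps cps class_vanishes_beta primes_ndvd_beta).
- by rewrite -[mu%:Z + 1]PoszD addn1 dvdzE !absz_nat.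
- by rewrite prodQ dvdzE !absz_nat.
- by rewrite El jacobi_prime.
Qed.

Lemma cong_mod_apply_ops_f_coeff n : cong_mod ell (apply_ops beta0 Q (fun m => (f_coeff ell delta m)%:R) n) 0.
Proof.
rewrite /cong_mod subr0 /apply_ops foldl_opUV ?primes_uniq // prodQ; set mu := (Q * n)%N; set v := (X in uv_sum _ _ _ X _).
exists Q; split; first by move: cQ; rewrite coprimeMr => /andP[].
have l0 : (ell%:R : algC) != 0 by rewrite pnatr_eq0 -lt0n prime_gt0.
have := dvd_uv_sum_f_coeff (dvdn_mulr n (dvdnn Q)); rewrite -/mu => /dvdzP[z Ez].
suff Ev : \prod_(p <- primes Q) (p%:R : algC) * uv_sum (fun=> 1) (lambda_coef beta0) (primes Q) v 1 = (z * ell%:Z)%:~R.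
  by rewrite mulrA -[in Q%:R]prodQ natr_prod Ev rmorphM /= -pmulrn mulfK // rpred_int.
rewrite -Ez rmorph_uv_sum uv_sum_scale; apply: (eq_uv_sum (P := xpredT)) => //= [p pin|p pin|d _].
- by rewrite mulr1 -pmulrn.
- have pp := allP pps p pin; have p0 : (p%:R : algC) != 0 by rewrite pnatr_eq0 -lt0n prime_gt0.
  by rewrite /lambda_coef !jacobi_prime // /twist_sign rmorphM /=; field.
- by rewrite /v -pmulrn; case: ifP.
Qed.
End Annihilation.

Theorem theorem3p4 (ell Q : nat) (beta0 : int) :
  prime ell -> (5 <= ell)%N ->
  (0 < Q)%N -> squarefree Q -> coprime Q (6 * ell) ->
  gcdz Q%:Z (24 * beta0 - 1) = 1 ->
  (forall n : int, (ell %| p_int (ell%:Z * Q%:Z * n + beta0))%N) ->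
  let delta := jacobi (1 - 24 * beta0) ell in
  (delta = 0 \/ delta = -1) /\
  (forall a : nat -> algC, is_f_coeffs ell delta a ->
     forall n : nat, cong_mod ell (apply_ops beta0 Q a n) 0).
Proof.
move=> pl l5 Q0 sq cQ gc hyp delta; have l3 := ltnW l5.
have Ed : delta = jacobi (- (24 * beta0 - 1)) ell by rewrite /delta opprB.
split; first by rewrite Ed; exact: (jacobi_beta pl l3 Q0 sq cQ gc hyp).
move=> a ha n.
apply: (@cong_mod_trans _ (apply_ops beta0 Q (fun m => (f_coeff ell delta m)%:R) n)).
  apply: cong_mod_foldl_opUV => [q|m].
    rewrite mem_primes => /and3P[qp _ dQ]; apply: in_Oell_lambda => //.
    by have := coprime_dvdl dQ cQ; rewrite coprimeMr => /andP[].
  by have [_] := ha m; rewrite /f_coeff; case: ifP.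
by rewrite Ed; exact: (cong_mod_apply_ops_f_coeff pl l3 Q0 sq cQ gc hyp).
Qed.
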